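(* The following two equalities hold: $${}_6F_5\left[\begin{matrix}\frac12&\frac12&\frac12&\frac12&\frac12&\frac12\\&1&1&1&1&1\end{matrix};1\right]=16\oint_{|t_2(\tau)|=1}\tau^2f_{8.6.a.a}\left(\frac\tau2\right)d\tau=16\int_{1/2+i/2}^{-1/2+i/2}\tau^2f_{8.6.a.a}\left(\frac\tau2\right)d\tau$$ and $${}_7F_6\left[\begin{matrix}\frac12&\frac54&\frac12&\frac12&\frac12&\frac12&\frac12\\&\frac14&1&1&1&1&1\end{matrix};1\right]=\frac{32i}{\pi}\oint_{|t_2(\tau)|=1}\tau f_{8.4.a.a}\left(\frac\tau2\right)d\tau=\frac{32i}{\pi}\int_{1/2+i/2}^{-1/2+i/2}\tau f_{8.4.a.a}\left(\frac\tau2\right)d\tau,$$ where $t_2(\tau)=-64\,\eta(2\tau)^{24}/\eta(\tau)^{24}$ is a Hauptmodul for $\Gamma_0(2)$, and the path $|t_2(\tau)|=1$ in the upper half plane is the hyperbolic geodesic from $\frac{1+i}2$ to $\frac{-1+i}2$ going counterclockwise.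
   Context: $\eta(\tau)=q^{1/24}\prod_{n\ge1}(1-q^n)$, $q=e^{2\pi i\tau}$, is the Dedekind eta function. $f_{8.6.a.a}$ and $f_{8.4.a.a}$ are the normalized cuspidal newforms of level $8$, trivial character, and weights $6$ and $4$ (LMFDB labels); explicitly $f_{8.6.a.a}(\tau/2)=\eta(\tau)^{12}+32\,\eta(\tau)^4\eta(4\tau)^8$ and $f_{8.4.a.a}(\tau)=\eta(2\tau)^4\eta(4\tau)^4$. ${}_{n}F_{n-1}\left[\begin{matrix}a_1&a_2&\cdots&a_n\\&b_2&\cdots&b_n\end{matrix};\lambda\right]=\sum_{k\ge0}\frac{(a_1)_k\cdots(a_n)_k}{k!\,(b_2)_k\cdots(b_n)_k}\lambda^k$ with $(a)_k=a(a+1)\cdots(a+k-1)$. *)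

(* Defs.v *)
From Stdlib Require Import Reals Factorial List.
From Coquelicot Require Export Coquelicot.
Import ListNotations.
Open Scope R_scope.

Definition Cexp (z : C) : C := (exp (Re z) * cos (Im z), exp (Re z) * sin (Im z)).

(* Total like [Lim_seq]: the limit of [u] whenever [u] converges in C. *)
Definition CLim_seq (u : nat -> C) : C :=
  (real (Lim_seq (fun n => Re (u n))), real (Lim_seq (fun n => Im (u n)))).

Fixpoint Cprod1 (u : nat -> C) (n : nat) : C :=
  match n with
  | O => RtoC 1
  | S m => Cmult (Cprod1 u m) (u (S m))
  end.

Definition nome (tau : C) : C := Cexp (2 * PI * Ci * tau)%C.

(* q^(1/24) is exp (2 pi i tau / 24), not a root extracted from q.
   Only meaningful for 0 < Im tau, where the product converges. *)
Definition eta (tau : C) : C :=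
  (Cexp (2 * PI * Ci * tau / 24)
   * CLim_seq (Cprod1 (fun n => 1 - nome tau ^ n)))%C.

(* The newform of level 8, weight 6 and trivial character, normalized at the
   cusp infinity (q + 20 q^3 - 74 q^5 - ...); equivalently,
   f_8_6 (tau / 2) = eta (tau)^12 + 32 eta (tau)^4 eta (4 tau)^8. *)
Definition f_8_6 (tau : C) : C :=
  (eta (2 * tau) ^ 12 + 32 * (eta (2 * tau) ^ 4 * eta (8 * tau) ^ 8))%C.

(* The newform of level 8, weight 4 and trivial character. *)
Definition f_8_4 (tau : C) : C := (eta (2 * tau) ^ 4 * eta (4 * tau) ^ 4)%C.

(* A Hauptmodul for Gamma_0(2). *)
Definition t2 (tau : C) : C :=
  (- (64) * eta (2 * tau) ^ 24 / eta tau ^ 24)%C.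

Fixpoint pochhammer (a : R) (k : nat) : R :=
  match k with
  | O => 1
  | S m => pochhammer a m * (a + INR m)
  end.

Definition prod_list (l : list R) : R := fold_right Rmult 1 l.

(* nF(n-1) with upper parameters [a] and lower parameters [b]; the implicit
   lower parameter 1 is the [fact k] and is not listed in [b]. *)
Definition hypergeometric (a b : list R) (x : R) : R :=
  Series (fun k =>
    prod_list (map (fun c => pochhammer c k) a)
    / (INR (fact k) * prod_list (map (fun c => pochhammer c k) b)) * x ^ k).

Definition velocity (g : R -> C) (s : R) : C :=
  (Derive (fun u => Re (g u)) s, Derive (fun u => Im (g u)) s).

(* [g] restricted to [al, be] is a C^1 path in the upper half plane from [z]
   to [w]. Derivatives at the end points are two-sided; a path that is C^1 on
   the closed interval always extends to one that is C^1 in this sense. *)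
Definition path_in_H (g : R -> C) (al be : R) (z w : C) : Prop :=
  al <= be /\ g al = z /\ g be = w /\
  forall s, al <= s <= be ->
    0 < Im (g s)
    /\ ex_derive (V := C_R_NormedModule) g s
    /\ continuous (velocity g) s.

Definition path_integral (f : C -> C) (g : R -> C) (al be : R) : C :=
  RInt (V := C_R_CompleteNormedModule)
    (fun s => Cmult (f (g s)) (velocity g s)) al be.

Definition z_start : C := (1 / 2, 1 / 2).
Definition z_end : C := (- (1 / 2), 1 / 2).

(* A path along |t2| = 1 from z_start to z_end.  The end points matter: the
   full locus |t2| = 1 in the half plane also contains all translates of the
   arc under Gamma_0(2). *)
Definition t2_contour (g : R -> C) (al be : R) : Prop :=
  path_in_H g al be z_start z_end
  /\ forall s, al <= s <= be -> Cmod (t2 (g s)) = 1.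

(* For s from PI/4 to 3 PI/4: the hyperbolic geodesic from z_start to z_end,
   i.e. the arc between them of the semicircle through both that is centred on
   the real axis (centre 0, radius 1 / sqrt 2), run counterclockwise. *)
Definition geodesic (s : R) : C := (cos s / sqrt 2, sin s / sqrt 2).

(* Main.v *)
Require Import Defs.
From Stdlib Require Import Reals List Lra Lia ZArith FunctionalExtensionality Ranalysis5 Classical.
From Coquelicot Require Import Coquelicot.
Import ListNotations.
Open Scope R_scope.

(* Let a, b, c be the squares of the Jacobi theta functions theta_3, theta_4, theta_2,
   D = q d/dq, t = t2 = -4 a^2 c^2 / b^4, G = b^2, E = D t / t = a^2 + c^2 and
   H = -4 tau^2 a c. Then 16 tau^2 f_8_6 (tau/2) = -G H E and f_8_4 (tau/2) = a b^2 c / 4.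
   The Fricke involution maps E to -2 tau^2 E; this is proved by summing a lattice sum in two
   orders. On the geodesic it gives |t| = 1 and shows that H is the complex conjugate of G.

   With alpha_k = ((1/2)_k / k!)^3, the moments of t^-k G E along the geodesic satisfy a two
   term recursion, because a combination of two consecutive ones is the integral of an exact
   differential; so they equal -alpha_k, and by conjugation so do those of t^k H E. On the
   lines Re tau = 1/2, -1/2 one has 0 < t <= 1 and G = sum_k alpha_k t^k, as both sides solve
   the same third order equation. Moving the path to these lines and exchanging sum and
   integral gives sum_k alpha_k^2 = - int G H E, which is the first formula. The second one
   follows in the same way after an integration by parts that absorbs the factor 4k + 1. *)

(** * Limits, series and double series in C *)

(** The geodesic lies on |t| = 1, the boundary of the disc of convergence of the series for G, and
    the singular point t = 1 sits at both ends. Sum and integral cannot be exchanged there directly;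
    hence the detour over the two vertical lines. One factor of alpha_k^2 is a coefficient of that
    series, the other a moment. Negative powers of t are used first because t^-k G E is invariant
    under tau -> tau + 1, which maps one end of the geodesic to the other: the recursion has no
    boundary terms, and its start is a constant term at the cusp. Conjugation, which inverts t on
    |t| = 1, then yields the positive powers that the series needs.

    Identities between theta functions and their derivatives rest on Jacobi's triple product and on
    tau -> 2 tau, iterated towards the cusp. The involution tau -> -1 / (2 tau) is established for E
    alone; what is needed of t and G follows from D t = t E and E^2 = G^2 (1 - t). The contour may
    be moved because the integrands concerned are, locally uniformly, limits of sums of terms tau^j
    exp (la tau), which have explicit primitives. *)

Definition CL (u : nat -> C) (l : C) : Prop :=
  forall eps, 0 < eps -> exists N, forall n, (N <= n)%nat -> Cmod (u n - l) < eps.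

Lemma Cmod_le_abs (z : C) : Cmod z <= Rabs (Re z) + Rabs (Im z).
Proof.
  replace z with (RtoC (Re z) + Ci * RtoC (Im z))%C at 1.
  2:{ destruct z; unfold Ci, RtoC, Cplus, Cmult; simpl; f_equal; ring. }
  eapply Rle_trans; [apply Cmod_triangle|].
  rewrite Cmod_mult, Cmod_Ci, !Cmod_R. lra.
Qed.

Lemma Im_le_Cmod (z : C) : Rabs (Im z) <= Cmod z.
Proof.
  eapply Rle_trans; [|apply Rmax_Cmod]. apply Rmax_r.
Qed.

Lemma Cmod_sub_sym (x y : C) : Cmod (x - y) = Cmod (y - x).
Proof. rewrite <- Cmod_opp. f_equal. ring. Qed.

Lemma Cmod_sub_triangle (x y z : C) : Cmod (x - z) <= Cmod (x - y) + Cmod (y - z).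
Proof. replace (x - z)%C with ((x - y) + (y - z))%C by ring. apply Cmod_triangle. Qed.

Lemma Cmod_triangle_rev (x y : C) : Cmod x - Cmod y <= Cmod (x - y).
Proof.
  pose proof (Cmod_triangle (x - y) y).
  replace (x - y + y)%C with x in H by ring. lra.
Qed.

Lemma Cmod_triangle_minus (x y : C) : Cmod (x - y) <= Cmod x + Cmod y.
Proof. unfold Cminus. rewrite <- (Cmod_opp y). apply Cmod_triangle. Qed.

Lemma CL_unique u l m : CL u l -> CL u m -> l = m.
Proof.
  intros Hl Hm.
  destruct (Req_dec (Cmod (l - m)) 0) as [H|H].
  - apply Cmod_eq_0 in H. replace l with (l - m + m)%C by ring. rewrite H. ring.
  - pose proof (Cmod_ge_0 (l - m)).
    destruct (Hl (Cmod (l - m) / 2)) as [N1 H1]; [lra|].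
    destruct (Hm (Cmod (l - m) / 2)) as [N2 H2]; [lra|].
    specialize (H1 (max N1 N2) ltac:(lia)). specialize (H2 (max N1 N2) ltac:(lia)).
    pose proof (Cmod_sub_triangle l (u (max N1 N2)) m).
    rewrite (Cmod_sub_sym l (u (max N1 N2))) in H3. lra.
Qed.

Lemma CL_ext u v l : (forall n, u n = v n) -> CL u l -> CL v l.
Proof. intros H Hu eps He. destruct (Hu eps He) as [N HN]. exists N. intros. rewrite <- H. auto. Qed.

Lemma CL_ext_from N0 u v l :
  (forall n, (N0 <= n)%nat -> u n = v n) -> CL u l -> CL v l.
Proof.
  intros H Hu eps He. destruct (Hu eps He) as [N HN]. exists (max N N0).
  intros. rewrite <- H by lia. apply HN. lia.
Qed.

Lemma CL_const c : CL (fun _ => c) c.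
Proof. intros eps He. exists O. intros. replace (c - c)%C with (RtoC 0) by ring. now rewrite Cmod_0. Qed.

Lemma CL_bounded u l : CL u l -> exists B, 0 < B /\ forall n, Cmod (u n) <= B.
Proof.
  intros H. destruct (H 1 Rlt_0_1) as [N HN].
  assert (exists B, 0 < B /\ forall n, (n < N)%nat -> Cmod (u n) <= B) as [B [HB1 HB]].
  { clear HN. induction N as [|N [B [HB1 HB]]].
    - exists 1. split; [lra|]. lia.
    - exists (B + Cmod (u N)). pose proof (Cmod_ge_0 (u N)). split; [lra|].
      intros n Hn. destruct (Nat.eq_dec n N) as [->|]; [lra|].
      specialize (HB n ltac:(lia)). lra. }
  exists (B + Cmod l + 1). pose proof (Cmod_ge_0 l). split; [lra|]. intros n.
  destruct (Nat.lt_ge_cases n N) as [Hn|Hn]; [specialize (HB n Hn); lra|].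
  specialize (HN n Hn). pose proof (Cmod_triangle_rev (u n) l). lra.
Qed.

Lemma CL_squeeze u l (e : nat -> R) :
  (forall n, Cmod (u n - l) <= e n) -> is_lim_seq e 0 -> CL u l.
Proof.
  intros H He eps Heps. apply is_lim_seq_spec in He.
  destruct (He (mkposreal eps Heps)) as [N HN]. exists N. intros n Hn.
  specialize (HN n Hn). simpl in HN. specialize (H n).
  pose proof (Rle_abs (e n - 0)). lra.
Qed.

Lemma CL_Cmod_0 u l : CL u l -> is_lim_seq (fun n => Cmod (u n - l)) 0.
Proof.
  intros H. apply is_lim_seq_spec. intros eps. destruct (H eps (cond_pos eps)) as [N HN].
  exists N. intros n Hn. rewrite Rminus_0_r, Rabs_pos_eq by apply Cmod_ge_0. auto.
Qed.

Lemma CL_plus u v l m : CL u l -> CL v m -> CL (fun n => u n + v n)%C (l + m)%C.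
Proof.
  intros Hu Hv eps He.
  destruct (Hu (eps / 2)) as [N1 H1]; [lra|]. destruct (Hv (eps / 2)) as [N2 H2]; [lra|].
  exists (max N1 N2). intros n Hn. specialize (H1 n ltac:(lia)). specialize (H2 n ltac:(lia)).
  replace (u n + v n - (l + m))%C with ((u n - l) + (v n - m))%C by ring.
  pose proof (Cmod_triangle (u n - l) (v n - m)). lra.
Qed.

Lemma CL_mult u v l m : CL u l -> CL v m -> CL (fun n => u n * v n)%C (l * m)%C.
Proof.
  intros Hu Hv.
  destruct (CL_bounded _ _ Hu) as [B [HB1 HB]].
  apply CL_squeeze with (e := fun n => B * Cmod (v n - m) + Cmod (u n - l) * Cmod m).
  - intros n. replace (u n * v n - l * m)%C with (u n * (v n - m) + (u n - l) * m)%C by ring.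
    eapply Rle_trans; [apply Cmod_triangle|]. rewrite !Cmod_mult.
    pose proof (Cmod_ge_0 (v n - m)). specialize (HB n). nra.
  - apply is_lim_seq_ext with (fun n => B * Cmod (v n - m) + Cmod m * Cmod (u n - l)).
    { intros; ring. }
    replace (Finite 0) with (Finite (B * 0 + Cmod m * 0)) by (f_equal; ring).
    apply is_lim_seq_plus'; (apply is_lim_seq_mult'; [apply is_lim_seq_const|now apply CL_Cmod_0]).
Qed.

Lemma CL_opp u l : CL u l -> CL (fun n => - u n)%C (- l)%C.
Proof.
  intros H. apply CL_ext with (fun n => RtoC (-1) * u n)%C; [intros; ring|].
  replace (- l)%C with (RtoC (-1) * l)%C by ring. apply CL_mult; [apply CL_const|auto].
Qed.

Lemma CL_minus u v l m : CL u l -> CL v m -> CL (fun n => u n - v n)%C (l - m)%C.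
Proof. intros. apply CL_plus; [auto|]. now apply CL_opp. Qed.

Lemma CL_scal c u l : CL u l -> CL (fun n => c * u n)%C (c * l)%C.
Proof. intros. apply CL_mult; [apply CL_const|auto]. Qed.

Lemma CL_pow u l k : CL u l -> CL (fun n => u n ^ k)%C (l ^ k)%C.
Proof.
  intros H. induction k; simpl; [apply CL_const|]. now apply CL_mult.
Qed.

Lemma CL_inv u (l : C) : l <> 0%C -> CL u l -> CL (fun n => / u n)%C (/ l)%C.
Proof.
  intros Hl H eps He. pose proof (proj1 (Cmod_gt_0 l) Hl) as Hl'.
  destruct (H (Cmod l / 2)) as [N1 H1]; [lra|].
  destruct (H (eps * (Cmod l / 2 * Cmod l))) as [N2 H2]; [apply Rmult_lt_0_compat; nra|].
  exists (max N1 N2). intros n Hn. specialize (H1 n ltac:(lia)). specialize (H2 n ltac:(lia)).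
  assert (Cmod l / 2 < Cmod (u n)) as Hu.
  { pose proof (Cmod_triangle_rev l (u n)). rewrite Cmod_sub_sym in H0. lra. }
  assert (u n <> 0%C) as Hun by (apply Cmod_gt_0; lra).
  replace (/ u n - / l)%C with ((l - u n) / (u n * l))%C by (field; auto).
  rewrite Cmod_div by (apply Cmult_neq_0; auto). rewrite Cmod_mult, Cmod_sub_sym.
  apply (Rmult_lt_reg_r (Cmod (u n) * Cmod l)); [nra|].
  unfold Rdiv. rewrite Rmult_assoc, Rinv_l, Rmult_1_r by nra.
  eapply Rlt_trans; [apply H2|]. apply Rmult_lt_compat_l; nra.
Qed.

Lemma CL_comp u l (phi : nat -> nat) :
  (forall n, (n <= phi n)%nat) -> CL u l -> CL (fun n => u (phi n)) l.
Proof.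
  intros Hp H eps He. destruct (H eps He) as [N HN]. exists N. intros n Hn.
  apply HN. specialize (Hp n). lia.
Qed.

Lemma CL_decr u l : CL (fun n => u (S n)) l -> CL u l.
Proof.
  intros H eps He. destruct (H eps He) as [N HN]. exists (S N). intros n Hn.
  destruct n; [lia|]. apply HN. lia.
Qed.

Lemma CL_le_bound u l B : CL u l -> (exists N, forall n, (N <= n)%nat -> Cmod (u n) <= B) -> Cmod l <= B.
Proof.
  intros H [N0 HB]. apply Rnot_lt_le. intros Hlt.
  destruct (H (Cmod l - B)) as [N HN]; [lra|].
  specialize (HN (max N N0) ltac:(lia)). specialize (HB (max N N0) ltac:(lia)).
  pose proof (Cmod_triangle_rev l (u (max N N0))). rewrite Cmod_sub_sym in H0. lra.
Qed.

Lemma CL_components u l :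
  is_lim_seq (fun n => Re (u n)) (Re l) -> is_lim_seq (fun n => Im (u n)) (Im l) -> CL u l.
Proof.
  intros Hr Hi.
  apply CL_squeeze with (e := fun n => Rabs (Re (u n) - Re l) + Rabs (Im (u n) - Im l)).
  - intros n. apply Cmod_le_abs.
  - replace (Finite 0) with (Finite (Rabs (Re l - Re l) + Rabs (Im l - Im l))).
    2:{ f_equal. rewrite !Rminus_diag, Rabs_R0. lra. }
    apply is_lim_seq_plus'; apply (is_lim_seq_abs _ (Finite _));
      apply is_lim_seq_minus'; auto using is_lim_seq_const.
Qed.

Lemma CL_Re u l : CL u l -> is_lim_seq (fun n => Re (u n)) (Re l).
Proof.
  intros H. apply is_lim_seq_spec. intros eps. destruct (H eps (cond_pos eps)) as [N HN].
  exists N. intros n Hn. specialize (HN n Hn). pose proof (re_le_Cmod (u n - l)).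
  eapply Rle_lt_trans; [|apply HN]. apply H0.
Qed.

Lemma CL_Im u l : CL u l -> is_lim_seq (fun n => Im (u n)) (Im l).
Proof.
  intros H. apply is_lim_seq_spec. intros eps. destruct (H eps (cond_pos eps)) as [N HN].
  exists N. intros n Hn. specialize (HN n Hn). pose proof (Im_le_Cmod (u n - l)).
  eapply Rle_lt_trans; [|apply HN]. apply H0.
Qed.

Lemma CLim_seq_unique u l : CL u l -> CLim_seq u = l.
Proof.
  intros H. unfold CLim_seq.
  rewrite (is_lim_seq_unique _ _ (CL_Re _ _ H)), (is_lim_seq_unique _ _ (CL_Im _ _ H)).
  now destruct l.
Qed.

(** The upper bound is exclusive, so that inductions start from the empty sum. [sum_n] includes its
    bound, hence the shift [S n] wherever the two meet. *)
Fixpoint psum (u : nat -> C) (n : nat) : C :=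
  match n with O => RtoC 0 | S m => (psum u m + u m)%C end.

Definition summ (u : nat -> C) : Prop := ex_series (fun n => Cmod (u n)).

Definition csum (u : nat -> C) : C := CLim_seq (psum u).

Lemma psum_Re u n : Re (psum u (S n)) = sum_n (fun k => Re (u k)) n.
Proof.
  induction n.
  - rewrite sum_O. unfold Re, Im. simpl. ring.
  - rewrite sum_Sn, <- IHn. reflexivity.
Qed.

Lemma psum_Im u n : Im (psum u (S n)) = sum_n (fun k => Im (u k)) n.
Proof.
  induction n.
  - rewrite sum_O. unfold Re, Im. simpl. ring.
  - rewrite sum_Sn, <- IHn. reflexivity.
Qed.

Lemma ex_series_dom (a b : nat -> R) :
  (forall n, Rabs (a n) <= b n) -> ex_series b -> ex_series a.
Proof. intros H Hb. apply (ex_series_le (V := R_CompleteNormedModule) a b); auto. Qed.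

Lemma summ_dom u b : (forall n, Cmod (u n) <= b n) -> ex_series b -> summ u.
Proof.
  intros H Hb. apply ex_series_dom with b; auto. intros n.
  rewrite Rabs_pos_eq by apply Cmod_ge_0. auto.
Qed.

Lemma csum_unique u l : CL (psum u) l -> csum u = l.
Proof. apply CLim_seq_unique. Qed.

Lemma summ_CL u : summ u -> CL (psum u) (csum u).
Proof.
  intros H.
  assert (ex_series (fun n => Re (u n))) as [lr Hr].
  { apply ex_series_dom with (fun n => Cmod (u n)); auto. intros; apply re_le_Cmod. }
  assert (ex_series (fun n => Im (u n))) as [li Hi].
  { apply ex_series_dom with (fun n => Cmod (u n)); auto. intros; apply Im_le_Cmod. }
  assert (CL (psum u) (lr, li)) as Hl.
  { apply CL_components; simpl.
    - apply is_lim_seq_incr_1. apply (is_lim_seq_ext (sum_n (fun n => Re (u n)))).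
      { intros n. now rewrite psum_Re. } exact Hr.
    - apply is_lim_seq_incr_1. apply (is_lim_seq_ext (sum_n (fun n => Im (u n)))).
      { intros n. now rewrite psum_Im. } exact Hi. }
  now rewrite (csum_unique _ _ Hl).
Qed.

Lemma psum_ext u v n : (forall k, (k < n)%nat -> u k = v k) -> psum u n = psum v n.
Proof.
  induction n; intros H; simpl; [auto|]. rewrite IHn by (intros; apply H; lia).
  now rewrite H by lia.
Qed.

Lemma psum_plus u v n : psum (fun k => u k + v k)%C n = (psum u n + psum v n)%C.
Proof. induction n; simpl; [ring|]. rewrite IHn. ring. Qed.

Lemma psum_scal c u n : psum (fun k => c * u k)%C n = (c * psum u n)%C.
Proof. induction n; simpl; [ring|]. rewrite IHn. ring. Qed.

Lemma psum_head u n : psum u (S n) = (u O + psum (fun k => u (S k)) n)%C.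
Proof.
  induction n; [simpl; ring|]. change (psum u (S (S n))) with (psum u (S n) + u (S n))%C.
  rewrite IHn. simpl. ring.
Qed.

Lemma summ_ext u v : (forall n, u n = v n) -> summ u -> summ v.
Proof. intros H. apply ex_series_ext. intros n. now rewrite H. Qed.

Lemma csum_ext u v : (forall n, u n = v n) -> csum u = csum v.
Proof. intros H. f_equal. now apply functional_extensionality. Qed.

Lemma summ_plus u v : summ u -> summ v -> summ (fun n => u n + v n)%C.
Proof.
  intros Hu Hv. apply summ_dom with (fun n => Cmod (u n) + Cmod (v n)).
  - intros; apply Cmod_triangle.
  - now apply (ex_series_plus (V := R_NormedModule)).
Qed.

Lemma summ_scal c u : summ u -> summ (fun n => c * u n)%C.
Proof.
  intros Hu. apply ex_series_ext with (fun n => Cmod c * Cmod (u n)).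
  { intros; now rewrite Cmod_mult. }
  now apply (ex_series_scal (V := R_NormedModule) (Cmod c)).
Qed.

Lemma csum_plus u v : summ u -> summ v -> csum (fun n => u n + v n)%C = (csum u + csum v)%C.
Proof.
  intros Hu Hv. apply csum_unique. apply CL_ext with (fun n => psum u n + psum v n)%C.
  { intros. now rewrite psum_plus. } apply CL_plus; now apply summ_CL.
Qed.

Lemma csum_scal c u : summ u -> csum (fun n => c * u n)%C = (c * csum u)%C.
Proof.
  intros Hu. apply csum_unique. apply CL_ext with (fun n => c * psum u n)%C.
  { intros. now rewrite psum_scal. } apply CL_scal; now apply summ_CL.
Qed.

Lemma summ_incr u : summ u <-> summ (fun n => u (S n)).
Proof. apply (ex_series_incr_1 (V := R_NormedModule) (fun n => Cmod (u n))). Qed.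

Lemma csum_head u : summ u -> csum u = (u O + csum (fun n => u (S n)))%C.
Proof.
  intros Hu. apply csum_unique. apply CL_decr.
  apply CL_ext with (fun n => u O + psum (fun k => u (S k)) n)%C.
  { intros. now rewrite psum_head. } apply CL_plus; [apply CL_const|].
  apply summ_CL. now apply summ_incr in Hu.
Qed.

Lemma psum_le u b n : (forall k, Cmod (u k) <= b k) -> Cmod (psum u (S n)) <= sum_n b n.
Proof.
  intros H. induction n.
  - rewrite sum_O. simpl. replace (0 + u 0%nat)%C with (u O) by ring. auto.
  - rewrite sum_Sn. change (psum u (S (S n))) with (psum u (S n) + u (S n))%C.
    eapply Rle_trans; [apply Cmod_triangle|]. unfold plus; simpl. specialize (H (S n)).
    apply Rplus_le_compat; auto.
Qed.

Lemma sum_n_le_Series (b : nat -> R) n :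
  (forall k, 0 <= b k) -> ex_series b -> sum_n b n <= Series b.
Proof.
  intros Hb Hs.
  assert (is_lim_seq (sum_n b) (Series b)) as Hl.
  { apply Series_correct in Hs. exact Hs. }
  apply (is_lim_seq_incr_compare _ _ Hl). intros k. rewrite sum_Sn.
  unfold plus; simpl. specialize (Hb (S k)). lra.
Qed.

Lemma csum_le u b : (forall n, Cmod (u n) <= b n) -> ex_series b -> Cmod (csum u) <= Series b.
Proof.
  intros H Hb. apply CL_le_bound with (psum u).
  - apply summ_CL. now apply summ_dom with b.
  - exists 1%nat. intros [|n] Hn; [lia|]. eapply Rle_trans; [now apply psum_le|].
    apply sum_n_le_Series; auto. intros k. eapply Rle_trans; [apply Cmod_ge_0|apply H].
Qed.

Lemma csum_split u K : summ u -> csum u = (psum u K + csum (fun n => u (K + n)%nat))%C.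
Proof.
  intros Hu. induction K.
  - simpl. change (fun n => u n) with u. ring.
  - rewrite IHK. assert (summ (fun n => u (K + n)%nat)) as HK.
    { clear IHK. induction K; [auto|]. apply summ_incr in IHK.
      apply summ_ext with (2 := IHK). intros. f_equal. lia. }
    rewrite (csum_head _ HK). simpl. rewrite Nat.add_0_r.
    rewrite (csum_ext (fun n => u (K + S n)%nat) (fun n => u (S (K + n)))).
    2:{ intros; f_equal; lia. } ring.
Qed.

(** The index is chosen from the majorant alone, before the sequence. This uniformity serves
    [Tannery] and, later, the approximation of q-series uniformly on regions of the half plane. *)
Lemma tail_small (b : nat -> R) : ex_series b -> (forall n, 0 <= b n) ->
  forall eps, 0 < eps -> exists K0, forall K, (K0 <= K)%nat ->
  forall u : nat -> C, (forall n, Cmod (u n) <= b n) -> Cmod (csum u - psum u K) <= eps.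
Proof.
  intros Hb Hpos eps He.
  assert (is_lim_seq (sum_n b) (Series b)) as Hl by (now apply Series_correct in Hb).
  apply is_lim_seq_spec in Hl. destruct (Hl (mkposreal eps He)) as [N HN]. simpl in HN.
  exists (S N). intros K HK u Hu.
  rewrite (csum_split u K) by (now apply summ_dom with b).
  replace (psum u K + csum (fun n => u (K + n)%nat) - psum u K)%C
    with (csum (fun n => u (K + n)%nat)) by ring.
  assert (0 < K)%nat as HK0 by lia.
  eapply Rle_trans; [apply (csum_le _ (fun n => b (K + n)%nat))|].
  - intros; apply Hu.
  - now apply (ex_series_incr_n (V := R_NormedModule) b K).
  - assert (Series b = sum_n b (pred K) + Series (fun n => b (K + n)%nat)) as HS.
    { rewrite (Series_incr_n b K) by auto. now rewrite sum_n_Reals. }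
    specialize (HN (pred K) ltac:(lia)). apply Rabs_def2 in HN. lra.
Qed.

(** Dominated convergence for series: two tails below the majorant cost eps / 4 each, and a fixed
    finite block converges termwise. [N0] allows for majorants that hold only from some index on, as
    in the partial fraction expansion of [cosec]. *)
Lemma Tannery (u : nat -> nat -> C) (v : nat -> C) (b : nat -> R) N0 :
  (forall n, CL (fun N => u N n) (v n)) ->
  (forall N n, (N0 <= N)%nat -> Cmod (u N n) <= b n) -> ex_series b ->
  summ v /\ CL (fun N => csum (u N)) (csum v).
Proof.
  intros Hl Hb Hs.
  assert (forall n, Cmod (v n) <= b n) as Hv.
  { intros n. apply CL_le_bound with (fun N => u N n); auto. exists N0; auto. }
  assert (forall n, 0 <= b n) as Hpos.
  { intros n. eapply Rle_trans; [apply Cmod_ge_0|apply Hv]. }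
  split; [now apply summ_dom with b|].
  intros eps He.
  destruct (tail_small b Hs Hpos (eps / 4)) as [K HK]; [lra|]. specialize (HK K (le_n _)).
  assert (CL (fun N => psum (u N) K) (psum v K)) as Hp.
  { clear HK. induction K; simpl; [apply CL_const|]. now apply CL_plus. }
  destruct (Hp (eps / 4)) as [N1 HN1]; [lra|].
  exists (max N0 N1). intros N HN.
  pose proof (HK (u N) ltac:(intros; apply Hb; lia)).
  pose proof (HK v Hv). specialize (HN1 N ltac:(lia)).
  pose proof (Cmod_sub_triangle (csum (u N)) (psum (u N) K) (csum v)).
  pose proof (Cmod_sub_triangle (psum (u N) K) (psum v K) (csum v)).
  rewrite (Cmod_sub_sym (psum v K) (csum v)) in H2. lra.
Qed.

Lemma psum_zero_from u N n : (forall k, (N <= k)%nat -> u k = RtoC 0) -> (N <= n)%nat ->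
  psum u n = psum u N.
Proof.
  intros H Hn. induction Hn; [auto|]. simpl. rewrite IHHn, H by lia. ring.
Qed.

Lemma csum_fin u N : (forall k, (N <= k)%nat -> u k = RtoC 0) -> csum u = psum u N.
Proof.
  intros H. apply csum_unique. apply CL_ext_from with N (fun _ => psum u N).
  - intros n Hn. symmetry. now apply psum_zero_from.
  - apply CL_const.
Qed.

Lemma ex_series_scal_r (b : nat -> R) c : ex_series b -> ex_series (fun n => c * b n).
Proof. apply (ex_series_scal (V := R_NormedModule)). Qed.

Lemma csum_psum (u : nat -> nat -> C) M : (forall m, summ (u m)) ->
  summ (fun n => psum (fun m => u m n) M) /\
  csum (fun n => psum (fun m => u m n) M) = psum (fun m => csum (u m)) M.
Proof.
  intros H. induction M as [|M [IH1 IH2]]; simpl.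
  - split.
    + apply summ_dom with (fun _ => 0 * 1).
      * intros; rewrite Cmod_0; lra.
      * apply ex_series_ext with (fun n => 0 * (1/2)^n); [intros n; change (0 * (1/2)^n = 0 * 1); ring|].
        apply ex_series_scal_r. apply ex_series_geom. rewrite Rabs_pos_eq; lra.
    + rewrite (csum_fin _ 0); auto.
  - split; [now apply summ_plus|]. rewrite csum_plus by auto. now rewrite IH2.
Qed.

(** A finite number of rows can be summed columnwise; [Tannery] then lets that number grow, with
    [Series al * be n] dominating the n-th column. *)
Lemma Fubini (u : nat -> nat -> C) (al be : nat -> R) :
  (forall m n, Cmod (u m n) <= al m * be n) ->
  (forall m, 0 <= al m) -> (forall n, 0 <= be n) -> ex_series al -> ex_series be ->
  csum (fun m => csum (u m)) = csum (fun n => csum (fun m => u m n)).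
Proof.
  intros H Ha Hb Sa Sb.
  assert (forall m, summ (u m)) as Hm.
  { intros m. apply summ_dom with (fun n => al m * be n); auto. now apply ex_series_scal_r. }
  assert (forall n, summ (fun m => u m n)) as Hn.
  { intros n. apply summ_dom with (fun m => be n * al m).
    - intros m. rewrite Rmult_comm. auto. - now apply ex_series_scal_r. }
  apply csum_unique.
  apply CL_ext with (fun M => csum (fun n => psum (fun m => u m n) M)).
  { intros M. apply csum_psum; auto. }
  apply (Tannery _ _ (fun n => Series al * be n) 0).
  - intros n. apply summ_CL; auto.
  - intros N n _. destruct N.
    + simpl. rewrite Cmod_0. apply Rmult_le_pos; auto.
      apply Rle_trans with (sum_n al 0); [now rewrite sum_O|now apply sum_n_le_Series].
    + eapply Rle_trans; [apply (psum_le _ (fun m => be n * al m))|].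
      * intros m. rewrite Rmult_comm; auto.
      * rewrite (sum_n_ext _ (fun m => scal (be n) (al m))) by reflexivity.
        rewrite (sum_n_scal_l (be n) al). change (be n * sum_n al N <= Series al * be n).
        rewrite (Rmult_comm (Series al)).
        apply Rmult_le_compat_l; auto. now apply sum_n_le_Series.
  - now apply ex_series_scal_r.
Qed.

(** * The complex exponential and complex derivatives *)

Lemma Cexp_add (x y : C) : Cexp (x + y) = (Cexp x * Cexp y)%C.
Proof.
  destruct x as [a b], y as [c d]. unfold Cexp, Cmult, Cplus; simpl.
  rewrite exp_plus, cos_plus, sin_plus. f_equal; ring.
Qed.

Lemma Cexp_0 : Cexp 0 = RtoC 1.
Proof. unfold Cexp, RtoC; simpl. rewrite exp_0, cos_0, sin_0. f_equal; ring. Qed.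

Lemma Cmod_Cexp (z : C) : Cmod (Cexp z) = exp (Re z).
Proof.
  destruct z as [a b]. unfold Cmod, Cexp; simpl.
  replace (exp a * cos b * (exp a * cos b * 1) + exp a * sin b * (exp a * sin b * 1))
    with (Rsqr (exp a) * (Rsqr (sin b) + Rsqr (cos b))) by (unfold Rsqr; ring).
  rewrite sin2_cos2, Rmult_1_r, sqrt_Rsqr; auto. left. apply exp_pos.
Qed.

Lemma Cexp_neq_0 (z : C) : Cexp z <> RtoC 0.
Proof. apply Cmod_gt_0. rewrite Cmod_Cexp. apply exp_pos. Qed.

Lemma Cexp_opp (z : C) : Cexp (- z) = (/ Cexp z)%C.
Proof.
  assert (Cexp (- z) * Cexp z = 1)%C as H.
  { rewrite <- Cexp_add. replace (- z + z)%C with (RtoC 0) by ring. apply Cexp_0. }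
  rewrite <- (Cmult_1_l (/ Cexp z)%C), <- H. field. apply Cexp_neq_0.
Qed.

Lemma Cexp_pow (z : C) (n : nat) : (Cexp z ^ n = Cexp (INR n * z))%C.
Proof.
  induction n.
  - simpl. replace (0 * z)%C with (RtoC 0) by ring. now rewrite Cexp_0.
  - rewrite S_INR, RtoC_plus. replace ((INR n + 1) * z)%C with (z + INR n * z)%C by ring.
    rewrite Cexp_add, <- IHn. reflexivity.
Qed.

Lemma Cexp_conj (z : C) : Cconj (Cexp z) = Cexp (Cconj z).
Proof.
  destruct z as [a b]. unfold Cexp, Cconj; simpl. rewrite cos_neg, sin_neg. f_equal. ring.
Qed.

Lemma Cexp_2PI : Cexp (2 * PI * Ci) = RtoC 1.
Proof.
  unfold Cexp, RtoC, Ci, Cmult; simpl.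
  replace ((2 * PI - 0 * 0) * 0 - (2 * 0 + 0 * PI) * 1) with 0 by ring.
  replace ((2 * PI - 0 * 0) * 1 + (2 * 0 + 0 * PI) * 0) with (2 * PI) by ring.
  rewrite cos_2PI, sin_2PI, exp_0. f_equal; ring.
Qed.

Lemma Cexp_PI : Cexp (PI * Ci) = RtoC (-1).
Proof.
  unfold Cexp, RtoC, Ci, Cmult; simpl.
  replace (PI * 0 - 0 * 1) with 0 by ring. replace (PI * 1 + 0 * 0) with PI by ring.
  rewrite cos_PI, sin_PI, exp_0. f_equal; ring.
Qed.

Lemma Cexp_PI2 : Cexp (PI / 2 * Ci) = Ci.
Proof.
  rewrite <- RtoC_div by lra. unfold Cexp, RtoC, Ci, Cmult; simpl.
  replace (PI / 2 * 0 - 0 * 1) with 0 by ring. replace (PI / 2 * 1 + 0 * 0) with (PI / 2) by ring.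
  rewrite cos_PI2, sin_PI2, exp_0. f_equal; ring.
Qed.

(** * Explicit Taylor remainders of the exponential function *)

Lemma exp_mono (x y : R) : x <= y -> exp x <= exp y.
Proof. intros [H|H]; [left; now apply exp_increasing|rewrite H; lra]. Qed.

(** Applied twice in a row it yields second order remainders: the derivative of [exp t - 1 - t] is
    the first order remainder, and [sin] is treated likewise through [cos]. *)
Lemma MVT_bound (f f' : R -> R) (x M : R) :
  (forall t, is_derive f t (f' t)) -> f 0 = 0 ->
  (forall t, Rabs t <= Rabs x -> Rabs (f' t) <= M) -> Rabs (f x) <= M * Rabs x.
Proof.
  intros Hd H0 HM.
  destruct (MVT_gen f 0 x f') as [c [Hc He]].
  - intros t _. apply Hd.
  - intros t _. apply continuity_pt_filterlim. apply (ex_derive_continuous f). now exists (f' t).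
  - rewrite H0, !Rminus_0_r in He. rewrite He, Rabs_mult.
    apply Rmult_le_compat_r; [apply Rabs_pos|]. apply HM.
    destruct (Rle_dec 0 x) as [Hx|Hx].
    + rewrite Rmin_left, Rmax_right in Hc by lra. rewrite !Rabs_pos_eq; lra.
    + rewrite Rmin_right, Rmax_left in Hc by lra. rewrite !Rabs_left1; lra.
Qed.

Lemma exp_bound1 (x : R) : Rabs (exp x - 1) <= exp (Rabs x) * Rabs x.
Proof.
  apply (MVT_bound (fun t => exp t - 1) exp).
  - intros t. auto_derive; auto. ring.
  - rewrite exp_0; ring.
  - intros t Ht. rewrite Rabs_pos_eq by (left; apply exp_pos). apply exp_mono.
    pose proof (Rle_abs t). lra.
Qed.

Lemma exp_bound2 (x : R) : Rabs (exp x - 1 - x) <= exp (Rabs x) * x ^ 2.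
Proof.
  replace (x ^ 2) with (Rabs x * Rabs x).
  2:{ rewrite <- Rabs_mult. rewrite Rabs_pos_eq; nra. }
  rewrite <- Rmult_assoc.
  apply (MVT_bound (fun t => exp t - 1 - t) (fun t => exp t - 1)).
  - intros t. auto_derive; auto. ring.
  - rewrite exp_0; ring.
  - intros t Ht. eapply Rle_trans; [apply exp_bound1|].
    apply Rmult_le_compat; auto using Rabs_pos.
    + left; apply exp_pos. + now apply exp_mono.
Qed.

Lemma sin_bound1 (y : R) : Rabs (sin y) <= Rabs y.
Proof.
  rewrite <- (Rmult_1_l (Rabs y)). apply (MVT_bound sin cos).
  - intros t. auto_derive; auto. ring.
  - apply sin_0.
  - intros t _. apply Rabs_le. pose proof (COS_bound t). lra.
Qed.

Lemma cos_bound (y : R) : Rabs (cos y - 1) <= y ^ 2 / 2.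
Proof.
  replace (cos y - 1) with (- 2 * (sin (y / 2) * sin (y / 2))).
  2:{ replace y with (2 * (y / 2)) at 3 by field. rewrite cos_2a_sin. ring. }
  rewrite !Rabs_mult, (Rabs_left (-2)) by lra.
  pose proof (sin_bound1 (y / 2)). pose proof (Rabs_pos (sin (y / 2))).
  assert (Rabs (y / 2) * Rabs (y / 2) = y ^ 2 / 4).
  { rewrite <- Rabs_mult, Rabs_pos_eq; nra. }
  nra.
Qed.

Lemma cos_bound1 (y : R) : Rabs (cos y - 1) <= Rabs y.
Proof.
  rewrite <- (Rmult_1_l (Rabs y)). apply (MVT_bound (fun t => cos t - 1) (fun t => - sin t)).
  - intros t. auto_derive; auto. ring.
  - rewrite cos_0; ring.
  - intros t _. rewrite Rabs_Ropp. apply Rabs_le. pose proof (SIN_bound t). lra.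
Qed.

Lemma sin_bound2 (y : R) : Rabs (sin y - y) <= y ^ 2.
Proof.
  replace (y ^ 2) with (Rabs y * Rabs y).
  2:{ rewrite <- Rabs_mult. rewrite Rabs_pos_eq; nra. }
  apply (MVT_bound (fun t => sin t - t) (fun t => cos t - 1)).
  - intros t. auto_derive; auto. ring.
  - rewrite sin_0; ring.
  - intros t Ht. eapply Rle_trans; [apply cos_bound1|auto].
Qed.

(** Valid for all z, with an exponential factor instead of a smallness condition: it is applied to z
    = 2 pi i k (w - tau) with w fixed and k running through the exponents of a q-series, where z is
    unbounded. *)
Lemma Cexp_bound2 (z : C) : Cmod (Cexp z - 1 - z) <= 2 * exp (Cmod z) * Cmod z ^ 2.
Proof.
  eapply Rle_trans; [apply Cmod_le_abs|].
  rewrite Cmod2_alt. pose proof (re_le_Cmod z) as Hre.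
  destruct z as [x y]. set (m := Cmod (x, y)) in *. simpl in Hre. unfold Re, Im. simpl fst; simpl snd.
  pose proof (exp_mono _ _ Hre) as He.
  assert (exp x <= exp (Rabs x)) as Hx by (apply exp_mono, Rle_abs).
  pose proof (exp_bound2 x). pose proof (exp_bound1 x). pose proof (cos_bound y).
  pose proof (sin_bound2 y). pose proof (exp_pos x).
  assert (1 <= exp m) as Hm1.
  { rewrite <- exp_0. apply exp_mono. unfold m. apply Cmod_ge_0. }
  replace (exp x * cos y + - (1) + - x) with (exp x * (cos y - 1) + (exp x - 1 - x)) by ring.
  replace (exp x * sin y + - 0 + - y) with (exp x * (sin y - y) + (exp x - 1) * y) by ring.
  pose proof (Rabs_triang (exp x * (cos y - 1)) (exp x - 1 - x)).
  pose proof (Rabs_triang (exp x * (sin y - y)) ((exp x - 1) * y)).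
  rewrite !Rabs_mult, (Rabs_pos_eq (exp x)) in * by lra.
  assert (Rabs x * Rabs y <= (x ^ 2 + y ^ 2) / 2) as Hxy.
  { rewrite <- Rabs_mult. apply Rabs_le. pose proof (pow2_ge_0 (x + y)). pose proof (pow2_ge_0 (x - y)). lra. }
  assert (exp x * Rabs (cos y - 1) <= exp m * (y ^ 2 / 2)).
  { apply Rmult_le_compat; auto using Rabs_pos; lra. }
  assert (exp x * Rabs (sin y - y) <= exp m * y ^ 2).
  { apply Rmult_le_compat; auto using Rabs_pos; lra. }
  assert (Rabs (exp x - 1) * Rabs y <= exp m * ((x ^ 2 + y ^ 2) / 2)).
  { eapply Rle_trans; [apply Rmult_le_compat_r; [apply Rabs_pos|eassumption]|].
    rewrite Rmult_assoc. apply Rmult_le_compat; try lra.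
    apply Rmult_le_pos; apply Rabs_pos. }
  assert (exp (Rabs x) * x ^ 2 <= exp m * x ^ 2).
  { apply Rmult_le_compat_r; auto. nra. }
  nra.
Qed.

(* A quadratic remainder is no loss for analytic functions and avoids nested epsilons. *)
Definition cd (f : C -> C) (z l : C) : Prop :=
  exists K d, 0 <= K /\ 0 < d /\ forall w, Cmod (w - z) < d ->
    Cmod (f w - f z - l * (w - z)) <= K * Cmod (w - z) ^ 2.

Lemma cd_lip f (z l : C) : cd f z l ->
  exists L d, 0 <= L /\ 0 < d /\ forall w, Cmod (w - z) < d -> Cmod (f w - f z) <= L * Cmod (w - z).
Proof.
  intros [K [d [HK [Hd H]]]]. exists (K * d + Cmod l), d.
  pose proof (Cmod_ge_0 l). split; [nra|]. split; [auto|]. intros w Hw.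
  specialize (H w Hw). pose proof (Cmod_triangle (f w - f z - l * (w - z)) (l * (w - z))).
  replace (f w - f z - l * (w - z) + l * (w - z))%C with (f w - f z)%C in H1 by ring.
  rewrite Cmod_mult in H1. pose proof (Cmod_ge_0 (w - z)).
  assert (K * Cmod (w - z) ^ 2 <= K * d * Cmod (w - z)).
  { rewrite Rmult_assoc. apply Rmult_le_compat_l; nra. }
  lra.
Qed.

Lemma cd_ext_loc f g (z l : C) r : 0 < r -> (forall w, Cmod (w - z) < r -> f w = g w) ->
  cd f z l -> cd g z l.
Proof.
  intros Hr Hfg [K [d [HK [Hd H]]]]. exists K, (Rmin d r).
  split; auto. split; [now apply Rmin_glb_lt|]. intros w Hw.
  rewrite <- !Hfg.
  - apply H. eapply Rlt_le_trans; [apply Hw|apply Rmin_l].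
  - replace (z - z)%C with (RtoC 0) by ring. now rewrite Cmod_0.
  - eapply Rlt_le_trans; [apply Hw|apply Rmin_r].
Qed.

Lemma cd_ext f g (z l : C) : (forall w, f w = g w) -> cd f z l -> cd g z l.
Proof. intros H. apply (cd_ext_loc f g z l 1); auto. lra. Qed.

Lemma cd_eq f (z l m : C) : cd f z l -> l = m -> cd f z m.
Proof. now intros H <-. Qed.

Lemma cd_const c z : cd (fun _ => c) z 0.
Proof.
  exists 0, 1. split; [lra|]. split; [lra|]. intros w _.
  replace (c - c - 0 * (w - z))%C with (RtoC 0) by ring. rewrite Cmod_0. lra.
Qed.

Lemma cd_id z : cd (fun w => w) z 1.
Proof.
  exists 0, 1. split; [lra|]. split; [lra|]. intros w _.
  replace (w - z - 1 * (w - z))%C with (RtoC 0) by ring. rewrite Cmod_0. lra.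
Qed.

Lemma cd_plus f g (z l m : C) : cd f z l -> cd g z m -> cd (fun w => f w + g w)%C z (l + m)%C.
Proof.
  intros [K1 [d1 [HK1 [Hd1 H1]]]] [K2 [d2 [HK2 [Hd2 H2]]]].
  exists (K1 + K2), (Rmin d1 d2). split; [lra|]. split; [now apply Rmin_glb_lt|]. intros w Hw.
  specialize (H1 w (Rlt_le_trans _ _ _ Hw (Rmin_l _ _))).
  specialize (H2 w (Rlt_le_trans _ _ _ Hw (Rmin_r _ _))).
  replace (f w + g w - (f z + g z) - (l + m) * (w - z))%C
    with ((f w - f z - l * (w - z)) + (g w - g z - m * (w - z)))%C by ring.
  eapply Rle_trans; [apply Cmod_triangle|]. lra.
Qed.

Lemma cd_mult f g (z l m : C) : cd f z l -> cd g z m ->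
  cd (fun w => f w * g w)%C z (l * g z + f z * m)%C.
Proof.
  intros Hf Hg.
  destruct (cd_lip _ _ _ Hf) as [L1 [r1 [HL1 [Hr1 Hl1]]]].
  destruct (cd_lip _ _ _ Hg) as [L2 [r2 [HL2 [Hr2 Hl2]]]].
  destruct Hf as [K1 [d1 [HK1 [Hd1 H1]]]]. destruct Hg as [K2 [d2 [HK2 [Hd2 H2]]]].
  pose proof (Cmod_ge_0 (f z)). pose proof (Cmod_ge_0 (g z)).
  exists (K1 * Cmod (g z) + Cmod (f z) * K2 + L1 * L2), (Rmin (Rmin d1 d2) (Rmin r1 r2)).
  split.
  { repeat apply Rplus_le_le_0_compat; apply Rmult_le_pos; auto. }
  split; [repeat apply Rmin_glb_lt; auto|]. intros w Hw.
  apply Rmin_Rgt_l in Hw. destruct Hw as [Hw1 Hw2].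
  apply Rmin_Rgt_l in Hw1. apply Rmin_Rgt_l in Hw2.
  specialize (H1 w ltac:(tauto)). specialize (H2 w ltac:(tauto)).
  specialize (Hl1 w ltac:(tauto)). specialize (Hl2 w ltac:(tauto)).
  replace (f w * g w - f z * g z - (l * g z + f z * m) * (w - z))%C
    with ((f w - f z - l * (w - z)) * g z + f z * (g w - g z - m * (w - z))
          + (f w - f z) * (g w - g z))%C by ring.
  eapply Rle_trans; [apply Cmod_triangle|].
  eapply Rle_trans; [apply Rplus_le_compat_r, Cmod_triangle|]. rewrite !Cmod_mult.
  replace ((K1 * Cmod (g z) + Cmod (f z) * K2 + L1 * L2) * Cmod (w - z) ^ 2)
    with ((K1 * Cmod (w - z) ^ 2) * Cmod (g z) + Cmod (f z) * (K2 * Cmod (w - z) ^ 2)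
          + (L1 * Cmod (w - z)) * (L2 * Cmod (w - z))) by ring.
  repeat apply Rplus_le_compat.
  - apply Rmult_le_compat_r; auto.
  - apply Rmult_le_compat_l; auto.
  - apply Rmult_le_compat; auto using Cmod_ge_0.
Qed.

Lemma cd_scal c f (z l : C) : cd f z l -> cd (fun w => c * f w)%C z (c * l)%C.
Proof.
  intros H. eapply cd_eq; [apply (cd_mult _ _ _ _ _ (cd_const c z) H)|]. ring.
Qed.

Lemma cd_opp f (z l : C) : cd f z l -> cd (fun w => - f w)%C z (- l)%C.
Proof.
  intros H. apply cd_ext with (fun w => RtoC (-1) * f w)%C; [intros; ring|].
  eapply cd_eq; [apply cd_scal, H|]. ring.
Qed.

Lemma cd_minus f g (z l m : C) : cd f z l -> cd g z m -> cd (fun w => f w - g w)%C z (l - m)%C.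
Proof. intros. apply cd_plus; auto. now apply cd_opp. Qed.

Lemma cd_inv f (z l : C) : f z <> RtoC 0 -> cd f z l -> cd (fun w => / f w)%C z (- l / f z ^ 2)%C.
Proof.
  intros Hz Hf. pose proof (proj1 (Cmod_gt_0 _) Hz) as Hz'.
  destruct (cd_lip _ _ _ Hf) as [L [r [HL [Hr Hl]]]].
  destruct Hf as [K [d [HK [Hd H]]]].
  set (A := Cmod (f z)) in *.
  assert (0 < A / (2 * (L + 1))) as HA by (apply Rdiv_lt_0_compat; lra).
  (* The last radius keeps |f w| above half of |f z|. *)
  exists ((L * L * 2 / A + K) / A ^ 2), (Rmin (Rmin d r) (A / (2 * (L + 1)))).
  split.
  { apply Rmult_le_pos; [|left; apply Rinv_0_lt_compat, pow_lt; auto].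
    apply Rplus_le_le_0_compat; auto. apply Rmult_le_pos; [nra|left; now apply Rinv_0_lt_compat]. }
  split; [repeat apply Rmin_glb_lt; auto|]. intros w Hw.
  apply Rmin_Rgt_l in Hw. destruct Hw as [Hw1 Hw2]. apply Rmin_Rgt_l in Hw1.
  specialize (H w ltac:(tauto)). specialize (Hl w ltac:(tauto)).
  set (e := Cmod (w - z)) in *. assert (0 <= e) as He by apply Cmod_ge_0.
  assert (e * (2 * (L + 1)) < A) as Hs.
  { apply (Rmult_lt_compat_r (2 * (L + 1))) in Hw2; [|lra].
    unfold Rdiv in Hw2. rewrite Rmult_assoc, Rinv_l, Rmult_1_r in Hw2; lra. }
  assert (A / 2 <= Cmod (f w)) as Hfw.
  { pose proof (Cmod_triangle_rev (f z) (f w)). rewrite Cmod_sub_sym in H0. fold A in H0. nra. }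
  assert (f w <> RtoC 0) as Hw0 by (apply Cmod_gt_0; lra).
  replace (/ f w - / f z - - l / f z ^ 2 * (w - z))%C
    with (((f w - f z) * (f w - f z) / f w - (f w - f z - l * (w - z))) / f z ^ 2)%C
    by (field; auto).
  rewrite Cmod_div by (apply Cpow_nz; auto). rewrite Cmod_pow. fold A.
  unfold Rdiv. match goal with |- ?x * _ <= ?y * _ * ?z =>
    replace (y * / A ^ 2 * z) with (y * z * / A ^ 2) by ring end.
  apply Rmult_le_compat_r; [left; apply Rinv_0_lt_compat, pow_lt; auto|].
  eapply Rle_trans; [apply Cmod_triangle_minus|]. rewrite Rmult_plus_distr_r.
  apply Rplus_le_compat; auto.
  rewrite Cmod_div by auto. rewrite Cmod_mult.
  assert (/ Cmod (f w) <= 2 * / A) as Hi.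
  { replace (2 * / A) with (/ (A / 2)) by (field; lra). apply Rinv_le_contravar; lra. }
  replace (L * L * 2 * / A * e ^ 2) with ((L * e) * (L * e) * (2 * / A)) by ring.
  unfold Rdiv. apply Rmult_le_compat; auto.
  - apply Rmult_le_pos; apply Cmod_ge_0.
  - left. apply Rinv_0_lt_compat. lra.
  - apply Rmult_le_compat; auto using Cmod_ge_0.
Qed.

Lemma cd_div f g (z l m : C) : g z <> RtoC 0 -> cd f z l -> cd g z m ->
  cd (fun w => f w / g w)%C z ((l * g z - f z * m) / g z ^ 2)%C.
Proof.
  intros Hz Hf Hg. eapply cd_eq; [apply (cd_mult _ _ _ _ _ Hf (cd_inv _ _ _ Hz Hg))|].
  field. auto.
Qed.

Lemma cd_pow f (z l : C) n : cd f z l -> cd (fun w => f w ^ n)%C z (INR n * f z ^ pred n * l)%C.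
Proof.
  intros H. induction n.
  - simpl. eapply cd_eq; [apply cd_const|]. ring.
  - eapply cd_eq; [apply (cd_mult _ _ _ _ _ H IHn)|]. rewrite S_INR, RtoC_plus.
    destruct n; simpl pred; [simpl; ring|]. change (f z ^ S n)%C with (f z * f z ^ n)%C. ring.
Qed.

Lemma cd_affine (f : C -> C) (al be z l : C) : cd f (al * z + be)%C l ->
  cd (fun w => f (al * w + be))%C z (al * l)%C.
Proof.
  intros [K [d [HK [Hd H]]]]. pose proof (Cmod_ge_0 al) as Ha.
  exists (K * Cmod al ^ 2), (d / (Cmod al + 1)).
  split; [apply Rmult_le_pos; auto; apply pow_le; auto|].
  split; [apply Rdiv_lt_0_compat; lra|]. intros w Hw.
  assert (al * w + be - (al * z + be) = al * (w - z))%C as E by ring.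
  assert (Cmod (al * w + be - (al * z + be)) < d) as Hd'.
  { rewrite E, Cmod_mult. apply (Rmult_lt_compat_r (Cmod al + 1)) in Hw; [|lra].
    unfold Rdiv in Hw. rewrite Rmult_assoc, Rinv_l, Rmult_1_r in Hw by lra.
    pose proof (Cmod_ge_0 (w - z)). nra. }
  specialize (H _ Hd'). rewrite E in H. rewrite Cmod_mult, Rpow_mult_distr in H.
  replace (al * l * (w - z))%C with (l * (al * (w - z)))%C by ring. lra.
Qed.

Lemma cd_Cexp (z : C) : cd Cexp z (Cexp z).
Proof.
  exists (Cmod (Cexp z) * (2 * exp 1)), 1.
  split. { apply Rmult_le_pos; [apply Cmod_ge_0|]. pose proof (exp_pos 1). lra. }
  split; [lra|]. intros w Hw.
  assert (Cexp w = Cexp z * Cexp (w - z))%C as ->.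
  { rewrite <- Cexp_add. f_equal. ring. }
  replace (Cexp z * Cexp (w - z) - Cexp z - Cexp z * (w - z))%C
    with (Cexp z * (Cexp (w - z) - 1 - (w - z)))%C by ring.
  rewrite Cmod_mult, Rmult_assoc. apply Rmult_le_compat_l; [apply Cmod_ge_0|].
  eapply Rle_trans; [apply Cexp_bound2|].
  apply Rmult_le_compat_r; [apply pow_le, Cmod_ge_0|].
  apply Rmult_le_compat_l; [lra|]. apply exp_mono. lra.
Qed.

Lemma cd_Cexp_lin (la z : C) : cd (fun w => Cexp (la * w)) z (la * Cexp (la * z))%C.
Proof.
  apply cd_ext with (fun w => Cexp (la * w + 0)).
  { intros. f_equal. ring. }
  eapply cd_eq; [apply cd_affine, cd_Cexp|]. do 2 f_equal. ring.
Qed.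

(** The tool for differentiating functional equations: the derivatives of the two sides, computed
    separately, must agree. A small real increment already separates two candidates. *)
Lemma cd_unique f (z l m : C) : cd f z l -> cd f z m -> l = m.
Proof.
  intros [K1 [d1 [HK1 [Hd1 H1]]]] [K2 [d2 [HK2 [Hd2 H2]]]].
  destruct (Req_dec (Cmod (l - m)) 0) as [H|H].
  { apply Cmod_eq_0 in H. replace l with (l - m + m)%C by ring. rewrite H. ring. }
  pose proof (Cmod_ge_0 (l - m)) as Hp.
  set (e := Rmin (Rmin d1 d2) (Cmod (l - m) / (K1 + K2 + 1)) / 2).
  assert (0 < Cmod (l - m) / (K1 + K2 + 1)) as Hq by (apply Rdiv_lt_0_compat; lra).
  assert (0 < e) as He.
  { unfold e. apply Rdiv_lt_0_compat; [|lra]. repeat apply Rmin_glb_lt; auto. }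
  assert (e < d1 /\ e < d2 /\ e * (K1 + K2 + 1) < Cmod (l - m)) as [He1 [He2 He3]].
  { pose proof (Rmin_l (Rmin d1 d2) (Cmod (l - m) / (K1 + K2 + 1))).
    pose proof (Rmin_r (Rmin d1 d2) (Cmod (l - m) / (K1 + K2 + 1))).
    pose proof (Rmin_l d1 d2). pose proof (Rmin_r d1 d2). unfold e in *.
    repeat split; try lra.
    apply Rlt_le_trans with (Cmod (l - m) / (K1 + K2 + 1) * (K1 + K2 + 1)).
    - apply Rmult_lt_compat_r; lra. - right. field. lra. }
  assert (Cmod (z + e - z) = e) as Ez.
  { replace (z + e - z)%C with (RtoC e) by ring. rewrite Cmod_R. apply Rabs_pos_eq. lra. }
  specialize (H1 (z + e)%C). specialize (H2 (z + e)%C). rewrite Ez in *.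
  specialize (H1 He1). specialize (H2 He2).
  pose proof (Cmod_sub_triangle (l * (z + e - z)) (f (z + e) - f z) (m * (z + e - z)))%C as Ht.
  rewrite (Cmod_sub_sym (l * (z + e - z)) (f (z + e) - f z))%C in Ht.
  replace (l * (z + e - z) - m * (z + e - z))%C with ((l - m) * (z + e - z))%C in Ht by ring.
  rewrite Cmod_mult, Ez in Ht. nra.
Qed.

Lemma cd_CL f (z l : C) (u : nat -> C) : cd f z l -> CL u z -> CL (fun n => f (u n)) (f z).
Proof.
  intros H Hu. destruct (cd_lip _ _ _ H) as [L [d [HL [Hd Hl]]]]. intros eps He.
  assert (0 < eps / (L + 1)) as He' by (apply Rdiv_lt_0_compat; lra).
  destruct (Hu (Rmin d (eps / (L + 1)))) as [N HN]; [now apply Rmin_glb_lt|].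
  exists N. intros n Hn. specialize (HN n Hn). apply Rmin_Rgt_l in HN. destruct HN as [HN1 HN2].
  eapply Rle_lt_trans; [apply Hl; auto|].
  apply Rlt_le_trans with (eps / (L + 1) * (L + 1)); [|right; field; lra].
  pose proof (Cmod_ge_0 (u n - z)). nra.
Qed.

(** * Differentiable paths and the chain rule along them *)

Definition is_dpath (g : R -> C) (s : R) (l : C) : Prop :=
  is_derive (V := C_R_NormedModule) g s l.

Lemma norm_C_R (x : C) : norm (V := C_R_NormedModule) x = Cmod x.
Proof.
  unfold norm; simpl. unfold prod_norm, Cmod. f_equal. unfold norm; simpl. unfold abs; simpl.
  rewrite !Rmult_1_r, <- !Rabs_mult.
  rewrite !Rabs_pos_eq; try apply Rle_0_sqr. reflexivity.
Qed.

Lemma is_dpath_eps (g : R -> C) s l : is_dpath g s l <->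
  forall eps, 0 < eps -> exists d, 0 < d /\ forall u, Rabs (u - s) < d ->
    Cmod (g u - g s - (u - s)%R * l) <= eps * Rabs (u - s).
Proof.
  split.
  - intros [_ H] eps He. specialize (H s (fun P HP => HP) (mkposreal eps He)).
    destruct H as [d Hd]. exists d. split; [apply cond_pos|]. intros u Hu.
    specialize (Hd u Hu). rewrite norm_C_R in Hd.
    unfold norm, minus, plus, opp, scal in Hd; simpl in Hd. unfold abs in Hd; simpl in Hd.
    match type of Hd with Cmod ?x <= _ => replace (g u - g s - (u - s)%R * l)%C with x end.
    + exact Hd.
    + destruct (g u), (g s), l. unfold prod_plus, prod_opp, prod_scal, Cminus, Cplus, Copp, Cmult, RtoC, plus, opp, scal; simpl.
      unfold mult; simpl. f_equal; ring.
  - intros H. split; [apply is_linear_scal_l|]. intros x Hx.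
    assert (s = x) as <- by exact (is_filter_lim_locally_unique (V := R_NormedModule) s x Hx).
    intros eps. destruct (H eps (cond_pos eps)) as [d [Hd Hb]].
    exists (mkposreal d Hd). intros u Hu. rewrite norm_C_R.
    specialize (Hb u Hu).
    unfold norm, minus, plus, opp, scal; simpl. unfold abs; simpl.
    match goal with |- Cmod ?x <= _ => replace x with (g u - g s - (u - s)%R * l)%C end.
    + exact Hb.
    + destruct (g u), (g s), l. unfold prod_plus, prod_opp, prod_scal, Cminus, Cplus, Copp, Cmult, RtoC, plus, opp, scal; simpl.
      unfold mult; simpl. f_equal; ring.
Qed.

Lemma cd_path (f : C -> C) (g : R -> C) s (l m : C) :
  cd f (g s) l -> is_dpath g s m -> is_dpath (fun u => f (g u)) s (l * m)%C.
Proof.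
  intros Hf Hg. destruct Hf as [K [d [HK [Hd H]]]].
  apply is_dpath_eps. intros eps He.
  pose proof (proj1 (is_dpath_eps g s m) Hg) as Hg'.
  pose proof (Cmod_ge_0 l) as Hl. pose proof (Cmod_ge_0 m) as Hm.
  destruct (Hg' (Rmin 1 (eps / (2 * (Cmod l + 1))))) as [d1 [Hd1 H1]].
  { apply Rmin_glb_lt; [lra|]. apply Rdiv_lt_0_compat; lra. }
  set (B := Cmod m + 1).
  set (d2 := Rmin d1 (Rmin (d / B) (eps / (2 * (K + 1) * B ^ 2)))).
  assert (0 < B) by (unfold B; lra).
  assert (0 < B ^ 2) by (now apply pow_lt).
  assert (0 < d2) as Hd2.
  { unfold d2. repeat apply Rmin_glb_lt; auto; apply Rdiv_lt_0_compat; auto.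
    apply Rmult_lt_0_compat; lra. }
  exists d2. split; auto. intros u Hu.
  apply Rmin_Rgt_l in Hu. destruct Hu as [Hu1 Hu]. apply Rmin_Rgt_l in Hu. destruct Hu as [Hu2 Hu3].
  specialize (H1 u Hu1). set (r := Rabs (u - s)) in *.
  assert (0 <= r) as Hr by apply Rabs_pos.
  assert (Cmod (g u - g s) <= B * r) as Hlip.
  { pose proof (Cmod_triangle (g u - g s - (u - s)%R * m) ((u - s)%R * m)) as Ht.
    replace (g u - g s - (u - s)%R * m + (u - s)%R * m)%C with (g u - g s)%C in Ht by ring.
    rewrite Cmod_mult, Cmod_R in Ht. fold r in Ht.
    pose proof (Rmin_l 1 (eps / (2 * (Cmod l + 1)))). unfold B. nra. }
  assert (Cmod (g u - g s) < d) as Hin.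
  { apply Rle_lt_trans with (1 := Hlip).
    apply (Rmult_lt_compat_l B) in Hu2; auto.
    replace (B * (d / B)) with d in Hu2 by (field; lra). lra. }
  specialize (H _ Hin).
  replace (f (g u) - f (g s) - (u - s)%R * (l * m))%C
    with ((f (g u) - f (g s) - l * (g u - g s)) + l * (g u - g s - (u - s)%R * m))%C by ring.
  eapply Rle_trans; [apply Cmod_triangle|]. rewrite Cmod_mult.
  assert (Cmod (f (g u) - f (g s) - l * (g u - g s)) <= eps / 2 * r).
  { apply Rle_trans with (1 := H). apply Rle_trans with (K * (B * r) ^ 2).
    - apply Rmult_le_compat_l; auto. apply pow_incr. split; auto using Cmod_ge_0.
    - apply Rle_trans with ((K + 1) * B ^ 2 * r * r); [ring_simplify; nra|].
      apply Rmult_le_compat_r; auto.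
      apply (Rmult_lt_compat_l ((K + 1) * B ^ 2)) in Hu3; [|apply Rmult_lt_0_compat; lra].
      replace ((K + 1) * B ^ 2 * (eps / (2 * (K + 1) * B ^ 2))) with (eps / 2) in Hu3
        by (field; split; lra). lra. }
  assert (Cmod l * Cmod (g u - g s - (u - s)%R * m) <= eps / 2 * r).
  { apply Rle_trans with (Cmod l * (eps / (2 * (Cmod l + 1)) * r)).
    - apply Rmult_le_compat_l; auto. apply Rle_trans with (1 := H1).
      apply Rmult_le_compat_r; auto. apply Rmin_r.
    - rewrite <- Rmult_assoc. apply Rmult_le_compat_r; auto.
      apply Rle_trans with ((Cmod l + 1) * (eps / (2 * (Cmod l + 1)))).
      + apply Rmult_le_compat_r; [|lra]. left. apply Rdiv_lt_0_compat; lra.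
      + right. field. lra. }
  lra.
Qed.

(** * Infinite products and Jacobi's triple product *)

Definition iprod (v : nat -> C) : C := CLim_seq (Cprod1 (fun n => 1 + v n)%C).

(** The products start at n = 1, hence the shift [S k]. *)
Definition geo_bounded (v : nat -> C) (r : R) : Prop :=
  0 <= r < 1 /\ forall k, Cmod (v (S k)) <= r ^ S k.

Lemma ex_series_pow (r : R) : 0 <= r < 1 -> ex_series (fun n => r ^ n).
Proof. intros. apply ex_series_geom. rewrite Rabs_pos_eq; lra. Qed.

Lemma Cprod1_ext u v n : (forall k, (1 <= k <= n)%nat -> u k = v k) -> Cprod1 u n = Cprod1 v n.
Proof.
  induction n; intros H; simpl; [auto|]. rewrite IHn by (intros; apply H; lia). now rewrite H by lia.
Qed.

Lemma Cprod1_mult u v n : Cprod1 (fun k => u k * v k)%C n = (Cprod1 u n * Cprod1 v n)%C.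
Proof. induction n; simpl; [ring|]. rewrite IHn. ring. Qed.

Lemma Cprod1_bound (v : nat -> C) (b : nat -> R) n : (forall k, Cmod (v (S k)) <= b k) ->
  (forall k, 0 <= b k) -> ex_series b ->
  Cmod (Cprod1 (fun k => 1 + v k)%C n) <= exp (Series b).
Proof.
  intros Hv Hb Hs.
  assert (forall n, Cmod (Cprod1 (fun k => 1 + v k)%C (S n)) <= exp (sum_n b n)) as H.
  { assert (forall k, Cmod (1 + v (S k)) <= exp (b k)) as H1.
    { intros k. eapply Rle_trans; [apply Cmod_triangle|]. rewrite Cmod_1.
      specialize (Hv k). pose proof (exp_ineq1_le (b k)). lra. }
    induction n0.
    - rewrite sum_O. simpl. rewrite Cmult_1_l. apply H1.
    - rewrite sum_Sn. unfold plus; simpl plus. rewrite exp_plus.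
      change (Cprod1 (fun k => 1 + v k) (S (S n0)))%C
        with (Cprod1 (fun k => 1 + v k) (S n0) * (1 + v (S (S n0))))%C.
      rewrite Cmod_mult. apply Rmult_le_compat; auto using Cmod_ge_0. }
  destruct n.
  - simpl. rewrite Cmod_1, <- exp_0. apply exp_mono.
    apply Rle_trans with (sum_n b 0); [rewrite sum_O; auto|now apply sum_n_le_Series].
  - eapply Rle_trans; [apply H|]. apply exp_mono. now apply sum_n_le_Series.
Qed.

(** Telescoping turns the product into a series, P (k+1) - P k = P k v (k+1). As the partial
    products are bounded, its terms are dominated by a multiple of [b]. *)
Lemma Cprod1_CL (v : nat -> C) (b : nat -> R) : (forall k, Cmod (v (S k)) <= b k) ->
  (forall k, 0 <= b k) -> ex_series b -> CL (Cprod1 (fun n => 1 + v n)%C) (iprod v).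
Proof.
  intros Hv Hb Hs. set (P := Cprod1 (fun n => 1 + v n)%C).
  assert (forall n, P n = (1 + psum (fun k => P k * v (S k)) n)%C) as HP.
  { induction n; simpl; [unfold P; simpl; ring|].
    rewrite Cplus_assoc, <- IHn. change (P (S n)) with (P n * (1 + v (S n)))%C. ring. }
  assert (summ (fun k => P k * v (S k))%C) as HS.
  { apply summ_dom with (fun k => exp (Series b) * b k).
    - intros k. rewrite Cmod_mult. apply Rmult_le_compat; auto using Cmod_ge_0.
      now apply Cprod1_bound.
    - now apply ex_series_scal_r. }
  assert (CL P (1 + csum (fun k => P k * v (S k)))%C) as H.
  { apply CL_ext with (fun n => 1 + psum (fun k => P k * v (S k)) n)%C; [auto|].
    apply CL_plus; [apply CL_const|now apply summ_CL]. }
  unfold iprod. fold P. now rewrite (CLim_seq_unique _ _ H).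
Qed.

Lemma geo_dom v r : geo_bounded v r -> (forall k, Cmod (v (S k)) <= r ^ k) /\
  (forall k, 0 <= r ^ k) /\ ex_series (fun k => r ^ k).
Proof.
  intros [Hr H]. split; [|split].
  - intros k. eapply Rle_trans; [apply H|]. simpl.
    assert (0 <= r ^ k) by (apply pow_le; lra). nra.
  - intros k. apply pow_le; lra.
  - now apply ex_series_pow.
Qed.

Lemma iprod_CL v r : geo_bounded v r -> CL (Cprod1 (fun n => 1 + v n)%C) (iprod v).
Proof. intros H. apply geo_dom in H. now apply Cprod1_CL with (fun k => r ^ k). Qed.

Lemma geo_bounded_neq v r k : geo_bounded v r -> (1 + v (S k))%C <> RtoC 0.
Proof.
  intros [Hr H] E. specialize (H k).
  replace (v (S k)) with (1 + v (S k) - 1)%C in H by ring. rewrite E in H.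
  replace (0 - 1)%C with (- (1))%C in H by ring. rewrite Cmod_m1 in H.
  assert (r ^ S k < 1) by (apply pow_lt_1_compat; [lra|lia]). lra.
Qed.

Lemma geo_bounded_inv v r : geo_bounded v r ->
  forall k, Cmod (/ (1 + v (S k)) - 1) <= / (1 - r) * r ^ k.
Proof.
  intros Hv k. pose proof (geo_bounded_neq _ _ k Hv) as Hn. destruct Hv as [Hr H].
  specialize (H k).
  assert (0 <= r ^ k) by (apply pow_le; lra).
  assert (r ^ S k <= r) as Hrk.
  { simpl. assert (r ^ k <= 1) by (rewrite <- (pow1 k); apply pow_incr; lra). nra. }
  assert (1 - r <= Cmod (1 + v (S k))) as H1.
  { pose proof (Cmod_triangle_rev 1 (- v (S k))). rewrite Cmod_1, Cmod_opp in H1.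
    replace (1 - - v (S k))%C with (1 + v (S k))%C in H1 by ring. lra. }
  replace (/ (1 + v (S k)) - 1)%C with (- v (S k) / (1 + v (S k)))%C by (field; auto).
  rewrite Cmod_div, Cmod_opp by auto. rewrite Rmult_comm. unfold Rdiv.
  apply Rmult_le_compat; auto using Cmod_ge_0.
  - left. apply Rinv_0_lt_compat. lra.
  - eapply Rle_trans; [apply H|]. simpl. nra.
  - apply Rinv_le_contravar; lra.
Qed.

Lemma Cinv_of_mult (x y : C) : (x * y = 1)%C -> (/ y = x)%C.
Proof.
  intros H. assert (y <> RtoC 0) as Hy.
  { intros E. rewrite E, Cmult_0_r in H. injection H. lra. }
  transitivity (x * y / y)%C; [rewrite H|]; field; auto.
Qed.

(** The reciprocals of the factors form a convergent product as well, and the two limits multiply to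
    1; this is how the infinite product is seen not to vanish. The uniform bound on the reciprocals
    is what [theta_limit] uses to dominate Gaussian binomials. *)
Lemma iprod_inv v r : geo_bounded v r ->
  CL (Cprod1 (fun n => / (1 + v n))%C) (/ iprod v)%C /\ iprod v <> RtoC 0 /\
  exists B, forall n, Cmod (/ Cprod1 (fun n => 1 + v n)%C n) <= B.
Proof.
  intros Hv. pose proof (geo_bounded_inv _ _ Hv) as Hi.
  pose proof (geo_dom _ _ Hv) as [_ [Hp Hs]].
  assert (0 < / (1 - r)) as Hr by (apply Rinv_0_lt_compat; destruct Hv; lra).
  set (w := fun k => (/ (1 + v k) - 1)%C).
  assert (forall k, 0 <= / (1 - r) * r ^ k) as Hp' by (intros; apply Rmult_le_pos; auto; lra).
  pose proof (ex_series_scal_r _ (/ (1 - r)) Hs) as Hs'.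
  assert (forall n, (Cprod1 (fun n => 1 + w n) n * Cprod1 (fun n => 1 + v n) n = 1)%C) as H1.
  { induction n; simpl; [ring|].
    replace (Cprod1 (fun n0 => 1 + w n0) n * (1 + w (S n)) *
      (Cprod1 (fun n0 => 1 + v n0) n * (1 + v (S n))))%C with
      ((Cprod1 (fun n0 => 1 + w n0) n * Cprod1 (fun n0 => 1 + v n0) n) *
       ((1 + w (S n)) * (1 + v (S n))))%C by ring.
    rewrite IHn. unfold w. field. now apply geo_bounded_neq with r. }
  assert (iprod w * iprod v = 1)%C as H2.
  { apply CL_unique with (fun n => Cprod1 (fun n => 1 + w n) n * Cprod1 (fun n => 1 + v n) n)%C.
    - apply CL_mult; [now apply Cprod1_CL with (2 := Hp')|now apply iprod_CL with r].
    - apply CL_ext with (fun _ => RtoC 1); [auto|apply CL_const]. }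
  assert (iprod v <> RtoC 0) as H3.
  { intros E. rewrite E in H2. rewrite Cmult_0_r in H2. injection H2. lra. }
  assert (/ iprod v = iprod w)%C as H4.
  { now apply Cinv_of_mult. }
  split; [|split; auto].
  - rewrite H4. apply CL_ext with (Cprod1 (fun n => 1 + w n)%C).
    + intros n. apply Cprod1_ext. intros. unfold w. ring.
    + now apply Cprod1_CL with (2 := Hp').
  - exists (exp (Series (fun k => / (1 - r) * r ^ k))). intros n.
    replace (/ Cprod1 (fun n0 => 1 + v n0) n)%C with (Cprod1 (fun n => 1 + w n)%C n).
    + now apply Cprod1_bound.
    + symmetry. apply Cinv_of_mult. apply H1.
Qed.

Lemma iprod_neq_0 v r : geo_bounded v r -> iprod v <> RtoC 0.
Proof. intros H. now apply iprod_inv in H. Qed.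

Lemma iprod_unique v r l : geo_bounded v r -> CL (Cprod1 (fun n => 1 + v n)%C) l -> iprod v = l.
Proof. intros H H1. eapply CL_unique; [now apply iprod_CL with r|auto]. Qed.

Lemma iprod_mult u v w r : geo_bounded u r -> geo_bounded v r -> geo_bounded w r ->
  (forall n, (1 <= n)%nat -> ((1 + u n) * (1 + v n) = 1 + w n)%C) -> (iprod u * iprod v = iprod w)%C.
Proof.
  intros Hu Hv Hw H. symmetry. apply iprod_unique with r; auto.
  apply CL_ext with (fun n => Cprod1 (fun n => 1 + u n) n * Cprod1 (fun n => 1 + v n) n)%C.
  - intros n. rewrite <- Cprod1_mult. apply Cprod1_ext. intros; apply H; lia.
  - apply CL_mult; now apply iprod_CL with r.
Qed.

Lemma geo_bounded_pow (e : C) (q : C) (f : nat -> nat) : Cmod e = 1 -> Cmod q < 1 ->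
  (forall n, (n <= f n)%nat) -> geo_bounded (fun n => e * q ^ f n)%C (Cmod q).
Proof.
  intros He Hq Hf. pose proof (Cmod_ge_0 q). split; [lra|]. intros k.
  rewrite Cmod_mult, He, Rmult_1_l, Cmod_pow.
  specialize (Hf (S k)). replace (f (S k)) with (S k + (f (S k) - S k))%nat by lia.
  rewrite pow_add. rewrite <- (Rmult_1_r (Cmod q ^ S k)) at 2.
  apply Rmult_le_compat_l; [apply pow_le; lra|].
  rewrite <- (pow1 (f (S k) - S k)). apply pow_incr. lra.
Qed.

Lemma geo_bounded_weaken v r s : geo_bounded v r -> r <= s < 1 -> geo_bounded v s.
Proof.
  intros [Hr H] Hs. split; [lra|]. intros k. eapply Rle_trans; [apply H|]. apply pow_incr. lra.
Qed.

(** Euler's function, that is, eta up to the factor q^(1/24). The explicit coefficient -1 makes it,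
    like the next two products, an instance of [geo_bounded_pow]. *)
Definition phi (q : C) : C := iprod (fun n => - (1) * q ^ n)%C.
Definition prod_plus_pow (q : C) : C := iprod (fun n => 1 * q ^ n)%C.
Definition prod_odd (e q : C) : C := iprod (fun n => e * q ^ (2 * n - 1))%C.

Lemma phi_neq_0 q : Cmod q < 1 -> phi q <> RtoC 0.
Proof. intros. apply iprod_neq_0 with (Cmod q). apply geo_bounded_pow; auto using Cmod_m1. Qed.

Lemma prod_plus_pow_neq_0 q : Cmod q < 1 -> prod_plus_pow q <> RtoC 0.
Proof. intros. apply iprod_neq_0 with (Cmod q). apply geo_bounded_pow; auto using Cmod_1. Qed.

Lemma Cmod_sq_lt q : Cmod q < 1 -> Cmod (q ^ 2) < 1.
Proof. intros H. rewrite Cmod_pow. pose proof (Cmod_ge_0 q). nra. Qed.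

Lemma Cmod_sq_le q : Cmod q < 1 -> Cmod (q ^ 2) <= Cmod q.
Proof. intros H. rewrite Cmod_pow. pose proof (Cmod_ge_0 q). nra. Qed.

Lemma geo_bounded_sq (e : C) (q : C) (f : nat -> nat) : Cmod e = 1 -> Cmod q < 1 ->
  (forall n, (n <= f n)%nat) -> geo_bounded (fun n => e * (q ^ 2) ^ f n)%C (Cmod q).
Proof.
  intros. apply geo_bounded_weaken with (Cmod (q ^ 2)).
  - apply geo_bounded_pow; auto using Cmod_sq_lt.
  - split; auto using Cmod_sq_le.
Qed.

Lemma Cpow_sq_pow (q : C) n : ((q ^ 2) ^ n = q ^ n * q ^ n)%C.
Proof. rewrite <- Cpow_mult_r, <- Cpow_add_r. f_equal. lia. Qed.

Lemma phi_mult_plus q : Cmod q < 1 -> (phi q * prod_plus_pow q = phi (q ^ 2))%C.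
Proof.
  intros Hq. apply iprod_mult with (Cmod q).
  - apply geo_bounded_pow; auto using Cmod_m1.
  - apply geo_bounded_pow; auto using Cmod_1.
  - apply geo_bounded_sq with (f := fun n => n); auto using Cmod_m1.
  - intros n _. rewrite Cpow_sq_pow. ring.
Qed.

(** Even and odd factors are separated in the partial product of length 2N. *)
Lemma phi_split q : Cmod q < 1 -> phi q = (phi (q ^ 2) * prod_odd (- (1)) q)%C.
Proof.
  intros Hq. apply CL_unique with (fun N => Cprod1 (fun n => 1 + (- (1)) * q ^ n)%C (2 * N)).
  - apply (CL_comp _ _ (fun N => 2 * N)%nat); [lia|].
    apply iprod_CL with (Cmod q). apply geo_bounded_pow; auto using Cmod_m1.
  - apply CL_ext with (fun N => Cprod1 (fun n => 1 + (- (1)) * (q ^ 2) ^ n) N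
      * Cprod1 (fun n => 1 + (- (1)) * q ^ (2 * n - 1)) N)%C.
    + induction n; [simpl; ring|]. replace (2 * S n)%nat with (S (S (2 * n))) by lia.
      cbn [Cprod1]. rewrite <- IHn, <- Cpow_mult_r.
      replace (2 * S n)%nat with (S (S (2 * n))) by lia.
      replace (S (S (2 * n)) - 1)%nat with (S (2 * n)) by lia. ring.
    + apply CL_mult; [apply iprod_CL with (Cmod q)|apply iprod_CL with (Cmod q)].
      * apply geo_bounded_sq with (f := fun n => n); auto using Cmod_m1.
      * apply geo_bounded_pow; auto using Cmod_m1. lia.
Qed.

Lemma prod_odd_mult q : Cmod q < 1 -> (prod_odd 1 q * prod_odd (- (1)) q = prod_odd (- (1)) (q ^ 2))%C.
Proof.
  intros Hq. apply iprod_mult with (Cmod q).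
  - apply geo_bounded_pow; auto using Cmod_1. lia.
  - apply geo_bounded_pow; auto using Cmod_m1. lia.
  - apply geo_bounded_sq with (f := fun n => (2 * n - 1)%nat); auto using Cmod_m1. lia.
  - intros n _. rewrite Cpow_sq_pow. ring.
Qed.

(** * Gaussian binomials and the triple product as a limit of finite products *)

Fixpoint tri (n : nat) : nat := match n with O => O | S m => (m + tri m)%nat end.

(** Gaussian binomial coefficient by Pascal's rule, so that no division by 1 - p^k occurs. The
    truncated difference [M' - j'] is harmless: for j' > M' the coefficient next to it is 0. *)
Fixpoint gauss_binom (p : C) (M j : nat) : C :=
  match M, j with
  | O, O => RtoC 1
  | O, S _ => RtoC 0
  | S _, O => RtoC 1
  | S M', S j' => (gauss_binom p M' (S j') + p ^ (M' - j') * gauss_binom p M' j')%C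
  end.

Fixpoint Cprod0 (u : nat -> C) (n : nat) : C :=
  match n with O => RtoC 1 | S m => (Cprod0 u m * u m)%C end.

Lemma gauss_binom_0 p M : gauss_binom p M 0 = RtoC 1.
Proof. now destruct M. Qed.

Lemma gauss_binom_gt p M : forall j, (M < j)%nat -> gauss_binom p M j = RtoC 0.
Proof.
  induction M; intros j Hj; destruct j; try lia; [auto|]. simpl.
  rewrite !IHM by lia. ring.
Qed.

Lemma gauss_binom_diag p M : gauss_binom p M M = RtoC 1.
Proof.
  induction M; [auto|]. simpl. rewrite IHM, gauss_binom_gt, Nat.sub_diag by lia. simpl. ring.
Qed.

(** Rothe's identity, the finite form of the q-binomial theorem. Multiplying by the factor k = M
    reproduces Pascal's rule, since p^M = p^(M-j) p^j. *)
Lemma q_binomial (p x : C) M : Cprod0 (fun k => 1 + x * p ^ k)%C M =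
  psum (fun j => gauss_binom p M j * p ^ tri j * x ^ j)%C (S M).
Proof.
  induction M; [simpl; ring|].
  rewrite psum_head. change (Cprod0 (fun k => 1 + x * p ^ k)%C (S M))
    with (Cprod0 (fun k => 1 + x * p ^ k) M * (1 + x * p ^ M))%C.
  assert (Cprod0 (fun k => 1 + x * p ^ k)%C M =
    (1 + psum (fun j => gauss_binom p M (S j) * p ^ tri (S j) * x ^ (S j)) (S M)))%C as E1.
  { rewrite IHM, psum_head. rewrite gauss_binom_0. simpl psum at 2.
    rewrite gauss_binom_gt with (j := S M) by lia. simpl. ring. }
  rewrite (psum_ext _ (fun j => gauss_binom p M (S j) * p ^ tri (S j) * x ^ (S j)
    + (x * p ^ M) * (gauss_binom p M j * p ^ tri j * x ^ j))%C).
  - rewrite psum_plus, psum_scal, <- IHM. rewrite gauss_binom_0. simpl tri at 1. simpl Cpow at 4 5.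
    transitivity (Cprod0 (fun k => 1 + x * p ^ k) M + x * p ^ M * Cprod0 (fun k => 1 + x * p ^ k) M)%C;
      [ring|]. rewrite E1 at 1. simpl tri at 2. simpl. ring.
  - intros j Hj. replace (p ^ M)%C with (p ^ (M - j) * p ^ j)%C.
    2:{ rewrite <- Cpow_add_r. f_equal. lia. }
    simpl gauss_binom. simpl tri. rewrite Cpow_add_r. simpl Cpow. ring.
Qed.

Definition qfac (p : C) : nat -> C := Cprod1 (fun n => 1 + (- (1)) * p ^ n)%C.

(** The quotient formula for the coefficient, cleared of denominators because [p] may be a root of
    unity here. *)
Lemma gauss_binom_qfac p M : forall j, (j <= M)%nat ->
  (gauss_binom p M j * (qfac p j * qfac p (M - j)) = qfac p M)%C.
Proof.
  induction M; intros j Hj.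
  - replace j with O by lia. unfold qfac; simpl. ring.
  - destruct j.
    + rewrite gauss_binom_0. unfold qfac; simpl. ring.
    + destruct (Nat.eq_dec j M) as [->|Hne].
      { rewrite gauss_binom_diag, Nat.sub_diag. unfold qfac; simpl. ring. }
      pose proof (IHM (S j) ltac:(lia)) as I1. pose proof (IHM j ltac:(lia)) as I2.
      replace (S M - S j)%nat with (S (M - S j)) by lia.
      replace (M - j)%nat with (S (M - S j)) in I2 by lia.
      simpl gauss_binom. replace (M - j)%nat with (S (M - S j)) by lia.
      set (k := (M - S j)%nat) in *.
      assert (qfac p (S k) = qfac p k * (1 - p ^ S k))%C as Ek by (unfold qfac; simpl; ring).
      assert (qfac p (S j) = qfac p j * (1 - p ^ S j))%C as Ej by (unfold qfac; simpl; ring).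
      assert (qfac p (S M) = qfac p M * (1 - p ^ S k * p ^ S j))%C as EM.
      { rewrite <- Cpow_add_r. replace (S k + S j)%nat with (S M) by (unfold k; lia).
        unfold qfac; simpl; ring. }
      rewrite EM.
      transitivity (gauss_binom p M (S j) * (qfac p (S j) * qfac p k) * (1 - p ^ S k)
        + p ^ S k * (gauss_binom p M j * (qfac p j * qfac p (S k))) * (1 - p ^ S j))%C.
      { rewrite Ek, Ej. ring. }
      rewrite I1, I2. ring.
Qed.

Lemma Cprod0_ext u v n : (forall k, (k < n)%nat -> u k = v k) -> Cprod0 u n = Cprod0 v n.
Proof.
  induction n; intros H; simpl; [auto|]. rewrite IHn by (intros; apply H; lia). now rewrite H by lia.
Qed.

Lemma Cprod0_head u n : Cprod0 u (S n) = (u O * Cprod0 (fun k => u (S k)) n)%C.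
Proof.
  induction n; [simpl; ring|]. change (Cprod0 u (S (S n))) with (Cprod0 u (S n) * u (S n))%C.
  rewrite IHn. simpl. ring.
Qed.

(** Replacing x by y / p^N centres the 2N exponents about 0, which is what lets the finite identity
    pass to a bilateral sum. Each induction step peels off the first and the last factor. *)
Lemma Cprod0_symmetric (p y : C) N : p <> RtoC 0 ->
  Cprod0 (fun k => 1 + y / p ^ N * p ^ k)%C (2 * N) =
  Cprod0 (fun i => (1 + y * p ^ i) * (1 + y / p ^ S i))%C N.
Proof.
  intros Hp. induction N; [auto|].
  replace (2 * S N)%nat with (S (S (2 * N))) by lia.
  rewrite Cprod0_head.
  change (Cprod0 (fun i => (1 + y * p ^ i) * (1 + y / p ^ S i))%C (S N)) with
    (Cprod0 (fun i => (1 + y * p ^ i) * (1 + y / p ^ S i)) N *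
    ((1 + y * p ^ N) * (1 + y / p ^ S N)))%C. rewrite <- IHN.
  change (Cprod0 (fun k => 1 + y / p ^ S N * p ^ S k)%C (S (2 * N))) with
    (Cprod0 (fun k => 1 + y / p ^ S N * p ^ S k) (2 * N) * (1 + y / p ^ S N * p ^ S (2 * N)))%C.
  rewrite (Cprod0_ext _ (fun k => 1 + y / p ^ N * p ^ k)%C (2 * N)).
  - replace (y / p ^ S N * p ^ S (2 * N))%C with (y * p ^ N)%C.
    + replace (y / p ^ S N * p ^ 0)%C with (y / p ^ S N)%C by (simpl; field; split; auto using Cpow_nz). ring.
    + replace (S (2 * N)) with (S N + N)%nat by lia. rewrite Cpow_add_r. field. now apply Cpow_nz.
  - intros k _. simpl. field. split; auto using Cpow_nz.
Qed.

Lemma psum_fold f N : psum f (2 * N + 1) =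
  psum (fun m => match m with O => f N | S _ => f (N + m)%nat + f (N - m)%nat end)%C (N + 1).
Proof.
  assert (forall K, (K <= N)%nat ->
    (psum (fun m => match m with O => f N | S _ => f (N + m)%nat + f (N - m)%nat end) (K + 1)
     + psum f (N - K) = psum f (N + K + 1))%C) as H.
  { induction K; intros HK.
    - replace (0 + 1)%nat with 1%nat by lia. replace (N + 0 + 1)%nat with (S N) by lia.
      rewrite Nat.sub_0_r. simpl. ring.
    - replace (S K + 1)%nat with (S (K + 1)) by lia.
      replace (N + S K + 1)%nat with (S (N + K + 1)) by lia. cbn [psum].
      rewrite <- IHK by lia. replace (K + 1)%nat with (S K) by lia.
      replace (N - K)%nat with (S (N - S K)) by lia. cbn [psum].
      replace (N + K + 1)%nat with (N + S K)%nat by lia. ring. }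
  specialize (H N (le_n _)). rewrite Nat.sub_diag in H. simpl psum at 2 in H.
  replace (2 * N + 1)%nat with (N + N + 1)%nat by lia. rewrite <- H. ring.
Qed.

(** The limit passage common to both triple products. The two terms at distance m from the centre
    add up to [W m] for every N, while the binomials [2N, N+m] tend to 1 / phi p; the quotient
    formula bounds them uniformly, so [Tannery] applies. *)
Lemma theta_limit (p : C) (W : nat -> C) (f : nat -> nat -> C) (b : nat -> R) (l : C) :
  Cmod p < 1 -> (forall m, Cmod (W m) <= b m) -> ex_series b ->
  (forall N, f N N = W O) ->
  (forall N m, (1 <= m <= N)%nat -> (f N (N + m)%nat + f N (N - m)%nat = W m)%C) ->
  CL (fun N => psum (fun j => gauss_binom p (2 * N) j * f N j)%C (2 * N + 1)) l ->
  (phi p * l = csum W)%C.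
Proof.
  intros Hp HW Hb H0 Hm Hl.
  assert (geo_bounded (fun n => - (1) * p ^ n)%C (Cmod p)) as Hg
    by (apply (geo_bounded_pow _ _ (fun n => n)); auto using Cmod_m1).
  pose proof (iprod_CL _ _ Hg) as HQ. change (CL (qfac p) (phi p)) in HQ.
  destruct (iprod_inv _ _ Hg) as [_ [Hphi [B HB]]]. fold (phi p) (qfac p) in Hphi, HB.
  destruct (CL_bounded _ _ HQ) as [A [HA1 HA]].
  assert (forall n, qfac p n <> RtoC 0) as Hn0.
  { induction n; [unfold qfac; simpl; intros E; injection E; lra|].
    unfold qfac in *; simpl. apply Cmult_neq_0; auto. now apply (geo_bounded_neq _ _ n Hg). }
  set (g := fun N m => (qfac p (2 * N) / (qfac p (N + m) * qfac p (N - m)))%C).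
  assert (forall N m, Cmod (g N m) <= A * (B * B)) as Hgb.
  { intros N m. unfold g, Cdiv. rewrite Cmod_mult. apply Rmult_le_compat; auto using Cmod_ge_0.
    replace (/ (qfac p (N + m) * qfac p (N - m)))%C with (/ qfac p (N + m) * / qfac p (N - m))%C by (field; auto).
    rewrite Cmod_mult. apply Rmult_le_compat; auto using Cmod_ge_0. }
  assert (forall N j, (j <= 2 * N)%nat -> gauss_binom p (2 * N) j = (qfac p (2 * N) / (qfac p j * qfac p (2 * N - j)))%C) as Hgb'.
  { intros N j Hj. rewrite <- (gauss_binom_qfac p (2 * N) j Hj). field. auto. }
  assert (forall N, psum (fun j => gauss_binom p (2 * N) j * f N j)%C (2 * N + 1) =
    csum (fun m => if Compare_dec.le_dec m N then g N m * W m else 0)%C) as HE.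
  { intros N. rewrite psum_fold, (csum_fin _ (N + 1)).
    2:{ intros k Hk. destruct (Compare_dec.le_dec k N); [lia|auto]. }
    apply psum_ext. intros m HmN. destruct (Compare_dec.le_dec m N) as [HN|]; [|lia].
    destruct m as [|m].
    - rewrite H0, Hgb' by lia. unfold g. rewrite Nat.add_0_r, Nat.sub_0_r.
      replace (2 * N - N)%nat with N by lia. ring.
    - rewrite <- (Hm N (S m)) by lia. rewrite !Hgb' by lia. unfold g.
      replace (2 * N - (N + S m))%nat with (N - S m)%nat by lia.
      replace (2 * N - (N - S m))%nat with (N + S m)%nat by lia.
      field. split; auto. }
  assert (CL (fun N => csum (fun m => if Compare_dec.le_dec m N then g N m * W m else 0)%C) (csum (fun m => / phi p * W m)%C)) as HL.
  { apply (Tannery _ _ (fun m => A * (B * B) * b m) 0).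
    - intros m. apply CL_ext_from with m (fun N => g N m * W m)%C.
      + intros N HN. destruct (Compare_dec.le_dec m N); [auto|lia].
      + apply CL_mult; [|apply CL_const]. unfold g.
        replace (/ phi p)%C with (phi p * / (phi p * phi p))%C by (field; auto).
        apply CL_mult; [apply (CL_comp _ _ (fun N => 2 * N)%nat); auto; lia|].
        apply CL_inv; [now apply Cmult_neq_0|]. apply CL_mult.
        * apply (CL_comp _ _ (fun N => N + m)%nat); auto; lia.
        * intros eps He. destruct (HQ eps He) as [N1 HN1]. exists (N1 + m)%nat. intros n Hn.
          apply HN1. lia.
    - intros N m _. destruct (Compare_dec.le_dec m N).
      + rewrite Cmod_mult. apply Rmult_le_compat; auto using Cmod_ge_0.
      + rewrite Cmod_0. apply Rmult_le_pos; [|eapply Rle_trans; [apply Cmod_ge_0|apply HW]].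
        eapply Rle_trans; [apply Cmod_ge_0|apply (Hgb O O)].
    - now apply ex_series_scal_r. }
  rewrite csum_scal in HL by (now apply summ_dom with b).
  assert (l = / phi p * csum W)%C as ->.
  { eapply CL_unique; [apply Hl|]. apply CL_ext with (2 := HL). intros. now rewrite HE. }
  field. auto.
Qed.

Lemma tri_double j : (2 * tri j + j = j * j)%nat.
Proof. induction j; simpl; [auto|]. lia. Qed.

Lemma Cprod0_Cprod1 u n : Cprod0 (fun k => u (S k)) n = Cprod1 u n.
Proof. induction n; simpl; [auto|]. now rewrite IHn. Qed.

Lemma pow_sq_dom (r : R) m : 0 <= r < 1 -> r ^ (m * m) <= r ^ m.
Proof.
  intros Hr. assert (exists k, (m * m = m + k)%nat) as [k ->].
  { exists (m * m - m)%nat. destruct m; simpl; lia. }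
  rewrite pow_add. rewrite <- (Rmult_1_r (r ^ m)) at 2.
  apply Rmult_le_compat_l; [apply pow_le; lra|].
  rewrite <- (pow1 k). apply pow_incr. lra.
Qed.

Definition theta_term (e q : C) (m : nat) : C :=
  match m with O => RtoC 1 | S _ => (2 * (e ^ m * q ^ (m * m)))%C end.

Lemma Csq_one_pow2 (e : C) n : (e * e = 1)%C -> (e ^ n * e ^ n = 1)%C.
Proof. intros He. rewrite <- Cpow_mult_l, He. apply Cpow_1_l. Qed.

(** Jacobi's triple product in base q^2 at x = e q, for a sign e: e = 1 will give [th3], e = -1
    [th4]. *)
Lemma triple_product_theta (e q : C) : (e * e = 1)%C -> q <> RtoC 0 -> Cmod q < 1 ->
  csum (theta_term e q) = (phi (q ^ 2) * prod_odd e q ^ 2)%C.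
Proof.
  intros He Hq0 Hq.
  assert (Cmod e = 1) as Hme.
  { apply (f_equal Cmod) in He. rewrite Cmod_mult, Cmod_1 in He.
    pose proof (Cmod_ge_0 e). nra. }
  pose proof (Cmod_ge_0 q) as Hq'.
  symmetry. apply theta_limit with
    (* Since 2 tri j + j = j^2, the exponent of q is (N - j)^2: these are the terms of the theta
       series, recentred at N. *)
    (f := fun N j => (e ^ (N + j) * (q ^ (N * N) * (q ^ 2) ^ tri j * q ^ j / (q ^ (2 * N)) ^ j))%C)
    (b := fun m => 2 * Cmod q ^ m).
  - now apply Cmod_sq_lt.
  - intros m. destruct m as [|k].
    + simpl. rewrite Cmod_1. lra.
    + unfold theta_term. rewrite !Cmod_mult, !Cmod_pow, Hme, pow1, Cmod_R, Rabs_pos_eq by lra.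
      rewrite Rmult_1_l. apply Rmult_le_compat_l; [lra|]. apply pow_sq_dom. lra.
  - apply ex_series_scal_r, ex_series_pow. lra.
  - intros N. simpl theta_term. rewrite Cpow_add_r, Csq_one_pow2 by auto.
    rewrite <- !Cpow_mult_r, <- !Cpow_add_r.
    pose proof (tri_double N). replace (N * N + 2 * tri N + N)%nat with (2 * N * N)%nat by lia.
    field. now apply Cpow_nz.
  - intros N m Hm. destruct m as [|m']; [lia|]. set (m := S m') in *.
    change (theta_term e q m) with (2 * (e ^ m * q ^ (m * m)))%C.
    assert (forall a b c d : nat, (a + d = b + c)%nat -> q ^ a / q ^ b = q ^ c / q ^ d)%C as Hd.
    { intros a b c d E. apply (f_equal (fun n => q ^ n)%C) in E. rewrite !Cpow_add_r in E.
      pose proof (Cpow_nz q b Hq0). pose proof (Cpow_nz q d Hq0).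
      transitivity (q ^ a * q ^ d / (q ^ b * q ^ d))%C; [field; auto|]. rewrite E. field. auto. }
    rewrite <- !Cpow_mult_r, <- !Cpow_add_r.
    pose proof (tri_double (N + m)). pose proof (tri_double (N - m)).
    rewrite (Hd _ _ (m * m)%nat 0%nat) by lia.
    rewrite (Hd (N * N + 2 * tri (N - m) + (N - m))%nat _ (m * m)%nat 0%nat).
    2:{ assert (exists k, N = m + k)%nat as [k ->] by (exists (N - m)%nat; lia).
        replace (m + k - m)%nat with k in * by lia. lia. }
    replace (N + (N + m))%nat with (N + N + m)%nat by lia.
    replace (e ^ (N + (N - m)))%C with (e ^ m)%C.
    + rewrite !Cpow_add_r, Csq_one_pow2 by auto. change (q ^ 0)%C with (RtoC 1). field.
    + transitivity (e ^ m * (e ^ (N - m) * e ^ (N - m)))%C.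
      * rewrite Csq_one_pow2 by auto. ring.
      * rewrite <- !Cpow_add_r. f_equal. lia.
  - assert (CL (fun N => (Cprod1 (fun n => 1 + e * q ^ (2 * n - 1)) N) ^ 2)%C (prod_odd e q ^ 2)%C) as HL.
    { apply CL_pow. apply iprod_CL with (Cmod q). apply geo_bounded_pow; auto. lia. }
    apply CL_ext with (2 := HL). intros N.
    transitivity (e ^ N * q ^ (N * N) * Cprod0 (fun k => 1 + (e * q) / (q ^ 2) ^ N * (q ^ 2) ^ k) (2 * N))%C.
    + rewrite Cprod0_symmetric by (now apply Cpow_nz). rewrite <- Cprod0_Cprod1.
      clear - He Hq0. induction N; [simpl; ring|]. cbn [Cprod0].
      replace (2 * S N - 1)%nat with (2 * N + 1)%nat by lia.
      replace (S N * S N)%nat with (N * N + (2 * N + 1))%nat by lia.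
      rewrite (Cpow_add_r q (N * N) (2 * N + 1)).
      set (X := Cprod0 (fun i => (1 + e * q * (q ^ 2) ^ i) * (1 + e * q / (q ^ 2) ^ S i))%C N) in *.
      set (Y := Cprod0 (fun k => 1 + e * q ^ (2 * S k - 1))%C N) in *.
      replace (q ^ (2 * N + 1))%C with (q * (q ^ 2) ^ N)%C
        by (rewrite <- Cpow_mult_r, Cpow_add_r; simpl; ring).
      transitivity (Y ^ 2 * (1 + e * (q * (q ^ 2) ^ N)) ^ 2)%C; [ring|]. rewrite IHN.
      assert (q ^ 2 <> 0)%C by (now apply Cpow_nz).
      pose proof (Cpow_nz _ N H) as Hz. change (e ^ S N)%C with (e * e ^ N)%C.
      change ((q ^ 2) ^ S N)%C with (q ^ 2 * (q ^ 2) ^ N)%C.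
      set (Z := ((q ^ 2) ^ N)%C) in *.
      transitivity (e ^ N * q ^ (N * N) * X * ((1 + e * q * Z) * (e * q * Z + (e * e))))%C.
      * rewrite He. ring. * field. auto.
    + rewrite q_binomial. replace (S (2 * N)) with (2 * N + 1)%nat by lia.
      rewrite <- psum_scal. apply psum_ext. intros j _.
      unfold Cdiv. rewrite !Cpow_mult_l, Cpow_add_r, Cpow_inv by (now apply Cpow_nz, Cpow_nz).
      rewrite <- (Cpow_mult_r q 2 N). ring.
Qed.

Definition psi_term (q : C) (m : nat) : C := (q ^ (m * S m))%C.

(** The triple product in base p = q^2 at x = p. There one factor equals 1 + 1 = 2, and in the
    bilateral sum every term q^(m(m+1)) occurs twice; both sides are halved at the end. *)
Lemma triple_product_psi (q : C) : q <> RtoC 0 -> Cmod q < 1 ->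
  summ (psi_term q) /\ csum (psi_term q) = (phi (q ^ 2) * prod_plus_pow (q ^ 2) ^ 2)%C.
Proof.
  intros Hq0 Hq. pose proof (Cmod_ge_0 q) as Hq'.
  set (p := (q ^ 2)%C). assert (p <> RtoC 0) as Hp0 by (now apply Cpow_nz).
  assert (Cmod p < 1) as Hp by (now apply Cmod_sq_lt). pose proof (Cmod_ge_0 p) as Hp'.
  assert (forall m, psi_term q m = p ^ tri (S m))%C as Hpsi.
  { intros m. unfold psi_term, p. rewrite <- Cpow_mult_r. f_equal. pose proof (tri_double (S m)). lia. }
  assert (forall m, Cmod (psi_term q m) <= Cmod p ^ m) as Hdom.
  { intros m. rewrite Hpsi, Cmod_pow. simpl tri. rewrite pow_add.
    rewrite <- (Rmult_1_r (Cmod p ^ m)) at 2. apply Rmult_le_compat_l; [apply pow_le; lra|].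
    rewrite <- (pow1 (tri m)). apply pow_incr. lra. }
  assert (summ (psi_term q)) as HS.
  { apply summ_dom with (fun m => Cmod p ^ m); auto. apply ex_series_pow. lra. }
  split; auto.
  (* Folding about N sends j = N + m and j = N - m to p^(tri (m+1)) and p^(tri m), two consecutive
     terms of the series. *)
  set (W := fun m => match m with O => RtoC 1 | S k => (psi_term q m + psi_term q k)%C end).
  assert (csum W = 2 * csum (psi_term q))%C as HW.
  { assert (summ W) as HSW.
    { apply summ_incr. simpl. apply summ_plus; auto. now apply summ_incr in HS. }
    rewrite (csum_head W HSW). simpl. rewrite csum_plus; auto.
    - rewrite (csum_head _ HS) at 2. rewrite (csum_head _ HS). unfold psi_term at 2 4. simpl. ring.
    - now apply summ_incr in HS. }
  assert (phi p * (2 * prod_plus_pow p ^ 2) = csum W)%C as H.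
  { apply theta_limit with (f := fun N j => (p ^ tri N * p ^ tri j * p ^ j / (p ^ N) ^ j)%C)
      (* The factor 1 / |p| makes up for the lower index of the second summand of [W m]. *)
      (b := fun m => / Cmod p * (2 * Cmod p ^ m)).
    - auto.
    - assert (0 < Cmod p) by (now apply Cmod_gt_0).
      assert (1 < / Cmod p) by (rewrite <- Rinv_1; apply Rinv_lt_contravar; lra).
      intros m. destruct m; simpl W.
      + rewrite Cmod_1. simpl. lra.
      + eapply Rle_trans; [apply Cmod_triangle|].
        pose proof (Hdom (S m)). pose proof (Hdom m).
        replace (/ Cmod p * (2 * Cmod p ^ S m)) with (2 * Cmod p ^ m) by (simpl; field; lra).
        assert (Cmod p ^ S m <= Cmod p ^ m); [|lra]. simpl.
        assert (0 <= Cmod p ^ m) by (apply pow_le; lra). nra.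
    - apply ex_series_scal_r, ex_series_scal_r, ex_series_pow. lra.
    - intros N. simpl W. rewrite <- !Cpow_mult_r, <- !Cpow_add_r.
      pose proof (tri_double N). replace (tri N + tri N + N)%nat with (N * N)%nat by lia.
      field. now apply Cpow_nz.
    - intros N m Hm. destruct m as [|k]; [lia|]. unfold W. rewrite !Hpsi.
      assert (forall a b c : nat, (a = b + c)%nat -> p ^ a / p ^ b = p ^ c)%C as Hd.
      { intros a b c ->. rewrite Cpow_add_r. field. now apply Cpow_nz. }
      rewrite <- !Cpow_mult_r, <- !Cpow_add_r.
      pose proof (tri_double (N + S k)). pose proof (tri_double (N - S k)).
      pose proof (tri_double N). pose proof (tri_double (S (S k))). pose proof (tri_double (S k)).
      f_equal; apply Hd.
      + lia.
      + assert (exists d, N = S k + d)%nat as [d ->] by (exists (N - S k)%nat; lia).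
        replace (S k + d - S k)%nat with d in * by lia. lia.
    - set (Pn := Cprod1 (fun n => 1 + 1 * p ^ n)%C).
      assert (CL Pn (prod_plus_pow p)) as HPn.
      { apply iprod_CL with (Cmod p). apply (geo_bounded_pow _ _ (fun n => n)); auto using Cmod_1. }
      (* The 2 is the factor 1 + p / p. The other factors 1 + p^-i run only up to i = N - 1, and
         [p ^ tri N] turns them into 1 + p^i. *)
      assert (CL (fun N => 2 * (Pn N * Pn (N - 1)%nat))%C (2 * prod_plus_pow p ^ 2)%C) as HL.
      { apply CL_scal. replace (prod_plus_pow p ^ 2)%C with (prod_plus_pow p * prod_plus_pow p)%C by ring.
        apply CL_mult; auto. apply CL_decr. apply CL_ext with Pn; auto.
        intros n. f_equal. lia. }
      apply CL_ext_from with (2 := HL) (N0 := 1%nat). intros N HN. destruct N as [|N]; [lia|].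
      transitivity (p ^ tri (S N) * Cprod0 (fun k => 1 + p / p ^ S N * p ^ k) (2 * S N))%C.
      + rewrite Cprod0_symmetric by auto. replace (S N - 1)%nat with N by lia. clear - Hp0.
        induction N.
        * unfold Pn; simpl. field. auto.
        * assert (forall K, Pn (S K) = Pn K * (1 + p ^ S K))%C as HPS by (intros; unfold Pn; simpl; ring).
          change (Cprod0 (fun i => (1 + p * p ^ i) * (1 + p / p ^ S i)) (S (S N)))%C with
           (Cprod0 (fun i => (1 + p * p ^ i) * (1 + p / p ^ S i)) (S N) * ((1 + p * p ^ (S N)) * (1 + p / p ^ S (S N))))%C.
          rewrite HPS. rewrite (HPS N) at 2.
          transitivity (2 * (Pn (S N) * Pn N) * ((1 + p ^ S (S N)) * (1 + p ^ S N)))%C; [ring|].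
          rewrite IHN. change (tri (S (S N))) with (S N + tri (S N))%nat. rewrite Cpow_add_r.
          set (Y := (p ^ tri (S N))%C). set (X := Cprod0 _ (S N)).
          change (p ^ S (S N))%C with (p * p ^ S N)%C.
          pose proof (Cpow_nz p (S N) Hp0). field. auto.
      + rewrite q_binomial. replace (S (2 * S N)) with (2 * S N + 1)%nat by lia.
        rewrite <- psum_scal. apply psum_ext. intros j _.
        unfold Cdiv. rewrite !Cpow_mult_l, Cpow_inv by (now apply Cpow_nz). ring. }
  rewrite HW in H.
  transitivity (2 * csum (psi_term q) / 2)%C; [field|]. rewrite <- H. field.
Qed.

(** * Theta functions and eta quotients *)

Definition expo (k : R) (tau : C) : C := Cexp (2 * PI * Ci * k * tau).

Lemma Cmod_expo k tau : Cmod (expo k tau) = exp (- (2 * PI * k * Im tau)).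
Proof.
  unfold expo. rewrite Cmod_Cexp. f_equal. destruct tau as [x y].
  unfold Re, Im, RtoC, Ci, Cmult; simpl. ring.
Qed.

Lemma expo_plus k l tau : (expo (k + l) tau = expo k tau * expo l tau)%C.
Proof. unfold expo. rewrite <- Cexp_add. f_equal. rewrite RtoC_plus. ring. Qed.

Lemma expo_pow k tau n : (expo k tau ^ n = expo (INR n * k) tau)%C.
Proof. unfold expo. rewrite Cexp_pow. f_equal. rewrite RtoC_mult. ring. Qed.

Lemma expo_scal k (l : R) tau : expo k (l * tau)%C = expo (k * l) tau.
Proof. unfold expo. f_equal. rewrite RtoC_mult. ring. Qed.

Lemma expo_nome tau : nome tau = expo 1 tau.
Proof. unfold nome, expo. f_equal. ring. Qed.

Lemma nome_pow tau n : (nome tau ^ n = expo (INR n) tau)%C.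
Proof. rewrite expo_nome, expo_pow. f_equal. ring. Qed.

Lemma expo_add k (s t : C) : (expo k (s + t) = expo k s * expo k t)%C.
Proof. unfold expo. rewrite <- Cexp_add. f_equal. ring. Qed.

Lemma expo_int (n : nat) : expo (INR n) 1 = RtoC 1.
Proof.
  unfold expo. replace (2 * PI * Ci * INR n * 1)%C with (INR n * (2 * PI * Ci))%C by ring.
  rewrite <- Cexp_pow, Cexp_2PI. apply Cpow_1_l.
Qed.

Lemma Cmod_nome_lt tau : 0 < Im tau -> Cmod (nome tau) < 1.
Proof.
  intros H. rewrite expo_nome, Cmod_expo. pose proof (Rmult_lt_0_compat _ _ PI_RGT_0 H).
  apply Rlt_le_trans with (exp 0); [apply exp_increasing; lra|rewrite exp_0; lra].
Qed.

Lemma nome_neq_0 tau : nome tau <> RtoC 0.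
Proof. apply Cexp_neq_0. Qed.

(** * Exponential series in tau and their termwise derivatives *)

Definition poly_bounded (u : nat -> C) : Prop :=
  exists K p, 0 <= K /\ forall n, Cmod (u n) <= K * (INR n + 1) ^ p.

Lemma poly_bounded_mult u v : poly_bounded u -> poly_bounded v -> poly_bounded (fun n => u n * v n)%C.
Proof.
  intros [K [p [HK H]]] [L [r [HL H']]]. exists (K * L), (p + r)%nat. split; [nra|].
  intros n. rewrite Cmod_mult, pow_add.
  replace (K * L * ((INR n + 1) ^ p * (INR n + 1) ^ r))
    with ((K * (INR n + 1) ^ p) * (L * (INR n + 1) ^ r)) by ring.
  apply Rmult_le_compat; auto using Cmod_ge_0.
Qed.

Lemma poly_bounded_const c : poly_bounded (fun _ => c).
Proof. exists (Cmod c), O. split; [apply Cmod_ge_0|]. intros; simpl; lra. Qed.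

Lemma exp_pow_nat x n : exp x ^ n = exp (INR n * x).
Proof.
  induction n; [simpl; now rewrite Rmult_0_l, exp_0|].
  rewrite S_INR. simpl pow. rewrite IHn, <- exp_plus. f_equal. ring.
Qed.

Lemma poly_exp_bound p d : 0 < d -> exists K, 0 <= K /\ forall n, (INR n + 1) ^ p <= K * exp (d * INR n).
Proof.
  (* Each of the p powers is absorbed by a share of the rate d through 1 + x <= exp x; dividing by p
     + 1 covers p = 0. *)
  intros Hd. set (e := d / INR (S p)).
  assert (0 < INR (S p)) as Hp by apply lt_0_INR, Nat.lt_0_succ.
  assert (0 < e) as He by (now apply Rdiv_lt_0_compat).
  assert (0 < / e) by (now apply Rinv_0_lt_compat).
  exists ((1 + / e) ^ p). split; [apply pow_le; lra|]. intros n.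
  pose proof (pos_INR n) as Hn.
  assert (INR n + 1 <= (1 + / e) * exp (e * INR n)) as H1.
  { apply Rle_trans with ((1 + / e) * (1 + e * INR n)).
    - replace ((1 + / e) * (1 + e * INR n)) with (1 + e * INR n + / e + INR n) by (field; lra). nra.
    - apply Rmult_le_compat_l; [lra|]. apply exp_ineq1_le. }
  apply Rle_trans with (((1 + / e) * exp (e * INR n)) ^ p).
  - apply pow_incr. lra.
  - rewrite Rpow_mult_distr. apply Rmult_le_compat_l; [apply pow_le; lra|].
    assert (exp (e * INR n) ^ p = exp (INR p * (e * INR n))) as ->.
    { apply exp_pow_nat. }
    apply exp_mono. replace (d * INR n) with (INR (S p) * (e * INR n)) by (unfold e; field; lra).
    rewrite S_INR. assert (0 <= e * INR n) by nra. lra.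
Qed.

Lemma poly_exp_summable (p : nat) (d : R) : 0 < d ->
  ex_series (fun n => (INR n + 1) ^ p * exp (- (d * INR n))).
Proof.
  intros Hd. destruct (poly_exp_bound p (d / 2)) as [K [HK H]]; [lra|].
  apply ex_series_dom with (fun n => K * exp (- (d / 2)) ^ n).
  - intros n. pose proof (pos_INR n).
    rewrite Rabs_pos_eq by (apply Rmult_le_pos; [apply pow_le; lra|left; apply exp_pos]).
    rewrite exp_pow_nat, (Rmult_comm (INR n)).
    replace (exp (- (d / 2) * INR n)) with (exp (d / 2 * INR n) * exp (- (d * INR n))).
    2:{ rewrite <- exp_plus. f_equal. field. }
    rewrite <- Rmult_assoc. apply Rmult_le_compat_r; auto. left; apply exp_pos.
  - apply ex_series_scal_r, ex_series_pow. split; [left; apply exp_pos|].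
    rewrite <- exp_0. apply exp_increasing. lra.
Qed.

Definition eseries (al : nat -> C) (k : nat -> R) (tau : C) : C :=
  csum (fun n => al n * expo (k n) tau)%C.

(** The lower bound on the exponents gives convergence on the whole half plane, and the polynomial
    bounds are stable under D, which multiplies the n-th coefficient by [k n]; so termwise
    differentiation can be repeated. *)
Definition admissible (al : nat -> C) (k : nat -> R) : Prop :=
  poly_bounded al /\ poly_bounded (fun n => RtoC (k n)) /\ forall n, INR n <= k n.

Definition upper (tau : C) : Prop := 0 < Im tau.

Lemma eseries_dom al k : admissible al k -> forall y0, 0 < y0 -> exists M, ex_series M /\
  forall tau, y0 <= Im tau -> forall n, Cmod (al n * expo (k n) tau) <= M n.
Proof.
  intros [[K [p [HK Ha]]] [_ Hk]] y0 Hy. pose proof PI_RGT_0 as Hpi.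
  exists (fun n => K * ((INR n + 1) ^ p * exp (- (2 * PI * y0 * INR n)))). split.
  - apply ex_series_scal_r, poly_exp_summable. nra.
  - intros tau Ht n. rewrite Cmod_mult, Cmod_expo, <- Rmult_assoc.
    apply Rmult_le_compat; auto using Cmod_ge_0.
    + left; apply exp_pos.
    + apply exp_mono, Ropp_le_contravar. specialize (Hk n). pose proof (pos_INR n).
      replace (2 * PI * y0 * INR n) with (2 * PI * (INR n * y0)) by ring.
      replace (2 * PI * k n * Im tau) with (2 * PI * (k n * Im tau)) by ring.
      apply Rmult_le_compat_l; [lra|]. apply Rmult_le_compat; lra.
Qed.

Lemma eseries_summ al k tau : admissible al k -> upper tau -> summ (fun n => al n * expo (k n) tau)%C.
Proof.
  intros H Ht. destruct (eseries_dom al k H _ Ht) as [M [HM Hb]].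
  apply summ_dom with M; auto. apply Hb. lra.
Qed.

Definition dcoef (al : nat -> C) (k : nat -> R) (n : nat) : C := (k n * al n)%C.

Lemma admissible_dcoef al k : admissible al k -> admissible (dcoef al k) k.
Proof.
  intros [Ha [Hk Hn]]. split; [|split]; auto. now apply (poly_bounded_mult (fun n => RtoC (k n))).
Qed.

(** Termwise second order remainders are summed. With h = |w - tau| < Im tau / 2 the growth exp (2
    pi k h) costs at most half of the decay of the term, and the other half still sums the
    coefficients k^2 al. *)
Lemma cd_eseries al k tau : admissible al k -> upper tau ->
  cd (eseries al k) tau (2 * PI * Ci * eseries (dcoef al k) k tau)%C.
Proof.
  intros H Ht. pose proof PI_RGT_0 as Hpi. unfold upper in Ht.
  set (al' := fun n => (RtoC (k n) * (RtoC (k n) * al n))%C).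
  assert (admissible al' k) as H'.
  { apply (admissible_dcoef (dcoef al k) k). now apply admissible_dcoef. }
  set (y := Im tau) in *.
  assert (exists M, ex_series M /\ forall n, Cmod (al' n) * exp (- (2 * PI * k n * (y / 2))) <= M n) as [M [HM Hb]].
  { destruct (eseries_dom al' k H' (y / 2)) as [M [HM Hb]]; [lra|]. exists M. split; auto.
    intros n. specialize (Hb (0, y / 2)). replace (exp (- (2 * PI * k n * (y / 2)))) with (Cmod (expo (k n) (0, y / 2)))
      by (rewrite Cmod_expo; reflexivity). rewrite <- Cmod_mult.
    apply Hb. simpl. lra. }
  assert (forall n, 0 <= M n) as HM0.
  { intros n. eapply Rle_trans; [|apply Hb]. apply Rmult_le_pos; [apply Cmod_ge_0|left; apply exp_pos]. }
  exists (8 * PI ^ 2 * Series M), (y / 2). split; [|split; [lra|]].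
  { apply Rmult_le_pos; [nra|]. apply Rle_trans with (sum_n M 0); [rewrite sum_O; auto|].
    now apply sum_n_le_Series. }
  intros w Hw.
  assert (upper w) as Huw.
  { unfold upper. pose proof (Im_le_Cmod (w - tau)) as HI.
    replace (Im (w - tau)) with (Im w - y) in HI by (unfold y; destruct w, tau; simpl; ring).
    assert (Rabs (Im w - y) < y / 2) as HI' by lra. apply Rabs_def2 in HI'. lra. }
  unfold eseries. rewrite <- csum_scal by (apply (eseries_summ (dcoef al k) k); auto using admissible_dcoef).
  set (u := fun n => (al n * expo (k n) w)%C). set (v := fun n => (al n * expo (k n) tau)%C).
  set (d := fun n => (2 * PI * Ci * (dcoef al k n * expo (k n) tau))%C).
  assert (summ u) as Hu by (now apply eseries_summ).
  assert (summ v) as Hv by (now apply eseries_summ).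
  assert (summ d) as Hd.
  { apply summ_scal. apply (eseries_summ (dcoef al k) k); auto using admissible_dcoef. }
  replace (csum u - csum v - csum d * (w - tau))%C
    with (csum (fun n => u n + ((- (1)) * v n + (- (w - tau)) * d n)))%C.
  2:{ rewrite csum_plus; auto.
      - rewrite csum_plus; try (apply summ_scal; auto). rewrite !csum_scal by auto. ring.
      - apply summ_plus; now apply summ_scal. }
  set (h := Cmod (w - tau)) in *. assert (0 <= h) as Hh by apply Cmod_ge_0.
  eapply Rle_trans; [apply (csum_le _ (fun n => (8 * PI ^ 2 * h ^ 2) * M n))|].
  - intros n. unfold u, v, d, dcoef. destruct H as [_ [_ Hkn]]. pose proof (Hkn n). pose proof (pos_INR n).
    set (X := (2 * PI * Ci * k n * (w - tau))%C).
    replace (expo (k n) w) with (expo (k n) tau * Cexp X)%C.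
    2:{ unfold expo. rewrite <- Cexp_add. f_equal. unfold X. ring. }
    replace (al n * (expo (k n) tau * Cexp X) + (- (1) * (al n * expo (k n) tau)
      + - (w - tau) * (2 * PI * Ci * (k n * al n * expo (k n) tau))))%C
      with (al n * expo (k n) tau * (Cexp X - 1 - X))%C by (unfold X; ring).
    assert (Cmod X = 2 * PI * k n * h) as HX.
    { unfold X. rewrite !Cmod_mult, Cmod_Ci, !Cmod_R. rewrite !Rabs_pos_eq by lra. fold h. ring. }
    rewrite !Cmod_mult, Cmod_expo.
    eapply Rle_trans; [apply Rmult_le_compat_l; [|apply Cexp_bound2]|].
    { apply Rmult_le_pos; [apply Cmod_ge_0|left; apply exp_pos]. }
    rewrite HX.
    assert (0 <= 2 * PI * k n) as Hpk by nra.
    assert (exp (- (2 * PI * k n * y)) * exp (2 * PI * k n * h) <= exp (- (2 * PI * k n * (y / 2)))) as HE.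
    { rewrite <- exp_plus. apply exp_mono. nra. }
    apply Rle_trans with (8 * PI ^ 2 * h ^ 2 * (Cmod (al' n) * exp (- (2 * PI * k n * (y / 2))))).
    2:{ apply Rmult_le_compat_l; auto. apply Rmult_le_pos; nra. }
    unfold al'. rewrite !Cmod_mult, !Cmod_R, !Rabs_pos_eq by lra. fold y.
    replace (Cmod (al n) * exp (- (2 * PI * k n * y)) * (2 * exp (2 * PI * k n * h) * (2 * PI * k n * h) ^ 2))
      with ((8 * PI ^ 2 * h ^ 2 * (k n * (k n * Cmod (al n)))) * (exp (- (2 * PI * k n * y)) * exp (2 * PI * k n * h))) by ring.
    replace (8 * PI ^ 2 * h ^ 2 * (k n * (k n * Cmod (al n)) * exp (- (2 * PI * k n * (y / 2)))))
      with ((8 * PI ^ 2 * h ^ 2 * (k n * (k n * Cmod (al n)))) * exp (- (2 * PI * k n * (y / 2)))) by ring.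
    apply Rmult_le_compat_l; auto. pose proof (Cmod_ge_0 (al n)).
    assert (0 <= 8 * PI ^ 2 * h ^ 2) by (apply Rmult_le_pos; nra).
    assert (0 <= k n) by lra. apply Rmult_le_pos; auto. apply Rmult_le_pos; auto.
    apply Rmult_le_pos; auto.
  - now apply ex_series_scal_r.
  - rewrite (Series_scal_l (8 * PI ^ 2 * h ^ 2) M). right. ring.
Qed.

(** Comparison with the majorant at height 1/2: each exponential that occurs shrinks at least by exp
    (- 2 pi ka (Im tau - 1/2)) on the way up. *)
Lemma eseries_decay al k (ka : R) : admissible al k -> (forall n, al n <> RtoC 0 -> ka <= k n) ->
  exists K, 0 <= K /\ forall tau, 1 / 2 <= Im tau -> Cmod (eseries al k tau) <= K * exp (- (2 * PI * ka * Im tau)).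
Proof.
  intros H Hka. pose proof PI_RGT_0 as Hpi.
  destruct (eseries_dom al k H (1 / 2)) as [M [HM Hb]]; [lra|].
  specialize (Hb (0, 1 / 2) ltac:(simpl; lra)).
  assert (forall n, 0 <= M n) as HM0.
  { intros n. eapply Rle_trans; [|apply Hb]. apply Cmod_ge_0. }
  exists (exp (PI * ka) * Series M). split.
  { apply Rmult_le_pos; [left; apply exp_pos|].
    apply Rle_trans with (sum_n M 0); [rewrite sum_O; auto|]. now apply sum_n_le_Series. }
  intros tau Ht. set (y := Im tau) in *.
  replace (exp (PI * ka) * Series M * exp (- (2 * PI * ka * y)))
    with (exp (- (2 * PI * ka * (y - 1 / 2))) * Series M).
  2:{ replace (- (2 * PI * ka * (y - 1 / 2))) with (PI * ka + - (2 * PI * ka * y)) by field.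
      rewrite exp_plus. ring. }
  rewrite <- Series_scal_l. apply csum_le; [|now apply ex_series_scal_r].
  intros n. specialize (Hb n). rewrite Cmod_mult, Cmod_expo in *. simpl Im in Hb. fold y.
  destruct (Ceq_dec (al n) 0) as [E|E].
  - rewrite E, Cmod_0, Rmult_0_l. apply Rmult_le_pos; auto. left; apply exp_pos.
  - specialize (Hka n E).
    replace (exp (- (2 * PI * k n * y))) with (exp (- (2 * PI * k n * (y - 1 / 2))) * exp (- (2 * PI * k n * (1 / 2)))).
    2:{ rewrite <- exp_plus. f_equal. field. }
    replace (Cmod (al n) * (exp (- (2 * PI * k n * (y - 1 / 2))) * exp (- (2 * PI * k n * (1 / 2)))))
      with (exp (- (2 * PI * k n * (y - 1 / 2))) * (Cmod (al n) * exp (- (2 * PI * k n * (1 / 2))))) by ring.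
    apply Rmult_le_compat; auto.
    + left; apply exp_pos.
    + apply Rmult_le_pos; [apply Cmod_ge_0|left; apply exp_pos].
    + apply exp_mono, Ropp_le_contravar. apply Rmult_le_compat_r; [lra|].
      apply Rmult_le_compat_l; lra.
Qed.

(** The sum over all integers is folded onto n >= 0, whence the 2. With q = exp (2 pi i tau) as
    variable, [th2], [th3], [th4] are the classical theta constants at 2 tau. *)
Definition theta_coef (e : C) (n : nat) : C := match n with O => RtoC 1 | S _ => (2 * e ^ n)%C end.
Definition sq (n : nat) : R := INR n * INR n.
Definition sq_half (n : nat) : R := (INR n + 1 / 2) * (INR n + 1 / 2).

Definition th3 : C -> C := eseries (theta_coef 1) sq.
Definition th4 : C -> C := eseries (theta_coef (- (1))) sq.
Definition th2 : C -> C := eseries (fun _ => RtoC 2) sq_half.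

Lemma admissible_theta e : Cmod e = 1 -> admissible (theta_coef e) sq.
Proof.
  intros He. split; [|split].
  - exists 2, O. split; [lra|]. intros [|n]; simpl; [rewrite Cmod_1; lra|].
    rewrite !Cmod_mult, Cmod_pow, He, pow1, Cmod_R, Rabs_pos_eq; lra.
  - exists 1, 2%nat. split; [lra|]. intros n. pose proof (pos_INR n). unfold sq.
    rewrite Cmod_R, Rabs_pos_eq by nra. nra.
  - intros [|n]; unfold sq; [simpl; lra|]. pose proof (pos_INR n). rewrite S_INR. nra.
Qed.

Lemma admissible_th2 : admissible (fun _ => RtoC 2) sq_half.
Proof.
  split; [|split].
  - apply poly_bounded_const.
  - exists 1, 2%nat. split; [lra|]. intros n. pose proof (pos_INR n). unfold sq_half.
    rewrite Cmod_R, Rabs_pos_eq by nra. nra.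
  - intros n; unfold sq_half. pose proof (pos_INR n). nra.
Qed.

Lemma theta_coef_term e tau n : (theta_coef e n * expo (sq n) tau)%C = theta_term e (nome tau) n.
Proof.
  unfold theta_coef, theta_term, sq. destruct n as [|n].
  - simpl. unfold expo. replace (2 * PI * Ci * (0 * 0)%R * tau)%C with (RtoC 0).
    + rewrite Cexp_0. ring. + rewrite RtoC_mult. ring.
  - rewrite nome_pow, mult_INR. ring.
Qed.

Lemma th3_prod tau : upper tau ->
  th3 tau = (phi (nome tau ^ 2) * prod_odd 1 (nome tau) ^ 2)%C.
Proof.
  intros Ht. unfold th3, eseries. rewrite (csum_ext _ _ (theta_coef_term 1 tau)).
  apply triple_product_theta; auto using nome_neq_0, Cmod_nome_lt. ring.
Qed.

Lemma th4_prod tau : upper tau ->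
  th4 tau = (phi (nome tau ^ 2) * prod_odd (- (1)) (nome tau) ^ 2)%C.
Proof.
  intros Ht. unfold th4, eseries. rewrite (csum_ext _ _ (theta_coef_term (- (1)) tau)).
  apply triple_product_theta; auto using nome_neq_0, Cmod_nome_lt. ring.
Qed.

Lemma th2_prod tau : upper tau ->
  th2 tau = (2 * expo (1 / 4) tau * (phi (nome tau ^ 2) * prod_plus_pow (nome tau ^ 2) ^ 2))%C.
Proof.
  intros Ht. destruct (triple_product_psi (nome tau)) as [HS HE]; auto using nome_neq_0, Cmod_nome_lt.
  rewrite <- HE, <- csum_scal by auto. apply csum_ext. intros n. unfold psi_term.
  rewrite nome_pow, <- Cmult_assoc, <- expo_plus. do 2 f_equal. unfold sq_half.
  rewrite mult_INR, S_INR. field.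
Qed.

Lemma upper_scal (l : R) tau : 0 < l -> upper tau -> upper (l * tau)%C.
Proof. unfold upper. intros. destruct tau as [x y]. simpl in *. nra. Qed.

Lemma nome_2 tau : (nome (2 * tau) = nome tau ^ 2)%C.
Proof. rewrite nome_pow, expo_nome, expo_scal. f_equal. simpl. ring. Qed.

Lemma upper_2 tau : upper tau -> upper (2 * tau)%C.
Proof. apply upper_scal. lra. Qed.

Lemma upper_4 tau : upper tau -> upper (4 * tau)%C.
Proof. apply upper_scal. lra. Qed.

Lemma upper_real (x : R) tau : upper tau -> upper (tau + x)%C.
Proof. unfold upper. destruct tau; simpl. intros; lra. Qed.

(** All theta values become quotients of the three numbers phi(q), phi(q^2), phi(q^4);
    multiplicative identities between eta and theta functions are then left to [field]. *)
Lemma thetas_phi tau : upper tau ->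
  let A := phi (nome tau) in let B := phi (nome tau ^ 2) in let D := phi (nome tau ^ 4) in
  (A <> 0 /\ B <> 0 /\ D <> 0 /\ prod_plus_pow (nome tau) = B / A /\
   th4 tau = A ^ 2 / B /\ th3 tau = B ^ 5 / (A ^ 2 * D ^ 2) /\
   th2 tau = 2 * expo (1 / 4) tau * (D ^ 2 / B))%C.
Proof.
  intros Ht A B D. set (q := nome tau) in *.
  assert (Cmod q < 1) as Hq by (now apply Cmod_nome_lt).
  pose proof (Cmod_sq_lt _ Hq) as Hq2. pose proof (Cmod_sq_lt _ Hq2) as Hq4.
  assert ((q ^ 2) ^ 2 = q ^ 4)%C as E4 by ring. rewrite E4 in Hq4.
  assert (A <> 0)%C as HA by (now apply phi_neq_0).
  assert (B <> 0)%C as HB by (now apply phi_neq_0).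
  assert (D <> 0)%C as HD by (now apply phi_neq_0).
  assert (prod_odd (- (1)) q = A / B)%C as Om.
  { unfold A. rewrite (phi_split q Hq). fold B. field. auto. }
  assert (prod_odd (- (1)) (q ^ 2) = B / D)%C as Om2.
  { unfold B. rewrite (phi_split _ Hq2), E4. fold D. field. auto. }
  assert (prod_odd 1 q = B ^ 2 / (A * D))%C as Op.
  { pose proof (prod_odd_mult q Hq) as H. rewrite Om, Om2 in H.
    transitivity (prod_odd 1 q * (A / B) * (B / A))%C; [field; auto|]. rewrite H. field. auto. }
  assert (prod_plus_pow q = B / A)%C as P1.
  { unfold B. rewrite <- (phi_mult_plus q Hq). fold A. field. auto. }
  assert (prod_plus_pow (q ^ 2) = D / B)%C as P2.
  { unfold D. rewrite <- E4, <- (phi_mult_plus _ Hq2). fold B. field. auto. }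
  repeat (split; auto).
  - rewrite th4_prod by auto. fold q. rewrite Om. fold B. field. auto.
  - rewrite th3_prod by auto. fold q. rewrite Op. fold B. field. auto.
  - rewrite th2_prod by auto. fold q. rewrite P2. fold B. field. auto.
Qed.

Lemma eta_phi tau : upper tau -> eta tau = (expo (1 / 24) tau * phi (nome tau))%C.
Proof.
  intros Ht. unfold eta. f_equal.
  - unfold expo. f_equal. rewrite RtoC_div by lra. field.
  - unfold phi, iprod. do 2 f_equal. apply functional_extensionality. intros n. ring.
Qed.

(* With a = [ta], b = [tb], c = [tc], these are theta_3^2, theta_4^2, theta_2^2. *)
Definition ta (tau : C) : C := (th3 tau ^ 2)%C.
Definition tb (tau : C) : C := (th4 tau ^ 2)%C.
Definition tc (tau : C) : C := (th2 tau ^ 2)%C.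

(** * Dissections and doubling formulas of the theta functions *)

Lemma csum_even_odd u : summ u ->
  summ (fun n => u (2 * n)%nat) /\ summ (fun n => u (2 * n + 1)%nat) /\
  csum u = (csum (fun n => u (2 * n)%nat) + csum (fun n => u (2 * n + 1)%nat))%C.
Proof.
  intros H.
  assert (forall (b : nat -> R) , (forall n, 0 <= b n) -> ex_series b ->
    ex_series (fun n => b (2 * n)%nat) /\ ex_series (fun n => b (2 * n + 1)%nat)) as Hb.
  { intros b Hb Hs.
    assert (forall n, sum_n (fun n => b (2 * n)%nat) n + sum_n (fun n => b (2 * n + 1)%nat) n
      = sum_n b (2 * n + 1)) as E.
    { induction n.
      - rewrite !sum_O. replace (2 * 0 + 1)%nat with 1%nat by lia. rewrite sum_Sn, sum_O. reflexivity.
      - rewrite !sum_Sn. replace (2 * S n + 1)%nat with (S (S (2 * n + 1))) by lia.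
        rewrite !sum_Sn, <- IHn. unfold plus; simpl plus.
        replace (2 * S n)%nat with (S (2 * n + 1)) by lia. simpl. ring. }
    split.
    - assert (forall n, sum_n (fun n => b (2 * n)%nat) n <= Series b) as Hbd.
      { intros n. eapply Rle_trans; [|apply (sum_n_le_Series b (2 * n + 1)); auto].
        rewrite <- E. assert (0 <= sum_n (fun n => b (2 * n + 1)%nat) n); [|lra].
        clear - Hb. induction n; [rewrite sum_O; auto|]. rewrite sum_Sn.
        apply Rplus_le_le_0_compat; auto. }
      destruct (ex_finite_lim_seq_incr (sum_n (fun n => b (2 * n)%nat)) (Series b)) as [l Hl]; auto.
      { intros n. rewrite sum_Sn. rewrite <- (Rplus_0_r (sum_n _ n)) at 1. apply Rplus_le_compat_l. auto. }
      exists l. exact Hl.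
    - assert (forall n, sum_n (fun n => b (2 * n + 1)%nat) n <= Series b) as Hbd.
      { intros n. eapply Rle_trans; [|apply (sum_n_le_Series b (2 * n + 1)); auto].
        rewrite <- E. assert (0 <= sum_n (fun n => b (2 * n)%nat) n); [|lra].
        clear - Hb. induction n; [rewrite sum_O; auto|]. rewrite sum_Sn.
        apply Rplus_le_le_0_compat; auto. }
      destruct (ex_finite_lim_seq_incr (sum_n (fun n => b (2 * n + 1)%nat)) (Series b)) as [l Hl]; auto.
      { intros n. rewrite sum_Sn. rewrite <- (Rplus_0_r (sum_n _ n)) at 1. apply Rplus_le_compat_l. auto. }
      exists l. exact Hl. }
  destruct (Hb (fun n => Cmod (u n))) as [H1 H2]; auto using Cmod_ge_0.
  split; [exact H1|]. split; [exact H2|].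
  apply CL_unique with (fun n => psum u (2 * n)).
  - apply (CL_comp _ _ (fun n => 2 * n)%nat); [lia|]. now apply summ_CL.
  - apply CL_ext with (fun n => psum (fun n => u (2 * n)%nat) n + psum (fun n => u (2 * n + 1)%nat) n)%C.
    + induction n; [simpl; ring|]. replace (2 * S n)%nat with (S (S (2 * n))) by lia.
      cbn [psum]. rewrite <- IHn. replace (S (2 * n)) with (2 * n + 1)%nat by lia. ring.
    + apply CL_plus; now apply summ_CL.
Qed.

Lemma expo_even_sq n : expo (sq (2 * n)) (1 / 4) = RtoC 1.
Proof.
  transitivity (expo (INR (n * n)) 1); [|apply expo_int]. unfold expo, sq. f_equal. rewrite !mult_INR.
  replace (INR 2) with 2 by (simpl; ring). rewrite !RtoC_mult. field.
Qed.

(** (2n+1)^2 / 4 = n^2 + n + 1/4, and exp (2 pi i / 4) = i. *)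
Lemma expo_odd_sq n : expo (sq (2 * n + 1)) (1 / 4) = Ci.
Proof.
  transitivity (expo (INR (n * n + n)) 1 * Cexp (PI / 2 * Ci))%C.
  - unfold expo, sq. rewrite <- Cexp_add. f_equal. rewrite !plus_INR, !mult_INR.
    replace (INR 2) with 2 by (simpl; ring). replace (INR 1) with 1 by reflexivity.
    rewrite ?RtoC_mult, ?RtoC_plus, ?RtoC_mult. field.
  - rewrite expo_int, Cexp_PI2. ring.
Qed.

(** Since (2n)^2 = 4 n^2 and (2n+1)^2 = 4 (n + 1/2)^2, the even and the odd terms are series at 4
    tau. The shifts s = 0 and s = 1/4 used below multiply each class by a constant, u or v. *)
Lemma theta_dissection e tau (s : R) (u v : C) : (e * e = 1)%C -> upper tau ->
  (forall n, expo (sq (2 * n)) s = u) -> (forall n, expo (sq (2 * n + 1)) s = v) ->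
  (eseries (theta_coef e) sq (tau + s) = u * th3 (4 * tau) + e * v * th2 (4 * tau))%C.
Proof.
  intros He Ht Hu Hv.
  assert (Cmod e = 1) as Hme.
  { apply (f_equal Cmod) in He. rewrite Cmod_mult, Cmod_1 in He. pose proof (Cmod_ge_0 e). nra. }
  unfold eseries.
  destruct (csum_even_odd (fun n => theta_coef e n * expo (sq n) (tau + s))%C) as [_ [_ ->]].
  { apply eseries_summ; [now apply admissible_theta|now apply upper_real]. }
  unfold th3, th2, eseries.
  rewrite <- !csum_scal.
  2:{ apply eseries_summ; [apply admissible_th2|now apply upper_4]. }
  2:{ apply eseries_summ; [apply admissible_theta, Cmod_1|now apply upper_4]. }
  f_equal; apply csum_ext; intros n; rewrite expo_add, expo_scal.
  - rewrite Hu. replace (sq (2 * n)) with (sq n * 4) by (unfold sq; rewrite !mult_INR; simpl; ring).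
    replace (theta_coef e (2 * n)) with (theta_coef 1 n); [ring|].
    destruct n; [reflexivity|]. replace (2 * S n)%nat with (S (2 * n + 1)) by lia.
    unfold theta_coef. rewrite Cpow_1_l. replace (S (2 * n + 1)) with (S n + S n)%nat by lia.
    rewrite Cpow_add_r, Csq_one_pow2 by auto. reflexivity.
  - rewrite Hv. replace (sq (2 * n + 1)) with (sq_half n * 4).
    2:{ unfold sq, sq_half; rewrite !plus_INR, !mult_INR; simpl; field. }
    replace (theta_coef e (2 * n + 1)) with (2 * e)%C; [ring|].
    replace (2 * n + 1)%nat with (S (n + n)) by lia. unfold theta_coef.
    change (e ^ S (n + n))%C with (e * e ^ (n + n))%C. rewrite Cpow_add_r, Csq_one_pow2 by auto. ring.
Qed.

Lemma expo_0 k : expo k 0 = RtoC 1.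
Proof. unfold expo. rewrite Cmult_0_r. apply Cexp_0. Qed.

Lemma th3_dissection tau : upper tau -> th3 tau = (th3 (4 * tau) + th2 (4 * tau))%C.
Proof.
  intros Ht. pose proof (theta_dissection 1 tau 0 1 1) as H.
  rewrite Cplus_0_r in H. unfold th3 at 1. rewrite H; auto using expo_0; ring.
Qed.

Lemma th4_dissection tau : upper tau -> th4 tau = (th3 (4 * tau) - th2 (4 * tau))%C.
Proof.
  intros Ht. pose proof (theta_dissection (- (1)) tau 0 1 1) as H.
  rewrite Cplus_0_r in H. unfold th4 at 1. rewrite H; auto using expo_0; ring.
Qed.

(** n^2 and n have the same parity, so the shift by 1/2 cancels the signs. *)
Lemma th4_half tau : th4 (tau + 1 / 2) = th3 tau.
Proof.
  apply csum_ext. intros n. rewrite expo_add.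
  assert (expo (sq n) (1 / 2) = (- (1)) ^ n)%C as ->.
  { replace (expo (sq n) (1 / 2)) with (Cexp (PI * Ci) ^ (n * n))%C.
    - rewrite Cexp_PI. replace (RtoC (-1)) with (- (1))%C by ring.
      assert ((- (1)) * (- (1)) = 1)%C as Hm by ring.
      induction n; [reflexivity|]. replace (S n * S n)%nat with (n * n + S (n + n))%nat by lia.
      rewrite Cpow_add_r, IHn. simpl. rewrite Cpow_add_r, Csq_one_pow2 by auto. ring.
    - rewrite Cexp_pow. unfold expo, sq. f_equal. rewrite mult_INR, RtoC_mult. field. }
  destruct n; simpl theta_coef; [ring|].
  transitivity (2 * ((- (1)) ^ S n * (- (1)) ^ S n) * expo (sq (S n)) tau)%C; [simpl; ring|].
  rewrite Csq_one_pow2 by ring. rewrite Cpow_1_l. ring.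
Qed.

Lemma th4_double tau : upper tau -> (th4 (2 * tau) ^ 2 = th3 tau * th4 tau)%C.
Proof.
  intros Ht. destruct (thetas_phi tau Ht) as [HA [HB [HD [_ [-> [-> _]]]]]].
  destruct (thetas_phi _ (upper_2 _ Ht)) as [HA2 [HB2 [HD2 [_ [-> _]]]]].
  rewrite nome_2 in *. replace ((nome tau ^ 2) ^ 2)%C with (nome tau ^ 4)%C in * by ring.
  field. auto.
Qed.

Lemma th2_double tau : upper tau -> (2 * th2 (2 * tau) * th3 (2 * tau) = th2 tau ^ 2)%C.
Proof.
  intros Ht. destruct (thetas_phi tau Ht) as [HA [HB [HD [_ [_ [_ ->]]]]]].
  destruct (thetas_phi _ (upper_2 _ Ht)) as [HA2 [HB2 [HD2 [_ [_ [-> ->]]]]]].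
  rewrite nome_2 in *. replace ((nome tau ^ 2) ^ 2)%C with (nome tau ^ 4)%C in * by ring.
  rewrite expo_scal. replace (1 / 4 * 2) with (1 / 4 + 1 / 4) by field. rewrite expo_plus.
  field. auto.
Qed.

Lemma tb_double tau : upper tau -> (tb (2 * tau) ^ 2 = ta tau * tb tau)%C.
Proof. intros Ht. unfold ta, tb. rewrite th4_double by auto. ring. Qed.

(** Shifting the product formula for th4(2 tau)^2 by 1/4 turns its left side into th3(2 tau)^2 and,
    by dissection, its right side into (x + i y)(x - i y), where x and y are th3 and th2 at 4
    tau. *)
Lemma ta_double tau : upper tau -> (ta (2 * tau) = (ta tau + tb tau) / 2)%C.
Proof.
  intros Ht. unfold ta, tb.
  assert (upper (tau + (1 / 4)%R)) as Ht4 by (now apply upper_real).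
  pose proof (th4_double _ Ht4) as H.
  replace (2 * (tau + (1 / 4)%R))%C with (2 * tau + 1 / 2)%C in H by (rewrite RtoC_div by lra; field).
  rewrite th4_half in H. rewrite H. unfold th3 at 1, th4 at 1.
  rewrite !(theta_dissection _ tau (1 / 4) 1 Ci); auto; try ring;
    try (intros; rewrite RtoC_div by lra; auto using expo_even_sq, expo_odd_sq).
  rewrite (th3_dissection tau), (th4_dissection tau) by auto.
  assert (Ci * Ci = - (1))%C as Hi.
  { unfold Ci, RtoC, Cmult, Copp; simpl. f_equal; ring. }
  set (x := th3 (4 * tau)). set (y := th2 (4 * tau)).
  transitivity (x * x - y * y * (Ci * Ci))%C; [ring|]. rewrite Hi. field.
Qed.

Lemma tc_double tau : upper tau -> (tc (2 * tau) = (ta tau - tb tau) / 2)%C.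
Proof.
  intros Ht. unfold ta, tb, tc. rewrite <- (th2_double _ (upper_2 _ Ht)).
  replace (2 * (2 * tau))%C with (4 * tau)%C by ring.
  rewrite (th3_dissection tau), (th4_dissection tau) by auto. field.
Qed.

(** By the doubling formulas it reads ((a + b) / 2)^2 = a b + ((a - b) / 2)^2 with a, b taken at tau
    / 2. *)
Lemma jacobi_quartic tau : upper tau -> (ta tau ^ 2 = tb tau ^ 2 + tc tau ^ 2)%C.
Proof.
  intros Ht. assert (upper ((1 / 2)%R * tau)) as Ht' by (apply upper_scal; auto; lra).
  replace tau with (2 * ((1 / 2)%R * tau))%C by (rewrite RtoC_div by lra; field).
  rewrite tb_double, ta_double, tc_double by auto. field.
Qed.

Lemma thetas_neq_0 tau : upper tau -> (th2 tau <> 0 /\ th3 tau <> 0 /\ th4 tau <> 0)%C.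
Proof.
  intros Ht. destruct (thetas_phi tau Ht) as [HA [HB [HD [_ [-> [-> ->]]]]]].
  assert (forall x y : C, x <> 0 -> y <> 0 -> x / y <> 0)%C as Hdiv.
  { intros x y Hx Hy E. apply Hx. replace x with (x / y * y)%C by (field; auto). rewrite E. ring. }
  split; [|split].
  - apply Cmult_neq_0; [apply Cmult_neq_0; [|apply Cexp_neq_0]|apply Hdiv; auto using Cpow_nz].
    intros E. injection E. lra.
  - apply Hdiv; auto using Cpow_nz, Cmult_neq_0.
  - apply Hdiv; auto using Cpow_nz.
Qed.

Lemma tabc_neq_0 tau : upper tau -> (ta tau <> 0 /\ tb tau <> 0 /\ tc tau <> 0)%C.
Proof.
  intros Ht. destruct (thetas_neq_0 tau Ht) as [H2 [H3 H4]]. repeat split; now apply Cpow_nz.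
Qed.

Lemma eta_thetas tau : upper tau ->
  (eta tau ^ 4 * eta (2 * tau) ^ 4 = tc tau * ta tau * tb tau ^ 2 / 4 /\
   eta tau ^ 12 + 32 * (eta tau ^ 4 * eta (4 * tau) ^ 8) =
     tc tau * ta tau * tb tau ^ 2 / 4 * (ta tau ^ 2 + tc tau ^ 2) /\
   t2 tau = - (4) * ta tau ^ 2 * tc tau ^ 2 / tb tau ^ 4 /\
   t2 tau = - (64) * nome tau * prod_plus_pow (nome tau) ^ 24)%C.
Proof.
  intros Ht. pose proof (jacobi_quartic tau Ht) as HJ. unfold t2.
  (* In this form the two summands match the two eta quotients of the newform one by one. *)
  replace (ta tau ^ 2 + tc tau ^ 2)%C with (tb tau ^ 2 + 2 * tc tau ^ 2)%C by (rewrite HJ; ring).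
  clear HJ.
  rewrite !eta_phi by (auto using upper_2, upper_4).
  replace (nome (4 * tau)) with (nome tau ^ 4)%C.
  2:{ replace (4 * tau)%C with (2 * (2 * tau))%C by ring. rewrite !nome_2. ring. }
  rewrite nome_2. unfold ta, tb, tc.
  destruct (thetas_phi tau Ht) as [HA [HB [HD [-> [-> [-> ->]]]]]].
  rewrite !expo_scal.
  assert (expo (1 / 24 * 2) tau = expo (1 / 24) tau ^ 2)%C as ->.
  { rewrite expo_pow. f_equal. simpl. field. }
  assert (expo (1 / 24 * 4) tau = expo (1 / 24) tau ^ 4)%C as ->.
  { rewrite expo_pow. f_equal. simpl. field. }
  assert (expo (1 / 4) tau = expo (1 / 24) tau ^ 6)%C as ->.
  { rewrite expo_pow. f_equal. simpl. field. }
  assert (nome tau = expo (1 / 24) tau ^ 24)%C as E24.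
  { rewrite expo_nome, expo_pow. f_equal. simpl. field. }
  assert (expo (1 / 24) tau <> 0)%C as Hw by apply Cexp_neq_0.
  set (A := phi (nome tau)) in *. set (B := phi (nome tau ^ 2)) in *. set (D := phi (nome tau ^ 4)) in *.
  rewrite E24. set (w := expo (1 / 24) tau) in *.
  repeat split; field; repeat split; auto.
Qed.

(** * Derivatives of the theta functions *)

(* Derivatives are recorded as [kap * l], so that [l] is the value of D = q d/dq. *)
Definition kap : C := (2 * PI * Ci)%C.

Lemma PI_C_neq_0 : RtoC PI <> RtoC 0.
Proof. intros E. injection E. apply PI_neq0. Qed.

Lemma Ci_neq_0 : Ci <> RtoC 0.
Proof. intros E. injection E. lra. Qed.

Lemma RtoC_neq_0 (x : R) : x <> 0 -> RtoC x <> RtoC 0.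
Proof. intros H E. injection E. auto. Qed.

Lemma kap_neq_0 : kap <> RtoC 0.
Proof.
  apply Cmult_neq_0; [apply Cmult_neq_0|]; auto using PI_C_neq_0, Ci_neq_0.
  apply RtoC_neq_0. lra.
Qed.

Lemma Cmult_cancel_l (x y z : C) : x <> RtoC 0 -> (x * y = x * z)%C -> y = z.
Proof.
  intros Hx E. transitivity (x * y / x)%C; [field; auto|]. rewrite E. field. auto.
Qed.

Definition Dth3 : C -> C := eseries (dcoef (theta_coef 1) sq) sq.
Definition Dth4 : C -> C := eseries (dcoef (theta_coef (- (1))) sq) sq.
Definition DDth4 : C -> C := eseries (dcoef (dcoef (theta_coef (- (1))) sq) sq) sq.
Definition Dth2 : C -> C := eseries (dcoef (fun _ => RtoC 2) sq_half) sq_half.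

Lemma cd_th3 tau : upper tau -> cd th3 tau (kap * Dth3 tau)%C.
Proof. apply cd_eseries, admissible_theta, Cmod_1. Qed.
Lemma cd_th4 tau : upper tau -> cd th4 tau (kap * Dth4 tau)%C.
Proof. apply cd_eseries, admissible_theta, Cmod_m1. Qed.
Lemma cd_Dth4 tau : upper tau -> cd Dth4 tau (kap * DDth4 tau)%C.
Proof. apply cd_eseries, admissible_dcoef, admissible_theta, Cmod_m1. Qed.
Lemma cd_th2 tau : upper tau -> cd th2 tau (kap * Dth2 tau)%C.
Proof. apply cd_eseries, admissible_th2. Qed.

Definition Dta (tau : C) : C := (2 * th3 tau * Dth3 tau)%C.
Definition Dtb (tau : C) : C := (2 * th4 tau * Dth4 tau)%C.
Definition Dtc (tau : C) : C := (2 * th2 tau * Dth2 tau)%C.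
(** The logarithmic derivative of [tb], a quasimodular function. Together with it, a, b, c generate
    a ring closed under D, see [cd_ta'] to [cd_th']. *)
Definition th (tau : C) : C := (Dtb tau / tb tau)%C.
Definition Dth (tau : C) : C := (2 * (DDth4 tau * th4 tau - Dth4 tau ^ 2) / tb tau)%C.

Lemma cd_sq f (z l : C) : cd f z l -> cd (fun w => f w ^ 2)%C z (2 * f z * l)%C.
Proof. intros H. eapply cd_eq; [apply (cd_pow _ _ _ 2 H)|]. replace (INR 2) with 2 by (simpl; ring). simpl. ring. Qed.

Lemma cd_ta tau : upper tau -> cd ta tau (kap * Dta tau)%C.
Proof. intros H. eapply cd_eq; [apply cd_sq, cd_th3, H|]. unfold Dta. ring. Qed.
Lemma cd_tb tau : upper tau -> cd tb tau (kap * Dtb tau)%C.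
Proof. intros H. eapply cd_eq; [apply cd_sq, cd_th4, H|]. unfold Dtb. ring. Qed.
Lemma cd_tc tau : upper tau -> cd tc tau (kap * Dtc tau)%C.
Proof. intros H. eapply cd_eq; [apply cd_sq, cd_th2, H|]. unfold Dtc. ring. Qed.

Lemma upper_open tau : upper tau -> forall w, Cmod (w - tau) < Im tau -> upper w.
Proof.
  unfold upper. intros Ht w Hw. pose proof (Im_le_Cmod (w - tau)) as HI.
  replace (Im (w - tau)) with (Im w - Im tau) in HI by (destruct w, tau; simpl; ring).
  assert (Rabs (Im w - Im tau) < Im tau) as H by lra. apply Rabs_def2 in H. lra.
Qed.

Lemma cd_ext_upper f g tau (l : C) : upper tau -> (forall w, upper w -> f w = g w) ->
  cd f tau l -> cd g tau l.
Proof.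
  intros Ht H. apply (cd_ext_loc f g tau l (Im tau)); auto.
  intros w Hw. apply H. now apply upper_open with tau.
Qed.

Lemma th_eq tau : upper tau -> th tau = (2 * Dth4 tau / th4 tau)%C.
Proof.
  intros Ht. destruct (thetas_neq_0 tau Ht) as [_ [_ H4]]. unfold th, Dtb, tb. field. auto.
Qed.

Lemma cd_th tau : upper tau -> cd th tau (kap * Dth tau)%C.
Proof.
  intros Ht. destruct (thetas_neq_0 tau Ht) as [_ [_ H4]].
  apply cd_ext_upper with (fun w => 2 * Dth4 w / th4 w)%C; auto.
  { intros w Hw. now rewrite th_eq. }
  eapply cd_eq; [apply cd_div; auto; [apply cd_scal, cd_Dth4, Ht|apply cd_th4, Ht]|].
  unfold Dth, tb. field. auto.
Qed.

Lemma cd_double f tau (l : C) : cd f (2 * tau)%C l -> cd (fun w => f (2 * w))%C tau (2 * l)%C.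
Proof.
  intros H. apply cd_ext with (fun w => f (2 * w + 0))%C; [intros; f_equal; ring|].
  apply cd_affine. replace (2 * tau + 0)%C with (2 * tau)%C by ring. auto.
Qed.

Lemma Dta_double tau : upper tau -> (Dta (2 * tau) = (Dta tau + Dtb tau) / 4)%C.
Proof.
  intros Ht.
  assert (kap * (2 * Dta (2 * tau)) = kap * ((Dta tau + Dtb tau) / 2))%C as E.
  { apply cd_unique with (fun w => ta (2 * w))%C tau.
    - eapply cd_eq; [apply cd_double, cd_ta; now apply upper_2|]. ring.
    - apply cd_ext_upper with (fun w => / 2 * (ta w + tb w))%C; auto.
      + intros w Hw. rewrite ta_double by auto. field.
      + eapply cd_eq; [apply cd_scal, cd_plus; [now apply cd_ta|now apply cd_tb]|]. field. }
  apply (Cmult_cancel_l _ _ _ kap_neq_0) in E.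
  transitivity (2 * Dta (2 * tau) / 2)%C; [field|]. rewrite E. field.
Qed.

Lemma Dtb_double tau : upper tau ->
  (Dtb (2 * tau) = (Dta tau * tb tau + ta tau * Dtb tau) / (4 * tb (2 * tau)))%C.
Proof.
  intros Ht. destruct (tabc_neq_0 _ (upper_2 _ Ht)) as [_ [Hb _]].
  assert (kap * (4 * tb (2 * tau) * Dtb (2 * tau)) = kap * (Dta tau * tb tau + ta tau * Dtb tau))%C as E.
  { apply cd_unique with (fun w => tb (2 * w) ^ 2)%C tau.
    - eapply cd_eq; [apply (cd_sq (fun w => tb (2 * w)))%C, cd_double, cd_tb; now apply upper_2|]. ring.
    - apply cd_ext_upper with (fun w => ta w * tb w)%C; auto.
      + intros w Hw. now rewrite tb_double.
      + eapply cd_eq; [apply cd_mult; [now apply cd_ta|now apply cd_tb]|]. ring. }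
  apply (Cmult_cancel_l _ _ _ kap_neq_0) in E. rewrite <- E. field. auto.
Qed.

(** * Limits along tau, 2 tau, 4 tau, ... towards the cusp *)

Fixpoint doubled (tau : C) (n : nat) : C := match n with O => tau | S m => (2 * doubled tau m)%C end.

Lemma doubled_upper tau n : upper tau -> upper (doubled tau n).
Proof. intros H. induction n; simpl; auto using upper_2. Qed.

Lemma doubled_Im tau n : Im (doubled tau n) = 2 ^ n * Im tau.
Proof.
  induction n; simpl; [ring|]. unfold Im in *. simpl. rewrite IHn. ring.
Qed.

Lemma pow2_ge n : INR n + 1 <= 2 ^ n.
Proof. induction n; [simpl; lra|]. rewrite S_INR. simpl pow. pose proof (pos_INR n). lra. Qed.

Lemma doubled_expo_0 k tau : upper tau -> 0 < k -> CL (fun N => expo k (doubled tau N)) 0.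
Proof.
  intros Ht Hk. unfold upper in Ht. pose proof PI_RGT_0.
  set (c := 2 * PI * k * Im tau). assert (0 < c) as Hc by (unfold c; apply Rmult_lt_0_compat; [apply Rmult_lt_0_compat|]; lra).
  apply CL_squeeze with (fun n => exp (- c) ^ n).
  - intros n. replace (expo k (doubled tau n) - 0)%C with (expo k (doubled tau n)) by ring.
    rewrite Cmod_expo, doubled_Im, exp_pow_nat. apply exp_mono.
    replace (- (2 * PI * k * (2 ^ n * Im tau))) with (- (c * 2 ^ n)) by (unfold c; ring).
    pose proof (pow2_ge n). nra.
  - apply is_lim_seq_geom. rewrite Rabs_pos_eq by (left; apply exp_pos).
    apply Rlt_le_trans with (exp 0); [apply exp_increasing; lra|rewrite exp_0; lra].
Qed.

(** After division by the leading exponential every other term tends to 0 as the height grows, and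
    the moduli at tau itself dominate those at all its doubles. *)
Lemma eseries_leading al k n0 tau : admissible al k -> upper tau ->
  (forall n, n <> n0 -> al n <> RtoC 0 -> k n0 < k n) ->
  CL (fun N => eseries al k (doubled tau N) / expo (k n0) (doubled tau N))%C (al n0).
Proof.
  intros H Ht Hk. pose proof PI_RGT_0.
  assert (forall N n, al n / expo (k n0) (doubled tau N) * expo (k n) (doubled tau N) = al n * expo (k n - k n0) (doubled tau N))%C as E.
  { intros N n. replace (k n) with (k n - k n0 + k n0) at 1 by ring. rewrite expo_plus.
    field. apply Cexp_neq_0. }
  apply CL_ext with (fun N => csum (fun n => al n * expo (k n - k n0) (doubled tau N)))%C.
  { intros N. unfold eseries, Cdiv. rewrite Cmult_comm, <- csum_scal by (apply eseries_summ; auto using doubled_upper).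
    apply csum_ext. intros n. rewrite <- E. unfold Cdiv. ring. }
  set (v := fun n => if Nat.eq_dec n n0 then al n0 else RtoC 0).
  replace (al n0) with (csum v).
  2:{ rewrite (csum_fin v (S n0)).
      - simpl. replace (psum v n0) with (RtoC 0).
        + unfold v. destruct (Nat.eq_dec n0 n0); [ring|lia].
        + symmetry. transitivity (psum v 0); [|auto].
          assert (forall m, (m <= n0)%nat -> psum v m = RtoC 0) as Hm.
          { induction m; intros; [auto|]. simpl. rewrite IHm by lia. unfold v.
            destruct (Nat.eq_dec m n0); [lia|]. ring. }
          rewrite Hm; auto.
      - intros m Hm. unfold v. destruct (Nat.eq_dec m n0); [lia|auto]. }
  apply (Tannery _ _ (fun n => / Cmod (expo (k n0) tau) * Cmod (al n * expo (k n) tau)) 0).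
  - intros n. unfold v. destruct (Nat.eq_dec n n0) as [->|Hn].
    + apply CL_ext with (fun _ => al n0); [|apply CL_const]. intros.
      rewrite Rminus_diag. unfold expo. replace (2 * PI * Ci * 0 * doubled tau n)%C with (RtoC 0) by ring.
      rewrite Cexp_0. ring.
    + destruct (Ceq_dec (al n) 0) as [E0|E0].
      * rewrite E0. apply CL_ext with (fun _ => RtoC 0); [intros; ring|apply CL_const].
      * replace (RtoC 0) with (al n * 0)%C by ring. apply CL_scal. apply doubled_expo_0; auto.
        specialize (Hk n Hn E0). lra.
  - intros N n _. destruct (Ceq_dec (al n) 0) as [E0|E0].
    { rewrite E0, Cmult_0_l, Cmod_0. right. rewrite Cmult_0_l, Cmod_0. ring. }
    assert (0 <= k n - k n0) as Hkn.
    { destruct (Nat.eq_dec n n0) as [->|Hn]; [lra|]. specialize (Hk n Hn E0). lra. }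
    replace (/ Cmod (expo (k n0) tau) * Cmod (al n * expo (k n) tau)) with (Cmod (al n * expo (k n - k n0) tau)).
    2:{ change tau with (doubled tau 0). rewrite <- (E O n). rewrite !Cmod_mult, Cmod_div by apply Cexp_neq_0.
        field. apply Rgt_not_eq, Cmod_gt_0, Cexp_neq_0. }
    rewrite !Cmod_mult, !Cmod_expo. apply Rmult_le_compat_l; [apply Cmod_ge_0|].
    apply exp_mono, Ropp_le_contravar. apply Rmult_le_compat_l; [apply Rmult_le_pos; lra|].
    rewrite doubled_Im. pose proof (pow2_ge N). pose proof (pos_INR N). unfold upper in Ht. nra.
  - apply ex_series_scal_r. now apply eseries_summ.
Qed.

Lemma sq_lt n0 n : (n0 < n)%nat -> sq n0 < sq n.
Proof. intros H. unfold sq. apply lt_INR in H. pose proof (pos_INR n0). nra. Qed.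

Lemma sq_half_lt n0 n : (n0 < n)%nat -> sq_half n0 < sq_half n.
Proof. intros H. unfold sq_half. apply lt_INR in H. pose proof (pos_INR n0). nra. Qed.

Lemma dcoef_sq_0 al : dcoef al sq 0 = RtoC 0.
Proof. unfold dcoef, sq. simpl. rewrite Rmult_0_l. ring. Qed.

Lemma theta_limits tau : upper tau ->
  CL (fun N => th3 (doubled tau N)) 1 /\ CL (fun N => th4 (doubled tau N)) 1 /\
  CL (fun N => Dth3 (doubled tau N) / nome (doubled tau N))%C 2 /\
  CL (fun N => Dth4 (doubled tau N) / nome (doubled tau N))%C (- (2))%C /\
  CL (fun N => DDth4 (doubled tau N) / nome (doubled tau N))%C (- (2))%C /\
  CL (fun N => th2 (doubled tau N) ^ 4 / nome (doubled tau N))%C 16.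
Proof.
  intros Ht.
  assert (forall e, Cmod e = 1 -> CL (fun N => eseries (theta_coef e) sq (doubled tau N)) 1) as H0.
  { intros e He. pose proof (eseries_leading (theta_coef e) sq 0 tau (admissible_theta e He) Ht) as H.
    apply CL_ext with (2 := H (fun n Hn _ => sq_lt 0 n ltac:(lia))).
    intros n. unfold sq at 2, expo. simpl INR. replace (2 * PI * Ci * (0 * 0)%R * doubled tau n)%C with (RtoC 0).
    - rewrite Cexp_0. field. - rewrite RtoC_mult. ring. }
  assert (forall al, admissible al sq -> al O = RtoC 0 ->
    CL (fun N => eseries al sq (doubled tau N) / nome (doubled tau N))%C (al 1%nat)) as H1.
  { intros al Ha Ha0. pose proof (eseries_leading al sq 1 tau Ha Ht) as H.
    apply CL_ext with (2 := H (fun n Hn Hnz => sq_lt 1 n ltac:(destruct n; [congruence|lia]))).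
    intros n. rewrite expo_nome. do 2 f_equal. unfold sq. simpl. ring. }
  assert (sq 1 = 1) as Hs1 by (unfold sq; simpl; ring).
  split; [apply H0, Cmod_1|]. split; [apply H0, Cmod_m1|]. split; [|split; [|split]].
  - replace (RtoC 2) with (dcoef (theta_coef 1) sq 1).
    + apply H1; auto using dcoef_sq_0. apply admissible_dcoef, admissible_theta, Cmod_1.
    + unfold dcoef. rewrite Hs1. simpl. ring.
  - replace (- (2))%C with (dcoef (theta_coef (- (1))) sq 1).
    + apply H1; auto using dcoef_sq_0. apply admissible_dcoef, admissible_theta, Cmod_m1.
    + unfold dcoef. rewrite Hs1. simpl. ring.
  - replace (- (2))%C with (dcoef (dcoef (theta_coef (- (1))) sq) sq 1).
    + apply H1; auto using dcoef_sq_0. apply admissible_dcoef, admissible_dcoef, admissible_theta, Cmod_m1.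
    + unfold dcoef. rewrite Hs1. simpl. ring.
  - pose proof (eseries_leading (fun _ => RtoC 2) sq_half 0 tau admissible_th2 Ht) as H.
    specialize (H (fun n Hn _ => sq_half_lt 0 n ltac:(lia))).
    apply (CL_pow _ _ 4) in H. replace (RtoC 16) with (2 ^ 4)%C by ring.
    apply CL_ext with (2 := H). intros n. unfold Cdiv. rewrite Cpow_mult_l.
    rewrite Cpow_inv by apply Cexp_neq_0. do 2 f_equal. rewrite expo_pow, expo_nome. f_equal.
    unfold sq_half. simpl. field.
Qed.

(* By the doubling formulas, (Da/a - Db/b) / c^2 takes the same value at tau and at 2 tau;
   it is therefore equal to its limit 1/2 at the cusp. *)
Lemma Dta_eq tau : upper tau -> (Dta tau = ta tau * (th tau + tc tau ^ 2 / 2))%C.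
Proof.
  intros Ht.
  set (de := fun z => ((Dta z * tb z - ta z * Dtb z) / (ta z * tb z * tc z ^ 2))%C).
  assert (forall z, upper z -> de (2 * z)%C = de z) as Hde.
  { intros z Hz. unfold de. destruct (tabc_neq_0 _ Hz) as [Ha [Hb Hc]].
    destruct (tabc_neq_0 _ (upper_2 _ Hz)) as [Ha2 [Hb2 Hc2]].
    pose proof (tb_double z Hz) as E2.
    pose proof (jacobi_quartic z Hz) as J.
    replace (tc z ^ 2)%C with (ta z ^ 2 - tb z ^ 2)%C by (rewrite J; ring).
    assert (ta z ^ 2 - tb z ^ 2 <> 0)%C as HJ.
    { replace (ta z ^ 2 - tb z ^ 2)%C with (tc z ^ 2)%C by (rewrite J; ring). now apply Cpow_nz. }
    assert (ta z + tb z <> 0)%C as Hp.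
    { intros E. apply HJ. transitivity ((ta z + tb z) * (ta z - tb z))%C; [ring|]. rewrite E. ring. }
    assert (ta z - tb z <> 0)%C as Hm.
    { intros E. apply HJ. transitivity ((ta z + tb z) * (ta z - tb z))%C; [ring|]. rewrite E. ring. }
    rewrite Dta_double, Dtb_double, ta_double, tc_double by auto.
    set (B2 := tb (2 * z)) in *.
    transitivity (((Dta z + Dtb z) / 4 * (B2 ^ 2) -
      (ta z + tb z) / 2 * ((Dta z * tb z + ta z * Dtb z) / 4)) /
      ((ta z + tb z) / 2 * B2 ^ 2 * ((ta z - tb z) / 2) ^ 2))%C; [field; repeat split; auto|].
    rewrite E2. field. repeat split; auto. }
  assert (forall n, de (doubled tau n) = de tau) as Hc.
  { induction n; simpl; auto. rewrite Hde; auto using doubled_upper. }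
  destruct (theta_limits tau Ht) as [L3 [L4 [LD3 [LD4 [_ L2]]]]].
  assert (CL (fun n => de (doubled tau n)) (/ 2)%C) as HL.
  { replace (/ 2)%C with (((2 * 1 * 2) * (1 ^ 2) - 1 ^ 2 * (2 * 1 * (- (2)))) / (1 ^ 2 * 1 ^ 2 * 16))%C by field.
    (* The numerator and [tc ^ 2] both vanish to first order in q, so each is divided by the nome
       before the limit is taken. *)
    apply CL_ext with (fun n => let z := doubled tau n in
      ((2 * th3 z * (Dth3 z / nome z)) * th4 z ^ 2 - th3 z ^ 2 * (2 * th4 z * (Dth4 z / nome z)))
       * / (th3 z ^ 2 * th4 z ^ 2 * (th2 z ^ 4 / nome z)))%C.
    - intros n. unfold de, Dta, Dtb, ta, tb, tc. simpl.
      destruct (thetas_neq_0 _ (doubled_upper tau n Ht)) as [H2 [H3 H4]].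
      field. pose proof (nome_neq_0 (doubled tau n)). repeat split; auto.
    - apply CL_mult.
      + apply CL_minus; apply CL_mult; auto using CL_pow, CL_scal; apply CL_mult; auto using CL_scal.
      + apply CL_inv; [|repeat apply CL_mult; auto using CL_pow, CL_const].
        replace (1 ^ 2 * 1 ^ 2 * 16)%C with (RtoC 16) by ring. apply RtoC_neq_0. lra. }
  assert (de tau = / 2)%C as E.
  { eapply CL_unique; [|apply HL]. apply CL_ext with (fun _ => de tau); [auto|apply CL_const]. }
  destruct (tabc_neq_0 _ Ht) as [Ha [Hb Hcc]].
  unfold de in E.
  assert (Dta tau * tb tau - ta tau * Dtb tau = / 2 * (ta tau * tb tau * tc tau ^ 2))%C as E1.
  { rewrite <- E. field. repeat split; auto. }
  unfold th.
  transitivity ((Dta tau * tb tau - ta tau * Dtb tau + ta tau * Dtb tau) / tb tau)%C; [field; auto|].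
  rewrite E1. field. auto.
Qed.

Lemma Dtb_eq tau : upper tau -> (Dtb tau = tb tau * th tau)%C.
Proof. intros Ht. destruct (tabc_neq_0 _ Ht) as [Ha [Hb Hc]]. unfold th. field. auto. Qed.

(** Obtained by differentiating c^2 = a^2 - b^2 and dividing by 2 c. *)
Lemma Dtc_eq tau : upper tau -> (Dtc tau = tc tau * (th tau + ta tau ^ 2 / 2))%C.
Proof.
  intros Ht. destruct (tabc_neq_0 _ Ht) as [Ha [Hb Hc]].
  assert (kap * (2 * tc tau * Dtc tau) = kap * (2 * ta tau * Dta tau - 2 * tb tau * Dtb tau))%C as E.
  { apply cd_unique with (fun w => tc w ^ 2)%C tau.
    - eapply cd_eq; [apply cd_sq, cd_tc, Ht|]. ring.
    - apply cd_ext_upper with (fun w => ta w ^ 2 - tb w ^ 2)%C; auto.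
      + intros w Hw. rewrite (jacobi_quartic w Hw). ring.
      + eapply cd_eq; [apply cd_minus; apply cd_sq; [now apply cd_ta|now apply cd_tb]|]. ring. }
  apply (Cmult_cancel_l _ _ _ kap_neq_0) in E. rewrite Dta_eq, Dtb_eq in E by auto.
  apply (Cmult_cancel_l (2 * tc tau)%C); [apply Cmult_neq_0; auto; apply RtoC_neq_0; lra|].
  rewrite E. pose proof (jacobi_quartic tau Ht) as J.
  replace (2 * ta tau * (ta tau * (th tau + tc tau ^ 2 / 2)) - 2 * tb tau * (tb tau * th tau))%C
    with (2 * ((ta tau ^ 2 - tb tau ^ 2) * th tau + ta tau ^ 2 * tc tau ^ 2 / 2))%C by field.
  replace (ta tau ^ 2 - tb tau ^ 2)%C with (tc tau ^ 2)%C by (rewrite J; ring). field.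
Qed.

Lemma th_double tau : upper tau -> (th (2 * tau) = th tau / 2 + tc tau ^ 2 / 8)%C.
Proof.
  intros Ht. destruct (tabc_neq_0 _ Ht) as [Ha [Hb Hc]].
  destruct (tabc_neq_0 _ (upper_2 _ Ht)) as [Ha2 [Hb2 Hc2]].
  unfold th at 1. rewrite Dtb_double, Dta_eq, Dtb_eq by auto.
  pose proof (tb_double tau Ht) as E2.
  transitivity ((ta tau * (th tau + tc tau ^ 2 / 2) * tb tau + ta tau * (tb tau * th tau)) / (4 * tb (2 * tau) ^ 2))%C.
  - field. auto.
  - rewrite E2. field. auto.
Qed.

Lemma Dth_double tau : upper tau ->
  (Dth (2 * tau) = Dth tau / 4 + tc tau ^ 2 * (th tau + ta tau ^ 2 / 2) / 8)%C.
Proof.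
  intros Ht.
  assert (kap * (2 * Dth (2 * tau)) = kap * (Dth tau / 2 + 2 * tc tau * Dtc tau / 8))%C as E.
  { apply cd_unique with (fun w => th (2 * w))%C tau.
    - eapply cd_eq; [apply cd_double, cd_th; now apply upper_2|]. ring.
    - apply cd_ext_upper with (fun w => / 2 * th w + / 8 * tc w ^ 2)%C; auto.
      + intros w Hw. rewrite th_double by auto. field.
      + eapply cd_eq; [apply cd_plus; apply cd_scal; [now apply cd_th|apply cd_sq, cd_tc, Ht]|]. field. }
  apply (Cmult_cancel_l _ _ _ kap_neq_0) in E. rewrite Dtc_eq in E by auto.
  transitivity (2 * Dth (2 * tau) / 2)%C; [field|]. rewrite E. field.
Qed.

Lemma pow4_nome_limit tau : upper tau ->
  CL (fun n => RtoC (4 ^ n) * nome (doubled tau n))%C 0.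
Proof.
  intros Ht. unfold upper in Ht. pose proof PI_RGT_0.
  (* A third of the decay rate: with X = 2^n, exp (3 c X) >= (c X)^3 beats 4^n = X^2. *)
  set (c := 2 * PI * Im tau / 3). assert (0 < c) as Hc.
  { unfold c. apply Rdiv_lt_0_compat; [|lra]. apply Rmult_lt_0_compat; lra. }
  apply CL_squeeze with (fun n => / c ^ 3 * (/ 2) ^ n).
  - intros n. replace (RtoC (4 ^ n) * nome (doubled tau n) - 0)%C with (RtoC (4 ^ n) * nome (doubled tau n))%C by ring.
    rewrite Cmod_mult, Cmod_R, expo_nome, Cmod_expo, doubled_Im.
    set (X := 2 ^ n). assert (0 < X) as HX by (apply pow_lt; lra).
    replace (4 ^ n) with (X * X) by (unfold X; rewrite <- Rpow_mult_distr; f_equal; ring).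
    rewrite Rabs_pos_eq by nra.
    replace (- (2 * PI * 1 * (X * Im tau))) with (- (INR 3 * (c * X))) by (unfold c; simpl; field).
    rewrite exp_Ropp, <- exp_pow_nat.
    replace (/ 2) with (/ (2 ^ 1)) by (f_equal; ring). rewrite pow_inv, <- pow_mult, Nat.mul_1_l. fold X.
    assert (c * X <= exp (c * X)) as He by (pose proof (exp_ineq1_le (c * X)); lra).
    apply Rle_trans with (X * X * / (c * X) ^ 3).
    + apply Rmult_le_compat_l; [nra|]. apply Rinv_le_contravar; [apply pow_lt; nra|].
      apply pow_incr. split; [nra|auto].
    + right. field. lra.
  - replace (Finite 0) with (Finite (/ c ^ 3 * 0)) by (f_equal; ring).
    apply is_lim_seq_mult'; [apply is_lim_seq_const|]. apply is_lim_seq_geom.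
    rewrite Rabs_pos_eq; lra.
Qed.

(* The defect of this identity gets multiplied by 4 when tau is replaced by tau / 2,
   while it is O(q) at the cusp. *)
Lemma Dth_eq tau : upper tau -> (Dth tau = th tau ^ 2 - ta tau ^ 2 * tc tau ^ 2 / 4)%C.
Proof.
  intros Ht.
  set (d := fun z => (Dth z - th z ^ 2 + ta z ^ 2 * tc z ^ 2 / 4)%C).
  assert (forall z, upper z -> d z = 4 * d (2 * z))%C as Hd.
  { intros z Hz. unfold d. rewrite Dth_double, th_double, ta_double, tc_double by auto.
    pose proof (jacobi_quartic z Hz) as J.
    replace (((ta z + tb z) / 2) ^ 2 * ((ta z - tb z) / 2) ^ 2)%C with ((ta z ^ 2 - tb z ^ 2) ^ 2 / 16)%C by field.
    replace (ta z ^ 2 - tb z ^ 2)%C with (tc z ^ 2)%C by (rewrite J; ring). field. }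
  assert (forall n, d tau = RtoC (4 ^ n) * d (doubled tau n))%C as Hn.
  { induction n; simpl; [ring|]. rewrite IHn, Hd by auto using doubled_upper.
    rewrite RtoC_mult. ring. }
  destruct (theta_limits tau Ht) as [L3 [L4 [LD3 [LD4 [LDD4 L2]]]]].
  assert (forall k : R, 0 < k -> CL (fun n => expo k (doubled tau n)) 0) as LE by (intros; now apply doubled_expo_0).
  assert (CL (fun n => nome (doubled tau n)) 0) as LN.
  { apply CL_ext with (fun n => expo 1 (doubled tau n)).
    - intros; now rewrite expo_nome. - apply LE. lra. }
  assert (exists l, CL (fun n => d (doubled tau n) / nome (doubled tau n))%C l) as [l Hl].
  { eexists. apply CL_ext with (fun n => let z := doubled tau n in
      (2 * ((DDth4 z / nome z) * th4 z - (Dth4 z / nome z) ^ 2 * nome z) * / (th4 z ^ 2)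
       - 4 * (Dth4 z / nome z) ^ 2 * nome z * / (th4 z ^ 2) + th3 z ^ 4 * (th2 z ^ 4 / nome z) * / 4))%C.
    - intros n. cbv zeta. unfold d, Dth. rewrite th_eq by (now apply doubled_upper). unfold ta, tb, tc.
      destruct (thetas_neq_0 _ (doubled_upper tau n Ht)) as [H2 [H3 H4]].
      pose proof (nome_neq_0 (doubled tau n)). field. auto.
    - assert (CL (fun n => / (th4 (doubled tau n) ^ 2))%C (/ (1 ^ 2))%C) as LI.
      { apply CL_inv; [|now apply CL_pow]. replace (1 ^ 2)%C with (RtoC 1) by ring. apply RtoC_neq_0. lra. }
      cbv zeta. apply CL_plus; [apply CL_minus|].
      + apply CL_mult; [|apply LI]. apply CL_scal. apply CL_minus; apply CL_mult; eauto. apply CL_pow, LD4.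
      + apply CL_mult; [|apply LI]. apply CL_mult; [|apply LN]. apply CL_scal. apply CL_pow, LD4.
      + apply CL_mult; [|apply CL_const]. apply CL_mult; eauto. apply CL_pow, L3. }
  assert (d tau = RtoC 0) as E.
  { replace (RtoC 0) with (0 * l)%C by ring.
    apply CL_unique with (fun n => (RtoC (4 ^ n) * nome (doubled tau n)) * (d (doubled tau n) / nome (doubled tau n)))%C.
    - apply CL_ext with (fun _ => d tau); [|apply CL_const]. intros n. rewrite (Hn n) at 1.
      field. apply nome_neq_0.
    - apply CL_mult; auto. now apply pow4_nome_limit. }
  unfold d in E.
  transitivity ((Dth tau - th tau ^ 2 + ta tau ^ 2 * tc tau ^ 2 / 4)
     + (th tau ^ 2 - ta tau ^ 2 * tc tau ^ 2 / 4))%C; [ring|]. rewrite E. ring.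
Qed.

Lemma cd_ta' tau : upper tau -> cd ta tau (kap * (ta tau * (th tau + tc tau ^ 2 / 2)))%C.
Proof. intros H. rewrite <- Dta_eq by auto. now apply cd_ta. Qed.
Lemma cd_tb' tau : upper tau -> cd tb tau (kap * (tb tau * th tau))%C.
Proof. intros H. rewrite <- Dtb_eq by auto. now apply cd_tb. Qed.
Lemma cd_tc' tau : upper tau -> cd tc tau (kap * (tc tau * (th tau + ta tau ^ 2 / 2)))%C.
Proof. intros H. rewrite <- Dtc_eq by auto. now apply cd_tc. Qed.
Lemma cd_th' tau : upper tau -> cd th tau (kap * (th tau ^ 2 - ta tau ^ 2 * tc tau ^ 2 / 4))%C.
Proof. intros H. rewrite <- Dth_eq by auto. now apply cd_th. Qed.

(** * Lambert series and the Fricke involution *)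

Definition tE (tau : C) : C := (ta tau ^ 2 + tc tau ^ 2)%C.

Lemma cd_t2 tau : upper tau -> cd t2 tau (kap * (t2 tau * tE tau))%C.
Proof.
  intros Ht. destruct (tabc_neq_0 _ Ht) as [Ha [Hb Hc]].
  apply cd_ext_upper with (fun w => - (4) * (ta w ^ 2 * tc w ^ 2 / (tb w ^ 2) ^ 2))%C; auto.
  { intros w Hw. destruct (eta_thetas w Hw) as [_ [_ [-> _]]].
    destruct (tabc_neq_0 _ Hw) as [_ [Hb' _]]. field. auto. }
  destruct (eta_thetas tau Ht) as [_ [_ [-> _]]].
  eapply cd_eq.
  - apply cd_scal, (cd_div (fun w => ta w ^ 2 * tc w ^ 2) (fun w => (tb w ^ 2) ^ 2))%C;
      [do 2 apply Cpow_nz; exact Hb| |].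
    + apply cd_mult; apply cd_sq; [now apply cd_ta'|now apply cd_tc'].
    + apply cd_sq, cd_sq. now apply cd_tb'.
  - unfold tE. field. auto.
Qed.

(* [A + D x + B x^2] majorizes the Taylor expansion of [f] at [z]; such majorants multiply. *)
Definition taylor (f : C -> C) (z l : C) (r A D B : R) : Prop :=
  Cmod (f z) <= A /\ Cmod l <= D /\ 0 <= B /\
  forall w, Cmod (w - z) < r -> Cmod (f w - f z - l * (w - z)) <= B * Cmod (w - z) ^ 2.

(** The radius is at most 1, so the terms of third and fourth order are absorbed into the quadratic
    one; the sum A + D + B is then exactly multiplicative. *)
Lemma taylor_mult f g z l m r A1 D1 B1 A2 D2 B2 : r <= 1 ->
  taylor f z l r A1 D1 B1 -> taylor g z m r A2 D2 B2 ->
  taylor (fun w => f w * g w)%C z (l * g z + f z * m)%C r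
    (A1 * A2) (D1 * A2 + A1 * D2) (B1 * A2 + A1 * B2 + D1 * D2 + D1 * B2 + B1 * D2 + B1 * B2).
Proof.
  intros Hr [Ha1 [Hd1 [Hb1 H1]]] [Ha2 [Hd2 [Hb2 H2]]].
  pose proof (Cmod_ge_0 (f z)). pose proof (Cmod_ge_0 (g z)).
  pose proof (Cmod_ge_0 l). pose proof (Cmod_ge_0 m).
  split; [|split; [|split]].
  - rewrite Cmod_mult. apply Rmult_le_compat; auto.
  - eapply Rle_trans; [apply Cmod_triangle|]. rewrite !Cmod_mult.
    apply Rplus_le_compat; apply Rmult_le_compat; auto.
  - repeat apply Rplus_le_le_0_compat; apply Rmult_le_pos; lra.
  - intros w Hw. specialize (H1 w Hw). specialize (H2 w Hw).
    set (h := Cmod (w - z)) in *. assert (0 <= h) as Hh by apply Cmod_ge_0.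
    set (rf := (f w - f z - l * (w - z))%C) in *. set (rg := (g w - g z - m * (w - z))%C) in *.
    replace (f w * g w - f z * g z - (l * g z + f z * m) * (w - z))%C
      with (rf * g z + f z * rg + l * (w - z) * (m * (w - z)) + l * (w - z) * rg + rf * (m * (w - z)) + rf * rg)%C
      by (unfold rf, rg; ring).
    assert (forall x1 x2 x3 x4 x5 x6 : C, Cmod (x1 + x2 + x3 + x4 + x5 + x6) <=
      Cmod x1 + Cmod x2 + Cmod x3 + Cmod x4 + Cmod x5 + Cmod x6) as Ht.
    { intros. do 5 (eapply Rle_trans; [apply Cmod_triangle|apply Rplus_le_compat_r]). lra. }
    eapply Rle_trans; [apply Ht|]. rewrite !Cmod_mult. fold h.
    assert (h ^ 2 <= h) as Hh2 by nra. assert (0 <= h ^ 2) as Hh0 by nra.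
    pose proof (Cmod_ge_0 rf). pose proof (Cmod_ge_0 rg).
    assert (Cmod rf <= B1 * h) as H1' by nra. assert (Cmod rg <= B2 * h) as H2' by nra.
    assert (Cmod l * h <= D1 * h) as Hl by (apply Rmult_le_compat_r; lra).
    assert (Cmod m * h <= D2 * h) as Hm by (apply Rmult_le_compat_r; lra).
    assert (0 <= Cmod l * h) by (now apply Rmult_le_pos). assert (0 <= Cmod m * h) by (now apply Rmult_le_pos).
    replace ((B1 * A2 + A1 * B2 + D1 * D2 + D1 * B2 + B1 * D2 + B1 * B2) * h ^ 2)
      with ((B1 * h ^ 2) * A2 + A1 * (B2 * h ^ 2) + (D1 * h) * (D2 * h) + (D1 * h) * (B2 * h)
            + (B1 * h) * (D2 * h) + (B1 * h) * (B2 * h)) by ring.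
    repeat apply Rplus_le_compat; apply Rmult_le_compat; auto.
Qed.

Lemma taylor_one z r : taylor (fun _ => RtoC 1) z 0 r 1 0 0.
Proof.
  split; [rewrite Cmod_1; lra|]. split; [rewrite Cmod_0; lra|]. split; [lra|]. intros w _.
  replace (1 - 1 - 0 * (w - z))%C with (RtoC 0) by ring. rewrite Cmod_0. lra.
Qed.

(** The logarithmic derivative, with respect to D, of the factor 1 + q^(n+1) of [prod_plus_pow]. *)
Definition lambert_term (tau : C) (n : nat) : C :=
  (INR (S n) * nome tau ^ S n / (1 + nome tau ^ S n))%C.

(** An infinite product is differentiated through its partial products. In the Taylor majorants the
    quantity A + D + B is multiplicative, and for the n-th factor it is at most exp (s n) with s
    summable; so the quadratic remainder is bounded independently of the number of factors. *)
Lemma cd_prod_plus_pow tau : upper tau -> summ (lambert_term tau) ->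
  cd (fun w => prod_plus_pow (nome w)) tau (kap * (prod_plus_pow (nome tau) * csum (lambert_term tau)))%C.
Proof.
  intros Ht HS. pose proof PI_RGT_0 as Hpi. unfold upper in Ht. set (y := Im tau) in *.
  set (r := Rmin 1 (y / 2)). assert (0 < r) as Hr by (apply Rmin_glb_lt; lra).
  assert (r <= 1) as Hr1 by apply Rmin_l. assert (r <= y / 2) as Hr2 by apply Rmin_r.
  (* The three coefficients account for the value, the derivative and the remainder of one factor;
     the rate pi y instead of 2 pi y is the price of the radius y / 2. *)
  set (s := fun n => (1 + 2 * PI + 8 * PI ^ 2) * ((INR (S n) + 1) ^ 2 * exp (- (PI * y * INR (S n))))).
  assert (forall n, 0 <= s n) as Hs0.
  { intros n. unfold s. apply Rmult_le_pos; [nra|]. apply Rmult_le_pos; [apply pow2_ge_0|left; apply exp_pos]. }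
  assert (ex_series s) as Hs.
  { apply ex_series_scal_r. apply (ex_series_incr_1 (V := R_NormedModule)
      (fun n => (INR n + 1) ^ 2 * exp (- (PI * y * INR n)))). apply poly_exp_summable.
    apply Rmult_lt_0_compat; lra. }
  set (f := fun n w => (1 + 1 * nome w ^ n)%C).
  assert (forall n, exists A D B, A + D + B <= exp (s n) /\
    taylor (f (S n)) tau (kap * (INR (S n) * nome tau ^ S n))%C r A D B) as Hf.
  { intros n. set (N := INR (S n)). set (E := exp (- (PI * y * N))).
    assert (1 <= N) as HN by (unfold N; rewrite S_INR; pose proof (pos_INR n); lra).
    assert (0 < E) as HE by apply exp_pos.
    assert (Cmod (nome tau ^ S n) <= E) as HA.
    { rewrite nome_pow, Cmod_expo. apply exp_mono. fold N y.
      assert (0 <= PI * (N * y)) by (apply Rmult_le_pos; nra). lra. }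
    assert (Cmod kap = 2 * PI) as Hkap.
    { unfold kap. rewrite !Cmod_mult, Cmod_Ci, !Cmod_R, !Rabs_pos_eq; lra. }
    exists (1 + E), (2 * PI * (N * E)), (8 * PI ^ 2 * (N ^ 2 * E)). split.
    - apply Rle_trans with (1 + s n); [|pose proof (exp_ineq1_le (s n)); lra].
      unfold s. fold N E.
      assert (E <= (N + 1) ^ 2 * E) by nra. assert (N * E <= (N + 1) ^ 2 * E) by nra.
      assert (N ^ 2 * E <= (N + 1) ^ 2 * E) by nra.
      assert (2 * PI * (N * E) <= 2 * PI * ((N + 1) ^ 2 * E)) by nra.
      assert (8 * PI ^ 2 * (N ^ 2 * E) <= 8 * PI ^ 2 * ((N + 1) ^ 2 * E)).
      { apply Rmult_le_compat_l; nra. } nra.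
    - split; [|split; [|split]].
      + unfold f. eapply Rle_trans; [apply Cmod_triangle|]. rewrite Cmod_1, Cmult_1_l. lra.
      + rewrite !Cmod_mult, Hkap, Cmod_R, Rabs_pos_eq by lra. fold N.
        apply Rmult_le_compat_l; [lra|]. apply Rmult_le_compat_l; lra.
      + assert (0 <= N ^ 2 * E) by nra. nra.
      + intros w Hw. unfold f. rewrite !nome_pow. fold N. set (h := Cmod (w - tau)) in *.
        assert (0 <= h) as Hh by apply Cmod_ge_0.
        set (X := (2 * PI * Ci * N * (w - tau))%C).
        replace (expo N w) with (expo N tau * Cexp X)%C.
        2:{ unfold expo. rewrite <- Cexp_add. f_equal. unfold X. ring. }
        replace (1 + 1 * (expo N tau * Cexp X) - (1 + 1 * expo N tau) - kap * (N * expo N tau) * (w - tau))%C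
          with (expo N tau * (Cexp X - 1 - X))%C by (unfold X, kap; ring).
        assert (Cmod X = 2 * PI * N * h) as HX.
        { unfold X. rewrite !Cmod_mult, Cmod_Ci, !Cmod_R, !Rabs_pos_eq by lra. fold h. ring. }
        rewrite Cmod_mult, Cmod_expo. fold y.
        eapply Rle_trans; [apply Rmult_le_compat_l; [left; apply exp_pos|apply Cexp_bound2]|]. rewrite HX.
        replace (exp (- (2 * PI * N * y)) * (2 * exp (2 * PI * N * h) * (2 * PI * N * h) ^ 2))
          with ((8 * PI ^ 2 * N ^ 2 * h ^ 2) * (exp (- (2 * PI * N * y)) * exp (2 * PI * N * h))) by ring.
        replace (8 * PI ^ 2 * (N ^ 2 * E) * h ^ 2) with ((8 * PI ^ 2 * N ^ 2 * h ^ 2) * E) by ring.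
        apply Rmult_le_compat_l.
        * assert (0 <= N ^ 2 * h ^ 2) by nra. assert (0 <= PI ^ 2) by nra. nra.
        * rewrite <- exp_plus. apply exp_mono.
          assert (2 * PI * N * h <= PI * N * y); [|lra].
          replace (PI * N * y) with (2 * PI * N * (y / 2)) by field.
          apply Rmult_le_compat_l; [nra|]. lra. }
  set (Lm := fun N => psum (fun n => lambert_term tau n) N).
  assert (forall n, f (S n) tau <> RtoC 0) as Hnz.
  { intros n. unfold f. apply (geo_bounded_neq (fun n => 1 * nome tau ^ n)%C (Cmod (nome tau)) n).
    apply (geo_bounded_pow _ _ (fun n => n)); auto using Cmod_1, Cmod_nome_lt. }
  assert (forall N, exists A D B, A + D + B <= exp (Series s) /\
    taylor (fun w => Cprod1 (fun n => f n w) N) tau (kap * (Cprod1 (fun n => f n tau) N * Lm N))%C r A D B) as HP.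
  { assert (forall N, exists A D B, A + D + B <= exp (match N with O => 0 | S m => sum_n s m end) /\
    taylor (fun w => Cprod1 (fun n => f n w) N) tau (kap * (Cprod1 (fun n => f n tau) N * Lm N))%C r A D B) as H.
    { induction N as [|N [A1 [D1 [B1 [HS1 HT1]]]]].
      - exists 1, 0, 0. split; [rewrite exp_0; lra|].
        change (taylor (fun _ => RtoC 1) tau (kap * (1 * 0))%C r 1 0 0).
        replace (kap * (1 * 0))%C with (RtoC 0) by ring. apply taylor_one.
      - destruct (Hf N) as [A2 [D2 [B2 [HS2 HT2]]]].
        eexists _, _, _. split.
        2:{ pose proof (taylor_mult _ _ _ _ _ _ _ _ _ _ _ _ Hr1 HT1 HT2) as HT.
            match type of HT with taylor _ _ ?l _ _ _ _ => replace (kap * (Cprod1 (fun n => f n tau) (S N) * Lm (S N)))%C with l end.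
            - exact HT.
            - unfold Lm. cbn [Cprod1 psum]. fold (Lm N). unfold lambert_term at 1.
              assert (f (S N) tau = 1 + nome tau ^ S N)%C as E by (unfold f; ring).
              pose proof (Hnz N) as Hz. rewrite E in *. field. auto. }
        assert (exp (sum_n s N) = exp (match N with O => 0 | S m => sum_n s m end) * exp (s N)) as ->.
        { rewrite <- exp_plus. f_equal. destruct N; [rewrite sum_O; symmetry; apply Rplus_0_l|now rewrite sum_Sn]. }
        destruct HT1 as [Ha1 [Hd1 [Hb1 _]]]. destruct HT2 as [Ha2 [Hd2 [Hb2 _]]].
        pose proof (Cmod_ge_0 (Cprod1 (fun n => f n tau) N)). pose proof (Cmod_ge_0 (f (S N) tau)).
        pose proof (Cmod_ge_0 (kap * (Cprod1 (fun n => f n tau) N * Lm N))).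
        pose proof (Cmod_ge_0 (kap * (INR (S N) * nome tau ^ S N))).
        apply Rle_trans with ((A1 + D1 + B1) * (A2 + D2 + B2)); [right; ring|].
        apply Rmult_le_compat; lra. }
    intros N. destruct (H N) as [A [D [B [HB HT]]]]. exists A, D, B. split; auto.
    apply Rle_trans with (1 := HB). apply exp_mono. destruct N; [|now apply sum_n_le_Series].
    apply Rle_trans with (sum_n s 0); [rewrite sum_O; auto|now apply sum_n_le_Series]. }
  assert (forall w, upper w -> CL (fun N => Cprod1 (fun n => f n w) N) (prod_plus_pow (nome w))) as HL.
  { intros w Hw. apply iprod_CL with (Cmod (nome w)).
    apply (geo_bounded_pow _ _ (fun n => n)); auto using Cmod_1, Cmod_nome_lt. }
  exists (exp (Series s)), r. split; [left; apply exp_pos|]. split; auto. intros w Hw.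
  assert (upper w) as Huw by (apply upper_open with tau; auto; fold y; lra).
  apply CL_le_bound with (fun N => Cprod1 (fun n => f n w) N - Cprod1 (fun n => f n tau) N
    - kap * (Cprod1 (fun n => f n tau) N * Lm N) * (w - tau))%C.
  - apply CL_minus; [apply CL_minus; auto|]. apply CL_mult; [|apply CL_const]. apply CL_scal.
    apply CL_mult; auto. now apply summ_CL.
  - exists O. intros N _. destruct (HP N) as [A [D [B [HB [Ha [Hd [Hb HT]]]]]]].
    eapply Rle_trans; [apply HT; auto|]. apply Rmult_le_compat_r; [apply pow_le, Cmod_ge_0|].
    pose proof (Cmod_ge_0 (Cprod1 (fun n => f n tau) N)).
    pose proof (Cmod_ge_0 (kap * (Cprod1 (fun n => f n tau) N * Lm N))). lra.
Qed.

Lemma csum_geom (w : C) : Cmod w < 1 -> summ (fun n => w ^ n)%C /\ csum (fun n => w ^ n)%C = (/ (1 - w))%C.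
Proof.
  intros Hw. pose proof (Cmod_ge_0 w).
  assert (summ (fun n => w ^ n)%C) as HS.
  { apply summ_dom with (fun n => Cmod w ^ n); [intros; rewrite Cmod_pow; lra|]. apply ex_series_pow. lra. }
  split; auto.
  pose proof (csum_head _ HS) as E. simpl in E. rewrite csum_scal in E by auto.
  symmetry. apply Cinv_of_mult. set (T := csum (fun n => w ^ n)%C) in *.
  transitivity (T - w * T)%C; [ring|]. rewrite E at 1. ring.
Qed.

Lemma one_minus_neq_0 (w : C) : Cmod w < 1 -> (1 - w <> 0)%C.
Proof.
  intros Hw E. assert (w = 1)%C as -> by (transitivity (1 - (1 - w))%C; [ring|rewrite E; ring]).
  rewrite Cmod_1 in Hw. lra.
Qed.

Lemma INR_pow_summable (r : R) : 0 <= r < 1 -> ex_series (fun n => (INR n + 1) * r ^ n).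
Proof.
  intros [Hr0 Hr]. destruct (Req_dec r 0) as [->|Hn].
  - apply (ex_series_incr_1 (V := R_NormedModule)). apply ex_series_ext with (fun n => 0 * (1 / 2) ^ n).
    + intros n. simpl. ring. + apply ex_series_scal_r, ex_series_pow. lra.
  - apply ex_series_ext with (fun n => (INR n + 1) ^ 1 * exp (- (- ln r * INR n))).
    + intros n. rewrite pow_1. f_equal. replace (- (- ln r * INR n)) with (INR n * ln r) by ring.
      rewrite <- exp_pow_nat, exp_ln by lra. auto.
    + apply poly_exp_summable. rewrite <- ln_1. assert (ln r < ln 1) by (apply ln_increasing; lra). rewrite ln_1 in *. lra.
Qed.

Lemma csum_geom_deriv (w : C) : Cmod w < 1 ->
  csum (fun n => INR (S n) * w ^ S n)%C = (w / (1 - w) ^ 2)%C.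
Proof.
  intros Hw. pose proof (Cmod_ge_0 w). destruct (csum_geom w Hw) as [HG EG].
  assert (forall n, INR (S n) * w ^ S n = w * (INR (S n) * w ^ n))%C as E0 by (intros; simpl; ring).
  rewrite (csum_ext _ _ E0).
  assert (summ (fun n => INR (S n) * w ^ n)%C) as HS.
  { apply summ_dom with (fun n => (INR n + 1) * Cmod w ^ n).
    - intros n. rewrite Cmod_mult, Cmod_R, Cmod_pow, S_INR, Rabs_pos_eq; [lra|]. pose proof (pos_INR n). lra.
    - apply INR_pow_summable. lra. }
  rewrite csum_scal by auto. pose proof (one_minus_neq_0 _ Hw) as Hn.
  set (T := csum (fun n => INR (S n) * w ^ n)%C).
  assert (T = 1 + (w * T + w * / (1 - w)))%C as E.
  { unfold T at 1. rewrite (csum_head _ HS), <- EG. unfold T. rewrite <- !csum_scal, <- csum_plus by (auto using summ_scal).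
    f_equal; [simpl; ring|]. apply csum_ext. intros n. rewrite (S_INR (S n)), RtoC_plus. simpl Cpow. ring. }
  replace (w * T)%C with (w * (T * (1 - w)) / (1 - w))%C by (field; auto).
  assert (T * (1 - w) = / (1 - w))%C as ->.
  { transitivity (T - w * T)%C; [ring|]. rewrite E at 1. field. auto. }
  field. auto.
Qed.

(* This is [- 1 / (4 sin^2 (pi z))]. *)
Definition cosec (z : C) : C := (Cexp (2 * PI * Ci * z) / (1 - Cexp (2 * PI * Ci * z)) ^ 2)%C.

Lemma cosec_nome tau m : cosec (INR m * tau) = (nome tau ^ m / (1 - nome tau ^ m) ^ 2)%C.
Proof.
  unfold cosec. replace (Cexp (2 * PI * Ci * (INR m * tau))) with (nome tau ^ m)%C; auto.
  rewrite nome_pow. unfold expo. f_equal. ring.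
Qed.

Definition sgn_pow (m : nat) : C := ((- (1)) ^ m)%C.

Lemma Cmod_sgn_pow m : Cmod (sgn_pow m) = 1.
Proof. unfold sgn_pow. rewrite Cmod_pow, Cmod_m1. apply pow1. Qed.

Lemma Cmod_nome_pow tau n : upper tau -> Cmod (nome tau ^ S n) < 1.
Proof.
  intros Ht. rewrite Cmod_pow. pose proof (Cmod_ge_0 (nome tau)). pose proof (Cmod_nome_lt tau Ht).
  apply pow_lt_1_compat; [lra|lia].
Qed.

(** Expanding 1 / (1 + q^n) geometrically gives a double series dominated by a product; summing over
    n first produces w / (1 - w)^2 at w = q^(m+1), which is [cosec]. *)
Lemma lambert_rearranged tau : upper tau -> summ (lambert_term tau) /\
  csum (lambert_term tau) = csum (fun m => sgn_pow m * cosec (INR (S m) * tau))%C.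
Proof.
  intros Ht. set (q := nome tau). set (r := Cmod q).
  assert (0 <= r < 1) as Hr by (split; [apply Cmod_ge_0|now apply Cmod_nome_lt]).
  set (u := fun n m => (INR (S n) * (sgn_pow m * q ^ (S n * S m)))%C).
  assert (forall n m, Cmod (u n m) <= ((INR n + 1) * r ^ n) * r ^ m) as Hu.
  { intros n m. unfold u. rewrite !Cmod_mult, Cmod_sgn_pow, Cmod_R, Cmod_pow, Rabs_pos_eq by apply pos_INR.
    rewrite Rmult_1_l, Rmult_assoc, S_INR. fold r.
    apply Rmult_le_compat_l; [pose proof (pos_INR n); lra|]. rewrite <- pow_add.
    replace (S n * S m)%nat with (n + m + (S n * S m - (n + m)))%nat by lia.
    rewrite pow_add. rewrite <- (Rmult_1_r (r ^ (n + m))) at 2.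
    apply Rmult_le_compat_l; [apply pow_le; lra|]. rewrite <- (pow1 (S n * S m - (n + m))). apply pow_incr. lra. }
  assert (forall n, csum (u n) = lambert_term tau n) as Hrow.
  { intros n. pose proof (Cmod_nome_pow tau n Ht) as Hn. fold q in Hn.
    assert (Cmod (- q ^ S n) < 1) as Hn' by (now rewrite Cmod_opp).
    destruct (csum_geom _ Hn') as [HG EG].
    rewrite (csum_ext (u n) (fun m => INR (S n) * q ^ S n * (- q ^ S n) ^ m)%C).
    - rewrite csum_scal by auto. change (csum (Cpow (- q ^ S n))) with (csum (fun m => (- q ^ S n) ^ m)%C). rewrite EG. unfold lambert_term. fold q.
      pose proof (one_minus_neq_0 _ Hn') as Hz.
      assert (1 + q ^ S n <> 0)%C by (replace (1 + q ^ S n)%C with (1 - - q ^ S n)%C by ring; auto).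
      replace (1 - - q ^ S n)%C with (1 + q ^ S n)%C by ring. field. auto.
    - intros m. unfold u, sgn_pow. replace (- q ^ S n)%C with ((- (1)) * q ^ S n)%C by ring.
      rewrite Cpow_mult_l, <- Cpow_mult_r. replace (S n * S m)%nat with (S n + S n * m)%nat by lia.
      rewrite Cpow_add_r. ring. }
  assert (forall m, csum (fun n => u n m) = sgn_pow m * cosec (INR (S m) * tau))%C as Hcol.
  { intros m. pose proof (Cmod_nome_pow tau m Ht) as Hm. fold q in Hm.
    rewrite cosec_nome. fold q. rewrite <- (csum_geom_deriv _ Hm), <- csum_scal.
    - apply csum_ext. intros n. unfold u. rewrite Nat.mul_comm, Cpow_mult_r. ring.
    - apply summ_dom with (fun n => 1 * ((INR n + 1) * r ^ n)); [|apply ex_series_scal_r, INR_pow_summable; auto].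
      intros n. rewrite <- Cpow_mult_r. specialize (Hu n 0%nat). unfold u in Hu.
      rewrite !Cmod_mult, Cmod_sgn_pow, Cmod_R, Cmod_pow, S_INR, !Rabs_pos_eq in * by (pose proof (pos_INR n); lra).
      rewrite Rmult_1_l in *. simpl (r ^ 0) in Hu. rewrite Rmult_1_r in Hu.
      eapply Rle_trans; [|apply Hu]. apply Rmult_le_compat_l; [pose proof (pos_INR n); lra|].
      fold r. replace (S m * S n)%nat with (S n * 1 + m * S n)%nat by lia.
      rewrite pow_add. rewrite <- (Rmult_1_r (r ^ (S n * 1))) at 2.
      apply Rmult_le_compat_l; [apply pow_le; lra|]. rewrite <- (pow1 (m * S n)). apply pow_incr. lra. }
  split.
  - apply summ_ext with (fun n => csum (u n)); auto.
    apply summ_dom with (fun n => Series (fun m => r ^ m) * ((INR n + 1) * r ^ n)).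
    + intros n. rewrite Rmult_comm, <- Series_scal_l. apply csum_le; auto. apply ex_series_scal_r, ex_series_pow; auto.
    + apply ex_series_scal_r, INR_pow_summable; auto.
  - rewrite <- (csum_ext _ _ Hrow), <- (csum_ext _ _ Hcol).
    apply (Fubini u (fun n => (INR n + 1) * r ^ n) (fun m => r ^ m)); auto.
    + intros n. apply Rmult_le_pos; [pose proof (pos_INR n); lra|apply pow_le; lra].
    + intros n. apply pow_le; lra.
    + apply INR_pow_summable; auto.
    + apply ex_series_pow; auto.
Qed.

(** Two computations of D t for t = - 64 q prod (1 + q^n)^24: through the theta functions it is t E,
    through the product it is t times 1 plus 24 times the Lambert series. *)
Lemma tE_lambert tau : upper tau ->
  tE tau = (1 + 24 * csum (fun m => sgn_pow m * cosec (INR (S m) * tau)))%C.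
Proof.
  intros Ht. destruct (lambert_rearranged tau Ht) as [HS <-].
  assert (t2 tau <> RtoC 0) as Hz.
  { destruct (eta_thetas tau Ht) as [_ [_ [_ ->]]].
    apply Cmult_neq_0; [apply Cmult_neq_0|].
    - intros E. injection E. lra.
    - apply nome_neq_0.
    - apply Cpow_nz, prod_plus_pow_neq_0. now apply Cmod_nome_lt. }
  apply (Cmult_cancel_l (t2 tau)); auto. apply (Cmult_cancel_l kap); auto using kap_neq_0.
  apply cd_unique with t2 tau; [now apply cd_t2|].
  apply cd_ext_upper with (fun w => - (64) * (nome w * prod_plus_pow (nome w) ^ 24))%C; auto.
  { intros w Hw. destruct (eta_thetas w Hw) as [_ [_ [_ ->]]]. ring. }
  destruct (eta_thetas tau Ht) as [_ [_ [_ ->]]].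
  eapply cd_eq.
  - apply cd_scal, cd_mult; [apply (cd_Cexp_lin kap tau)|]. apply cd_pow. now apply cd_prod_plus_pow.
  - change (Cexp (kap * tau)) with (nome tau). replace (INR 24) with 24 by (simpl; ring).
    cbn [pred]. set (P := prod_plus_pow (nome tau)). ring.
Qed.

(** * Partial fractions of the squared cosecant *)

Lemma ex_series_inv_sq : ex_series (fun n => / (INR n + 1) ^ 2).
Proof.
  apply (ex_series_incr_1 (V := R_NormedModule)).
  assert (forall n, sum_n (fun n => / (INR (S n) + 1) ^ 2) n <= 1 - / (INR n + 2)) as H.
  { induction n.
    - rewrite sum_O. simpl. lra.
    - rewrite sum_Sn. unfold plus; simpl plus. eapply Rle_trans; [apply Rplus_le_compat_r, IHn|].
      pose proof (pos_INR n). rewrite !S_INR. set (x := INR n) in *.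
      assert (/ (x + 1 + 1 + 1) ^ 2 <= / (x + 2) - / (x + 1 + 2)); [|lra].
      replace (/ (x + 2) - / (x + 1 + 2)) with (/ ((x + 2) * (x + 3))) by (field; lra).
      apply Rinv_le_contravar; nra. }
  destruct (ex_finite_lim_seq_incr (sum_n (fun n => / (INR (S n) + 1) ^ 2)) 1) as [l Hl].
  - intros n. rewrite sum_Sn. rewrite <- (Rplus_0_r (sum_n _ n)) at 1. apply Rplus_le_compat_l.
    left. apply Rinv_0_lt_compat. pose proof (pos_INR (S (S n))). nra.
  - intros n. eapply Rle_trans; [apply H|]. pose proof (pos_INR n).
    assert (0 < / (INR n + 2)) by (apply Rinv_0_lt_compat; lra). lra.
  - exists l. exact Hl.
Qed.

Lemma Cexp_1_lin (z : C) : Cexp (2 * PI * Ci * (z + 1)) = Cexp (2 * PI * Ci * z).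
Proof.
  replace (2 * PI * Ci * (z + 1))%C with (2 * PI * Ci * z + 2 * PI * Ci)%C by ring.
  rewrite Cexp_add, Cexp_2PI. ring.
Qed.

Lemma cosec_period z : cosec (z + 1) = cosec z.
Proof. unfold cosec. now rewrite Cexp_1_lin. Qed.

Lemma cosec_even z : Cexp (2 * PI * Ci * z) <> RtoC 1 -> cosec (- z) = cosec z.
Proof.
  intros H. unfold cosec. replace (2 * PI * Ci * - z)%C with (- (2 * PI * Ci * z))%C by ring.
  rewrite Cexp_opp. set (w := Cexp _) in *.
  assert (w <> 0)%C by apply Cexp_neq_0.
  assert (1 - w <> 0)%C. { intros E. apply H. transitivity (1 - (1 - w))%C; [ring|]. rewrite E. ring. }
  assert (w - 1 <> 0)%C. { intros E. apply H. transitivity ((w - 1) + 1)%C; [ring|]. rewrite E. ring. }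
  field. auto.
Qed.

(** With v = exp (pi i z) this is 4 v^2 / (1 - v^2)^2 = v / (1 - v)^2 - v / (1 + v)^2, as the
    translation by 1 changes the sign of v. *)
Lemma cosec_duplication z : Cexp (2 * PI * Ci * z) <> RtoC 1 ->
  (4 * cosec z = cosec (z / 2) + cosec ((z + 1) / 2))%C.
Proof.
  intros H. unfold cosec.
  replace (2 * PI * Ci * ((z + 1) / 2))%C with (2 * PI * Ci * (z / 2) + PI * Ci)%C by field.
  rewrite Cexp_add, Cexp_PI.
  set (v := Cexp (2 * PI * Ci * (z / 2))).
  assert (Cexp (2 * PI * Ci * z) = v * v)%C as E.
  { unfold v. rewrite <- Cexp_add. f_equal. field. }
  rewrite E in *.
  assert (1 - v <> 0)%C. { intros E1. apply H. assert (v = 1)%C as -> by (transitivity (1 - (1 - v))%C; [ring|rewrite E1; ring]). ring. }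
  assert (1 + v <> 0)%C. { intros E1. apply H. assert (v = - (1))%C as -> by (transitivity ((1 + v) - 1)%C; [ring|rewrite E1; ring]). ring. }
  assert (1 - v * v <> 0)%C. { replace (1 - v * v)%C with ((1 - v) * (1 + v))%C by ring. now apply Cmult_neq_0. }
  field. repeat split; auto. intros E1. apply H1. rewrite <- E1. ring.
Qed.

Lemma psum_add u m n : psum u (m + n) = (psum u m + psum (fun k => u (m + k)%nat) n)%C.
Proof.
  induction n; [rewrite Nat.add_0_r; simpl; ring|].
  rewrite Nat.add_succ_r. simpl. rewrite IHn. ring.
Qed.

Lemma psum_rev u n : psum u n = psum (fun k => u (n - 1 - k)%nat) n.
Proof.
  induction n; [auto|]. rewrite (psum_head (fun k => u (S n - 1 - k)%nat)). simpl psum at 1.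
  rewrite IHn. replace (S n - 1 - 0)%nat with n by lia.
  rewrite (psum_ext (fun k => u (S n - 1 - S k)%nat) (fun k => u (n - 1 - k)%nat)); [ring|].
  intros k Hk. f_equal. lia.
Qed.

(** The two translates arising from index j have indices j and j + 2^n, which together fill the
    range below 2^(n+1). *)
Lemma cosec_iterate z n : (forall k m : nat, Cexp (2 * PI * Ci * ((z + INR k) / 2 ^ m)) <> RtoC 1) ->
  (4 ^ n * cosec z = psum (fun j => cosec ((z + INR j) / 2 ^ n)) (2 ^ n))%C.
Proof.
  intros H.
  assert (forall m, (2 ^ m <> 0)%C) as H2 by (intros; apply Cpow_nz, RtoC_neq_0; lra).
  induction n.
  - simpl. replace ((z + 0) / 1)%C with z by field. ring.
  - change (4 ^ S n)%C with (4 * 4 ^ n)%C. rewrite <- Cmult_assoc, IHn, <- psum_scal.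
    replace (2 ^ S n)%nat with (2 ^ n + 2 ^ n)%nat by (simpl; lia).
    rewrite psum_add, <- psum_plus. apply psum_ext. intros j _.
    rewrite cosec_duplication by auto. f_equal; f_equal.
    + change (2 ^ S n)%C with (2 * 2 ^ n)%C. field. auto.
    + rewrite plus_INR, pow_INR, RtoC_plus, RtoC_pow. replace (INR 2) with 2 by (simpl; ring).
      change (2 ^ S n)%C with (2 * 2 ^ n)%C. field. auto.
Qed.

(** The range goes beyond pi / 2 because the bound is needed at pi (z + b) / 2^(n+1) with |b| <=
    2^n, where the real part of (z + b) / 2^(n+1) may reach 1/2 + |z| / 2^(n+1); 3/4 leaves room for
    this. *)
Lemma sin_lower_pos (x : R) : 0 <= x <= 3 * (PI / 4) -> x / 5 <= sin x.
Proof.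
  intros Hx. pose proof PI_4. pose proof PI_RGT_0. pose proof PI2_3_2.
  destruct (Rle_dec x (PI / 3)) as [H3|H3].
  - destruct (Req_dec x 0) as [->|Hx0]; [rewrite sin_0; lra|].
    destruct (MVT_gen sin 0 x cos) as [c [Hc E]].
    + intros t _. auto_derive; auto. ring.
    + intros t _. apply continuity_pt_filterlim, (ex_derive_continuous sin). auto_derive. auto.
    + rewrite Rmin_left, Rmax_right in Hc by lra.
      assert (1 / 2 <= cos c) by (rewrite <- cos_PI3; apply cos_decr_1; lra).
      rewrite sin_0 in E. nra.
  - assert (7 / 10 <= 1 / sqrt 2) as Hs.
    { assert (sqrt 2 <= 10 / 7).
      { rewrite <- (sqrt_pow2 (10 / 7)) by lra. apply sqrt_le_1_alt. lra. }
      assert (0 < sqrt 2) by (apply sqrt_lt_R0; lra).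
      apply (Rmult_le_reg_r (sqrt 2)); auto. unfold Rdiv. rewrite Rmult_assoc, (Rmult_assoc 1), Rinv_l by lra. lra. }
    destruct (Rle_dec x (PI / 2)) as [H2|H2].
    + assert (sqrt 3 / 2 <= sin x) by (rewrite <- sin_PI3; apply sin_incr_1; lra).
      assert (1 <= sqrt 3) by (rewrite <- sqrt_1 at 1; apply sqrt_le_1_alt; lra). lra.
    + assert (sin (3 * (PI / 4)) <= sin x) by (apply sin_decr_1; lra).
      rewrite sin_3PI4 in H4. lra.
Qed.

Lemma sin_lower (u : R) : Rabs u <= 3 / 4 -> u ^ 2 / 4 <= sin (PI * u) ^ 2.
Proof.
  intros Hu. pose proof PI_RGT_0. pose proof PI2_3_2.
  assert (forall v, 0 <= v <= 3 / 4 -> v ^ 2 / 4 <= sin (PI * v) ^ 2) as Hp.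
  { intros v Hv. pose proof (sin_lower_pos (PI * v) ltac:(split; nra)).
    assert (3 * v <= PI * v) by (apply Rmult_le_compat_r; lra). nra. }
  destruct (Rle_dec 0 u) as [H1|H1].
  - rewrite Rabs_pos_eq in Hu by auto. auto.
  - rewrite Rabs_left in Hu by lra. specialize (Hp (- u) ltac:(lra)).
    replace (PI * - u) with (- (PI * u)) in Hp by ring. rewrite sin_neg in Hp. nra.
Qed.

Lemma exp_cosh_lower (x : R) : x ^ 2 / 4 <= exp x + exp (- x) - 2.
Proof.
  replace (exp x + exp (- x) - 2) with ((exp (x / 2) - exp (- (x / 2))) ^ 2).
  2:{ replace (exp x) with (exp (x / 2) * exp (x / 2)) by (rewrite <- exp_plus; f_equal; field).
      replace (exp (- x)) with (exp (- (x / 2)) * exp (- (x / 2))) by (rewrite <- exp_plus; f_equal; field).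
      assert (exp (x / 2) * exp (- (x / 2)) = 1) by (rewrite <- exp_plus, <- exp_0; f_equal; field). nra. }
  pose proof (exp_ineq1_le (x / 2)). pose proof (exp_ineq1_le (- (x / 2))).
  destruct (Rle_dec 0 x) as [Hx|Hx].
  - assert (exp (- (x / 2)) <= 1) by (rewrite <- exp_0; apply exp_mono; lra). nra.
  - assert (exp (x / 2) <= 1) by (rewrite <- exp_0; apply exp_mono; lra). nra.
Qed.

(** At z = u + i v and w = exp (2 pi i z), |1 - w|^2 / |w| equals 2 cosh (2 pi v) - 2 + 4 sin^2 (pi
    u); the hyperbolic part is at least v^2, the trigonometric one at least u^2 in this strip. This
    supplies the majorant for the partial fractions. *)
Lemma cosec_bound (z : C) : z <> RtoC 0 -> Rabs (Re z) <= 3 / 4 ->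
  Cexp (2 * PI * Ci * z) <> RtoC 1 /\ Cmod (cosec z) <= / Cmod z ^ 2.
Proof.
  intros Hz Hre. destruct z as [u v]. simpl in Hre. pose proof PI2_3_2.
  set (w := Cexp (2 * PI * Ci * (u, v))).
  assert (w = (exp (- (2 * PI * v)) * cos (2 * PI * u), exp (- (2 * PI * v)) * sin (2 * PI * u))) as Ew.
  { unfold w, Cexp, Ci, RtoC, Cmult; simpl. f_equal; f_equal; f_equal; ring. }
  set (m := exp (- (2 * PI * v))) in *. assert (0 < m) as Hm by apply exp_pos.
  assert (Cmod w = m) as Hw.
  { unfold w. rewrite Cmod_Cexp. unfold m. f_equal. unfold Ci, RtoC, Cmult; simpl. ring. }
  assert (0 < Cmod (u, v)) as Hz' by (now apply Cmod_gt_0).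
  assert (Cmod (1 - w) ^ 2 = m * (m + / m - 2 + 4 * sin (PI * u) ^ 2)) as E1.
  { rewrite Cmod2_alt, Ew. simpl Re. simpl Im.
    replace (2 * PI * u) with (2 * (PI * u)) by ring. set (x := PI * u).
    assert (sin (2 * x) ^ 2 = 1 - cos (2 * x) ^ 2) as Es.
    { pose proof (sin2_cos2 (2 * x)). unfold Rsqr in H0. lra. }
    replace ((1 + - (m * cos (2 * x))) ^ 2 + (0 + - (m * sin (2 * x))) ^ 2)
      with (1 - 2 * m * cos (2 * x) + m ^ 2 * (cos (2 * x) ^ 2 + sin (2 * x) ^ 2)) by ring.
    rewrite Es. rewrite cos_2a_sin. field. lra. }
  assert (m * Cmod (u, v) ^ 2 <= Cmod (1 - w) ^ 2) as E2.
  { rewrite E1. apply Rmult_le_compat_l; [lra|]. rewrite Cmod2_alt. simpl Re. simpl Im.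
    pose proof (sin_lower u Hre). pose proof (exp_cosh_lower (2 * PI * v)).
    replace (/ m) with (exp (2 * PI * v)) by (unfold m; rewrite exp_Ropp, Rinv_inv; auto). fold m in H1.
    assert (v ^ 2 <= (2 * PI * v) ^ 2 / 4); [|lra].
    replace ((2 * PI * v) ^ 2 / 4) with (PI ^ 2 * v ^ 2) by field.
    assert (1 <= PI ^ 2) by nra. pose proof (pow2_ge_0 v). nra. }
  assert (0 < Cmod (1 - w) ^ 2) as E3.
  { apply Rlt_le_trans with (2 := E2). apply Rmult_lt_0_compat; auto. now apply pow_lt. }
  assert (1 - w <> 0)%C as Hn.
  { intros E. rewrite E, Cmod_0 in E3. lra. }
  split.
  - intros E. apply Hn. fold w in E. rewrite E. ring.
  - unfold cosec. fold w. rewrite Cmod_div, Cmod_pow, Hw by (now apply Cpow_nz).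
    apply (Rmult_le_reg_r (Cmod (1 - w) ^ 2)); auto. unfold Rdiv. rewrite Rmult_assoc, Rinv_l, Rmult_1_r by lra.
    apply (Rmult_le_reg_l (Cmod (u, v) ^ 2)); [now apply pow_lt|].
    rewrite <- Rmult_assoc, Rinv_r, Rmult_1_l; [lra|]. apply pow_nonzero. lra.
Qed.

(** Pairs j with -(j+1), so that j = 0, 1, 2, ... meets every integer exactly once. *)
Definition zsum_term (f : Z -> C) (j : nat) : C := (f (Z.of_nat j) + f (- Z.of_nat (S j))%Z)%C.
Definition zsum (f : Z -> C) : C := csum (zsum_term f).

(** At z = 0 the term b = 0 is 0 because the inverse of 0 is 0; the value is then 2 zeta(2), see
    [eisen2_0]. *)
Definition eisen2 (z : C) : C := zsum (fun b => / (z + IZR b) ^ 2)%C.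

Definition away_from_int (z : C) (c : R) : Prop := 0 < c /\
  forall b : Z, c * (Rabs (IZR b) + 1) <= Cmod (z + IZR b).

Lemma away_from_int_neq z c b : away_from_int z c -> (z + IZR b <> 0)%C.
Proof.
  intros [Hc H]. apply Cmod_gt_0. specialize (H b). pose proof (Rabs_pos (IZR b)). nra.
Qed.

Lemma away_from_int_upper z : Im z <> 0 -> exists c, away_from_int z c.
Proof.
  intros Hz. set (y := Rabs (Im z)). assert (0 < y) as Hy by (now apply Rabs_pos_lt).
  pose proof (Cmod_ge_0 z) as Hm.
  set (K := 1 + (1 + Cmod z) / y). assert (0 < (1 + Cmod z) / y) as HK by (apply Rdiv_lt_0_compat; lra).
  exists (/ K). split; [apply Rinv_0_lt_compat; unfold K; lra|]. intros b.
  set (x := Cmod (z + IZR b)).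
  assert (y <= x) as H1.
  { unfold x, y. replace (Im z) with (Im (z + IZR b)) by (destruct z; simpl; ring). apply Im_le_Cmod. }
  assert (Rabs (IZR b) <= x + Cmod z) as H2.
  { rewrite <- Cmod_R. replace (RtoC (IZR b)) with ((z + IZR b) - z)%C by ring. apply Cmod_triangle_minus. }
  apply (Rmult_le_reg_l K); [unfold K; lra|]. rewrite <- Rmult_assoc, Rinv_r, Rmult_1_l by (unfold K; lra).
  unfold K. rewrite Rmult_plus_distr_r, Rmult_1_l.
  assert (1 + Cmod z <= (1 + Cmod z) / y * x); [|lra].
  apply Rle_trans with ((1 + Cmod z) / y * y); [right; field; lra|]. apply Rmult_le_compat_l; lra.
Qed.

Lemma away_bound z c b : away_from_int z c -> Cmod (/ (z + IZR b) ^ 2) <= / c ^ 2 * / (Rabs (IZR b) + 1) ^ 2.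
Proof.
  intros Hc. pose proof (away_from_int_neq _ _ b Hc) as Hn. destruct Hc as [Hc H]. specialize (H b).
  pose proof (Rabs_pos (IZR b)).
  rewrite Cmod_inv, Cmod_pow by (now apply Cpow_nz). rewrite <- Rinv_mult, <- Rpow_mult_distr.
  apply Rinv_le_contravar; [apply pow_lt; nra|]. apply pow_incr. split; [nra|auto].
Qed.

Lemma abs_of_nat j : Rabs (IZR (Z.of_nat j)) = INR j.
Proof. rewrite <- INR_IZR_INZ. apply Rabs_pos_eq, pos_INR. Qed.

Lemma abs_of_nat_opp j : Rabs (IZR (- Z.of_nat (S j))) = INR j + 1.
Proof. rewrite opp_IZR, Rabs_Ropp, abs_of_nat, S_INR. auto. Qed.

Lemma inv_sq_mono (x y : R) : 0 < x <= y -> / y ^ 2 <= / x ^ 2.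
Proof. intros H. apply Rinv_le_contravar; [apply pow_lt; lra|]. apply pow_incr. lra. Qed.

Lemma zsum_term_bound (f : Z -> C) K : 0 <= K ->
  (forall b, Cmod (f b) <= K * / (Rabs (IZR b) + 1) ^ 2) ->
  forall j, Cmod (zsum_term f j) <= 2 * K * / (INR j + 1) ^ 2.
Proof.
  intros HK H j. unfold zsum_term. eapply Rle_trans; [apply Cmod_triangle|].
  pose proof (H (Z.of_nat j)) as H1. pose proof (H (- Z.of_nat (S j))%Z) as H2.
  rewrite abs_of_nat in H1. rewrite abs_of_nat_opp in H2. pose proof (pos_INR j).
  pose proof (inv_sq_mono (INR j + 1) (INR j + 1 + 1) ltac:(lra)).
  assert (K * / (INR j + 1 + 1) ^ 2 <= K * / (INR j + 1) ^ 2) by (now apply Rmult_le_compat_l). lra.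
Qed.

Lemma zsum_summ (f : Z -> C) K : 0 <= K ->
  (forall b, Cmod (f b) <= K * / (Rabs (IZR b) + 1) ^ 2) -> summ (zsum_term f).
Proof.
  intros HK H. apply summ_dom with (fun j => 2 * K * / (INR j + 1) ^ 2).
  - now apply zsum_term_bound. - apply ex_series_scal_r, ex_series_inv_sq.
Qed.

Lemma eisen2_summ z c : away_from_int z c -> summ (zsum_term (fun b => / (z + IZR b) ^ 2)%C).
Proof.
  intros H. apply zsum_summ with (/ c ^ 2).
  - left. apply Rinv_0_lt_compat, pow_lt, H. - intros; now apply away_bound.
Qed.

(** With h = 2^-(n+1) and y = 2 pi i x, (exp (y h) - 1) / h tends to y; so [cosec] behaves like 1 /
    (2 pi i x)^2 near 0. *)
Lemma cosec_scaled_limit (x : C) : x <> RtoC 0 ->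
  CL (fun n => cosec (x / 2 ^ S n) / 4 ^ S n)%C (- (/ (4 * PI ^ 2)) * / x ^ 2)%C.
Proof.
  intros Hx. set (y := (2 * PI * Ci * x)%C).
  assert (y <> 0)%C as Hy by (apply Cmult_neq_0; auto; apply kap_neq_0).
  assert (forall m, (2 ^ m <> 0)%C) as H2 by (intros; apply Cpow_nz, RtoC_neq_0; lra).
  set (h := fun n => (/ 2 ^ S n)%C).
  assert (forall n, Cmod (h n) = (/ 2) ^ S n) as Hh.
  { intros n. unfold h. rewrite Cmod_inv, Cmod_pow, Cmod_R, Rabs_pos_eq, pow_inv by (auto; lra). auto. }
  assert (CL h 0) as Lh.
  { apply CL_squeeze with (fun n => (/ 2) ^ S n).
    - intros n. replace (h n - 0)%C with (h n) by ring. rewrite Hh. lra.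
    - apply (is_lim_seq_incr_1 (fun n => (/ 2) ^ n)). apply is_lim_seq_geom. rewrite Rabs_pos_eq; lra. }
  assert (CL (fun n => (Cexp (y * h n) - 1) / h n)%C y) as L1.
  { apply CL_squeeze with (fun n => 2 * exp (Cmod y) * Cmod y ^ 2 * (/ 2) ^ S n).
    - intros n. pose proof (H2 (S n)) as Hn. assert (h n <> 0)%C as Hhn by (apply Cmod_gt_0; rewrite Hh; apply pow_lt; lra).
      replace ((Cexp (y * h n) - 1) / h n - y)%C with ((Cexp (y * h n) - 1 - y * h n) / h n)%C by (field; auto).
      rewrite Cmod_div by auto. apply (Rmult_le_reg_r (Cmod (h n))); [now apply Cmod_gt_0|].
      unfold Rdiv. rewrite Rmult_assoc, Rinv_l, Rmult_1_r by (apply Rgt_not_eq; now apply Cmod_gt_0).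
      eapply Rle_trans; [apply Cexp_bound2|]. rewrite Cmod_mult. rewrite Hh. set (t := (/ 2) ^ S n).
      assert (0 <= t <= 1) as Ht. { unfold t. split; [apply pow_le; lra|]. rewrite <- (pow1 (S n)). apply pow_incr. lra. }
      pose proof (Cmod_ge_0 y).
      replace (2 * exp (Cmod y) * Cmod y ^ 2 * t * t) with (2 * exp (Cmod y) * (Cmod y * t) ^ 2) by ring.
      apply Rmult_le_compat_r; [apply pow2_ge_0|]. apply Rmult_le_compat_l; [lra|]. apply exp_mono. nra.
    - replace (Finite 0) with (Finite (2 * exp (Cmod y) * Cmod y ^ 2 * 0)) by (f_equal; ring).
      apply is_lim_seq_mult'; [apply is_lim_seq_const|].
      apply (is_lim_seq_incr_1 (fun n => (/ 2) ^ n)). apply is_lim_seq_geom. rewrite Rabs_pos_eq; lra. }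
  assert (CL (fun n => Cexp (y * h n)) 1) as L0.
  { replace (RtoC 1) with (Cexp (y * 0)) by (rewrite Cmult_0_r; apply Cexp_0).
    apply (cd_CL Cexp (y * 0) _ (fun n => y * h n)%C (cd_Cexp _)). now apply CL_scal. }
  replace (- (/ (4 * PI ^ 2)) * / x ^ 2)%C with (1 * / (y ^ 2))%C.
  2:{ unfold y. assert (Ci ^ 2 = - (1))%C as Hi by (unfold Cpow, Ci, RtoC, Cmult, Copp; simpl; f_equal; ring).
      transitivity (/ (4 * PI ^ 2 * x ^ 2 * Ci ^ 2))%C.
      - field. auto using PI_C_neq_0, Ci_neq_0.
      - rewrite Hi. field. auto using PI_C_neq_0. }
  apply CL_ext with (fun n => Cexp (y * h n) * / ((Cexp (y * h n) - 1) / h n) ^ 2)%C.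
  - intros n. unfold cosec. replace (2 * PI * Ci * (x / 2 ^ S n))%C with (y * h n)%C by (unfold y, h; field; auto).
    replace (4 ^ S n)%C with (2 ^ S n * 2 ^ S n)%C by (rewrite <- Cpow_mult_l; f_equal; ring).
    set (W := Cexp (y * h n)). unfold h. set (t := (2 ^ S n)%C). assert (t <> 0)%C as Ht by apply H2.
    (* At W = 1 both sides are 0, as the inverse of 0 is 0. *)
    destruct (Ceq_dec W 1) as [E|E].
    + rewrite E. replace (1 - 1)%C with (RtoC 0) by ring.
      assert (forall u : C, u / 0 ^ 2 = 0)%C as D0.
      { intros u. unfold Cdiv. replace (0 ^ 2)%C with (RtoC 0) by ring. replace (/ 0)%C with (RtoC 0); [ring|].
        unfold Cinv, RtoC; simpl. unfold Rdiv. rewrite !Rmult_0_l, Ropp_0, !Rmult_0_l. auto. }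
      rewrite D0. replace (0 / / t)%C with (RtoC 0) by (unfold Cdiv; ring).
      specialize (D0 1%C). unfold Cdiv in *. rewrite Cmult_1_l in D0. rewrite D0. ring.
    + assert (W - 1 <> 0)%C. { intros E1. apply E. transitivity (W - 1 + 1)%C; [ring|]. rewrite E1. ring. }
      assert (1 - W <> 0)%C. { intros E1. apply E. transitivity (1 - (1 - W))%C; [ring|]. rewrite E1. ring. }
      field. repeat split; auto.
  - apply CL_mult; auto. apply CL_inv; [now apply Cpow_nz|]. now apply CL_pow.
Qed.

(* Iterating the duplication formula writes [cosec z] as 4^-n times a sum over 2^n translates,
   whose terms tend to those of the partial fraction series; Tannery's theorem applies. *)
Lemma cosec_partial_fractions z c : away_from_int z c -> eisen2 z = (- (4) * PI ^ 2 * cosec z)%C.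
Proof.
  intros Haw.
  assert (forall m, (2 ^ m <> 0)%C) as H2 by (intros; apply Cpow_nz, RtoC_neq_0; lra).
  assert (forall m, (4 ^ m <> 0)%C) as H4 by (intros; apply Cpow_nz, RtoC_neq_0; lra).
  set (fz := fun b => (z + IZR b)%C).
  assert (forall b, fz b <> 0)%C as Hfz by (intros; now apply away_from_int_neq with c).
  (* After subtraction of an integer from x, the remainder d or d - 1 lies in the strip |Re| <= 3/4,
     where [cosec_bound] leaves 0 as the only solution. *)
  assert (forall x : C, Cexp (2 * PI * Ci * x) = RtoC 1 -> exists b, x = RtoC (IZR b)) as Hint.
  { intros x E.
    assert (Im x = 0) as Hi.
    { apply (f_equal Cmod) in E. rewrite Cmod_Cexp, Cmod_1, <- exp_0 in E. apply exp_inv in E.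
      destruct x as [a b]. unfold Re, Ci, RtoC, Cmult in E; simpl in E. pose proof PI_RGT_0. simpl. nra. }
    pose proof (archimed (Re x)) as [Ha1 Ha2].
    exists (up (Re x) - 1)%Z. set (d := (x - IZR (up (Re x) - 1))%C).
    assert (Re d = Re x - IZR (up (Re x)) + 1) as Hd.
    { unfold d. rewrite minus_IZR. destruct x; simpl. ring. }
    assert (forall (k : Z) (y : C), Cexp (2 * PI * Ci * (y + IZR k)) = Cexp (2 * PI * Ci * y)) as Hper.
    { assert (forall n (y : C), Cexp (2 * PI * Ci * (y + INR n)) = Cexp (2 * PI * Ci * y)) as Hn.
      { induction n; intros y; [simpl; f_equal; ring|]. rewrite S_INR, RtoC_plus.
        replace (y + (INR n + 1))%C with (y + INR n + 1)%C by ring. now rewrite Cexp_1_lin. }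
      intros k y. destruct (Z_le_dec 0 k) as [Hk|Hk].
      - rewrite <- (Z2Nat.id k) by auto. rewrite <- INR_IZR_INZ. apply Hn.
      - rewrite <- (Hn (Z.to_nat (- k)) (y + IZR k)%C).
        replace (y + IZR k + INR (Z.to_nat (- k)))%C with y; auto.
        rewrite INR_IZR_INZ, Z2Nat.id, opp_IZR by lia. rewrite RtoC_opp. ring. }
    assert (Cexp (2 * PI * Ci * d) = RtoC 1) as Ed.
    { rewrite <- E. rewrite <- (Hper (up (Re x) - 1)%Z d). f_equal. unfold d. ring. }
    destruct (Ceq_dec d 0) as [E0|E0].
    { transitivity (d + IZR (up (Re x) - 1))%C; [unfold d; ring|]. rewrite E0. ring. }
    destruct (Rle_dec (Re d) (3 / 4)) as [Hle|Hle].
    - exfalso. apply (cosec_bound d E0); auto. apply Rabs_le. lra.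
    - exfalso. destruct (Ceq_dec (d - 1) 0) as [E1|E1].
      + assert (Re d = 1) as Hr. { replace d with (d - 1 + 1)%C by ring. rewrite E1. simpl. ring. } lra.
      + apply (cosec_bound _ E1).
        * replace (Re (d - 1)) with (Re d - 1) by (destruct d; simpl; ring). apply Rabs_le. lra.
        * rewrite <- (Cexp_1_lin (d - 1)). replace (d - 1 + 1)%C with d by ring. exact Ed. }
  assert (forall k m : nat, Cexp (2 * PI * Ci * ((z + INR k) / 2 ^ m)) <> RtoC 1) as Hne.
  { intros k m E. destruct (Hint _ E) as [b Hb].
    apply (Hfz (Z.of_nat k - b * 2 ^ Z.of_nat m)%Z). unfold fz.
    rewrite minus_IZR, mult_IZR, <- INR_IZR_INZ, <- pow_IZR, RtoC_minus, RtoC_mult, <- Hb, RtoC_pow. field. auto. }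
  (* The 2^(n+1) translates of the iterated duplication formula. By periodicity the upper half of
     them is moved to the negative indices -(j+1), so that they are centred about 0. *)
  set (U := fun n (j : nat) => if Compare_dec.lt_dec j (2 ^ n)
    then zsum_term (fun b => cosec (fz b / 2 ^ S n) / 4 ^ S n)%C j else RtoC 0).
  assert (forall n, cosec z = csum (U n)) as HU.
  { intros n. rewrite (csum_fin _ (2 ^ n)).
    2:{ intros k Hk. unfold U. destruct (Compare_dec.lt_dec k (2 ^ n)); [lia|auto]. }
    transitivity (4 ^ S n * cosec z / 4 ^ S n)%C; [field; auto|]. rewrite cosec_iterate by auto.
    replace (2 ^ S n)%nat with (2 ^ n + 2 ^ n)%nat by (simpl; lia). rewrite psum_add.
    rewrite (psum_rev (fun k => cosec ((z + INR (2 ^ n + k)) / 2 ^ S n))).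
    rewrite <- psum_plus. unfold Cdiv at 1. rewrite Cmult_comm, <- psum_scal. apply psum_ext. intros j Hj.
    unfold U. destruct (Compare_dec.lt_dec j (2 ^ n)); [|lia]. unfold zsum_term, fz.
    rewrite <- INR_IZR_INZ.
    replace (cosec ((z + INR (2 ^ n + (2 ^ n - 1 - j))) / 2 ^ S n)) with (cosec ((z + IZR (- Z.of_nat (S j))) / 2 ^ S n)).
    - unfold Cdiv. ring.
    - rewrite <- cosec_period. f_equal. replace (2 ^ n + (2 ^ n - 1 - j))%nat with (2 * 2 ^ n - S j)%nat by lia.
      rewrite minus_INR by lia. rewrite opp_IZR, <- INR_IZR_INZ, mult_INR, pow_INR, RtoC_opp, RtoC_minus, RtoC_mult, RtoC_pow.
      replace (INR 2) with 2 by (simpl; ring). change (2 ^ S n)%C with (2 * 2 ^ n)%C. field. auto. }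
  destruct Haw as [Hc Hb].
  (* From here on |z| / 2^(n+1) <= 1/4; with |b| <= 2^n this puts the scaled points into the strip
     |Re| <= 3/4. *)
  assert (exists N0, forall n, (N0 <= n)%nat -> 4 * Cmod z <= 2 ^ S n) as [N0 HN0].
  { destruct (INR_archimed 1 (4 * Cmod z)) as [N HN]; [lra|]. exists N. intros n Hn.
    apply le_INR in Hn. pose proof (pow2_ge (S n)). rewrite S_INR in H. lra. }
  assert (forall n b, (N0 <= n)%nat -> Rabs (IZR b) <= 2 ^ n ->
    Cmod (cosec (fz b / 2 ^ S n) / 4 ^ S n) <= / c ^ 2 * / (Rabs (IZR b) + 1) ^ 2) as Hbd.
  { intros n b Hn Hbn.
    assert (0 < 2 ^ S n) as Hp by (apply pow_lt; lra).
    assert (Cmod (2 ^ S n) = 2 ^ S n) as Ep by (rewrite Cmod_pow, Cmod_R, Rabs_pos_eq; lra).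
    assert (Rabs (Re (fz b / 2 ^ S n)) <= 3 / 4) as Hre.
    { eapply Rle_trans; [apply re_le_Cmod|]. rewrite Cmod_div, Ep by auto.
      apply (Rmult_le_reg_r (2 ^ S n)); auto. unfold Rdiv at 1. rewrite Rmult_assoc, Rinv_l, Rmult_1_r by lra.
      unfold fz. eapply Rle_trans; [apply Cmod_triangle|]. rewrite Cmod_R. specialize (HN0 n Hn).
      simpl pow in *. lra. }
    assert (fz b / 2 ^ S n <> 0)%C as Hnz.
    { intros E. apply (Hfz b). transitivity (fz b / 2 ^ S n * 2 ^ S n)%C; [field; auto|]. rewrite E. ring. }
    destruct (cosec_bound _ Hnz Hre) as [_ Hcb].
    pose proof (Hb b) as Hbb. fold (fz b) in Hbb. pose proof (Rabs_pos (IZR b)).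
    assert (0 < Cmod (fz b)) by (now apply Cmod_gt_0).
    apply Rle_trans with (/ Cmod (fz b) ^ 2).
    - rewrite Cmod_div by auto. rewrite Cmod_div, Ep in Hcb by auto.
      replace (Cmod (4 ^ S n)) with (2 ^ S n * 2 ^ S n).
      2:{ rewrite Cmod_pow, Cmod_R, Rabs_pos_eq by lra. rewrite <- Rpow_mult_distr. replace (2 * 2) with 4 by ring. auto. }
      apply (Rmult_le_reg_r (2 ^ S n * 2 ^ S n)); [nra|]. unfold Rdiv at 1.
      rewrite Rmult_assoc, Rinv_l, Rmult_1_r by nra. eapply Rle_trans; [apply Hcb|]. right. field. lra.
    - rewrite <- Rinv_mult, <- Rpow_mult_distr. apply Rinv_le_contravar; [apply pow_lt; nra|].
      apply pow_incr. split; [nra|auto]. }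
  assert (CL (fun n => csum (U n)) (csum (fun j => - (/ (4 * PI ^ 2)) * zsum_term (fun b => / (z + IZR b) ^ 2) j)%C)) as HL.
  { apply (Tannery _ _ (fun j => 2 * / c ^ 2 * / (INR j + 1) ^ 2) N0).
    - intros j. apply CL_ext_from with (S j) (fun n => zsum_term (fun b => cosec (fz b / 2 ^ S n) / 4 ^ S n)%C j).
      + intros n Hn. unfold U. destruct (Compare_dec.lt_dec j (2 ^ n)) as [|Hj]; auto. exfalso. apply Hj.
        assert (n < 2 ^ n)%nat by (apply Nat.pow_gt_lin_r; lia). lia.
      + unfold zsum_term. rewrite Cmult_plus_distr_l. apply CL_plus; apply cosec_scaled_limit; apply Hfz.
    - intros n j Hn. unfold U. destruct (Compare_dec.lt_dec j (2 ^ n)) as [Hj|].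
      + assert (INR j + 1 <= 2 ^ n) as Hj2.
        { rewrite <- S_INR. replace 2 with (INR 2) by (simpl; ring). rewrite <- pow_INR. apply le_INR. lia. }
        unfold zsum_term. eapply Rle_trans; [apply Cmod_triangle|]. pose proof (pos_INR j).
        pose proof (Hbd n (Z.of_nat j) Hn) as H1. pose proof (Hbd n (- Z.of_nat (S j))%Z Hn) as H3.
        rewrite abs_of_nat in H1. rewrite abs_of_nat_opp in H3.
        specialize (H1 ltac:(lra)). specialize (H3 ltac:(lra)).
        pose proof (inv_sq_mono (INR j + 1) (INR j + 1 + 1) ltac:(lra)).
        assert (0 < / c ^ 2) by (apply Rinv_0_lt_compat, pow_lt; auto).
        assert (/ c ^ 2 * / (INR j + 1 + 1) ^ 2 <= / c ^ 2 * / (INR j + 1) ^ 2) by (apply Rmult_le_compat_l; lra). lra.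
      + rewrite Cmod_0. apply Rmult_le_pos; [apply Rmult_le_pos; [lra|]|];
          left; apply Rinv_0_lt_compat, pow_lt; auto. pose proof (pos_INR j). lra.
    - apply ex_series_scal_r, ex_series_inv_sq. }
  assert (summ (zsum_term (fun b => / (z + IZR b) ^ 2)%C)) as HS by (apply eisen2_summ with c; split; auto).
  rewrite csum_scal in HL by auto. fold (zsum (fun b => / (z + IZR b) ^ 2)%C) (eisen2 z) in HL.
  assert (cosec z = - (/ (4 * PI ^ 2)) * eisen2 z)%C as ->.
  { eapply CL_unique; [|apply HL]. apply CL_ext with (fun _ => cosec z); [auto|apply CL_const]. }
  field. apply PI_C_neq_0.
Qed.

Lemma Cinv_0 : (/ 0 = 0)%C.
Proof.
  unfold Cinv, RtoC; simpl. unfold Rdiv. rewrite !Rmult_0_l, Ropp_0, !Rmult_0_l. auto.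
Qed.

(** * A lattice sum by rows and by columns *)

Definition quadratic_decay (f : Z -> C) : Prop :=
  exists K, 0 <= K /\ forall b, Cmod (f b) <= K * / (Rabs (IZR b) + 1) ^ 2.

Lemma decay_summ f : quadratic_decay f -> summ (zsum_term f).
Proof. intros [K [HK H]]. now apply zsum_summ with K. Qed.

Lemma zsum_lin3 (p r s : C) f g h : quadratic_decay f -> quadratic_decay g -> quadratic_decay h ->
  zsum (fun b => p * f b + r * g b + s * h b)%C = (p * zsum f + r * zsum g + s * zsum h)%C.
Proof.
  intros Hf Hg Hh. apply decay_summ in Hf, Hg, Hh. unfold zsum.
  rewrite <- !csum_scal, <- !csum_plus by auto using summ_scal, summ_plus.
  apply csum_ext. intros j. unfold zsum_term. ring.
Qed.

(** Pairing the integers in both directions reduces this to [Fubini], at the cost of a factor 4 in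
    the majorant. *)
Lemma zFubini (f : Z -> Z -> C) K : 0 <= K ->
  (forall a b, Cmod (f a b) <= K * (/ (Rabs (IZR a) + 1) ^ 2 * / (Rabs (IZR b) + 1) ^ 2)) ->
  zsum (fun a => zsum (f a)) = zsum (fun b => zsum (fun a => f a b)).
Proof.
  intros HK H.
  assert (forall x, 0 <= / (Rabs x + 1) ^ 2) as Hp.
  { intros. left. apply Rinv_0_lt_compat, pow_lt. pose proof (Rabs_pos x). lra. }
  assert (forall a, summ (zsum_term (f a))) as Ha.
  { intros a. apply (zsum_summ _ (K * / (Rabs (IZR a) + 1) ^ 2)); [apply Rmult_le_pos; auto|].
    intros b. rewrite Rmult_assoc. auto. }
  assert (forall b, summ (zsum_term (fun a => f a b))) as Hb.
  { intros b. apply (zsum_summ _ (K * / (Rabs (IZR b) + 1) ^ 2)); [apply Rmult_le_pos; auto|].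
    intros a. rewrite Rmult_assoc, (Rmult_comm (/ (Rabs (IZR b) + 1) ^ 2)). auto. }
  set (U := fun i j => zsum_term (fun a => zsum_term (f a) j) i).
  transitivity (csum (fun i => csum (U i))).
  { apply csum_ext. intros i. unfold zsum_term at 1. unfold zsum. rewrite <- csum_plus by auto. auto. }
  rewrite (Fubini U (fun i => 4 * K * / (INR i + 1) ^ 2) (fun j => / (INR j + 1) ^ 2)).
  - apply csum_ext. intros j. unfold zsum_term at 1. unfold zsum. rewrite <- csum_plus by auto.
    apply csum_ext. intros i. unfold U, zsum_term. ring.
  - intros i j. unfold U. pose proof (pos_INR i). pose proof (pos_INR j).
    assert (0 < / (INR j + 1) ^ 2) by (apply Rinv_0_lt_compat, pow_lt; lra).
    eapply Rle_trans; [apply (zsum_term_bound _ (2 * K * / (INR j + 1) ^ 2))|].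
    + apply Rmult_le_pos; lra.
    + intros a. eapply Rle_trans; [apply (zsum_term_bound _ (K * / (Rabs (IZR a) + 1) ^ 2))|].
      * apply Rmult_le_pos; auto. * intros b. rewrite Rmult_assoc. auto. * right. ring.
    + right. ring.
  - intros i. apply Rmult_le_pos; [lra|]. left. apply Rinv_0_lt_compat, pow_lt. pose proof (pos_INR i). lra.
  - intros i. left. apply Rinv_0_lt_compat, pow_lt. pose proof (pos_INR i). lra.
  - apply ex_series_scal_r, ex_series_inv_sq.
  - apply ex_series_inv_sq.
Qed.

(** As Im om > 0, the real numbers x and n can be recovered linearly from x om + n, so the sizes are
    comparable; |x| + |n| >= 1 then allows the extra 1. *)
Lemma lattice_lower (om : C) : upper om -> exists c, 0 < c /\ forall x n : R,
  1 <= Rabs x + Rabs n -> c * (1 + Rabs x + Rabs n) <= Cmod (x * om + n).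
Proof.
  intros Hom. unfold upper in Hom. set (y := Im om) in *. pose proof (Cmod_ge_0 om) as Hm.
  set (Q := 1 + (1 + Cmod om) / y). assert (0 < (1 + Cmod om) / y) as HQ by (apply Rdiv_lt_0_compat; lra).
  exists (/ (2 * Q)). split; [apply Rinv_0_lt_compat; unfold Q; lra|]. intros x n H1.
  set (w := Cmod (x * om + n)).
  assert (Rabs x * y <= w) as Hx.
  { rewrite <- (Rabs_pos_eq y) by lra. rewrite <- Rabs_mult. unfold w.
    replace (x * y) with (Im (x * om + n)) by (unfold y; destruct om; simpl; ring). apply Im_le_Cmod. }
  assert (Rabs n <= w + Rabs x * Cmod om) as Hn.
  { rewrite <- !Cmod_R, <- Cmod_mult. replace (RtoC n) with ((x * om + n) - x * om)%C by ring.
    apply Cmod_triangle_minus. }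
  assert (Rabs x <= w / y) as Hx'.
  { apply (Rmult_le_reg_r y); auto. unfold Rdiv. rewrite Rmult_assoc, Rinv_l, Rmult_1_r by lra. auto. }
  apply (Rmult_le_reg_l (2 * Q)); [unfold Q; lra|]. rewrite <- Rmult_assoc, Rinv_r, Rmult_1_l by (unfold Q; lra).
  assert (Rabs x + Rabs n <= Q * w); [|lra]. unfold Q.
  replace ((1 + (1 + Cmod om) / y) * w) with (w + w / y + w / y * Cmod om) by (field; lra).
  assert (Rabs x * Cmod om <= w / y * Cmod om) by (now apply Rmult_le_compat_r). lra.
Qed.

Lemma Zpair_zero_or_not (a b : Z) : (a = 0 /\ b = 0)%Z \/ (a <> 0 \/ b <> 0)%Z.
Proof. lia. Qed.

(* The second difference makes the double series absolutely convergent, so that the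
   order of summation, delicate in weight two, does not matter. *)
Definition lattice_term (om : C) (a b : Z) : C :=
  (2 * / (IZR a * om + 2 * IZR b) ^ 2 + (- (1)) * / (IZR a * om + 2 * IZR b + 1) ^ 2
   + (- (1)) * / (IZR a * om + 2 * IZR b - 1) ^ 2)%C.

Lemma lattice_term_bound om : upper om -> exists K, 0 <= K /\ forall a b,
  Cmod (lattice_term om a b) <= K * (/ (Rabs (IZR a) + 1) ^ 2 * / (Rabs (IZR b) + 1) ^ 2).
Proof.
  intros Hom. destruct (lattice_lower om Hom) as [c [Hc Hlow]].
  set (K := 2 * (/ c ^ 2 + 3) * / c ^ 4).
  assert (0 < / c ^ 2) as Hc2 by (apply Rinv_0_lt_compat, pow_lt; auto).
  assert (0 < / c ^ 4) as Hc4 by (apply Rinv_0_lt_compat, pow_lt; auto).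
  assert (0 < K) as HK by (unfold K; apply Rmult_lt_0_compat; lra).
  exists (K + 2). split; [lra|]. intros a b.
  assert (forall n : Z, n <> 0%Z -> 1 <= Rabs (IZR n)) as Hint.
  { intros n Hn. rewrite <- abs_IZR. apply IZR_le. lia. }
  pose proof (Rabs_pos (IZR a)) as HA0. pose proof (Rabs_pos (IZR b)) as HB0.
  set (A := Rabs (IZR a)) in *. set (B := Rabs (IZR b)) in *.
  (* At the origin the first fraction is 0 by the convention on the inverse and the other two give
     -2; this is the 2 in [K + 2]. *)
  destruct (Zpair_zero_or_not a b) as [[-> ->]|Hab].
  { unfold A, B, lattice_term. replace (0 * om + 2 * 0)%C with (RtoC 0) by ring.
    replace (0 ^ 2)%C with (RtoC 0) by ring. rewrite Cinv_0.
    replace (2 * 0 + - (1) * / (0 + 1) ^ 2 + - (1) * / (0 - 1) ^ 2)%C with (- (2))%C by field.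
    rewrite Cmod_opp, Cmod_R, Rabs_pos_eq by lra. rewrite Rabs_R0.
    replace (/ (0 + 1) ^ 2) with 1 by field. lra. }
  assert (1 <= A + B) as HAB.
  { destruct Hab as [Ha|Hb]; [specialize (Hint a Ha); fold A in Hint|specialize (Hint b Hb); fold B in Hint]; lra. }
  set (s := 1 + A + B). set (w := (IZR a * om + 2 * IZR b)%C).
  assert (c * s <= Cmod w) as Hw.
  { replace w with (IZR a * om + (2 * IZR b)%R)%C by (unfold w; rewrite RtoC_mult; ring).
    assert (Rabs (2 * IZR b) = 2 * B) as E by (rewrite Rabs_mult, (Rabs_pos_eq 2) by lra; auto).
    eapply Rle_trans; [|apply Hlow; fold A; rewrite E; lra]. fold A. rewrite E. apply Rmult_le_compat_l; unfold s; lra. }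
  assert (forall e : Z, (e = 1 \/ e = -1)%Z -> c * s <= Cmod (w + IZR e)) as Hwe.
  { intros e He. replace (w + IZR e)%C with (IZR a * om + IZR (2 * b + e))%C.
    2:{ unfold w. rewrite plus_IZR, mult_IZR, RtoC_plus, RtoC_mult. ring. }
    assert (B <= Rabs (IZR (2 * b + e))) as HB.
    { unfold B. rewrite <- !abs_IZR. apply IZR_le. lia. }
    assert (1 <= Rabs (IZR (2 * b + e))) as HB1 by (apply Hint; lia).
    eapply Rle_trans; [|apply Hlow; fold A; lra]. fold A. apply Rmult_le_compat_l; unfold s; lra. }
  pose proof (Hwe 1%Z ltac:(auto)) as Hp. pose proof (Hwe (-1)%Z ltac:(auto)) as Hm.
  replace (w + -1)%C with (w - 1)%C in Hm by ring.
  assert (0 < c * s) as Hcs by (apply Rmult_lt_0_compat; unfold s; lra).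
  assert (w <> 0)%C as W0 by (apply Cmod_gt_0; lra).
  assert (w + 1 <> 0)%C as W1 by (apply Cmod_gt_0; lra).
  assert (w - 1 <> 0)%C as W2 by (apply Cmod_gt_0; lra).
  (* Over a common denominator the orders w^-2 cancel; what remains is of order w^-4, enough for a
     product of two inverse squares. *)
  assert (lattice_term om a b = 2 * (/ w ^ 2 - 3) * (/ (w + 1) ^ 2 * / (w - 1) ^ 2))%C as ->.
  { unfold lattice_term. fold w. field. auto. }
  assert (forall x : C, c * s <= Cmod x -> Cmod (/ x ^ 2) <= / c ^ 2 * / s ^ 2) as Hinv.
  { intros x Hx. assert (x <> 0)%C by (apply Cmod_gt_0; lra).
    rewrite Cmod_inv, Cmod_pow by (now apply Cpow_nz). rewrite <- Rinv_mult, <- Rpow_mult_distr.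
    apply Rinv_le_contravar; [apply pow_lt; lra|]. apply pow_incr. lra. }
  assert (1 <= s) as Hs by (unfold s; lra).
  assert (0 < / s ^ 2 <= 1) as Hs2.
  { split; [apply Rinv_0_lt_compat, pow_lt; lra|]. rewrite <- Rinv_1. apply Rinv_le_contravar; [lra|nra]. }
  assert (Cmod (2 * (/ w ^ 2 - 3)) <= 2 * (/ c ^ 2 + 3)) as H1.
  { rewrite Cmod_mult, Cmod_R, Rabs_pos_eq by lra. apply Rmult_le_compat_l; [lra|].
    eapply Rle_trans; [apply Cmod_triangle_minus|]. rewrite Cmod_R, Rabs_pos_eq by lra.
    specialize (Hinv w Hw).
    assert (/ c ^ 2 * / s ^ 2 <= / c ^ 2 * 1) by (apply Rmult_le_compat_l; lra). lra. }
  assert (Cmod (/ (w + 1) ^ 2 * / (w - 1) ^ 2) <= / c ^ 4 * / (s ^ 2 * s ^ 2)) as H2.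
  { rewrite Cmod_mult. replace (/ c ^ 4 * / (s ^ 2 * s ^ 2)) with ((/ c ^ 2 * / s ^ 2) * (/ c ^ 2 * / s ^ 2)) by (field; split; lra).
    apply Rmult_le_compat; auto using Cmod_ge_0. }
  assert (/ (s ^ 2 * s ^ 2) <= / (A + 1) ^ 2 * / (B + 1) ^ 2) as H3.
  { rewrite <- Rinv_mult. apply Rinv_le_contravar.
    - apply Rmult_lt_0_compat; apply pow_lt; lra.
    - rewrite <- !Rpow_mult_distr. apply pow_incr. unfold s. nra. }
  rewrite Cmod_mult. apply Rle_trans with (K * / (s ^ 2 * s ^ 2)).
  - unfold K. rewrite Rmult_assoc. apply Rmult_le_compat; auto using Cmod_ge_0.
  - assert (0 < / (s ^ 2 * s ^ 2)) by (apply Rinv_0_lt_compat, Rmult_lt_0_compat; apply pow_lt; lra).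
    apply Rmult_le_compat; lra.
Qed.

Lemma decay_away z c : away_from_int z c -> quadratic_decay (fun b => / (z + IZR b) ^ 2)%C.
Proof.
  intros H. exists (/ c ^ 2). split; [left; apply Rinv_0_lt_compat, pow_lt, H|].
  intros b. now apply away_bound.
Qed.

Lemma decay_0 : quadratic_decay (fun b => / (0 + IZR b) ^ 2)%C.
Proof.
  exists 4. split; [lra|]. intros b. destruct (Z.eq_dec b 0) as [->|Hb].
  - replace ((0 + 0) ^ 2)%C with (RtoC 0) by ring. rewrite Cinv_0, Cmod_0, Rabs_R0.
    replace (/ (0 + 1) ^ 2) with 1 by field. lra.
  - assert (1 <= Rabs (IZR b)) as H by (rewrite <- abs_IZR; apply IZR_le; lia).
    rewrite Cplus_0_l, Cmod_inv, Cmod_pow, Cmod_R.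
    2:{ apply Cpow_nz, RtoC_neq_0. intros E. rewrite E, Rabs_R0 in H. lra. }
    set (x := Rabs (IZR b)) in *. replace (4 * / (x + 1) ^ 2) with (/ ((x + 1) / 2) ^ 2) by (field; lra).
    apply inv_sq_mono. lra.
Qed.

Lemma away_half (e : R) : e = 1 / 2 \/ e = - (1 / 2) -> away_from_int e (1 / 8).
Proof.
  intros He. split; [lra|]. intros b. rewrite <- RtoC_plus, Cmod_R.
  destruct (Z.eq_dec b 0) as [->|Hb].
  - rewrite Rabs_R0. replace (Rabs (e + 0)) with (1 / 2); [lra|].
    destruct He as [-> | ->]; [rewrite Rabs_pos_eq|rewrite Rabs_left]; lra.
  - assert (1 <= Rabs (IZR b)) as H by (rewrite <- abs_IZR; apply IZR_le; lia).
    pose proof (Rabs_triang_inv (IZR b) (- e)) as H1. replace (IZR b - - e) with (e + IZR b) in H1 by ring.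
    replace (Rabs (- e)) with (1 / 2) in H1; [lra|].
    destruct He as [-> | ->]; [rewrite Rabs_left|rewrite Rabs_pos_eq]; lra.
Qed.

Lemma cosec_half : cosec (1 / 2) = (- / 4)%C.
Proof.
  unfold cosec. replace (2 * PI * Ci * (1 / 2))%C with (PI * Ci)%C by field.
  rewrite Cexp_PI. replace (RtoC (-1)) with (- (1))%C by ring. field.
Qed.

Lemma eisen2_half (e : R) : e = 1 / 2 \/ e = - (1 / 2) -> eisen2 e = (PI ^ 2)%C.
Proof.
  intros He. rewrite (cosec_partial_fractions _ _ (away_half e He)).
  replace (cosec e) with (cosec (1 / 2)).
  - rewrite cosec_half. field.
  - destruct He as [-> | ->].
    + now rewrite RtoC_div by lra.
    + rewrite <- (cosec_period (- (1 / 2))%R). f_equal. rewrite RtoC_opp, RtoC_div by lra. field.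
Qed.

(** [cosec] has a pole at 0, so the value is derived from z = 1/2: there the series runs over the
    odd integers, and the even ones contribute a quarter of the whole sum. *)
Lemma eisen2_0 : eisen2 0 = (PI ^ 2 / 3)%C.
Proof.
  set (g := fun n => (/ INR n ^ 2)%C).
  assert (g O = 0)%C as G0 by (unfold g; simpl INR; replace (0 ^ 2)%C with (RtoC 0) by ring; apply Cinv_0).
  assert (summ (fun n => g (S n))) as HS.
  { apply summ_dom with (2 := ex_series_inv_sq). intros n. unfold g.
    pose proof (pos_INR n). rewrite Cmod_inv, Cmod_pow, Cmod_R, Rabs_pos_eq, S_INR; try lra.
    - apply pos_INR. - apply Cpow_nz, RtoC_neq_0. apply not_0_INR. lia. }
  assert (summ g) as Hg by (now apply summ_incr).
  set (G := csum (fun n => g (S n))).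
  assert (csum g = G) as EG by (rewrite (csum_head _ Hg), G0; unfold G; ring).
  assert (eisen2 0 = 2 * G)%C as E0.
  { unfold eisen2, zsum. transitivity (csum (fun j => g j + g (S j))%C).
    - apply csum_ext. intros j. unfold zsum_term, g. rewrite opp_IZR, <- !INR_IZR_INZ, RtoC_opp.
      f_equal; f_equal; ring.
    - rewrite csum_plus, EG by auto. fold G. ring. }
  destruct (csum_even_odd g Hg) as [Se [So Eeo]].
  assert (csum (fun n => g (2 * n)%nat) = G / 4)%C as Ee.
  { rewrite <- EG. unfold Cdiv. rewrite Cmult_comm, <- csum_scal by auto. apply csum_ext. intros n.
    unfold g. rewrite mult_INR, RtoC_mult. replace (INR 2) with 2 by (simpl; ring).
    destruct n; [simpl INR; replace ((2 * 0) ^ 2)%C with (RtoC 0) by ring; replace (0 ^ 2)%C with (RtoC 0) by ring; rewrite Cinv_0; ring|].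
    field. apply RtoC_neq_0, not_0_INR. lia. }
  assert (eisen2 (1 / 2)%R = 8 * csum (fun n => g (2 * n + 1)%nat))%C as Eh.
  { unfold eisen2, zsum. rewrite <- csum_scal by auto. apply csum_ext. intros j.
    unfold zsum_term, g. rewrite opp_IZR, <- !INR_IZR_INZ, RtoC_opp, plus_INR, mult_INR, S_INR, !RtoC_plus, RtoC_mult, RtoC_div by lra.
    replace (INR 2) with 2 by (simpl; ring). simpl (INR 1). set (x := RtoC (INR j)).
    assert (2 * x + 1 <> 0)%C.
    { unfold x. rewrite <- RtoC_mult, <- RtoC_plus. apply RtoC_neq_0. pose proof (pos_INR j). lra. }
    replace (1 / 2 + x)%C with ((2 * x + 1) / 2)%C by field.
    replace (1 / 2 + - (x + 1))%C with (- ((2 * x + 1) / 2))%C by field. field. auto. }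
  rewrite (eisen2_half (1 / 2)) in Eh by auto.
  rewrite EG, Ee in Eeo. rewrite E0.
  assert (csum (fun n => g (2 * n + 1)%nat) = 3 / 4 * G)%C as Eo.
  { transitivity (G / 4 + csum (fun n => g (2 * n + 1)%nat) - G / 4)%C; [ring|]. rewrite <- Eeo. field. }
  rewrite Eo in Eh. rewrite Eh. field.
Qed.

Lemma inv_sq_scal (s x : C) : s <> RtoC 0 -> (/ (s * x) ^ 2 = / s ^ 2 * / x ^ 2)%C.
Proof.
  intros Hs. destruct (Ceq_dec x 0) as [->|Hx].
  - replace ((s * 0) ^ 2)%C with (RtoC 0) by ring. replace (0 ^ 2)%C with (RtoC 0) by ring.
    rewrite Cinv_0. ring.
  - field. auto.
Qed.

(** Factoring 2 out of a om + 2b + e with e = 0, 1, -1 leaves the shift e / 2 in the argument. *)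
Lemma lattice_row om (a : Z) : let x := (IZR a * om / 2)%C in
  quadratic_decay (fun b => / (x + IZR b) ^ 2)%C ->
  quadratic_decay (fun b => / (x + (1 / 2)%R + IZR b) ^ 2)%C ->
  quadratic_decay (fun b => / (x + (- (1 / 2))%R + IZR b) ^ 2)%C ->
  zsum (lattice_term om a) = (/ 2 * eisen2 x - / 4 * eisen2 (x + (1 / 2)%R) - / 4 * eisen2 (x + (- (1 / 2))%R))%C.
Proof.
  intros x H0 H1 H2. unfold eisen2.
  transitivity (/ 2 * zsum (fun b => / (x + IZR b) ^ 2) + (- / 4) * zsum (fun b => / (x + (1 / 2)%R + IZR b) ^ 2)
    + (- / 4) * zsum (fun b => / (x + (- (1 / 2))%R + IZR b) ^ 2))%C; [|ring].
  rewrite <- zsum_lin3 by auto. apply csum_ext. intros j. unfold zsum_term.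
  assert (forall b, lattice_term om a b = / 2 * / (x + IZR b) ^ 2 + (- / 4) * / (x + (1 / 2)%R + IZR b) ^ 2
    + (- / 4) * / (x + (- (1 / 2))%R + IZR b) ^ 2)%C as E.
  { intros b. unfold lattice_term. rewrite RtoC_opp, RtoC_div by lra.
    replace (IZR a * om + 2 * IZR b)%C with (2 * (x + IZR b))%C by (unfold x; field).
    replace (2 * (x + IZR b) + 1)%C with (2 * (x + 1 / 2 + IZR b))%C by field.
    replace (2 * (x + IZR b) - 1)%C with (2 * (x + - (1 / 2) + IZR b))%C by field.
    rewrite !inv_sq_scal by (apply RtoC_neq_0; lra).
    set (p := (/ (x + IZR b) ^ 2)%C). set (r := (/ (x + 1 / 2 + IZR b) ^ 2)%C).
    set (s := (/ (x + - (1 / 2) + IZR b) ^ 2)%C). field. }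
  now rewrite !E.
Qed.

Lemma lattice_column om (b : Z) : om <> RtoC 0 ->
  (forall n : Z, quadratic_decay (fun a => / (IZR n / om + IZR a) ^ 2)%C) ->
  zsum (fun a => lattice_term om a b) =
  (/ om ^ 2 * (2 * eisen2 (IZR (2 * b) / om) - eisen2 (IZR (2 * b + 1) / om) - eisen2 (IZR (2 * b - 1) / om)))%C.
Proof.
  intros Hom Hd. unfold eisen2.
  transitivity ((/ om ^ 2 * 2) * zsum (fun a => / (IZR (2 * b) / om + IZR a) ^ 2) + (- / om ^ 2) * zsum (fun a => / (IZR (2 * b + 1) / om + IZR a) ^ 2)
    + (- / om ^ 2) * zsum (fun a => / (IZR (2 * b - 1) / om + IZR a) ^ 2))%C; [|ring].
  rewrite <- zsum_lin3 by auto. apply csum_ext. intros j. unfold zsum_term.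
  assert (forall a, lattice_term om a b = (/ om ^ 2 * 2) * / (IZR (2 * b) / om + IZR a) ^ 2
    + (- / om ^ 2) * / (IZR (2 * b + 1) / om + IZR a) ^ 2 + (- / om ^ 2) * / (IZR (2 * b - 1) / om + IZR a) ^ 2)%C as E.
  { intros a. unfold lattice_term. rewrite plus_IZR, minus_IZR, mult_IZR, RtoC_plus, RtoC_minus, RtoC_mult.
    replace (IZR a * om + 2 * IZR b + 1)%C with (om * ((2 * IZR b + 1) / om + IZR a))%C by (field; auto).
    replace (IZR a * om + 2 * IZR b - 1)%C with (om * ((2 * IZR b - 1) / om + IZR a))%C by (field; auto).
    replace (IZR a * om + 2 * IZR b)%C with (om * (2 * IZR b / om + IZR a))%C by (field; auto).
    rewrite !inv_sq_scal by auto. ring. }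
  now rewrite !E.
Qed.

Lemma cosec_summ tau : upper tau -> summ (fun m => cosec (INR (S m) * tau)).
Proof.
  intros Ht. pose proof (Cmod_ge_0 (nome tau)) as H0. pose proof (Cmod_nome_lt tau Ht) as H1.
  set (r := Cmod (nome tau)) in *.
  apply summ_dom with (fun m => / (1 - r) ^ 2 * r ^ m); [|apply ex_series_scal_r, ex_series_pow; lra].
  intros m. rewrite cosec_nome. set (w := (nome tau ^ S m)%C).
  assert (Cmod w = r ^ S m) as Ew by (unfold w; now rewrite Cmod_pow).
  assert (0 <= r ^ m <= 1) as Hm. { split; [apply pow_le; lra|]. rewrite <- (pow1 m). apply pow_incr. lra. }
  assert (r ^ S m <= r ^ m) by (simpl; nra). assert (r ^ S m <= r) by (simpl; nra).
  pose proof (Cmod_triangle_rev 1 w) as Ht2. rewrite Cmod_1, Ew in Ht2.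
  assert (1 - w <> 0)%C as Hn by (apply Cmod_gt_0; lra).
  rewrite Cmod_div, Cmod_pow, Ew by (now apply Cpow_nz). rewrite Rmult_comm. unfold Rdiv.
  apply Rmult_le_compat; try lra; [apply pow_le; lra|left; apply Rinv_0_lt_compat, pow_lt; lra|].
  apply inv_sq_mono. lra.
Qed.

Definition cosec_mul (tau : C) (m : nat) : C := cosec (INR m * tau).

Lemma cosec_alternating tau : upper tau ->
  let K := cosec_mul tau in
  summ (fun i => K (2 * i + 1)%nat) /\ summ (fun i => K (2 * i + 2)%nat) /\
  csum (fun m => K (S m)) = (csum (fun i => K (2 * i + 1)%nat) + csum (fun i => K (2 * i + 2)%nat))%C /\
  csum (fun m => sgn_pow m * K (S m))%C = (csum (fun i => K (2 * i + 1)%nat) - csum (fun i => K (2 * i + 2)%nat))%C.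
Proof.
  intros Ht K. pose proof (cosec_summ tau Ht) as HS. change (summ (fun m => K (S m))) in HS.
  assert (forall i, (2 * i + 1 = S (2 * i))%nat) as E1 by (intros; lia).
  assert (forall i, (2 * i + 2 = S (2 * i + 1))%nat) as E2 by (intros; lia).
  destruct (csum_even_odd (fun m => K (S m)) HS) as [S1 [S2 Es]].
  assert (summ (fun m => sgn_pow m * K (S m))%C) as HS'.
  { apply summ_dom with (2 := HS). intros m. rewrite Cmod_mult, Cmod_sgn_pow. unfold K, cosec_mul. lra. }
  destruct (csum_even_odd _ HS') as [_ [_ Es']].
  assert (forall i, sgn_pow (2 * i) = 1)%C as G1.
  { intros. unfold sgn_pow. replace (2 * i)%nat with (i + i)%nat by lia. rewrite Cpow_add_r. apply Csq_one_pow2. ring. }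
  assert (forall i, sgn_pow (2 * i + 1) = - (1))%C as G2.
  { intros i. unfold sgn_pow. rewrite Cpow_add_r. fold (sgn_pow (2 * i)). rewrite G1. simpl. ring. }
  assert (csum (fun i => K (2 * i + 1)%nat) = csum (fun n => K (S (2 * n)))) as F1.
  { apply csum_ext. intros. now rewrite E1. }
  assert (csum (fun i => K (2 * i + 2)%nat) = csum (fun n => K (S (2 * n + 1)))) as F2.
  { apply csum_ext. intros. now rewrite E2. }
  split; [|split; [|split]].
  - apply summ_ext with (2 := S1). intros. now rewrite E1.
  - apply summ_ext with (2 := S2). intros. now rewrite E2.
  - now rewrite F1, F2.
  - rewrite Es', F1, F2.
    replace (csum (fun n => sgn_pow (2 * n) * K (S (2 * n))))%C with (csum (fun n => K (S (2 * n)))).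
    2:{ apply csum_ext. intros. rewrite G1. ring. }
    replace (csum (fun n => sgn_pow (2 * n + 1) * K (S (2 * n + 1))))%C with (csum (fun n => (- (1)) * K (S (2 * n + 1))))%C.
    2:{ apply csum_ext. intros. now rewrite G2. }
    rewrite csum_scal by auto. ring.
Qed.

Lemma upper_S_nome tau m : upper tau -> Cexp (2 * PI * Ci * (INR (S m) * tau)) <> RtoC 1.
Proof.
  intros Ht E. pose proof (Cmod_nome_pow tau m Ht) as H. rewrite nome_pow in H. unfold expo in H.
  replace (2 * PI * Ci * INR (S m) * tau)%C with (2 * PI * Ci * (INR (S m) * tau))%C in H by ring.
  rewrite E, Cmod_1 in H. lra.
Qed.

Lemma Im_nat_scal m tau : Im (INR m * tau)%C = INR m * Im tau.
Proof. destruct tau. simpl. ring. Qed.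

(** With om = 2 tau, row a involves [cosec] at a tau and at a tau + 1/2, and duplication trades the
    latter for [cosec] at 2 a tau. Rows a and -a agree, and together they give the alternating sum
    of [tE_lambert]; row 0 supplies the constant term. *)
Lemma rows_sum tau : upper tau ->
  zsum (fun a => zsum (lattice_term (2 * tau) a)) = (- (PI ^ 2 / 3) * tE tau)%C.
Proof.
  intros Ht. set (r := fun a => zsum (lattice_term (2 * tau) a)).
  set (K := cosec_mul tau).
  assert (forall m (e : Z), (e = 1 \/ e = -1)%Z ->
    r (e * Z.of_nat (S m))%Z = (- (4) * PI ^ 2 * (K (S m) - 2 * K (2 * m + 2)%nat))%C) as Hr.
  { intros m e He. unfold r. set (x0 := (INR (S m) * tau)%C).
    assert (IZR (e * Z.of_nat (S m)) * (2 * tau) / 2 = IZR e * x0)%C as Ex.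
    { rewrite mult_IZR, <- INR_IZR_INZ, RtoC_mult. unfold x0. field. }
    set (x := (IZR e * x0)%C) in *.
    assert (0 < Im x0) as Hx0.
    { unfold x0. rewrite Im_nat_scal. apply Rmult_lt_0_compat; auto. apply lt_0_INR. lia. }
    assert (forall s : R, exists c, away_from_int (x + s) c) as Haw.
    { intros s. apply away_from_int_upper. unfold x. destruct He as [-> | ->]; destruct x0; simpl in *; lra. }
    destruct (Haw 0) as [c0 Hc0]. rewrite Cplus_0_r in Hc0. destruct (Haw (1 / 2)) as [c1 Hc1]. destruct (Haw (- (1 / 2))) as [c2 Hc2].
    pose proof (lattice_row (2 * tau) (e * Z.of_nat (S m))) as HR. cbv zeta in HR. rewrite Ex in HR.
    rewrite HR; try (eapply decay_away; eauto).
    rewrite (cosec_partial_fractions _ _ Hc0), (cosec_partial_fractions _ _ Hc1), (cosec_partial_fractions _ _ Hc2).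
    assert (cosec (x + (- (1 / 2))%R) = cosec (x + (1 / 2)%R)) as ->.
    { rewrite <- cosec_period. f_equal. rewrite RtoC_opp, RtoC_div by lra. field. }
    assert (cosec x = K (S m)) as Ek.
    { unfold x, K, cosec_mul. destruct He as [-> | ->].
      - f_equal. unfold x0. ring.
      - replace (-1 * x0)%C with (- x0)%C by ring. unfold x0. apply cosec_even. now apply upper_S_nome. }
    assert (cosec x + cosec (x + (1 / 2)%R) = 4 * K (2 * m + 2)%nat)%C as Ed.
    { assert (cosec (2 * x) = K (2 * m + 2)%nat) as <-.
      { unfold x, K, cosec_mul. replace (2 * m + 2)%nat with (S (2 * m + 1)) by lia.
        assert (2 * x0 = INR (S (2 * m + 1)) * tau)%C as E2.
        { unfold x0. replace (S (2 * m + 1)) with (2 * S m)%nat by lia. rewrite mult_INR, RtoC_mult. simpl (INR 2).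
          replace (1 + 1) with 2 by ring. ring. }
        destruct He as [-> | ->].
        - f_equal. rewrite <- E2. ring.
        - replace (2 * (-1 * x0))%C with (- (2 * x0))%C by ring. rewrite E2. apply cosec_even. now apply upper_S_nome. }
      rewrite cosec_duplication.
      - f_equal; f_equal; [field|]. rewrite RtoC_div by lra. field.
      - intros E. apply (f_equal Cmod) in E. rewrite Cmod_Cexp, Cmod_1, <- exp_0 in E. apply exp_inv in E.
        pose proof PI_RGT_0. unfold x in E. destruct x0 as [p q]. simpl in Hx0.
        destruct He as [-> | ->]; unfold Ci, RtoC, Cmult in E; simpl in E; nra. }
    replace (cosec (x + (1 / 2)%R)) with (4 * K (2 * m + 2)%nat - cosec x)%C by (rewrite <- Ed; ring).
    rewrite Ek. field. }
  assert (r 0%Z = - (PI ^ 2 / 3))%C as Hr0.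
  { unfold r. pose proof (lattice_row (2 * tau) 0) as HR. cbv zeta in HR.
    replace (0 * (2 * tau) / 2)%C with (RtoC 0) in HR by field.
    rewrite HR; clear HR.
    - rewrite !Cplus_0_l, eisen2_0, !eisen2_half by auto. field.
    - apply decay_0.
    - rewrite Cplus_0_l. eapply decay_away, away_half; auto.
    - rewrite Cplus_0_l. eapply decay_away, away_half; auto. }
  destruct (cosec_alternating tau Ht) as [S1 [S2 [E1 E2]]]. fold K in S1, S2, E1, E2.
  pose proof (cosec_summ tau Ht) as S0. change (summ (fun m => K (S m))) in S0.
  set (u := fun m => (- (4) * PI ^ 2 * (K (S m) + (- (2)) * K (2 * m + 2)%nat))%C).
  assert (summ u) as Su by (unfold u; auto using summ_scal, summ_plus).
  assert (csum u = - (4) * PI ^ 2 * csum (fun m => sgn_pow m * K (S m)))%C as Eu.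
  { unfold u. rewrite csum_scal, csum_plus, csum_scal by auto using summ_scal, summ_plus.
    rewrite E2, E1. ring. }
  assert (forall m (e : Z), (e = 1 \/ e = -1)%Z -> r (e * Z.of_nat (S m))%Z = u m) as Hru.
  { intros. rewrite Hr by auto. unfold u. ring. }
  assert (zsum r = r 0%Z + 2 * csum u)%C as EZ.
  { unfold zsum. assert (forall j, zsum_term r j = (match j with O => r 0%Z | S i => u i end) + u j)%C as Et.
    { intros j. unfold zsum_term. apply f_equal2.
      - destruct j as [|i]; [reflexivity|]. rewrite <- (Hru i 1%Z) by auto.
        now replace (1 * Z.of_nat (S i))%Z with (Z.of_nat (S i)) by lia.
      - rewrite <- (Hru j (-1)%Z) by auto.
        now replace (-1 * Z.of_nat (S j))%Z with (- Z.of_nat (S j))%Z by lia. }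
    rewrite (csum_ext _ _ Et).
    assert (summ (fun j => match j with O => r 0%Z | S i => u i end)) as Sv by (now apply summ_incr).
    rewrite csum_plus by auto. rewrite (csum_head _ Sv). change (csum (fun n => u n)) with (csum u). ring. }
  rewrite EZ, Hr0, Eu, tE_lambert by auto.
  change (fun m => sgn_pow m * cosec (INR (S m) * tau))%C with (fun m => sgn_pow m * K (S m))%C. field.
Qed.

(** Dividing by om = 2 tau turns n / om into - n tau', so for b <> 0 column b is a second difference
    of [cosec] at (2b - 1) tau', 2b tau', (2b + 1) tau'. Over all b each odd multiple occurs twice,
    which makes the sum alternating again, now at tau'. *)
Lemma columns_sum tau tau' : upper tau -> upper tau' -> (tau' * (2 * tau) = - (1))%C ->
  zsum (fun b => zsum (fun a => lattice_term (2 * tau) a b)) = (/ (2 * tau) ^ 2 * (2 * PI ^ 2 / 3) * tE tau')%C.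
Proof.
  intros Ht Ht' Hinv. set (om := (2 * tau)%C) in *.
  assert (om <> 0)%C as Hom.
  { intros E. rewrite E in Hinv. replace (tau' * 0)%C with (RtoC 0) in Hinv by ring. injection Hinv. lra. }
  set (K := cosec_mul tau'). set (rho := fun n : Z => eisen2 (IZR n / om)).
  assert (forall n : Z, IZR n / om = - (IZR n * tau'))%C as Hn.
  { intros n. transitivity (- (IZR n * (- (1)) / om))%C; [field; auto|]. rewrite <- Hinv. field. auto. }
  assert (forall n : Z, n <> 0%Z -> exists c, away_from_int (IZR n / om) c) as Haw.
  { intros n Hz. apply away_from_int_upper. rewrite Hn. unfold upper in Ht'.
    assert (IZR n <> 0) by (now apply not_0_IZR). destruct tau'. simpl in *.
    intros E. apply (Rmult_integral_contrapositive_currified (IZR n) r0); lra. }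
  assert (forall n, quadratic_decay (fun a => / (IZR n / om + IZR a) ^ 2)%C) as Hd.
  { intros n. destruct (Z.eq_dec n 0) as [->|Hz].
    - replace (0 / om)%C with (RtoC 0) by (field; auto). apply decay_0.
    - destruct (Haw n Hz) as [c Hc]. eapply decay_away; eauto. }
  assert (forall m (e : Z), (e = 1 \/ e = -1)%Z -> rho (e * Z.of_nat (S m))%Z = - (4) * PI ^ 2 * K (S m))%C as Hrho.
  { intros m e He. unfold rho. destruct (Haw (e * Z.of_nat (S m))%Z ltac:(lia)) as [c Hc].
    rewrite (cosec_partial_fractions _ _ Hc), Hn. f_equal. unfold K, cosec_mul.
    rewrite mult_IZR, <- INR_IZR_INZ, RtoC_mult. destruct He as [-> | ->].
    - replace (- (1 * INR (S m) * tau'))%C with (- (INR (S m) * tau'))%C by ring. apply cosec_even. now apply upper_S_nome.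
    - f_equal. ring. }
  set (c := fun b => zsum (fun a => lattice_term om a b)).
  assert (forall b, c b = / om ^ 2 * (2 * rho (2 * b)%Z - rho (2 * b + 1)%Z - rho (2 * b - 1)%Z))%C as Hc.
  { intros b. unfold c. now rewrite lattice_column. }
  set (u := fun m => (/ om ^ 2 * (- (4) * PI ^ 2) * (2 * K (2 * m + 2)%nat + (- (1)) * K (2 * m + 3)%nat + (- (1)) * K (2 * m + 1)%nat))%C).
  assert (forall m (e : Z), (e = 1 \/ e = -1)%Z -> c (e * Z.of_nat (S m))%Z = u m) as Hcu.
  { intros m e He. rewrite Hc. unfold u.
    replace (2 * (e * Z.of_nat (S m)))%Z with (e * Z.of_nat (S (2 * m + 1)))%Z by lia.
    rewrite Hrho by auto.
    assert (forall k l : nat, rho (e * Z.of_nat (S (2 * m + 1)) + 1)%Z + rho (e * Z.of_nat (S (2 * m + 1)) - 1)%Z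
      = - (4) * PI ^ 2 * (K (2 * m + 3)%nat + K (2 * m + 1)%nat))%C as Es.
    { intros _ _. destruct He as [-> | ->].
      - replace (1 * Z.of_nat (S (2 * m + 1)) + 1)%Z with (1 * Z.of_nat (S (2 * m + 2)))%Z by lia.
        replace (1 * Z.of_nat (S (2 * m + 1)) - 1)%Z with (1 * Z.of_nat (S (2 * m)))%Z by lia.
        rewrite !Hrho by auto. replace (S (2 * m + 2)) with (2 * m + 3)%nat by lia. replace (S (2 * m)) with (2 * m + 1)%nat by lia. ring.
      - replace (-1 * Z.of_nat (S (2 * m + 1)) - 1)%Z with (-1 * Z.of_nat (S (2 * m + 2)))%Z by lia.
        replace (-1 * Z.of_nat (S (2 * m + 1)) + 1)%Z with (-1 * Z.of_nat (S (2 * m)))%Z by lia.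
        rewrite !Hrho by auto. replace (S (2 * m + 2)) with (2 * m + 3)%nat by lia. replace (S (2 * m)) with (2 * m + 1)%nat by lia. ring. }
    specialize (Es O O). replace (S (2 * m + 1)) with (2 * m + 2)%nat in * by lia.
    set (X := rho (e * Z.of_nat (2 * m + 2) + 1)%Z) in *. set (Y := rho (e * Z.of_nat (2 * m + 2) - 1)%Z) in *.
    transitivity (/ om ^ 2 * (2 * (- (4) * PI ^ 2 * K (2 * m + 2)%nat) - (X + Y)))%C; [ring|]. rewrite Es. ring. }
  assert (c 0%Z = / om ^ 2 * (2 * (PI ^ 2 / 3) + 8 * PI ^ 2 * K 1%nat))%C as Hc0.
  { rewrite Hc. change (2 * 0)%Z with 0%Z. change (0 + 1)%Z with (1 * Z.of_nat 1)%Z. change (0 - 1)%Z with (-1 * Z.of_nat 1)%Z.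
    rewrite !Hrho by auto. unfold rho. replace (0 / om)%C with (RtoC 0) by (field; auto). rewrite eisen2_0. field. auto. }
  destruct (cosec_alternating tau' Ht') as [S1 [S2 [E1 E2]]]. fold K in S1, S2, E1, E2.
  assert (forall i, (2 * S i + 1 = 2 * i + 3)%nat) as Ei by (intros; lia).
  assert (summ (fun i => K (2 * i + 3)%nat)) as S3.
  { apply summ_incr in S1. apply summ_ext with (2 := S1). intros i. now rewrite Ei. }
  assert (csum (fun i => K (2 * i + 1)%nat) = K 1%nat + csum (fun i => K (2 * i + 3)%nat))%C as E3.
  { rewrite (csum_head _ S1). f_equal. apply csum_ext. intros i. now rewrite Ei. }
  assert (summ u) as Su by (unfold u; auto 10 using summ_scal, summ_plus).
  assert (csum u = / om ^ 2 * (- (4) * PI ^ 2) * (2 * csum (fun i => K (2 * i + 2)%nat)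
    - csum (fun i => K (2 * i + 3)%nat) - csum (fun i => K (2 * i + 1)%nat)))%C as Eu.
  { unfold u. rewrite csum_scal, csum_plus, csum_plus, !csum_scal by auto 10 using summ_scal, summ_plus. ring. }
  assert (zsum c = c 0%Z + 2 * csum u)%C as EZ.
  { unfold zsum. assert (forall j, zsum_term c j = (match j with O => c 0%Z | S i => u i end) + u j)%C as Et.
    { intros j. unfold zsum_term. apply f_equal2.
      - destruct j as [|i]; [reflexivity|]. rewrite <- (Hcu i 1%Z) by auto.
        now replace (1 * Z.of_nat (S i))%Z with (Z.of_nat (S i)) by lia.
      - rewrite <- (Hcu j (-1)%Z) by auto.
        now replace (-1 * Z.of_nat (S j))%Z with (- Z.of_nat (S j))%Z by lia. }
    rewrite (csum_ext _ _ Et).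
    assert (summ (fun j => match j with O => c 0%Z | S i => u i end)) as Sv by (now apply summ_incr).
    rewrite csum_plus by auto. rewrite (csum_head _ Sv). change (csum (fun n => u n)) with (csum u). ring. }
  rewrite EZ, Hc0, Eu, tE_lambert by auto.
  change (fun m => sgn_pow m * cosec (INR (S m) * tau'))%C with (fun m => sgn_pow m * K (S m))%C. rewrite E2, E3. field. auto.
Qed.

(* Both orders of summation of the lattice sum are evaluated by [cosec_partial_fractions]. *)
Lemma tE_fricke tau tau' : upper tau -> upper tau' -> (tau' * (2 * tau) = - (1))%C ->
  tE tau' = (- (2) * tau ^ 2 * tE tau)%C.
Proof.
  intros Ht Ht' H. destruct (lattice_term_bound _ (upper_2 _ Ht)) as [K [HK HB]].
  pose proof (zFubini _ _ HK HB) as E. rewrite rows_sum, (columns_sum tau tau') in E by auto.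
  assert (tau <> 0)%C as Hn.
  { intros E0. rewrite E0 in H. replace (tau' * (2 * 0))%C with (RtoC 0) in H by ring. injection H. lra. }
  pose proof PI_C_neq_0.
  transitivity (/ (2 * tau) ^ 2 * (2 * PI ^ 2 / 3) * tE tau' * ((2 * tau) ^ 2 * 3 / (2 * PI ^ 2)))%C.
  - field. auto.
  - rewrite <- E. field. auto.
Qed.

(** * Paths in the upper half plane *)

Definition ccont (g : R -> C) (s : R) : Prop :=
  forall eps, 0 < eps -> exists d, 0 < d /\ forall u, Rabs (u - s) < d -> Cmod (g u - g s) < eps.

Lemma ccont_continuous g s : ccont g s <-> continuous (U := C_UniformSpace) g s.
Proof.
  split.
  - intros H. apply filterlim_locally. intros eps. destruct (H eps (cond_pos eps)) as [d [Hd Hb]].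
    exists (mkposreal d Hd). intros u Hu. specialize (Hb u Hu).
    split; [eapply Rle_lt_trans; [|apply Hb]; apply (re_le_Cmod (g u - g s))
           |eapply Rle_lt_trans; [|apply Hb]; apply (Im_le_Cmod (g u - g s))].
  - intros H eps He. pose proof (proj1 (filterlim_locally g (g s)) H (mkposreal (eps / 2) ltac:(lra))) as [d Hd].
    exists d. split; [apply cond_pos|]. intros u Hu. destruct (Hd u Hu) as [H1 H2].
    eapply Rle_lt_trans; [apply Cmod_le_abs|].
    change (Rabs (Re (g u - g s)) < eps / 2) in H1. change (Rabs (Im (g u - g s)) < eps / 2) in H2. lra.
Qed.

Lemma ccont_continuous_R g s : ccont g s -> continuous (U := C_R_CompleteNormedModule) g s.
Proof. apply ccont_continuous. Qed.

Lemma is_dpath_ccont g s l : is_dpath g s l -> ccont g s.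
Proof.
  intros H eps He. destruct (proj1 (is_dpath_eps g s l) H 1 Rlt_0_1) as [d [Hd Hb]].
  pose proof (Cmod_ge_0 l). exists (Rmin d (eps / (Cmod l + 2))).
  split; [apply Rmin_glb_lt; auto; apply Rdiv_lt_0_compat; lra|]. intros u Hu.
  apply Rmin_Rgt_l in Hu. destruct Hu as [Hu1 Hu2]. specialize (Hb u Hu1).
  pose proof (Cmod_triangle (g u - g s - (u - s)%R * l) ((u - s)%R * l)) as Ht.
  replace (g u - g s - (u - s)%R * l + (u - s)%R * l)%C with (g u - g s)%C in Ht by ring.
  rewrite Cmod_mult, Cmod_R in Ht. pose proof (Rabs_pos (u - s)).
  apply (Rmult_lt_compat_r (Cmod l + 2)) in Hu2; [|lra].
  unfold Rdiv in Hu2. rewrite Rmult_assoc, Rinv_l, Rmult_1_r in Hu2; lra.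
Qed.

Lemma ccont_const c s : ccont (fun _ => c) s.
Proof.
  intros eps He. exists 1. split; [lra|]. intros. replace (c - c)%C with (RtoC 0) by ring. now rewrite Cmod_0.
Qed.

Lemma ccont_ext f g s : (forall u, f u = g u) -> ccont f s -> ccont g s.
Proof.
  intros H Hf eps He. destruct (Hf eps He) as [d [Hd Hb]]. exists d. split; auto. intros. rewrite <- !H. auto.
Qed.

Lemma ccont_plus f g s : ccont f s -> ccont g s -> ccont (fun u => f u + g u)%C s.
Proof.
  intros Hf Hg eps He. destruct (Hf (eps / 2)) as [d1 [Hd1 H1]]; [lra|]. destruct (Hg (eps / 2)) as [d2 [Hd2 H2]]; [lra|].
  exists (Rmin d1 d2). split; [now apply Rmin_glb_lt|]. intros u Hu. apply Rmin_Rgt_l in Hu. destruct Hu.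
  specialize (H1 u ltac:(auto)). specialize (H2 u ltac:(auto)).
  replace (f u + g u - (f s + g s))%C with ((f u - f s) + (g u - g s))%C by ring.
  eapply Rle_lt_trans; [apply Cmod_triangle|]. lra.
Qed.

Lemma ccont_mult f g s : ccont f s -> ccont g s -> ccont (fun u => f u * g u)%C s.
Proof.
  intros Hf Hg eps He.
  pose proof (Cmod_ge_0 (f s)). pose proof (Cmod_ge_0 (g s)).
  set (e1 := Rmin 1 (eps / (2 * (Cmod (g s) + 1)))). set (e2 := eps / (2 * (Cmod (f s) + 1))).
  assert (0 < e1) by (apply Rmin_glb_lt; [lra|apply Rdiv_lt_0_compat; lra]).
  assert (0 < e2) by (apply Rdiv_lt_0_compat; lra).
  destruct (Hf e1) as [d1 [Hd1 H1']]; auto. destruct (Hg e2) as [d2 [Hd2 H2']]; auto.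
  exists (Rmin d1 d2). split; [now apply Rmin_glb_lt|]. intros u Hu. apply Rmin_Rgt_l in Hu. destruct Hu.
  specialize (H1' u ltac:(auto)). specialize (H2' u ltac:(auto)).
  replace (f u * g u - f s * g s)%C with (f u * (g u - g s) + (f u - f s) * g s)%C by ring.
  eapply Rle_lt_trans; [apply Cmod_triangle|]. rewrite !Cmod_mult.
  pose proof (Rmin_l 1 (eps / (2 * (Cmod (g s) + 1)))). pose proof (Rmin_r 1 (eps / (2 * (Cmod (g s) + 1)))).
  fold e1 in H5, H6.
  assert (Cmod (f u) <= Cmod (f s) + 1) as Hfu.
  { pose proof (Cmod_triangle_rev (f u) (f s)). lra. }
  pose proof (Cmod_ge_0 (g u - g s)). pose proof (Cmod_ge_0 (f u - f s)).
  assert (Cmod (f u) * Cmod (g u - g s) <= (Cmod (f s) + 1) * Cmod (g u - g s)) by (apply Rmult_le_compat_r; auto).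
  assert ((Cmod (f s) + 1) * Cmod (g u - g s) < eps / 2).
  { apply Rlt_le_trans with ((Cmod (f s) + 1) * e2); [apply Rmult_lt_compat_l; lra|]. unfold e2. right. field. lra. }
  assert (Cmod (f u - f s) * Cmod (g s) <= eps / 2).
  { apply Rle_trans with (eps / (2 * (Cmod (g s) + 1)) * (Cmod (g s) + 1)); [|right; field; lra].
    apply Rmult_le_compat; auto; lra. }
  lra.
Qed.

Lemma ccont_cd f g s (l : C) : cd f (g s) l -> ccont g s -> ccont (fun u => f (g u)) s.
Proof.
  intros Hf Hg eps He. destruct (cd_lip _ _ _ Hf) as [L [d [HL [Hd Hl]]]].
  destruct (Hg (Rmin d (eps / (L + 1)))) as [d1 [Hd1 H1]].
  { apply Rmin_glb_lt; auto. apply Rdiv_lt_0_compat; lra. }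
  exists d1. split; auto. intros u Hu. specialize (H1 u Hu). apply Rmin_Rgt_l in H1. destruct H1 as [H1 H2].
  eapply Rle_lt_trans; [apply Hl; auto|]. pose proof (Cmod_ge_0 (g u - g s)).
  apply (Rmult_lt_compat_r (L + 1)) in H2; [|lra].
  unfold Rdiv in H2. rewrite Rmult_assoc, Rinv_l, Rmult_1_r in H2; lra.
Qed.

Lemma is_dpath_Re g s l : is_dpath g s l -> is_derive (fun u => Re (g u)) s (Re l).
Proof.
  intros H. apply is_derive_Reals. intros eps He.
  destruct (proj1 (is_dpath_eps g s l) H (eps / 2)) as [d [Hd Hb]]; [lra|]. exists (mkposreal d Hd). intros h Hh0 Hh.
  specialize (Hb (s + h)). replace (s + h - s) with h in Hb by ring. specialize (Hb Hh).
  assert (0 < Rabs h) as Hp by (now apply Rabs_pos_lt).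
  replace ((Re (g (s + h)%R) - Re (g s)) / h - Re l) with (Re (g (s + h)%R - g s - h * l) / h).
  2:{ destruct (g (s + h)%R), (g s), l; simpl. field. auto. }
  unfold Rdiv. rewrite Rabs_mult, Rabs_inv.
  apply (Rmult_lt_reg_r (Rabs h)); auto. rewrite Rmult_assoc, Rinv_l, Rmult_1_r by lra.
  eapply Rle_lt_trans; [apply re_le_Cmod|]. nra.
Qed.

Lemma is_dpath_Im g s l : is_dpath g s l -> is_derive (fun u => Im (g u)) s (Im l).
Proof.
  intros H. apply is_derive_Reals. intros eps He.
  destruct (proj1 (is_dpath_eps g s l) H (eps / 2)) as [d [Hd Hb]]; [lra|]. exists (mkposreal d Hd). intros h Hh0 Hh.
  specialize (Hb (s + h)). replace (s + h - s) with h in Hb by ring. specialize (Hb Hh).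
  assert (0 < Rabs h) as Hp by (now apply Rabs_pos_lt).
  replace ((Im (g (s + h)%R) - Im (g s)) / h - Im l) with (Im (g (s + h)%R - g s - h * l) / h).
  2:{ destruct (g (s + h)%R), (g s), l; simpl. field. auto. }
  unfold Rdiv. rewrite Rabs_mult, Rabs_inv.
  apply (Rmult_lt_reg_r (Rabs h)); auto. rewrite Rmult_assoc, Rinv_l, Rmult_1_r by lra.
  eapply Rle_lt_trans; [apply Im_le_Cmod|]. nra.
Qed.

Lemma is_dpath_components g s (l : C) : is_derive (fun u => Re (g u)) s (Re l) ->
  is_derive (fun u => Im (g u)) s (Im l) -> is_dpath g s l.
Proof.
  intros Hr Hi. apply is_derive_Reals in Hr, Hi. apply is_dpath_eps. intros eps He.
  destruct (Hr (eps / 2)) as [d1 H1]; [lra|]. destruct (Hi (eps / 2)) as [d2 H2]; [lra|].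
  exists (Rmin d1 d2). split; [apply Rmin_glb_lt; apply cond_pos|]. intros u Hu.
  apply Rmin_Rgt_l in Hu. destruct Hu as [Hu1 Hu2].
  destruct (Req_dec u s) as [->|Hne].
  { replace (g s - g s - (s - s)%R * l)%C with (RtoC 0) by (rewrite Rminus_diag; ring). rewrite Cmod_0, Rminus_diag, Rabs_R0. lra. }
  set (h := u - s) in *. assert (h <> 0) as Hh by (unfold h; lra). assert (0 < Rabs h) as Hp by (now apply Rabs_pos_lt).
  specialize (H1 h Hh Hu1). specialize (H2 h Hh Hu2). replace (s + h) with u in * by (unfold h; ring).
  eapply Rle_trans; [apply Cmod_le_abs|].
  replace (Re (g u - g s - h * l)) with (((Re (g u) - Re (g s)) / h - Re l) * h).
  2:{ destruct (g u), (g s), l; simpl. field. auto. }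
  replace (Im (g u - g s - h * l)) with (((Im (g u) - Im (g s)) / h - Im l) * h).
  2:{ destruct (g u), (g s), l; simpl. field. auto. }
  rewrite !Rabs_mult. nra.
Qed.

Lemma velocity_eq g s l : is_dpath g s l -> velocity g s = l.
Proof.
  intros H. unfold velocity. transitivity (Re l, Im l); [f_equal; apply is_derive_unique|now destruct l].
  - now apply is_dpath_Re. - now apply is_dpath_Im.
Qed.

Lemma const_of_derive_0 (f : R -> R) a b : (forall s, a < s < b -> is_derive f s 0) ->
  forall s t, a < s < b -> a < t < b -> f s = f t.
Proof.
  intros H s t Hs Ht.
  destruct (MVT_gen f s t (fun _ => 0)) as [c [_ E]].
  - intros x Hx. apply H. revert Hx; unfold Rmin, Rmax; destruct (Rle_dec s t); lra.
  - intros x Hx. apply continuity_pt_filterlim, (ex_derive_continuous f). exists 0. apply H.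
    revert Hx; unfold Rmin, Rmax; destruct (Rle_dec s t); lra.
  - lra.
Qed.

Lemma is_RInt_dpath (P : R -> C) (f : R -> C) a b :
  (forall s, Rmin a b <= s <= Rmax a b -> is_dpath P s (f s)) ->
  (forall s, Rmin a b <= s <= Rmax a b -> ccont f s) ->
  is_RInt (V := C_R_CompleteNormedModule) f a b (P b - P a)%C.
Proof.
  intros H Hc. apply (is_RInt_derive (V := C_R_CompleteNormedModule) P f a b H).
  intros x Hx. apply ccont_continuous_R. auto.
Qed.

Lemma ex_RInt_ccont (f : R -> C) a b : (forall s, Rmin a b <= s <= Rmax a b -> ccont f s) ->
  ex_RInt (V := C_R_CompleteNormedModule) f a b.
Proof. intros H. apply ex_RInt_continuous. intros. apply ccont_continuous_R; auto. Qed.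

Lemma RInt_bound (f : R -> C) a b M (l : C) : a <= b -> (forall s, a <= s <= b -> Cmod (f s) <= M) ->
  is_RInt (V := C_R_CompleteNormedModule) f a b l -> Cmod l <= (b - a) * M.
Proof.
  intros Hab HM Hl. rewrite <- norm_C_R.
  apply (norm_RInt_le (V := C_R_NormedModule) f (fun _ => M) a b l ((b - a) * M)); auto.
  - intros x Hx. rewrite norm_C_R. auto.
  - apply (is_RInt_const (V := R_NormedModule)).
Qed.

Lemma is_RInt_Cplus (f g : R -> C) a b (l m : C) :
  is_RInt (V := C_R_CompleteNormedModule) f a b l -> is_RInt (V := C_R_CompleteNormedModule) g a b m ->
  is_RInt (V := C_R_CompleteNormedModule) (fun s => f s + g s)%C a b (l + m)%C.
Proof. apply (is_RInt_plus (V := C_R_NormedModule)). Qed.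

Lemma is_RInt_Cminus (f g : R -> C) a b (l m : C) :
  is_RInt (V := C_R_CompleteNormedModule) f a b l -> is_RInt (V := C_R_CompleteNormedModule) g a b m ->
  is_RInt (V := C_R_CompleteNormedModule) (fun s => f s - g s)%C a b (l - m)%C.
Proof. apply (is_RInt_minus (V := C_R_NormedModule)). Qed.

(** * The geodesic *)

Lemma csum_conj u : summ u -> csum (fun n => Cconj (u n)) = Cconj (csum u).
Proof.
  intros H. apply csum_unique. intros eps He. destruct (summ_CL u H eps He) as [N HN].
  exists N. intros n Hn. specialize (HN n Hn). rewrite <- Cmod_conj, Cminus_conj, Cconj_conj.
  replace (Cconj (psum (fun n => Cconj (u n)) n)) with (psum u n); auto.
  clear. induction n; simpl; [now rewrite <- RtoC_opp, Ropp_0 || (unfold Cconj, RtoC; simpl; f_equal; ring)|].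
  now rewrite Cplus_conj, Cconj_conj, <- IHn.
Qed.

Lemma expo_conj k tau : expo k (- Cconj tau) = Cconj (expo k tau).
Proof.
  unfold expo. rewrite Cexp_conj. f_equal. destruct tau as [x y].
  unfold Cconj, RtoC, Ci, Cmult, Copp; simpl. f_equal; ring.
Qed.

Lemma upper_conj tau : upper tau -> upper (- Cconj tau).
Proof. unfold upper. destruct tau; simpl. intros; lra. Qed.

(** The coefficients are real, and passing from tau to - conj tau conjugates every exponential. *)
Lemma eseries_conj al k tau : admissible al k -> (forall n, Cconj (al n) = al n) -> upper tau ->
  eseries al k (- Cconj tau) = Cconj (eseries al k tau).
Proof.
  intros Ha Hr Ht. unfold eseries. rewrite <- csum_conj by (now apply eseries_summ).
  apply csum_ext. intros n. now rewrite Cmult_conj, Hr, expo_conj.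
Qed.

Lemma Cconj_R (x : R) : Cconj x = RtoC x.
Proof. unfold Cconj, RtoC; simpl. f_equal. ring. Qed.

Lemma theta_coef_conj (e : R) n : Cconj (theta_coef e n) = theta_coef e n.
Proof.
  destruct n; simpl; [apply Cconj_R|]. now rewrite !Cmult_conj, Cpow_conj, !Cconj_R.
Qed.

Lemma thetas_conj tau : upper tau -> th2 (- Cconj tau) = Cconj (th2 tau) /\
  th3 (- Cconj tau) = Cconj (th3 tau) /\ th4 (- Cconj tau) = Cconj (th4 tau).
Proof.
  intros Ht. split; [|split]; apply eseries_conj; auto.
  - apply admissible_th2. - intros; apply Cconj_R.
  - apply admissible_theta, Cmod_1. - apply (theta_coef_conj 1).
  - apply admissible_theta, Cmod_m1. - replace (- (1))%C with (RtoC (-1)) by ring. apply theta_coef_conj.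
Qed.

Lemma tE_conj tau : upper tau -> tE (- Cconj tau) = Cconj (tE tau).
Proof.
  intros Ht. destruct (thetas_conj tau Ht) as [E2 [E3 E4]]. unfold tE, ta, tc.
  now rewrite E2, E3, Cplus_conj, !Cpow_conj.
Qed.

Lemma theta_period e tau : eseries (theta_coef e) sq (tau + 1) = eseries (theta_coef e) sq tau.
Proof.
  apply csum_ext. intros n. rewrite expo_add. unfold sq at 2. rewrite <- mult_INR, expo_int. ring.
Qed.

Lemma ta_period tau : ta (tau + 1) = ta tau.
Proof. unfold ta, th3. now rewrite theta_period. Qed.

Lemma tb_period tau : tb (tau + 1) = tb tau.
Proof. unfold tb, th4. now rewrite theta_period. Qed.

Lemma Ci_sq : (Ci ^ 2 = - (1))%C.
Proof. unfold Cpow, Ci, RtoC, Cmult, Copp; simpl; f_equal; ring. Qed.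

(** (n + 1/2)^2 is 1/4 modulo 1, so [th2] acquires the factor i. *)
Lemma tc_period tau : upper tau -> tc (tau + 1) = (- tc tau)%C.
Proof.
  intros H. unfold tc, th2.
  assert (eseries (fun _ => RtoC 2) sq_half (tau + 1) = Ci * eseries (fun _ => RtoC 2) sq_half tau)%C as ->.
  { unfold eseries. rewrite <- csum_scal by (apply eseries_summ; auto using admissible_th2).
    apply csum_ext. intros n. rewrite expo_add.
    assert (expo (sq_half n) 1 = Ci) as ->; [|ring].
    rewrite <- (expo_odd_sq n). unfold expo. f_equal. replace (sq_half n) with (sq (2 * n + 1) / 4).
    - rewrite RtoC_div by lra. field.
    - unfold sq, sq_half. rewrite plus_INR, mult_INR. simpl. field. }
  replace ((Ci * eseries (fun _ => RtoC 2) sq_half tau) ^ 2)%C with (Ci ^ 2 * eseries (fun _ => RtoC 2) sq_half tau ^ 2)%C by ring.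
  rewrite Ci_sq. ring.
Qed.

(* [tG] is the hypergeometric series 3F2(1/2, 1/2, 1/2; 1, 1; t2) near the cusp, and [tH] is
   its complex conjugate on the geodesic. *)
Definition tG (tau : C) : C := (tb tau ^ 2)%C.
Definition tH (tau : C) : C := (- (4) * tau ^ 2 * (tc tau * ta tau))%C.

Lemma t2_thetas tau : upper tau -> t2 tau = (- (4) * ta tau ^ 2 * tc tau ^ 2 / tb tau ^ 4)%C.
Proof. intros Ht. now destruct (eta_thetas tau Ht) as [_ [_ [-> _]]]. Qed.

(** From (a^2 + c^2)^2 = (a^2 - c^2)^2 + 4 a^2 c^2 and Jacobi's a^2 - c^2 = b^2. *)
Lemma tE_sq tau : upper tau -> (tE tau ^ 2 = tG tau ^ 2 * (1 - t2 tau))%C.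
Proof.
  intros Ht. destruct (tabc_neq_0 _ Ht) as [_ [Hb _]].
  rewrite t2_thetas by auto. unfold tG, tE. pose proof (jacobi_quartic tau Ht) as J.
  transitivity ((ta tau ^ 2 - tc tau ^ 2) ^ 2 + 4 * ta tau ^ 2 * tc tau ^ 2)%C; [ring|].
  replace (ta tau ^ 2 - tc tau ^ 2)%C with (tb tau ^ 2)%C by (rewrite J; ring). field. auto.
Qed.

Lemma tE_period tau : upper tau -> tE (tau + 1) = tE tau.
Proof. intros Ht. unfold tE. rewrite ta_period, tc_period by auto. ring. Qed.

Lemma tG_period tau : tG (tau + 1) = tG tau.
Proof. unfold tG. now rewrite tb_period. Qed.

Lemma t2_period tau : upper tau -> t2 (tau + 1) = t2 tau.
Proof.
  intros Ht. rewrite !t2_thetas; auto.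
  - rewrite ta_period, tb_period, tc_period by auto. unfold Cdiv. ring.
  - apply upper_real; auto.
Qed.

Lemma upper_z_start : upper z_start. Proof. unfold upper, z_start; simpl; lra. Qed.
Lemma upper_z_end : upper z_end. Proof. unfold upper, z_end; simpl; lra. Qed.

Lemma z_start_end : z_start = (z_end + 1)%C.
Proof. unfold z_start, z_end, Cplus, RtoC; simpl. f_equal; field. Qed.

(** [z_end] is both -1 / (2 z_start) and z_start - 1. So the Fricke relation and the period compare
    E with itself there, with the factor - 2 z_start^2 = - i, which differs from 1. *)
Lemma tE_z_start : tE z_start = RtoC 0.
Proof.
  assert (z_end * (2 * z_start) = - (1))%C as H.
  { unfold z_start, z_end, Cmult, RtoC, Copp; simpl. f_equal; field. }
  pose proof (tE_fricke z_start z_end upper_z_start upper_z_end H) as E.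
  rewrite z_start_end in E at 2. rewrite tE_period in E by apply upper_z_end.
  rewrite z_start_end, tE_period by apply upper_z_end.
  assert (- (2) * z_start ^ 2 = - Ci)%C as E2.
  { unfold z_start, Ci, Cpow, Cmult, RtoC, Copp; simpl. f_equal; field. }
  rewrite E2 in E.
  apply (Cmult_cancel_l (1 + Ci)%C).
  - intros Q. injection Q. lra.
  - transitivity (tE z_end - - Ci * tE z_end)%C; [ring|]. rewrite <- E. ring.
Qed.

Lemma t2_z_start : t2 z_start = RtoC 1.
Proof.
  pose proof (tE_sq _ upper_z_start) as E. rewrite tE_z_start in E.
  destruct (tabc_neq_0 _ upper_z_start) as [_ [Hb _]].
  assert (tG z_start ^ 2 <> 0)%C as HG by (unfold tG; auto using Cpow_nz).
  assert (1 - t2 z_start = 0)%C as E1.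
  { apply (Cmult_cancel_l (tG z_start ^ 2)%C); auto. rewrite <- E. ring. }
  transitivity (1 - (1 - t2 z_start))%C; [ring|]. rewrite E1. ring.
Qed.

Lemma sqrt2_pos : 0 < sqrt 2.
Proof. apply sqrt_lt_R0. lra. Qed.

Lemma sqrt2_sq : sqrt 2 * sqrt 2 = 2.
Proof. apply sqrt_sqrt. lra. Qed.

Lemma geodesic_upper s : 0 < s < PI -> upper (geodesic s).
Proof.
  intros Hs. unfold upper, geodesic; simpl. apply Rdiv_lt_0_compat; [apply sin_gt_0; lra|apply sqrt2_pos].
Qed.

Lemma geodesic_dpath s : is_dpath geodesic s (Ci * geodesic s)%C.
Proof.
  pose proof sqrt2_pos. apply is_dpath_components; simpl.
  - replace (0 * (cos s / sqrt 2) - 1 * (sin s / sqrt 2)) with (- sin s / sqrt 2) by (field; lra).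
    auto_derive; auto. field. lra.
  - replace (0 * (sin s / sqrt 2) + 1 * (cos s / sqrt 2)) with (cos s / sqrt 2) by (field; lra).
    auto_derive; auto. field. lra.
Qed.

(** On |z|^2 = 1/2 the Fricke involution z -> -1 / (2 z) is the reflection z -> - conj z. *)
Lemma geodesic_conj s : (- Cconj (geodesic s) * (2 * geodesic s) = - (1))%C.
Proof.
  pose proof sqrt2_pos. unfold geodesic, Cconj, Cmult, RtoC, Copp; simpl. pose proof sqrt2_sq as H2.
  pose proof (sin2_cos2 s) as Hsc. unfold Rsqr in Hsc. f_equal; [|field; lra].
  transitivity (- 2 * (sin s * sin s + cos s * cos s) / (sqrt 2 * sqrt 2)); [field; lra|]. rewrite Hsc, H2. field.
Qed.

Lemma geodesic_start : geodesic (PI / 4) = z_start.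
Proof.
  unfold geodesic, z_start. rewrite cos_PI4, sin_PI4. pose proof sqrt2_pos. pose proof sqrt2_sq.
  f_equal; transitivity (1 / (sqrt 2 * sqrt 2)); try (field; lra); now rewrite H0.
Qed.

Lemma geodesic_end : geodesic (3 * PI / 4) = z_end.
Proof.
  unfold geodesic, z_end. replace (3 * PI / 4) with (3 * (PI / 4)) by field.
  rewrite cos_3PI4, sin_3PI4. pose proof sqrt2_pos. pose proof sqrt2_sq.
  f_equal; [transitivity (- (1 / (sqrt 2 * sqrt 2)))|transitivity (1 / (sqrt 2 * sqrt 2))]; try (field; lra); now rewrite H0.
Qed.

Lemma tE_geodesic s : 0 < s < PI -> Cconj (tE (geodesic s)) = (- (2) * geodesic s ^ 2 * tE (geodesic s))%C.
Proof.
  intros Hs. pose proof (geodesic_upper s Hs) as Hu. rewrite <- tE_conj by auto.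
  apply tE_fricke; auto using upper_conj, geodesic_conj.
Qed.

Lemma geodesic_tE_imaginary s : 0 < s < PI -> Re (geodesic s * tE (geodesic s)) = 0.
Proof.
  intros Hs. assert (Cconj (geodesic s * tE (geodesic s)) = - (geodesic s * tE (geodesic s)))%C as E.
  { rewrite Cmult_conj, tE_geodesic by auto.
    transitivity (- Cconj (geodesic s) * (2 * geodesic s) * (geodesic s * tE (geodesic s)))%C; [ring|].
    rewrite geodesic_conj. ring. }
  apply (f_equal Re) in E. rewrite re_conj in E.
  replace (Re (- (geodesic s * tE (geodesic s)))) with (- Re (geodesic s * tE (geodesic s))) in E by reflexivity. lra.
Qed.

Lemma tangential_derivative (T e : C) : Re e = 0 ->
  (Re (- (2) * PI * (T * e)) * Re T + Re T * Re (- (2) * PI * (T * e)))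
  + (Im (- (2) * PI * (T * e)) * Im T + Im T * Im (- (2) * PI * (T * e))) = 0.
Proof. destruct T, e. simpl. intros ->. ring. Qed.

(** The derivative of t along the arc is - 2 pi t (z E) with z E imaginary, so t moves tangentially
    to its circle about 0; and t = 1 at [z_start]. *)
Lemma geodesic_t2 s : 0 < s < PI -> Cmod (t2 (geodesic s)) = 1.
Proof.
  intros Hs. set (f := fun u => Re (t2 (geodesic u)) ^ 2 + Im (t2 (geodesic u)) ^ 2).
  assert (f s = f (PI / 4)) as E.
  { apply const_of_derive_0 with 0 PI; auto; [|pose proof PI_RGT_0; lra]. intros u Hu.
    pose proof (geodesic_upper u Hu) as Hg. pose proof (geodesic_tE_imaginary u Hu) as Him.
    pose proof (cd_path t2 geodesic u _ _ (cd_t2 _ Hg) (geodesic_dpath u)) as Hd.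
    set (l := (kap * (t2 (geodesic u) * tE (geodesic u)) * (Ci * geodesic u))%C) in *.
    assert (l = - (2) * PI * (t2 (geodesic u) * (geodesic u * tE (geodesic u))))%C as El.
    { unfold l, kap. transitivity (Ci ^ 2 * 2 * PI * (t2 (geodesic u) * (geodesic u * tE (geodesic u))))%C; [ring|].
      rewrite Ci_sq. ring. }
    rewrite El in Hd. clear El l.
    pose proof (is_dpath_Re _ _ _ Hd) as Hr. pose proof (is_dpath_Im _ _ _ Hd) as Hi.
    unfold f. apply (is_derive_ext (fun u => Re (t2 (geodesic u)) * Re (t2 (geodesic u)) + Im (t2 (geodesic u)) * Im (t2 (geodesic u)))).
    { intros v. generalize (Re (t2 (geodesic v))) (Im (t2 (geodesic v))). intros x y.
      change (x * x + y * y = x ^ 2 + y ^ 2). ring. }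
    set (T := t2 (geodesic u)) in *. set (e := (geodesic u * tE (geodesic u))%C) in *.
    match type of Hr with is_derive _ _ ?a => set (lr := a) in * end.
    match type of Hi with is_derive _ _ ?a => set (li := a) in * end.
    replace 0 with ((lr * Re T + Re T * lr) + (li * Im T + Im T * li)).
    - apply (is_derive_plus (V := R_NormedModule)); apply (is_derive_mult (K := R_AbsRing)); auto; intros; apply Rmult_comm.
    - now apply tangential_derivative. }
  unfold f in E. rewrite <- !Cmod2_alt, geodesic_start, t2_z_start, Cmod_1 in E.
  pose proof (Cmod_ge_0 (t2 (geodesic s))). nra.
Qed.

Lemma cd_tE tau : upper tau -> cd tE tau (kap * (2 * th tau * tE tau + 2 * ta tau ^ 2 * tc tau ^ 2))%C.
Proof.
  intros Ht. eapply cd_eq; [apply cd_plus; apply cd_sq; [now apply cd_ta'|now apply cd_tc']|].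
  unfold tE. field.
Qed.

Lemma ccont_conj g s : ccont g s -> ccont (fun u => Cconj (g u)) s.
Proof.
  intros H eps He. destruct (H eps He) as [d [Hd Hb]]. exists d. split; auto. intros u Hu.
  rewrite <- Cminus_conj, Cmod_conj. auto.
Qed.

Lemma ccont_geodesic_cd f s (l : C) : cd f (geodesic s) l -> ccont (fun u => f (geodesic u)) s.
Proof. intros H. eapply ccont_cd; eauto. eapply is_dpath_ccont, geodesic_dpath. Qed.

Lemma cd_tG tau : upper tau -> cd tG tau (kap * (2 * th tau * tG tau))%C.
Proof.
  intros Ht. eapply cd_eq; [apply cd_sq, cd_tb', Ht|]. unfold tG. ring.
Qed.

Lemma cd_tH tau : upper tau -> cd tH tau
  (- (4) * (2 * tau * (tc tau * ta tau) + tau ^ 2 * (kap * (tc tau * ta tau * (2 * th tau + tE tau / 2)))))%C.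
Proof.
  intros Ht. apply cd_ext with (fun w => - (4) * (w ^ 2 * (tc w * ta w)))%C; [intros; unfold tH; ring|].
  eapply cd_eq; [apply cd_scal, cd_mult; [apply cd_sq, cd_id|apply cd_mult; [now apply cd_tc'|now apply cd_ta']]|].
  unfold tE. field.
Qed.

Lemma tH_neq_0 tau : upper tau -> tH tau <> RtoC 0.
Proof.
  intros Ht. destruct (tabc_neq_0 _ Ht) as [Ha [_ Hc]]. unfold tH.
  assert (tau <> 0)%C as H0. { intros E. unfold upper in Ht. rewrite E in Ht. simpl in Ht. lra. }
  apply Cmult_neq_0; [apply Cmult_neq_0; [|now apply Cpow_nz]|now apply Cmult_neq_0].
  intros E. injection E. lra.
Qed.

Lemma tH_sq tau : upper tau -> (tH tau ^ 2 = - (4) * tau ^ 4 * t2 tau * tG tau ^ 2)%C.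
Proof.
  intros Ht. destruct (tabc_neq_0 _ Ht) as [Ha [Hb Hc]]. rewrite t2_thetas by auto. unfold tH, tG. field. auto.
Qed.

(** Conjugating E^2 = G^2 (1 - t) and using conj t = 1 / t gives the claim multiplied by E^2. If it
    failed at s, E would vanish on an interval around s by continuity; but at a zero of E its
    derivative is a non-zero multiple of a^2 c^2. *)
Lemma geodesic_tG_sq s : 0 < s < PI -> (Cconj (tG (geodesic s)) ^ 2 = tH (geodesic s) ^ 2)%C.
Proof.
  intros Hs.
  set (D := fun u => (Cconj (tG (geodesic u)) ^ 2 - tH (geodesic u) ^ 2)%C).
  assert (forall u, 0 < u < PI -> tE (geodesic u) ^ 2 * D u = 0)%C as HD.
  { intros u Hu. pose proof (geodesic_upper u Hu) as Hg. set (z := geodesic u) in *.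
    pose proof (tE_sq z Hg) as E. pose proof (geodesic_t2 u Hu) as Hm. fold z in Hm.
    assert (Cconj (t2 z) * t2 z = 1)%C as Ht.
    { pose proof (Cmod2_conj (t2 z)) as H. rewrite Hm in H. rewrite Cmult_comm, <- H. f_equal. ring. }
    pose proof (tE_geodesic u Hu) as Ec. fold z in Ec.
    assert (Cconj (tE z) ^ 2 = Cconj (tG z) ^ 2 * (1 - Cconj (t2 z)))%C as Econj.
    { rewrite <- !Cpow_conj, E, Cmult_conj, Cminus_conj, Cconj_R. auto. }
    rewrite Ec in Econj. unfold D. fold z. rewrite tH_sq by auto.
    assert (Cconj (tG z) ^ 2 * (1 - t2 z) = - (4 * z ^ 4 * t2 z * tE z ^ 2))%C as A.
    { transitivity (- (Cconj (tG z) ^ 2 * (t2 z - Cconj (t2 z) * t2 z)))%C; [rewrite Ht; ring|].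
      transitivity (- (t2 z * (Cconj (tG z) ^ 2 * (1 - Cconj (t2 z)))))%C; [ring|]. rewrite <- Econj. ring. }
    transitivity (tG z ^ 2 * (Cconj (tG z) ^ 2 * (1 - t2 z)) + tE z ^ 2 * (4 * z ^ 4 * t2 z * tG z ^ 2))%C.
    - transitivity ((tG z ^ 2 * (1 - t2 z)) * Cconj (tG z) ^ 2 + tE z ^ 2 * (4 * z ^ 4 * t2 z * tG z ^ 2))%C; [|ring].
      rewrite <- E. ring.
    - rewrite A. ring. }
  apply NNPP. intros Hne.
  assert (D s <> 0)%C as HDs.
  { intros E. apply Hne. unfold D in E. transitivity (Cconj (tG (geodesic s)) ^ 2 - tH (geodesic s) ^ 2 + tH (geodesic s) ^ 2)%C; [ring|]. rewrite E. ring. }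
  pose proof (geodesic_upper s Hs) as Hg.
  assert (ccont D s) as HDc.
  { unfold D. apply ccont_ext with (fun u => Cconj (tG (geodesic u)) * Cconj (tG (geodesic u)) + (- (1)) * (tH (geodesic u) * tH (geodesic u)))%C.
    { intros; ring. }
    pose proof (ccont_geodesic_cd tG s _ (cd_tG _ Hg)) as H1. pose proof (ccont_geodesic_cd tH s _ (cd_tH _ Hg)) as H2.
    apply ccont_plus; [apply ccont_mult; now apply ccont_conj|]. apply ccont_mult; [apply ccont_const|now apply ccont_mult]. }
  destruct (HDc (Cmod (D s)) (proj1 (Cmod_gt_0 _) HDs)) as [d [Hd Hb]].
  set (r := Rmin d (Rmin s (PI - s))). assert (0 < r) as Hr by (unfold r; repeat apply Rmin_glb_lt; lra).
  assert (forall u, Rabs (u - s) < r -> tE (geodesic u) = RtoC 0) as HE0.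
  { intros u Hu. unfold r in Hu. apply Rmin_Rgt_l in Hu. destruct Hu as [Hu1 Hu]. apply Rmin_Rgt_l in Hu. destruct Hu as [Hu2 Hu3].
    assert (0 < u < PI) as Hup by (apply Rabs_def2 in Hu2; apply Rabs_def2 in Hu3; lra).
    specialize (Hb u Hu1). specialize (HD u Hup).
    assert (D u <> 0)%C as Hdu.
    { intros E. rewrite E in Hb. replace (0 - D s)%C with (- D s)%C in Hb by ring. rewrite Cmod_opp in Hb. lra. }
    apply NNPP. intros Hn. apply (Cmult_neq_0 (tE (geodesic u) ^ 2) (D u)); auto using Cpow_nz. }
  assert (tE (geodesic s) = RtoC 0) as E0 by (apply HE0; rewrite Rminus_diag, Rabs_R0; auto).
  pose proof (cd_path tE geodesic s _ _ (cd_tE _ Hg) (geodesic_dpath s)) as Hdp.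
  rewrite E0 in Hdp. set (z := geodesic s) in *.
  set (l := (kap * (2 * th z * 0 + 2 * ta z ^ 2 * tc z ^ 2) * (Ci * z))%C) in *.
  assert (l <> 0)%C as Hl.
  { destruct (tabc_neq_0 _ Hg) as [Ha [_ Hc]]. unfold l.
    assert (z <> 0)%C as H0. { intros E. unfold upper in Hg. rewrite E in Hg. simpl in Hg. lra. }
    apply Cmult_neq_0; [|apply Cmult_neq_0; auto using Ci_neq_0].
    apply Cmult_neq_0; [apply kap_neq_0|]. replace (2 * th z * 0 + 2 * ta z ^ 2 * tc z ^ 2)%C with (2 * ta z ^ 2 * tc z ^ 2)%C by ring.
    apply Cmult_neq_0; [apply Cmult_neq_0|]; auto using Cpow_nz. intros E; injection E; lra. }
  apply Cmod_gt_0 in Hl.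
  destruct (proj1 (is_dpath_eps _ _ _) Hdp (Cmod l / 2)) as [d2 [Hd2 Hb2]]; [lra|].
  set (e := Rmin r d2 / 2). pose proof (Rmin_l r d2). pose proof (Rmin_r r d2).
  assert (0 < Rmin r d2) by (now apply Rmin_glb_lt).
  assert (Rabs (s + e - s) = e) as Ee by (replace (s + e - s) with e by ring; apply Rabs_pos_eq; unfold e; lra).
  specialize (Hb2 (s + e)). rewrite Ee in Hb2. specialize (Hb2 ltac:(unfold e; lra)).
  rewrite (HE0 (s + e)) in Hb2 by (rewrite Ee; unfold e; lra). fold z in Hb2. rewrite E0 in Hb2.
  replace (0 - 0 - (s + e - s)%R * l)%C with (- ((s + e - s)%R * l))%C in Hb2 by ring.
  rewrite Cmod_opp, Cmod_mult, Cmod_R, Ee in Hb2. assert (0 < e) by (unfold e; lra). nra.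
Qed.

(** The quotient of the two sides is continuous with values in {1, -1}, hence constant. At the
    midpoint i / sqrt 2 the theta values are real and z^2 = -1/2, so both sides are positive
    there. *)
Lemma geodesic_tG s : 0 < s < PI -> Cconj (tG (geodesic s)) = tH (geodesic s).
Proof.
  set (q := fun u => (Cconj (tG (geodesic u)) * / tH (geodesic u))%C).
  assert (forall u, 0 < u < PI -> q u = RtoC 1 \/ q u = RtoC (-1)) as Hq.
  { intros u Hu. pose proof (geodesic_tG_sq u Hu) as E. pose proof (tH_neq_0 _ (geodesic_upper u Hu)) as Hn.
    assert ((q u - 1) * (q u + 1) = 0)%C as E1.
    { unfold q. transitivity ((Cconj (tG (geodesic u)) ^ 2 - tH (geodesic u) ^ 2) / tH (geodesic u) ^ 2)%C; [field; auto|].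
      rewrite E. field. auto. }
    destruct (Ceq_dec (q u - 1) 0) as [E2|E2].
    - left. transitivity (q u - 1 + 1)%C; [ring|]. rewrite E2. ring.
    - right. apply (Cmult_cancel_l (q u - 1)); auto. transitivity ((q u - 1) * (q u + 1) - (q u - 1))%C; [ring|]. rewrite E1. ring. }
  assert (forall u, 0 < u < PI -> continuity_pt (fun v => Re (q v)) u) as Hc.
  { intros u Hu. pose proof (geodesic_upper u Hu) as Hg.
    assert (ccont q u) as Hcc.
    { unfold q. apply ccont_mult; [apply ccont_conj, (ccont_geodesic_cd tG u _ (cd_tG _ Hg))|].
      apply (ccont_geodesic_cd (fun w => / tH w)%C u _ (cd_inv _ _ _ (tH_neq_0 _ Hg) (cd_tH _ Hg))). }
    intros eps He. destruct (Hcc eps He) as [d [Hd Hb]]. exists d. split; auto. intros x [_ Hx].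
    eapply Rle_lt_trans; [apply (re_le_Cmod (q x - q u))|]. apply Hb. exact Hx. }
  pose proof PI_RGT_0 as Hpi.
  assert (Re (q (PI / 2)) = 1) as Hmid.
  { destruct (Hq (PI / 2) ltac:(lra)) as [->| E]; [reflexivity|]. exfalso.
    assert (0 < PI / 2 < PI) as Hp by lra. pose proof (geodesic_upper _ Hp) as Hg.
    set (z := geodesic (PI / 2)) in *.
    assert (- Cconj z = z)%C as Ez.
    { unfold z, geodesic. rewrite cos_PI2. unfold Cconj, Copp; simpl. unfold Rdiv. f_equal; ring. }
    destruct (thetas_conj z Hg) as [E2 [E3 E4]]. rewrite Ez in E2, E3, E4.
    assert (forall x : C, x = Cconj x -> x <> RtoC 0 -> exists r : R, x = RtoC r /\ r <> 0) as Hreal.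
    { intros [x y] Hx Hn. unfold Cconj in Hx; simpl in Hx. injection Hx as Hy. assert (y = 0) as -> by lra.
      exists x. split; [reflexivity|]. intros ->. now apply Hn. }
    destruct (thetas_neq_0 z Hg) as [N2 [N3 N4]].
    destruct (Hreal _ E2 N2) as [r2 [R2 P2]]. destruct (Hreal _ E3 N3) as [r3 [R3 P3]]. destruct (Hreal _ E4 N4) as [r4 [R4 P4]].
    assert (z ^ 2 = RtoC (- (1 / 2)))%C as Ez2.
    { pose proof (geodesic_conj (PI / 2)) as H. fold z in H. rewrite Ez in H.
      transitivity (z * (2 * z) / 2)%C; [field|]. rewrite H, RtoC_opp, RtoC_div by lra. field. }
    assert (Cconj (tG z) = - tH z)%C as E'.
    { transitivity (q (PI / 2)%R * tH z)%C; [|rewrite E; ring]. unfold q. fold z. field. now apply tH_neq_0. }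
    unfold tG, tH, ta, tb, tc in E'. rewrite Ez2, R2, R3, R4 in E'.
    rewrite <- !RtoC_pow, Cconj_R in E'.
    assert (RtoC ((r4 ^ 2) ^ 2) = RtoC (- (2 * (r2 ^ 2 * r3 ^ 2)))) as E5.
    { rewrite E'. rewrite !RtoC_opp, RtoC_div, !RtoC_mult by lra. field. }
    injection E5 as E5. assert (0 < (r4 ^ 2) ^ 2) by (apply pow2_gt_0; now apply pow_nonzero).
    assert (0 <= r2 ^ 2 * r3 ^ 2) by (apply Rmult_le_pos; apply pow2_ge_0). lra. }
  intros Hs. destruct (Hq s Hs) as [E|E].
  { transitivity (q s * tH (geodesic s))%C; [|rewrite E; ring]. unfold q. field. apply tH_neq_0, geodesic_upper, Hs. }
  exfalso. assert (Re (q s) = -1) as Es by (now rewrite E).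
  assert (exists x, 0 < x < PI /\ Re (q x) = 0) as [x [Hx Ex]].
  { destruct (Rtotal_order s (PI / 2)) as [Hlt|[->|Hgt]]; [|lra|].
    - destruct (IVT_interv (fun v => Re (q v)) s (PI / 2)) as [x [Hx Ex]]; try lra.
      + intros. apply Hc. lra. + exists x. split; [lra|auto].
    - destruct (IVT_interv (fun v => - Re (q v)) (PI / 2) s) as [x [Hx Ex]]; try lra.
      + intros. apply (continuity_pt_opp (fun v => Re (q v))), Hc. lra. + exists x. split; lra. }
  destruct (Hq x Hx) as [E1|E1]; rewrite E1 in Ex; simpl in Ex; lra.
Qed.

(** * Cauchy's theorem *)

(** Contains the truncated q-expansions with polynomial factors in tau, and is closed under products
    and primitives. *)
Inductive exppoly : (C -> C) -> Prop :=
  | exppoly_mono c j la : exppoly (fun z => c * z ^ j * Cexp (la * z))%C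
  | exppoly_plus f g : exppoly f -> exppoly g -> exppoly (fun z => f z + g z)%C.

Lemma exppoly_ext f g : (forall z, f z = g z) -> exppoly f -> exppoly g.
Proof. intros H. now replace g with f by (now apply functional_extensionality). Qed.

Lemma exppoly_mult f g : exppoly f -> exppoly g -> exppoly (fun z => f z * g z)%C.
Proof.
  intros Hf Hg. induction Hf as [c j la|f1 f2 _ IH1 _ IH2].
  - induction Hg as [c' j' la'|g1 g2 _ IH1 _ IH2].
    + apply exppoly_ext with (fun z => (c * c') * z ^ (j + j') * Cexp ((la + la') * z))%C; [|constructor].
      intros z. rewrite Cpow_add_r. replace ((la + la') * z)%C with (la * z + la' * z)%C by ring.
      rewrite Cexp_add. ring.
    + eapply exppoly_ext; [|apply (exppoly_plus _ _ IH1 IH2)]. intros z; simpl. ring.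
  - eapply exppoly_ext; [|apply (exppoly_plus _ _ IH1 IH2)]. intros z; simpl. ring.
Qed.

Lemma exppoly_const c : exppoly (fun _ => c).
Proof.
  apply exppoly_ext with (fun z => c * z ^ 0 * Cexp (0 * z))%C; [|constructor].
  intros z. rewrite Cmult_0_l, Cexp_0. simpl. ring.
Qed.

Lemma exppoly_id : exppoly (fun z => z).
Proof.
  apply exppoly_ext with (fun z => 1 * z ^ 1 * Cexp (0 * z))%C; [|constructor].
  intros z. rewrite Cmult_0_l, Cexp_0. simpl. ring.
Qed.

Lemma exppoly_expo k : exppoly (expo k).
Proof.
  apply exppoly_ext with (fun z => 1 * z ^ 0 * Cexp ((2 * PI * Ci * k) * z))%C; [|constructor].
  intros z. unfold expo. simpl. ring.
Qed.

Lemma exppoly_nome_pow n : exppoly (fun z => nome z ^ n)%C.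
Proof. apply exppoly_ext with (expo (INR n)); [|apply exppoly_expo]. intros; now rewrite nome_pow. Qed.

Lemma exppoly_psum (f : nat -> C -> C) n : (forall k, exppoly (f k)) -> exppoly (fun z => psum (fun k => f k z) n).
Proof. intros H. induction n; simpl; [apply exppoly_const|]. now apply exppoly_plus. Qed.

Lemma exppoly_Cprod1 (f : nat -> C -> C) n : (forall k, exppoly (f k)) -> exppoly (fun z => Cprod1 (fun k => f k z) n).
Proof. intros H. induction n; simpl; [apply exppoly_const|]. now apply exppoly_mult. Qed.

Lemma exppoly_cd f : exppoly f -> forall z, exists l, cd f z l.
Proof.
  intros Hf. induction Hf as [c j la|f g _ IH1 _ IH2]; intros z.
  - eexists. apply cd_mult; [apply cd_scal, (cd_pow (fun w => w)), cd_id|apply cd_Cexp_lin].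
  - destruct (IH1 z), (IH2 z). eexists. apply cd_plus; eauto.
Qed.

(** Integration by parts lowers the power j; la = 0 is the polynomial case. *)
Lemma exppoly_primitive f : exppoly f -> exists P, forall z, cd P z (f z).
Proof.
  intros Hf. induction Hf as [c j la|f g _ [P1 H1] _ [P2 H2]].
  - assert (exists Q, forall z, cd Q z (z ^ j * Cexp (la * z))%C) as [Q HQ].
    { destruct (Ceq_dec la 0) as [->|Hla].
      - exists (fun z => / INR (S j) * z ^ S j)%C. intros z. eapply cd_eq.
        + apply cd_scal, (cd_pow (fun w => w)), cd_id.
        + assert (RtoC (INR (S j)) <> 0)%C as HN by (apply RtoC_neq_0, not_0_INR; lia).
          rewrite Cmult_0_l, Cexp_0. change (pred (S j)) with j.
          set (N := RtoC (INR (S j))) in *. set (Z := (z ^ j)%C). field. auto.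
      - induction j as [|j [Q HQ]].
        + exists (fun z => / la * Cexp (la * z))%C. intros z. eapply cd_eq; [apply cd_scal, cd_Cexp_lin|]. simpl. field. auto.
        + exists (fun z => / la * (z ^ S j * Cexp (la * z)) - INR (S j) / la * Q z)%C. intros z. eapply cd_eq.
          * apply cd_minus; apply cd_scal; [|apply HQ].
            apply cd_mult; [apply (cd_pow (fun w => w)), cd_id|apply cd_Cexp_lin].
          * cbv beta. change (pred (S j)) with j. change (z ^ S j)%C with (z * z ^ j)%C.
            set (N := RtoC (INR (S j))). set (Z := (z ^ j)%C). field. auto. }
    exists (fun z => c * Q z)%C. intros z. eapply cd_eq; [apply cd_scal, HQ|]. ring.
  - exists (fun z => P1 z + P2 z)%C. intros z. now apply cd_plus.
Qed.

Definition box (X d : R) (z : C) : Prop := Rabs (Re z) <= X /\ d <= Im z <= X.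

Lemma exppoly_bounded f X d : exppoly f -> exists B, 0 < B /\ forall z, box X d z -> Cmod (f z) <= B.
Proof.
  intros Hf. induction Hf as [c j la|f g _ [B1 [P1 H1]] _ [B2 [P2 H2]]].
  - set (M := Rabs X + Rabs d + Rabs X). pose proof (Rabs_pos X). pose proof (Rabs_pos d).
    assert (0 <= M) as HM by (unfold M; lra).
    exists (Cmod c * M ^ j * exp (Cmod la * M) + 1).
    pose proof (Cmod_ge_0 c). pose proof (pow_le M j HM). pose proof (exp_pos (Cmod la * M)).
    assert (0 <= Cmod c * M ^ j * exp (Cmod la * M)) by (apply Rmult_le_pos; [apply Rmult_le_pos|]; lra).
    split; [lra|]. intros z [Hz1 Hz2].
    assert (Cmod z <= M) as Hz.
    { eapply Rle_trans; [apply Cmod_le_abs|]. unfold M. pose proof (Rle_abs X). pose proof (Rle_abs (- d)) as Hd. rewrite Rabs_Ropp in Hd.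
      assert (Rabs (Im z) <= Rabs X + Rabs d) by (apply Rabs_le; lra). lra. }
    rewrite !Cmod_mult, Cmod_pow, Cmod_Cexp.
    apply Rle_trans with (Cmod c * M ^ j * exp (Cmod la * M)); [|lra].
    apply Rmult_le_compat.
    + apply Rmult_le_pos; auto. apply pow_le, Cmod_ge_0.
    + left; apply exp_pos.
    + apply Rmult_le_compat_l; auto. apply pow_incr. split; auto using Cmod_ge_0.
    + apply exp_mono. pose proof (re_le_Cmod (la * z)) as Hr. pose proof (Rle_abs (Re (la * z))).
      rewrite Cmod_mult in Hr. pose proof (Cmod_ge_0 la).
      assert (Cmod la * Cmod z <= Cmod la * M) by (now apply Rmult_le_compat_l). lra.
  - exists (B1 + B2). split; [lra|]. intros z Hz. eapply Rle_trans; [apply Cmod_triangle|].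
    specialize (H1 z Hz). specialize (H2 z Hz). lra.
Qed.

(* Holomorphic functions on the upper half plane that are uniform limits, on boxes, of
   functions with a global primitive: for these Cauchy's theorem is immediate. *)
Definition tame (f : C -> C) : Prop :=
  (forall z, upper z -> exists l, cd f z l) /\
  forall X d, 0 < d -> forall eps, 0 < eps -> exists g, exppoly g /\
    forall z, box X d z -> Cmod (f z - g z) < eps.

Lemma box_upper X d z : 0 < d -> box X d z -> upper z.
Proof. unfold upper. intros Hd [_ H]. lra. Qed.

Lemma tame_ext f g : (forall z, upper z -> f z = g z) -> tame f -> tame g.
Proof.
  intros H [H1 H2]. split.
  - intros z Hz. destruct (H1 z Hz) as [l Hl]. exists l. now apply cd_ext_upper with f.
  - intros X d Hd eps He. destruct (H2 X d Hd eps He) as [p [Hp Hb]]. exists p. split; auto.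
    intros z Hz. rewrite <- H; auto. now apply box_upper with X d.
Qed.

Lemma tame_exppoly f : exppoly f -> tame f.
Proof.
  intros H. split.
  - intros; now apply exppoly_cd.
  - intros X d _ eps He. exists f. split; auto. intros. replace (f z - f z)%C with (RtoC 0) by ring. now rewrite Cmod_0.
Qed.

Lemma tame_plus f g : tame f -> tame g -> tame (fun z => f z + g z)%C.
Proof.
  intros [F1 F2] [G1 G2]. split.
  - intros z Hz. destruct (F1 z Hz), (G1 z Hz). eexists. apply cd_plus; eauto.
  - intros X d Hd eps He. destruct (F2 X d Hd (eps / 2)) as [p [Hp Hb]]; [lra|].
    destruct (G2 X d Hd (eps / 2)) as [q [Hq Hc]]; [lra|]. exists (fun z => p z + q z)%C. split; [now constructor|].
    intros z Hz. specialize (Hb z Hz). specialize (Hc z Hz).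
    replace (f z + g z - (p z + q z))%C with ((f z - p z) + (g z - q z))%C by ring.
    eapply Rle_lt_trans; [apply Cmod_triangle|]. lra.
Qed.

Lemma tame_bounded f X d : 0 < d -> tame f -> exists B, 0 < B /\ forall z, box X d z -> Cmod (f z) <= B.
Proof.
  intros Hd [_ H]. destruct (H X d Hd 1 Rlt_0_1) as [p [Hp Hb]].
  destruct (exppoly_bounded p X d Hp) as [B [HB HB']]. exists (B + 1). split; [lra|].
  intros z Hz. specialize (Hb z Hz). specialize (HB' z Hz). pose proof (Cmod_triangle_rev (f z) (p z)). lra.
Qed.

Lemma tame_mult f g : tame f -> tame g -> tame (fun z => f z * g z)%C.
Proof.
  intros Hf Hg. pose proof Hf as [F1 F2]. pose proof Hg as [G1 G2]. split.
  - intros z Hz. destruct (F1 z Hz), (G1 z Hz). eexists. apply cd_mult; eauto.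
  - intros X d Hd eps He. destruct (tame_bounded f X d Hd Hf) as [B [HB HfB]].
    set (e2 := eps / (2 * B)). assert (0 < e2) as He2 by (apply Rdiv_lt_0_compat; lra).
    destruct (G2 X d Hd e2 He2) as [q [Hq Hgq]].
    destruct (exppoly_bounded q X d Hq) as [B' [HB' HqB]].
    (* The tolerance for [f] depends on a bound for [q], so [q] is chosen before [p]. *)
    set (e1 := eps / (2 * B')). assert (0 < e1) as He1 by (apply Rdiv_lt_0_compat; lra).
    destruct (F2 X d Hd e1 He1) as [p [Hp Hfp]].
    exists (fun z => p z * q z)%C. split; [now apply exppoly_mult|]. intros z Hz.
    specialize (HfB z Hz). specialize (Hgq z Hz). specialize (HqB z Hz). specialize (Hfp z Hz).
    replace (f z * g z - p z * q z)%C with (f z * (g z - q z) + (f z - p z) * q z)%C by ring.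
    eapply Rle_lt_trans; [apply Cmod_triangle|]. rewrite !Cmod_mult.
    pose proof (Cmod_ge_0 (g z - q z)). pose proof (Cmod_ge_0 (f z - p z)).
    assert (Cmod (f z) * Cmod (g z - q z) <= B * Cmod (g z - q z)) by (now apply Rmult_le_compat_r).
    assert (B * Cmod (g z - q z) < eps / 2).
    { apply Rlt_le_trans with (B * e2); [now apply Rmult_lt_compat_l|]. unfold e2. right. field. lra. }
    assert (Cmod (f z - p z) * Cmod (q z) <= eps / 2).
    { apply Rle_trans with (e1 * B'); [apply Rmult_le_compat; auto using Cmod_ge_0; lra|]. unfold e1. right. field. lra. }
    lra.
Qed.

Lemma tame_const c : tame (fun _ => c).
Proof. apply tame_exppoly, exppoly_const. Qed.

Lemma tame_id : tame (fun z => z).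
Proof. apply tame_exppoly, exppoly_id. Qed.

Lemma tame_scal c f : tame f -> tame (fun z => c * f z)%C.
Proof. apply tame_mult, tame_const. Qed.

Lemma tame_minus f g : tame f -> tame g -> tame (fun z => f z - g z)%C.
Proof.
  intros Hf Hg. apply tame_ext with (fun z => f z + (- (1)) * g z)%C; [intros; ring|].
  apply tame_plus; auto. now apply tame_scal.
Qed.

Lemma tame_pow f n : tame f -> tame (fun z => f z ^ n)%C.
Proof.
  intros H. induction n; simpl; [apply tame_const|]. now apply tame_mult.
Qed.

Lemma tame_eseries al k : admissible al k -> tame (eseries al k).
Proof.
  intros H. split.
  - intros z Hz. eexists. now apply cd_eseries.
  - intros X d Hd eps He. destruct (eseries_dom al k H d Hd) as [M [HM Hb]].
    assert (forall n, 0 <= M n) as HM0.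
    { intros n. eapply Rle_trans; [|apply (Hb (0, d) ltac:(simpl; lra) n)]. apply Cmod_ge_0. }
    destruct (tail_small M HM HM0 (eps / 2)) as [K HK]; [lra|]. specialize (HK K (le_n _)).
    exists (fun z => psum (fun n => al n * expo (k n) z)%C K). split.
    + apply (exppoly_psum (fun n z => al n * expo (k n) z)%C). intros n.
      apply exppoly_mult; [apply exppoly_const|apply exppoly_expo].
    + intros z [_ Hz]. unfold eseries. specialize (HK (fun n => al n * expo (k n) z)%C (Hb z ltac:(lra))). lra.
Qed.

Lemma Cprod1_psum (v : nat -> C) n : Cprod1 (fun k => 1 + v k)%C n =
  (1 + psum (fun k => Cprod1 (fun k => 1 + v k) k * v (S k)) n)%C.
Proof.
  induction n; simpl; [ring|]. rewrite IHn at 1. set (S := psum _ n).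
  replace (Cprod1 (fun k => 1 + v k) n)%C with (1 + S)%C by (unfold S; now rewrite <- IHn). ring.
Qed.

(** The product is rewritten as the series of its increments, whose terms are bounded by a geometric
    series uniformly on a box; [tail_small] then makes the partial products uniform
    approximations. *)
Lemma tame_prod_plus_pow : tame (fun z => prod_plus_pow (nome z)).
Proof.
  split.
  - intros z Hz. eexists. apply cd_prod_plus_pow; auto. now apply lambert_rearranged.
  - intros X d Hd eps He.
    set (r := exp (- (2 * PI * 1 * d))). pose proof PI_RGT_0 as Hpi.
    assert (0 <= r < 1) as Hr.
    { split; [left; apply exp_pos|]. unfold r. apply Rlt_le_trans with (exp 0); [apply exp_increasing; nra|rewrite exp_0; lra]. }
    set (B := exp (Series (fun k => r ^ k))).
    destruct (tail_small (fun k => B * r ^ k)) with (eps := eps / 2) as [K HK]; try lra.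
    { apply ex_series_scal_r, ex_series_pow; auto. }
    { intros n. apply Rmult_le_pos; [left; apply exp_pos|apply pow_le; lra]. }
    specialize (HK K (le_n _)).
    exists (fun z => Cprod1 (fun n => 1 + 1 * nome z ^ n)%C K). split.
    + apply (exppoly_Cprod1 (fun n z => 1 + 1 * nome z ^ n)%C). intros n.
      apply exppoly_plus; [apply exppoly_const|]. apply exppoly_mult; [apply exppoly_const|apply exppoly_nome_pow].
    + intros z Hz. set (v := fun n => (1 * nome z ^ n)%C).
      assert (upper z) as Hu by (now apply box_upper with X d).
      assert (geo_bounded v r) as Hv.
      { apply geo_bounded_weaken with (Cmod (nome z)).
        - apply (geo_bounded_pow _ _ (fun n => n)); auto using Cmod_1, Cmod_nome_lt.
        - split; [|lra]. rewrite expo_nome, Cmod_expo. apply exp_mono, Ropp_le_contravar.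
          apply Rmult_le_compat_l; [lra|]. apply Hz. }
      destruct (geo_dom v r Hv) as [D1 [D2 D3]].
      set (u := fun k => (Cprod1 (fun k => 1 + v k) k * v (S k))%C).
      assert (forall k, Cmod (u k) <= B * r ^ k) as Hu'.
      { intros k. unfold u. rewrite Cmod_mult. apply Rmult_le_compat; auto using Cmod_ge_0.
        apply Cprod1_bound; auto. }
      assert (prod_plus_pow (nome z) = 1 + csum u)%C as ->.
      { apply iprod_unique with r; auto. apply CL_ext with (fun n => 1 + psum u n)%C.
        - intros n. symmetry. apply Cprod1_psum.
        - apply CL_plus; [apply CL_const|]. apply summ_CL. apply summ_dom with (fun k => B * r ^ k); auto.
          now apply ex_series_scal_r. }
      change (Cprod1 (fun n => 1 + 1 * nome z ^ n)%C K) with (Cprod1 (fun n => 1 + v n)%C K).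
      rewrite (Cprod1_psum v K). fold u.
      replace (1 + csum u - (1 + psum u K))%C with (csum u - psum u K)%C by ring. specialize (HK u Hu'). lra.
Qed.

Lemma tame_t2 : tame t2.
Proof.
  apply tame_ext with (fun z => - (64) * (nome z ^ 1 * prod_plus_pow (nome z) ^ 24))%C.
  - intros z Hz. destruct (eta_thetas z Hz) as [_ [_ [_ ->]]]. ring.
  - apply tame_scal, tame_mult; [apply tame_exppoly, exppoly_nome_pow|apply tame_pow, tame_prod_plus_pow].
Qed.

Lemma tame_ta : tame ta.
Proof. apply tame_pow, tame_eseries, admissible_theta, Cmod_1. Qed.
Lemma tame_tb : tame tb.
Proof. apply tame_pow, tame_eseries, admissible_theta, Cmod_m1. Qed.
Lemma tame_tc : tame tc.
Proof. apply tame_pow, tame_eseries, admissible_th2. Qed.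
Lemma tame_Dta : tame Dta.
Proof.
  apply tame_mult; [apply tame_scal|]; apply tame_eseries; [|apply admissible_dcoef]; apply admissible_theta, Cmod_1.
Qed.
Lemma tame_Dtc : tame Dtc.
Proof.
  apply tame_mult; [apply tame_scal|]; apply tame_eseries; [|apply admissible_dcoef]; apply admissible_th2.
Qed.
Lemma tame_tE : tame tE.
Proof. apply tame_plus; apply tame_pow; [apply tame_ta|apply tame_tc]. Qed.
Lemma tame_tG : tame tG.
Proof. apply tame_pow, tame_tb. Qed.
Lemma tame_tH : tame tH.
Proof. apply tame_mult; [apply tame_scal, tame_pow, tame_id|apply tame_mult; [apply tame_tc|apply tame_ta]]. Qed.

Lemma path_dpath g al be z w s : path_in_H g al be z w -> al <= s <= be -> is_dpath g s (velocity g s).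
Proof.
  intros [_ [_ [_ H]]] Hs. destruct (H s Hs) as [_ [[l Hl] _]].
  rewrite (velocity_eq g s l Hl). exact Hl.
Qed.

Lemma ccont_bounded (g : R -> C) al be : al <= be -> (forall s, al <= s <= be -> ccont g s) ->
  exists M, 0 <= M /\ forall s, al <= s <= be -> Cmod (g s) <= M.
Proof.
  intros Hab Hc.
  destruct (continuity_ab_maj (fun s => Cmod (g s)) al be Hab) as [m [Hm _]].
  - intros s Hs eps He. destruct (Hc s Hs eps He) as [d [Hd Hb]]. exists d. split; auto. intros x [_ Hx].
    simpl in *. unfold Rdist in *. specialize (Hb x Hx). apply Rle_lt_trans with (2 := Hb).
    apply Rabs_le. pose proof (Cmod_triangle_rev (g x) (g s)). pose proof (Cmod_triangle_rev (g s) (g x)).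
    rewrite (Cmod_sub_sym (g s) (g x)) in H0. lra.
  - exists (Cmod (g m)). split; [apply Cmod_ge_0|auto].
Qed.

Lemma path_box g al be z w : path_in_H g al be z w -> exists X d M, 0 < d /\ 0 <= M /\
  forall s, al <= s <= be -> box X d (g s) /\ Cmod (velocity g s) <= M.
Proof.
  intros H. pose proof H as [Hab [_ [_ Hs]]].
  assert (forall s, al <= s <= be -> ccont g s) as Hg.
  { intros s Hss. eapply is_dpath_ccont. eapply path_dpath; eauto. }
  destruct (ccont_bounded g al be Hab Hg) as [X [HX HX']].
  destruct (ccont_bounded (velocity g) al be Hab) as [M [HM HM']].
  { intros s Hss. apply ccont_continuous. now apply Hs. }
  destruct (continuity_ab_min (fun s => Im (g s)) al be Hab) as [m [Hm Hmm]].
  { intros s Hss eps He. destruct (Hg s Hss eps He) as [d [Hd Hb]]. exists d. split; auto. intros x [_ Hx].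
    simpl in *. unfold Rdist in *. specialize (Hb x Hx). apply Rle_lt_trans with (2 := Hb).
    apply (Im_le_Cmod (g x - g s)). }
  exists X, (Im (g m)), M. split; [now apply Hs|]. split; auto. intros s Hss. split; auto.
  split; [eapply Rle_trans; [apply re_le_Cmod|auto]|]. split; auto.
  eapply Rle_trans; [apply Rle_abs|]. eapply Rle_trans; [apply Im_le_Cmod|auto].
Qed.

Lemma path_integrable f g al be z w : (forall z, upper z -> exists l, cd f z l) -> path_in_H g al be z w ->
  is_RInt (V := C_R_CompleteNormedModule) (fun s => f (g s) * velocity g s)%C al be (path_integral f g al be).
Proof.
  intros Hf Hp. pose proof Hp as [Hab [_ [_ Hs]]]. apply RInt_correct, ex_RInt_ccont.
  rewrite Rmin_left, Rmax_right by auto. intros s Hss. destruct (Hs s Hss) as [Hu [_ Hv]].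
  apply ccont_mult; [|now apply ccont_continuous].
  destruct (Hf (g s) Hu) as [l Hl]. eapply ccont_cd; eauto. eapply is_dpath_ccont, path_dpath; eauto.
Qed.

Lemma path_integral_near f p P g al be z w X d M eps :
  (forall z, upper z -> exists l, cd f z l) -> path_in_H g al be z w -> 0 <= M -> 0 <= eps ->
  (forall z, cd P z (p z)) -> exppoly p ->
  (forall s, al <= s <= be -> box X d (g s) /\ Cmod (velocity g s) <= M) ->
  (forall z, box X d z -> Cmod (f z - p z) <= eps) ->
  Cmod (path_integral f g al be - (P w - P z)) <= (be - al) * (eps * M).
Proof.
  intros Hf Hp HM He HP Hpp Hb Hfp. pose proof Hp as [Hab [Ez [Ew Hs]]].
  pose proof (path_integrable f g al be z w Hf Hp) as I1.
  assert (is_RInt (V := C_R_CompleteNormedModule) (fun s => p (g s) * velocity g s)%C al be (P w - P z)%C) as I2.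
  { rewrite <- Ez, <- Ew. apply (is_RInt_dpath (fun s => P (g s))); rewrite Rmin_left, Rmax_right by auto; intros s Hss.
    - apply cd_path; auto. eapply path_dpath; eauto.
    - apply ccont_mult; [|apply ccont_continuous; now apply Hs].
      destruct (exppoly_cd p Hpp (g s)) as [l Hl]. eapply ccont_cd; eauto. eapply is_dpath_ccont, path_dpath; eauto. }
  apply (RInt_bound (fun s => f (g s) * velocity g s - p (g s) * velocity g s)%C al be); auto.
  - intros s Hss. destruct (Hb s Hss) as [H1 H2].
    replace (f (g s) * velocity g s - p (g s) * velocity g s)%C with ((f (g s) - p (g s)) * velocity g s)%C by ring.
    rewrite Cmod_mult. apply Rmult_le_compat; auto using Cmod_ge_0.
  - now apply is_RInt_Cminus.
Qed.

(** * Integrals along segments *)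

Definition seg (z w : C) (s : R) : C := (z + s * (w - z))%C.
Definition Iseg (f : C -> C) (z w : C) : C := path_integral f (seg z w) 0 1.

Lemma seg_dpath z w s : is_dpath (seg z w) s (w - z)%C.
Proof.
  apply is_dpath_eps. intros eps He. exists 1. split; [lra|]. intros u _. unfold seg.
  replace (z + u * (w - z) - (z + s * (w - z)) - (u - s)%R * (w - z))%C with (RtoC 0) by (rewrite RtoC_minus; ring).
  rewrite Cmod_0. apply Rmult_le_pos; [lra|apply Rabs_pos].
Qed.

Lemma velocity_seg z w s : velocity (seg z w) s = (w - z)%C.
Proof. apply velocity_eq, seg_dpath. Qed.

Lemma seg_upper z w s : upper z -> upper w -> 0 <= s <= 1 -> upper (seg z w s).
Proof. unfold upper, seg. destruct z, w; simpl. intros. nra. Qed.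

Lemma seg_path z w : upper z -> upper w -> path_in_H (seg z w) 0 1 z w.
Proof.
  intros Hz Hw. split; [lra|]. split; [unfold seg; ring|]. split; [unfold seg; ring|].
  intros s Hs. split; [now apply seg_upper|]. split; [eexists; apply seg_dpath|].
  apply ccont_continuous. apply ccont_ext with (fun _ => (w - z)%C); [intros; now rewrite velocity_seg|apply ccont_const].
Qed.

Lemma box_mono X X' d d' z : X <= X' -> d' <= d -> box X d z -> box X' d' z.
Proof. unfold box. intros. lra. Qed.

Lemma Cmod_small_eq (x y : C) K : 0 <= K -> (forall eps, 0 < eps -> Cmod (x - y) <= K * eps) -> x = y.
Proof.
  intros HK H. assert (Cmod (x - y) <= 0) as H0.
  { apply Rnot_lt_le. intros Hlt. specialize (H (Cmod (x - y) / (2 * (K + 1)))).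
    assert (0 < Cmod (x - y) / (2 * (K + 1))) by (apply Rdiv_lt_0_compat; lra). specialize (H H0).
    assert (K * (Cmod (x - y) / (2 * (K + 1))) <= (K + 1) * (Cmod (x - y) / (2 * (K + 1)))) by (apply Rmult_le_compat_r; lra).
    replace ((K + 1) * (Cmod (x - y) / (2 * (K + 1)))) with (Cmod (x - y) / 2) in H1 by (field; lra). lra. }
  pose proof (Cmod_ge_0 (x - y)). assert (x - y = 0)%C as E by (apply Cmod_eq_0; lra).
  transitivity (x - y + y)%C; [ring|]. rewrite E. ring.
Qed.

(** On a box containing both paths f is eps-close to a function with a global primitive P, so each
    integral differs from P w - P z by at most a constant times eps. *)
Lemma path_independent f g al be z w : tame f -> path_in_H g al be z w -> path_integral f g al be = Iseg f z w.
Proof.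
  intros [Hd Ha] Hp. pose proof Hp as [Hab [Ez [Ew Hs]]].
  assert (upper z) as Hz by (rewrite <- Ez; apply Hs; lra). assert (upper w) as Hw by (rewrite <- Ew; apply Hs; lra).
  pose proof (seg_path z w Hz Hw) as Hq.
  destruct (path_box _ _ _ _ _ Hp) as [X1 [d1 [M1 [D1 [N1 B1]]]]].
  destruct (path_box _ _ _ _ _ Hq) as [X2 [d2 [M2 [D2 [N2 B2]]]]].
  apply (Cmod_small_eq _ _ ((be - al) * M1 + (1 - 0) * M2)).
  { apply Rplus_le_le_0_compat; apply Rmult_le_pos; lra. }
  intros eps He. set (X := Rmax X1 X2). set (d := Rmin d1 d2).
  destruct (Ha X d ltac:(unfold d; now apply Rmin_glb_lt) eps He) as [p [Hp' Hfp]].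
  destruct (exppoly_primitive p Hp') as [P HP].
  assert (forall z, box X d z -> Cmod (f z - p z) <= eps) as Hfp' by (intros; left; auto).
  assert (Cmod (path_integral f g al be - (P w - P z)) <= (be - al) * (eps * M1)) as E1.
  { apply (path_integral_near f p P g al be z w X d M1 eps); auto; [lra|].
    intros s Hss. destruct (B1 s Hss) as [b1 b2]. split; auto. revert b1; apply box_mono; [apply Rmax_l|apply Rmin_l]. }
  assert (Cmod (Iseg f z w - (P w - P z)) <= (1 - 0) * (eps * M2)) as E2.
  { apply (path_integral_near f p P (seg z w) 0 1 z w X d M2 eps); auto; [lra|].
    intros s Hss. destruct (B2 s Hss) as [b1 b2]. split; auto. revert b1; apply box_mono; [apply Rmax_r|apply Rmin_r]. }
  pose proof (Cmod_sub_triangle (path_integral f g al be) (P w - P z) (Iseg f z w)).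
  rewrite (Cmod_sub_sym (P w - P z) (Iseg f z w)) in H. lra.
Qed.

(** One approximating function with one primitive serves all three sides of the triangle. *)
Lemma Iseg_chain f x y z : tame f -> upper x -> upper y -> upper z -> (Iseg f x y + Iseg f y z = Iseg f x z)%C.
Proof.
  intros [Hd Ha] Hx Hy Hz.
  pose proof (seg_path x y Hx Hy) as H1. pose proof (seg_path y z Hy Hz) as H2. pose proof (seg_path x z Hx Hz) as H3.
  destruct (path_box _ _ _ _ _ H1) as [X1 [d1 [M1 [D1 [N1 B1]]]]].
  destruct (path_box _ _ _ _ _ H2) as [X2 [d2 [M2 [D2 [N2 B2]]]]].
  destruct (path_box _ _ _ _ _ H3) as [X3 [d3 [M3 [D3 [N3 B3]]]]].
  apply (Cmod_small_eq _ _ (M1 + M2 + M3)); [lra|].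
  intros eps He. set (X := Rmax X1 (Rmax X2 X3)). set (d := Rmin d1 (Rmin d2 d3)).
  destruct (Ha X d ltac:(unfold d; repeat apply Rmin_glb_lt; auto) eps He) as [p [Hp' Hfp]].
  destruct (exppoly_primitive p Hp') as [P HP].
  assert (forall z, box X d z -> Cmod (f z - p z) <= eps) as Hfp' by (intros; left; auto).
  pose proof (Rmax_l X1 (Rmax X2 X3)). pose proof (Rmax_r X1 (Rmax X2 X3)). pose proof (Rmax_l X2 X3). pose proof (Rmax_r X2 X3).
  pose proof (Rmin_l d1 (Rmin d2 d3)). pose proof (Rmin_r d1 (Rmin d2 d3)). pose proof (Rmin_l d2 d3). pose proof (Rmin_r d2 d3).
  assert (Cmod (Iseg f x y - (P y - P x)) <= (1 - 0) * (eps * M1)) as E1.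
  { apply (path_integral_near f p P (seg x y) 0 1 x y X d M1 eps); auto; [lra|].
    intros s Hss. destruct (B1 s Hss) as [b1 b2]. split; auto. revert b1; apply box_mono; unfold X, d; lra. }
  assert (Cmod (Iseg f y z - (P z - P y)) <= (1 - 0) * (eps * M2)) as E2.
  { apply (path_integral_near f p P (seg y z) 0 1 y z X d M2 eps); auto; [lra|].
    intros s Hss. destruct (B2 s Hss) as [b1 b2]. split; auto. revert b1; apply box_mono; unfold X, d; lra. }
  assert (Cmod (Iseg f x z - (P z - P x)) <= (1 - 0) * (eps * M3)) as E3.
  { apply (path_integral_near f p P (seg x z) 0 1 x z X d M3 eps); auto; [lra|].
    intros s Hss. destruct (B3 s Hss) as [b1 b2]. split; auto. revert b1; apply box_mono; unfold X, d; lra. }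
  replace (Iseg f x y + Iseg f y z - Iseg f x z)%C with ((Iseg f x y - (P y - P x)) + (Iseg f y z - (P z - P y)) - (Iseg f x z - (P z - P x)))%C by ring.
  eapply Rle_trans; [apply Cmod_triangle_minus|]. eapply Rle_trans; [apply Rplus_le_compat_r, Cmod_triangle|]. lra.
Qed.

Lemma Iseg_integrable f z w : tame f -> upper z -> upper w ->
  is_RInt (V := C_R_CompleteNormedModule) (fun s => f (seg z w s) * (w - z))%C 0 1 (Iseg f z w).
Proof.
  intros [Hf _] Hz Hw. pose proof (path_integrable f (seg z w) 0 1 z w Hf (seg_path z w Hz Hw)) as H.
  apply is_RInt_ext with (2 := H). intros s _. now rewrite velocity_seg.
Qed.

Lemma Iseg_bound f z w M : tame f -> upper z -> upper w ->
  (forall s, 0 <= s <= 1 -> Cmod (f (seg z w s)) <= M) -> Cmod (Iseg f z w) <= M * Cmod (w - z).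
Proof.
  intros Hf Hz Hw HM. replace (M * Cmod (w - z)) with ((1 - 0) * (M * Cmod (w - z))) by ring.
  apply (RInt_bound (fun s => f (seg z w s) * (w - z))%C 0 1); [lra| |now apply Iseg_integrable].
  intros s Hs. rewrite Cmod_mult. apply Rmult_le_compat_r; auto using Cmod_ge_0.
Qed.

Lemma Iseg_unique f z w l : upper z -> upper w ->
  is_RInt (V := C_R_CompleteNormedModule) (fun s => f (seg z w s) * (w - z))%C 0 1 l -> Iseg f z w = l.
Proof.
  intros Hz Hw H. unfold Iseg, path_integral. apply (is_RInt_unique (V := C_R_CompleteNormedModule)).
  apply is_RInt_ext with (2 := H). intros s _. now rewrite velocity_seg.
Qed.

Lemma Iseg_plus f g z w : tame f -> tame g -> upper z -> upper w ->
  Iseg (fun x => f x + g x)%C z w = (Iseg f z w + Iseg g z w)%C.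
Proof.
  intros Hf Hg Hz Hw. apply Iseg_unique; auto.
  eapply is_RInt_ext; [|apply is_RInt_Cplus; apply Iseg_integrable; eauto]. intros s _. simpl. ring.
Qed.

(** The scalar is complex while the integral is one of vectors over R; the linearity is read off
    from the primitives of the approximating functions. *)
Lemma Iseg_scal c f z w : tame f -> upper z -> upper w ->
  Iseg (fun x => c * f x)%C z w = (c * Iseg f z w)%C.
Proof.
  intros Hf Hz Hw. pose proof Hf as [Hd Ha]. pose proof (seg_path z w Hz Hw) as Hq.
  destruct (path_box _ _ _ _ _ Hq) as [X [d [M [D [N B]]]]]. pose proof (Cmod_ge_0 c) as Hc.
  apply (Cmod_small_eq _ _ (Cmod c * M + Cmod c * M)).
  { apply Rplus_le_le_0_compat; now apply Rmult_le_pos. }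
  intros eps He. destruct (Ha X d D eps He) as [p [Hp Hfp]].
  destruct (exppoly_primitive p Hp) as [P HP].
  assert (Cmod (Iseg f z w - (P w - P z)) <= (1 - 0) * (eps * M)) as E1.
  { apply (path_integral_near f p P (seg z w) 0 1 z w X d M eps); auto; [lra|]. intros; left; auto. }
  assert (Cmod (Iseg (fun x => c * f x)%C z w - (c * P w - c * P z)) <= (1 - 0) * (Cmod c * eps * M)) as E2.
  { apply (path_integral_near (fun x => c * f x)%C (fun x => c * p x)%C (fun x => c * P x)%C (seg z w) 0 1 z w X d M); auto.
    - apply (tame_scal c f Hf).
    - apply Rmult_le_pos; lra.
    - intros x. now apply cd_scal.
    - apply exppoly_mult; auto. apply exppoly_const.
    - intros x Hx. replace (c * f x - c * p x)%C with (c * (f x - p x))%C by ring.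
      rewrite Cmod_mult. apply Rmult_le_compat_l; auto. left; auto. }
  replace (Iseg (fun x => c * f x) z w - c * Iseg f z w)%C
    with ((Iseg (fun x => c * f x) z w - (c * P w - c * P z)) - c * (Iseg f z w - (P w - P z)))%C by ring.
  eapply Rle_trans; [apply Cmod_triangle_minus|]. rewrite Cmod_mult.
  apply (Rmult_le_compat_l (Cmod c)) in E1; auto. lra.
Qed.

Lemma Iseg_ext f g z w : upper z -> upper w -> (forall x, upper x -> f x = g x) -> Iseg f z w = Iseg g z w.
Proof.
  intros Hz Hw H. unfold Iseg, path_integral. apply (RInt_ext (V := C_R_CompleteNormedModule)). rewrite Rmin_left, Rmax_right by lra.
  intros s Hs. rewrite H; auto. apply seg_upper; auto; lra.
Qed.

Lemma Iseg_minus f g z w : tame f -> tame g -> upper z -> upper w ->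
  Iseg (fun x => f x - g x)%C z w = (Iseg f z w - Iseg g z w)%C.
Proof.
  intros Hf Hg Hz Hw. transitivity (Iseg (fun x => f x + (- (1)) * g x)%C z w).
  - apply Iseg_ext; auto. intros; ring.
  - rewrite Iseg_plus, Iseg_scal; auto using tame_scal. ring.
Qed.

Lemma Iseg_primitive P f z w : tame f -> upper z -> upper w -> (forall x, upper x -> cd P x (f x)) ->
  Iseg f z w = (P w - P z)%C.
Proof.
  intros Hf Hz Hw HP. apply Iseg_unique; auto.
  replace (P w - P z)%C with (P (seg z w 1) - P (seg z w 0))%C by (unfold seg; do 2 f_equal; ring).
  apply (is_RInt_dpath (fun s => P (seg z w s))); rewrite Rmin_left, Rmax_right by lra; intros s Hs.
  - apply cd_path; [|apply seg_dpath]. apply HP, seg_upper; auto.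
  - apply ccont_mult; [|apply ccont_const]. destruct (proj1 Hf (seg z w s)) as [l Hl]; [now apply seg_upper|].
    eapply ccont_cd; eauto. eapply is_dpath_ccont, seg_dpath.
Qed.

Lemma Iseg_translate f c z w : Iseg f (z + c) (w + c) = Iseg (fun x => f (x + c)%C) z w.
Proof.
  unfold Iseg, path_integral. apply (RInt_ext (V := C_R_CompleteNormedModule)). intros s _. rewrite !velocity_seg.
  replace (seg (z + c) (w + c) s) with (seg z w s + c)%C by (unfold seg; ring).
  f_equal. ring.
Qed.

Lemma Iseg_swap f z w : tame f -> upper z -> upper w -> Iseg f w z = (- Iseg f z w)%C.
Proof.
  intros Hf Hz Hw. pose proof (Iseg_chain f z w z Hf Hz Hw Hz) as H.
  pose proof (Iseg_chain f z z z Hf Hz Hz Hz) as H0.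
  transitivity (Iseg f z w + Iseg f w z - Iseg f z w)%C; [ring|]. rewrite H.
  transitivity (Iseg f z z + Iseg f z z - Iseg f z z - Iseg f z w)%C; [ring|]. rewrite H0. ring.
Qed.

(** * Moments on the geodesic *)

(** The limit is uniform in the real part. The condition Y >= 1/2 stays within the range of
    [eseries_decay]. *)
Definition cusp_lim (f : C -> C) (l : C) : Prop :=
  forall eps, 0 < eps -> exists Y, 1 / 2 <= Y /\ forall z, Y <= Im z -> Cmod (f z - l) < eps.

Lemma cusp_lim_const c : cusp_lim (fun _ => c) c.
Proof.
  intros eps He. exists (1 / 2). split; [lra|]. intros. replace (c - c)%C with (RtoC 0) by ring. now rewrite Cmod_0.
Qed.

Lemma cusp_lim_plus f g l m : cusp_lim f l -> cusp_lim g m -> cusp_lim (fun z => f z + g z)%C (l + m)%C.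
Proof.
  intros Hf Hg eps He. destruct (Hf (eps / 2)) as [Y1 [H1 B1]]; [lra|]. destruct (Hg (eps / 2)) as [Y2 [H2 B2]]; [lra|].
  exists (Rmax Y1 Y2). pose proof (Rmax_l Y1 Y2). pose proof (Rmax_r Y1 Y2). split; [lra|]. intros z Hz.
  specialize (B1 z ltac:(lra)). specialize (B2 z ltac:(lra)).
  replace (f z + g z - (l + m))%C with ((f z - l) + (g z - m))%C by ring.
  eapply Rle_lt_trans; [apply Cmod_triangle|]. lra.
Qed.

Lemma cusp_lim_mult f g l m : cusp_lim f l -> cusp_lim g m -> cusp_lim (fun z => f z * g z)%C (l * m)%C.
Proof.
  intros Hf Hg eps He. pose proof (Cmod_ge_0 l). pose proof (Cmod_ge_0 m).
  set (e1 := Rmin 1 (eps / (2 * (Cmod m + 1)))). set (e2 := eps / (2 * (Cmod l + 1))).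
  assert (0 < e1) as He1 by (apply Rmin_glb_lt; [lra|apply Rdiv_lt_0_compat; lra]).
  assert (0 < e2) as He2 by (apply Rdiv_lt_0_compat; lra).
  destruct (Hf e1 He1) as [Y1 [H1 B1]]. destruct (Hg e2 He2) as [Y2 [H2 B2]].
  exists (Rmax Y1 Y2). pose proof (Rmax_l Y1 Y2). pose proof (Rmax_r Y1 Y2). split; [lra|]. intros z Hz.
  specialize (B1 z ltac:(lra)). specialize (B2 z ltac:(lra)).
  replace (f z * g z - l * m)%C with (f z * (g z - m) + (f z - l) * m)%C by ring.
  eapply Rle_lt_trans; [apply Cmod_triangle|]. rewrite !Cmod_mult.
  assert (e1 <= 1) as L1 by apply Rmin_l. assert (e1 <= eps / (2 * (Cmod m + 1))) as L2 by apply Rmin_r.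
  assert (Cmod (f z) <= Cmod l + 1) as Hfz by (pose proof (Cmod_triangle_rev (f z) l); lra).
  pose proof (Cmod_ge_0 (g z - m)). pose proof (Cmod_ge_0 (f z - l)).
  assert (Cmod (f z) * Cmod (g z - m) <= (Cmod l + 1) * Cmod (g z - m)) by (apply Rmult_le_compat_r; auto).
  assert ((Cmod l + 1) * Cmod (g z - m) < eps / 2).
  { apply Rlt_le_trans with ((Cmod l + 1) * e2); [apply Rmult_lt_compat_l; lra|]. unfold e2. right. field. lra. }
  assert (Cmod (f z - l) * Cmod m <= eps / 2).
  { apply Rle_trans with (eps / (2 * (Cmod m + 1)) * (Cmod m + 1)); [|right; field; lra].
    apply Rmult_le_compat; auto; lra. }
  lra.
Qed.

Lemma cusp_lim_eq f l m : cusp_lim f l -> l = m -> cusp_lim f m.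
Proof. now intros H <-. Qed.

Lemma cusp_lim_sq f l : cusp_lim f l -> cusp_lim (fun z => f z ^ 2)%C (l ^ 2)%C.
Proof.
  intros H. replace (fun z => f z ^ 2)%C with (fun z => f z * f z)%C.
  - eapply cusp_lim_eq; [apply (cusp_lim_mult _ _ _ _ H H)|]. ring.
  - apply functional_extensionality. intros. ring.
Qed.

Lemma exp_decay_small c K eps : 0 < c -> 0 <= K -> 0 < eps -> exists Y, 1 / 2 <= Y /\ forall y, Y <= y -> K * exp (- (c * y)) < eps.
Proof.
  intros Hc HK He. exists (Rmax (1 / 2) ((K + 1) / eps / c)). split; [apply Rmax_l|].
  intros y Hy. pose proof (Rmax_r (1 / 2) ((K + 1) / eps / c)).
  assert ((K + 1) / eps <= c * y) as H1.
  { apply Rle_trans with (c * ((K + 1) / eps / c)); [right; field; lra|]. apply Rmult_le_compat_l; lra. }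
  assert (0 < (K + 1) / eps) by (apply Rdiv_lt_0_compat; lra).
  pose proof (exp_ineq1 (c * y) ltac:(lra)) as H2. rewrite exp_Ropp.
  apply (Rmult_lt_reg_r (exp (c * y))); [apply exp_pos|]. rewrite Rmult_assoc, Rinv_l by (apply Rgt_not_eq, exp_pos).
  apply Rlt_trans with (eps * ((K + 1) / eps)); [|apply Rmult_lt_compat_l; lra].
  replace (eps * ((K + 1) / eps)) with (K + 1) by (field; lra). lra.
Qed.

Lemma cusp_lim_eseries al k ka : admissible al k -> 0 < ka -> (forall n, al n <> RtoC 0 -> ka <= k n) ->
  cusp_lim (eseries al k) 0.
Proof.
  intros H Hk Hn eps He. destruct (eseries_decay al k ka H Hn) as [K [HK HB]]. pose proof PI_RGT_0.
  destruct (exp_decay_small (2 * PI * ka) K eps) as [Y [HY HYb]]; auto.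
  { apply Rmult_lt_0_compat; lra. }
  exists Y. split; auto. intros z Hz. replace (eseries al k z - 0)%C with (eseries al k z) by ring.
  eapply Rle_lt_trans; [apply HB; lra|]. auto.
Qed.

Lemma cusp_lim_th2 : cusp_lim th2 0.
Proof.
  apply (cusp_lim_eseries _ _ (1 / 4)); [apply admissible_th2|lra|]. intros n _. unfold sq_half.
  pose proof (pos_INR n). nra.
Qed.

Lemma theta_head e z : Cmod e = 1 -> upper z ->
  eseries (theta_coef e) sq z = (1 + eseries (fun n => match n with O => RtoC 0 | S _ => theta_coef e n end) sq z)%C.
Proof.
  intros He Hz. set (al := fun n : nat => match n with O => RtoC 0 | S _ => theta_coef e n end).
  assert (admissible al sq) as Ha.
  { destruct (admissible_theta e He) as [[K [p [HK HB]]] Hs]. split; auto. exists K, p. split; auto.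
    intros n. destruct n; [|apply HB]. simpl al. rewrite Cmod_0. eapply Rle_trans; [apply Cmod_ge_0|apply (HB O)]. }
  unfold eseries. rewrite (csum_head (fun n => theta_coef e n * expo (sq n) z)%C) by (apply eseries_summ; auto using admissible_theta).
  rewrite (csum_head (fun n => al n * expo (sq n) z)%C) by (now apply eseries_summ).
  simpl al. simpl theta_coef. replace (sq 0) with 0 by (unfold sq; simpl; ring).
  unfold expo at 1. rewrite Cmult_0_r, Cmult_0_l, Cexp_0.
  transitivity (1 + csum (fun n => (2 * (e ^ S n)) * expo (sq (S n)) z))%C; [now rewrite Cmult_1_r|].
  change (fun n => 2 * e ^ S n * expo (sq (S n)) z)%C with (fun n => 2 * (e * e ^ n) * expo (sq (S n)) z)%C. ring.
Qed.

Lemma cusp_lim_theta e : Cmod e = 1 -> cusp_lim (eseries (theta_coef e) sq) 1.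
Proof.
  intros He1. set (al := fun n : nat => match n with O => RtoC 0 | S _ => theta_coef e n end).
  assert (admissible al sq) as Ha.
  { destruct (admissible_theta _ He1) as [[K [p [HK HB]]] Hs]. split; auto. exists K, p. split; auto.
    intros n. destruct n; [|apply HB]. simpl al. rewrite Cmod_0. eapply Rle_trans; [apply Cmod_ge_0|apply (HB O)]. }
  assert (cusp_lim (eseries al sq) 0) as Hl.
  { apply (cusp_lim_eseries _ _ 1 Ha); [lra|]. intros [|n] Hn; [now elim Hn|]. unfold sq. rewrite S_INR.
    pose proof (pos_INR n). nra. }
  intros eps He. destruct (Hl eps He) as [Y [HY HB]]. exists Y. split; auto. intros z Hz. specialize (HB z Hz).
  rewrite theta_head; [|auto|unfold upper; lra]. fold al.
  replace (1 + eseries al sq z - 1)%C with (eseries al sq z - 0)%C by ring. exact HB.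
Qed.

Lemma cusp_lim_th4 : cusp_lim th4 1.
Proof. apply cusp_lim_theta, Cmod_m1. Qed.

Lemma cusp_lim_ta : cusp_lim ta 1.
Proof. eapply cusp_lim_eq; [apply cusp_lim_sq, cusp_lim_theta, Cmod_1|]. ring. Qed.

Lemma cusp_lim_tG : cusp_lim tG 1.
Proof.
  eapply cusp_lim_eq; [apply cusp_lim_sq, cusp_lim_sq, cusp_lim_th4|]. ring.
Qed.

Lemma cusp_lim_tc : cusp_lim tc 0.
Proof. eapply cusp_lim_eq; [apply cusp_lim_sq, cusp_lim_th2|]. ring. Qed.

Lemma tE_tG_tc z : upper z -> tE z = (tG z + 2 * tc z ^ 2)%C.
Proof. intros Hz. unfold tE, tG. rewrite (jacobi_quartic z Hz). ring. Qed.

Lemma cusp_lim_tE : cusp_lim tE 1.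
Proof.
  assert (cusp_lim (fun z => tG z + 2 * tc z ^ 2)%C 1) as H.
  { eapply cusp_lim_eq; [apply cusp_lim_plus; [apply cusp_lim_tG|apply cusp_lim_mult; [apply cusp_lim_const|apply cusp_lim_sq, cusp_lim_tc]]|]. ring. }
  intros eps He. destruct (H eps He) as [Y [HY HB]]. exists Y. split; auto. intros z Hz.
  rewrite tE_tG_tc by (unfold upper; lra). auto.
Qed.

Lemma geodesic_path : path_in_H geodesic (PI / 4) (3 * PI / 4) z_start z_end.
Proof.
  pose proof PI_RGT_0. split; [lra|]. split; [apply geodesic_start|]. split; [apply geodesic_end|].
  intros s Hs. split; [apply geodesic_upper; lra|]. split; [eexists; apply geodesic_dpath|].
  apply ccont_continuous. apply ccont_ext with (fun u => Ci * geodesic u)%C.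
  - intros u. symmetry. apply velocity_eq, geodesic_dpath.
  - apply ccont_mult; [apply ccont_const|eapply is_dpath_ccont, geodesic_dpath].
Qed.

Definition rise (z : C) (Y : R) : C := (z + Ci * Y)%C.

Lemma rise_upper z Y : upper z -> 0 <= Y -> upper (rise z Y).
Proof. unfold upper, rise. destruct z; simpl. intros; lra. Qed.

Lemma Im_rise z Y : Im (rise z Y) = Im z + Y.
Proof. destruct z; simpl. ring. Qed.

Lemma Iseg_arch f Y : tame f -> 0 <= Y -> Iseg f z_start z_end =
  (Iseg f z_start (rise z_start Y) + Iseg f (rise z_start Y) (rise z_end Y) - Iseg f z_end (rise z_end Y))%C.
Proof.
  intros Hf HY. pose proof (rise_upper _ Y upper_z_start HY). pose proof (rise_upper _ Y upper_z_end HY).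
  rewrite (Iseg_chain f z_start (rise z_start Y) (rise z_end Y)) by auto using upper_z_start.
  rewrite <- (Iseg_chain f z_start (rise z_end Y) z_end) by auto using upper_z_start, upper_z_end.
  rewrite (Iseg_swap f z_end (rise z_end Y)) by auto using upper_z_end. ring.
Qed.

Lemma rise_start_end Y : rise z_start Y = (rise z_end Y + 1)%C.
Proof. unfold rise. rewrite z_start_end. ring. Qed.

(** The integrand has period 1, so the two vertical sides of the arch cancel. On the top side, run
    from right to left over length 1, it is close to its limit 1 at the cusp. *)
Lemma Iseg_GE : Iseg (fun z => tG z * tE z)%C z_start z_end = (- (1))%C.
Proof.
  set (f := fun z => (tG z * tE z)%C).
  assert (tame f) as Hf by (apply tame_mult; [apply tame_tG|apply tame_tE]).
  assert (cusp_lim f 1) as Hl.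
  { eapply cusp_lim_eq; [apply cusp_lim_mult; [apply cusp_lim_tG|apply cusp_lim_tE]|]. ring. }
  apply (Cmod_small_eq _ _ 1); [lra|]. intros eps He. rewrite Rmult_1_l.
  destruct (Hl eps He) as [Y [HY HB]].
  pose proof (rise_upper _ Y upper_z_start ltac:(lra)) as U1. pose proof (rise_upper _ Y upper_z_end ltac:(lra)) as U2.
  rewrite (Iseg_arch f Y Hf) by lra. rewrite rise_start_end, z_start_end.
  rewrite Iseg_translate, (Iseg_ext (fun x => f (x + 1)%C) f); auto using upper_z_end.
  2:{ intros x Hx. unfold f. now rewrite tG_period, tE_period. }
  rewrite <- rise_start_end.
  assert (Iseg f (rise z_start Y) (rise z_end Y) - - (1) = Iseg (fun z => f z - 1) (rise z_start Y) (rise z_end Y))%C as E.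
  { rewrite Iseg_minus by auto using tame_const. f_equal.
    rewrite (Iseg_primitive (fun z => z) (fun _ => RtoC 1)); auto using tame_const, cd_id.
    rewrite rise_start_end. ring. }
  match goal with |- Cmod ?x <= _ => replace x with (Iseg f (rise z_start Y) (rise z_end Y) - - (1))%C by ring end.
  rewrite E. replace eps with (eps * Cmod (rise z_end Y - rise z_start Y)).
  - apply Iseg_bound; auto using tame_minus, tame_const. intros s Hs. left. apply HB.
    unfold seg, rise, z_start, z_end. simpl. lra.
  - rewrite rise_start_end. replace (rise z_end Y - (rise z_end Y + 1))%C with (- (1))%C by ring.
    rewrite Cmod_opp, Cmod_1. ring.
Qed.

Definition integrand_G (k : nat) (z : C) : C := ((/ t2 z) ^ k * (tG z * tE z))%C.

Lemma t2_neq_0 z : upper z -> t2 z <> RtoC 0.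
Proof.
  intros Hz E. pose proof (tH_sq z Hz) as H. rewrite E in H.
  pose proof (tH_neq_0 z Hz). assert (tH z ^ 2 = 0)%C as H1 by (rewrite H; ring).
  revert H1. apply Cpow_nz; auto.
Qed.

Lemma tac_sq z : upper z -> (ta z ^ 2 * tc z ^ 2 = - (t2 z * tG z ^ 2) / 4)%C.
Proof.
  intros Hz. destruct (tabc_neq_0 _ Hz) as [_ [Hb _]]. rewrite t2_thetas by auto. unfold tG. field. auto.
Qed.

Lemma tG_neq_0 z : upper z -> tG z <> RtoC 0.
Proof. intros Hz. destruct (tabc_neq_0 _ Hz) as [_ [Hb _]]. now apply Cpow_nz. Qed.

Lemma th_period z : th (z + 1) = th z.
Proof.
  assert (forall e, eseries (dcoef (theta_coef e) sq) sq (z + 1) = eseries (dcoef (theta_coef e) sq) sq z) as H.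
  { intros e. apply csum_ext. intros n. rewrite expo_add. unfold sq at 3. rewrite <- mult_INR, expo_int. ring. }
  unfold th, Dtb, Dth4, th4. rewrite H, theta_period. rewrite tb_period. reflexivity.
Qed.

(** With theta = t d/dt, x = theta + 1/2 and y = k + 1/2, this is the coefficient of order zero in
    x^2 + x y + y^2. That is the cofactor of x - y in x^3 - y^3, and t^-k (x - y) F is the exact
    derivative theta (t^-k F). *)
Definition primitive_coef (k : nat) : C := (1 / 4 + (INR k + 1 / 2) / 2 + (INR k + 1 / 2) ^ 2)%C.

(* Found by the method of undetermined coefficients from the third order equation of [tG]:
   it makes [cd_primitive_G] an exact differential. *)
Definition primitive_G (k : nat) (z : C) : C :=
  ((/ t2 z) ^ S k * (- (2 * (th z ^ 2 / tG z) + / 8 * (t2 z * tG z)) - INR (S k) * (2 * (th z * (tE z / tG z)))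
    + primitive_coef k * (t2 z * tG z) - INR (S k) ^ 2 * tG z))%C.

(** Put n = k + 1, x = theta + 1/2, y = k + 1/2 for theta = t d/dt. As a function of t,
    [primitive_G] is t^-n times - (theta^2 + n theta + n^2) G + t (x^2 + x y + y^2) G, where theta G
    = 2 h G / E. Its theta-derivative is n^3 t^-n G - y^3 t^-k G, because the third order terms
    cancel by theta^3 G = t x^3 G. *)
Lemma cd_primitive_G k z : upper z ->
  cd (primitive_G k) z (kap * (INR (S k) ^ 3 * integrand_G (S k) z - (INR k + 1 / 2) ^ 3 * integrand_G k z))%C.
Proof.
  intros Hz. pose proof (t2_neq_0 z Hz) as Ht. pose proof (tG_neq_0 z Hz) as HG.
  pose proof (cd_t2 z Hz) as D1. pose proof (cd_tG z Hz) as D2. pose proof (cd_tE z Hz) as D3. pose proof (cd_th' z Hz) as D4.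
  pose proof (cd_inv _ _ _ HG D2) as D5.
  eapply cd_eq.
  - apply cd_mult; [apply (cd_pow (fun z => / t2 z)%C), cd_inv; eauto|].
    apply cd_minus; [apply cd_plus; [apply cd_minus; [apply cd_opp, cd_plus|]|]|].
    + apply cd_scal, (cd_mult (fun z => th z ^ 2)%C (fun z => / tG z)%C); [apply cd_sq, D4|apply D5].
    + apply cd_scal, cd_mult; eauto.
    + apply cd_scal, cd_scal, cd_mult; [apply D4|apply (cd_mult tE (fun z => / tG z)%C); eauto].
    + apply cd_scal, cd_mult; eauto.
    + apply cd_scal; eauto.
  - cbv beta. change (pred (S k)) with k. unfold integrand_G, primitive_coef.
    replace (2 * ta z ^ 2 * tc z ^ 2)%C with (2 * (ta z ^ 2 * tc z ^ 2))%C by ring.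
    rewrite tac_sq by auto. pose proof (tE_sq z Hz) as E2.
    rewrite S_INR, RtoC_plus.
    change ((/ t2 z) ^ S k)%C with (/ t2 z * (/ t2 z) ^ k)%C.
    generalize (th z). intros h. set (p := ((/ t2 z) ^ k)%C). set (n := RtoC (INR k)).
    revert E2 HG Ht. clearbody p. generalize (t2 z) (tG z) (tE z) kap n. clear. intros t G E ka n E2 HG Ht.
    (* The two sides agree only modulo E^2 = G^2 (1 - t); the added summand is the multiple of this
       relation by which they differ. *)
    match goal with |- _ = ?B => transitivity (B + ka * (/ t * p * (2 * (n + 1) ^ 2 * (h / G))) * (E ^ 2 - G ^ 2 * (1 - t)))%C end.
    + field. auto.
    + rewrite E2. ring.
Qed.

Lemma primitive_G_period k z : upper z -> primitive_G k (z + 1) = primitive_G k z.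
Proof. intros Hz. unfold primitive_G. now rewrite th_period, t2_period, tG_period, tE_period. Qed.

Lemma scal_C_R (r : R) (z : C) : scal (V := C_R_CompleteNormedModule) r z = (r * z)%C.
Proof. destruct z as [x y]. change ((r * x, r * y) = (r * x - 0 * y, r * y + 0 * x)). f_equal; ring. Qed.

(** An exact integrand is integrated without approximation by exponential polynomials, so this also
    covers the negative powers of [t2], for which [tame] is not established. *)
Lemma path_integral_primitive P f g al be z w : path_in_H g al be z w ->
  (forall x, upper x -> cd P x (f x)) -> (forall x, upper x -> exists l, cd f x l) ->
  path_integral f g al be = (P w - P z)%C.
Proof.
  intros Hp HP Hf. pose proof Hp as [Hab [Ez [Ew Hs]]]. unfold path_integral.
  apply (is_RInt_unique (V := C_R_CompleteNormedModule)). rewrite <- Ez, <- Ew.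
  apply (is_RInt_dpath (fun s => P (g s))); rewrite Rmin_left, Rmax_right by auto; intros s Hss.
  - apply cd_path; [apply HP; now apply Hs|]. eapply path_dpath; eauto.
  - destruct (Hs s Hss) as [Hu [_ Hv]]. apply ccont_mult; [|now apply ccont_continuous].
    destruct (Hf (g s) Hu) as [l Hl]. eapply ccont_cd; eauto. eapply is_dpath_ccont, path_dpath; eauto.
Qed.

Lemma path_integral_lin (r s : R) f h g al be z w : path_in_H g al be z w ->
  (forall x, upper x -> exists l, cd f x l) -> (forall x, upper x -> exists l, cd h x l) ->
  path_integral (fun x => r * f x - s * h x)%C g al be = (r * path_integral f g al be - s * path_integral h g al be)%C.
Proof.
  intros Hp Hf Hh. pose proof (path_integrable f g al be z w Hf Hp) as I1.
  pose proof (path_integrable h g al be z w Hh Hp) as I2.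
  apply (is_RInt_unique (V := C_R_CompleteNormedModule)).
  apply (is_RInt_scal (V := C_R_CompleteNormedModule) _ al be r) in I1.
  apply (is_RInt_scal (V := C_R_CompleteNormedModule) _ al be s) in I2.
  rewrite scal_C_R in I1, I2. pose proof (is_RInt_Cminus _ _ al be _ _ I1 I2) as I.
  apply (is_RInt_ext (V := C_R_CompleteNormedModule)) with (2 := I). intros u _. rewrite !scal_C_R.
  match goal with |- ?a = ?b => change (a = b :> C) end. ring.
Qed.

(** Taken along the geodesic itself, since the conjugation argument works on it. *)
Definition moment_G (k : nat) : C := path_integral (integrand_G k) geodesic (PI / 4) (3 * PI / 4).

Lemma integrand_G_cd k z : upper z -> exists l, cd (integrand_G k) z l.
Proof.
  intros Hz. eexists. apply cd_mult; [apply (cd_pow (fun z => / t2 z)%C), cd_inv|apply cd_mult].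
  - now apply t2_neq_0.
  - now apply cd_t2.
  - now apply cd_tG.
  - now apply cd_tE.
Qed.

(** The primitive has period 1 and the ends of the geodesic differ by 1, so there are no boundary
    terms. *)
Lemma moment_G_rec k : (INR (S k) ^ 3 * moment_G (S k) = (INR k + 1 / 2) ^ 3 * moment_G k)%C.
Proof.
  assert (INR (S k) ^ 3 * moment_G (S k) - (INR k + 1 / 2) ^ 3 * moment_G k = 0)%C as H.
  { transitivity (path_integral (fun z => (INR (S k) ^ 3)%R * integrand_G (S k) z - ((INR k + 1 / 2) ^ 3)%R * integrand_G k z)%C geodesic (PI / 4) (3 * PI / 4)).
    - rewrite (path_integral_lin _ _ _ _ _ _ _ _ _ geodesic_path) by (intros; now apply integrand_G_cd).
      unfold moment_G. rewrite !RtoC_pow, RtoC_plus, RtoC_div by lra. reflexivity.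
    - rewrite (path_integral_primitive (fun z => / kap * primitive_G k z)%C _ _ _ _ _ _ geodesic_path).
      + rewrite z_start_end, primitive_G_period by apply upper_z_end. ring.
      + intros x Hx. eapply cd_eq; [apply cd_scal, cd_primitive_G, Hx|].
        rewrite !RtoC_pow, RtoC_plus, RtoC_div by lra. field. apply kap_neq_0.
      + intros x Hx. destruct (integrand_G_cd (S k) x Hx), (integrand_G_cd k x Hx). eexists. apply cd_minus; apply cd_scal; eauto. }
  transitivity (INR (S k) ^ 3 * moment_G (S k) - (INR k + 1 / 2) ^ 3 * moment_G k + (INR k + 1 / 2) ^ 3 * moment_G k)%C; [ring|].
  rewrite H. ring.
Qed.

Definition alpha (k : nat) : R := (pochhammer (1 / 2) k / INR (fact k)) ^ 3.

Lemma alpha_0 : alpha 0 = 1.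
Proof. unfold alpha. simpl. field. Qed.

Lemma alpha_rec k : INR (S k) ^ 3 * alpha (S k) = (INR k + 1 / 2) ^ 3 * alpha k.
Proof.
  unfold alpha. change (pochhammer (1 / 2) (S k)) with (pochhammer (1 / 2) k * (1 / 2 + INR k)).
  replace (INR (fact (S k))) with (INR (S k) * INR (fact k)) by (now rewrite <- mult_INR).
  assert (INR (S k) <> 0) by (apply not_0_INR; lia). pose proof (INR_fact_neq_0 k).
  generalize dependent (INR (S k)). intros. field. auto.
Qed.

Lemma moment_G_alpha k : moment_G k = RtoC (- alpha k).
Proof.
  induction k as [|k IH].
  - rewrite alpha_0. unfold moment_G.
    rewrite (path_independent (integrand_G 0) geodesic _ _ z_start z_end).
    + rewrite (Iseg_ext (integrand_G 0) (fun z => tG z * tE z)%C); auto using upper_z_start, upper_z_end.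
      * rewrite Iseg_GE. now rewrite RtoC_opp.
      * intros x _. unfold integrand_G. change ((/ t2 x) ^ 0)%C with (RtoC 1). ring.
    + apply tame_ext with (fun z => tG z * tE z)%C.
      * intros x _. unfold integrand_G. change ((/ t2 x) ^ 0)%C with (RtoC 1). ring.
      * apply tame_mult; [apply tame_tG|apply tame_tE].
    + apply geodesic_path.
  - pose proof (moment_G_rec k) as H. rewrite IH in H.
    assert (RtoC (INR (S k)) <> 0)%C as Hn by (apply RtoC_neq_0, not_0_INR; lia).
    apply (Cmult_cancel_l (INR (S k) ^ 3)%C); [now apply Cpow_nz|]. rewrite H.
    rewrite <- RtoC_pow, <- RtoC_mult.
    replace (INR (S k) ^ 3 * - alpha (S k)) with (- ((INR k + 1 / 2) ^ 3 * alpha k)) by (rewrite <- alpha_rec; ring).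
    rewrite !RtoC_opp, RtoC_mult, RtoC_pow, RtoC_plus, RtoC_div by lra. ring.
Qed.

Lemma is_RInt_conj (f : R -> C) a b (l : C) : is_RInt (V := C_R_CompleteNormedModule) f a b l ->
  is_RInt (V := C_R_CompleteNormedModule) (fun s => Cconj (f s)) a b (Cconj l).
Proof.
  intros H.
  pose proof (is_RInt_fct_extend_fst (U := R_NormedModule) (V := R_NormedModule) f a b l H) as H1.
  pose proof (is_RInt_fct_extend_snd (U := R_NormedModule) (V := R_NormedModule) f a b l H) as H2.
  apply (is_RInt_fct_extend_pair (U := R_NormedModule) (V := R_NormedModule) (fun s => Cconj (f s)) a b).
  - exact H1.
  - apply (is_RInt_opp (V := R_NormedModule)), H2.
Qed.

Definition integrand_H (k : nat) (z : C) : C := (t2 z ^ k * (tH z * tE z))%C.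

Lemma tame_integrand_H k : tame (integrand_H k).
Proof. apply tame_mult; [apply tame_pow, tame_t2|apply tame_mult; [apply tame_tH|apply tame_tE]]. Qed.

Lemma Cinv_unit z : Cmod z = 1 -> (/ z = Cconj z)%C.
Proof.
  intros H. assert (z <> 0)%C as Hz by (intros ->; rewrite Cmod_0 in H; lra).
  apply (Cmult_cancel_l z); auto. rewrite Cinv_r by auto. rewrite <- Cmod2_conj, H. now rewrite pow1.
Qed.

(** The velocity i z is grouped with E, as i z E is real on the arc; conjugation then only exchanges
    1 / t with t and G with H. *)
Lemma geodesic_integrand_conj k s : 0 < s < PI ->
  (Cconj (integrand_G k (geodesic s) * (Ci * geodesic s)) = integrand_H k (geodesic s) * (Ci * geodesic s))%C.
Proof.
  intros Hs. pose proof (geodesic_tE_imaginary s Hs) as Hi.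
  assert (Cconj (Ci * (geodesic s * tE (geodesic s))) = Ci * (geodesic s * tE (geodesic s)))%C as Hr.
  { destruct (geodesic s * tE (geodesic s))%C as [x y]. simpl in Hi. rewrite Hi. unfold Cconj, Ci, Cmult; simpl. f_equal; ring. }
  unfold integrand_G, integrand_H. rewrite Cinv_unit by (now apply geodesic_t2).
  transitivity (Cconj (Cconj (t2 (geodesic s)) ^ k) * Cconj (tG (geodesic s)) * Cconj (Ci * (geodesic s * tE (geodesic s))))%C.
  { rewrite <- !Cmult_conj. f_equal. ring. }
  rewrite Hr, geodesic_tG, Cpow_conj, Cconj_conj by auto. ring.
Qed.

Lemma Iseg_integrand_H k : Iseg (integrand_H k) z_start z_end = RtoC (- alpha k).
Proof.
  rewrite <- (path_independent (integrand_H k) geodesic _ _ _ _ (tame_integrand_H k) geodesic_path).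
  pose proof (path_integrable (integrand_G k) geodesic _ _ _ _ (integrand_G_cd k) geodesic_path) as I.
  fold (moment_G k) in I. rewrite moment_G_alpha in I. apply is_RInt_conj in I. rewrite Cconj_R in I.
  apply (is_RInt_unique (V := C_R_CompleteNormedModule)).
  pose proof PI_RGT_0. apply (is_RInt_ext (V := C_R_CompleteNormedModule)) with (2 := I).
  rewrite Rmin_left, Rmax_right by lra. intros s Hs.
  rewrite (velocity_eq _ _ _ (geodesic_dpath s)). apply geodesic_integrand_conj. lra.
Qed.

(** * The vertical line Re tau = 1/2 *)

Definition vline (Y : R) : C := rise z_start Y.

Lemma vline_upper Y : 0 <= Y -> upper (vline Y).
Proof. intros. apply rise_upper; auto using upper_z_start. Qed.

Lemma vline_0 : vline 0 = z_start.
Proof. unfold vline, rise. ring. Qed.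

(** The line is pointwise fixed by z -> 1 - conj z. With real q-coefficients and period 1 this makes
    a, b, h, t, G and E real on it, whereas c, which changes sign under the translation, is
    imaginary. *)
Lemma vline_conj Y : vline Y = (- Cconj (vline Y) + 1)%C.
Proof. unfold vline, rise, z_start, Cconj, Ci, Cmult, Cplus, Copp, RtoC; simpl. f_equal; field. Qed.

Definition real_on (f : C -> C) (Y : R) : Prop := f (vline Y) = RtoC (Re (f (vline Y))).

Lemma Cconj_real (x : C) : Cconj x = x -> x = RtoC (Re x).
Proof. destruct x as [x y]. unfold Cconj, RtoC; simpl. intros E. injection E as E. f_equal. lra. Qed.

Lemma vline_thetas Y : 0 <= Y -> exists a b c : R, ta (vline Y) = RtoC a /\ tb (vline Y) = RtoC b /\ tc (vline Y) = (Ci * c)%C.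
Proof.
  intros HY. pose proof (vline_upper Y HY) as Hu. pose proof (upper_conj _ Hu) as Hu'.
  destruct (thetas_conj (vline Y) Hu) as [E2 [E3 E4]].
  exists (Re (ta (vline Y))), (Re (tb (vline Y))), (Im (tc (vline Y))). split; [|split].
  - apply Cconj_real. rewrite (vline_conj Y) at 2. rewrite ta_period. unfold ta.
    now rewrite E3, Cpow_conj.
  - apply Cconj_real. rewrite (vline_conj Y) at 2. rewrite tb_period. unfold tb. now rewrite E4, Cpow_conj.
  - assert (Cconj (tc (vline Y)) = - tc (vline Y))%C as E.
    { transitivity (- - Cconj (tc (vline Y)))%C; [ring|]. f_equal. rewrite (vline_conj Y) at 2. rewrite tc_period by auto.
      unfold tc. now rewrite E2, Cpow_conj. }
    destruct (tc (vline Y)) as [x y]. unfold Cconj, Copp in E; simpl in E. injection E as E1.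
    unfold Ci, Cmult, RtoC; simpl. f_equal; lra.
Qed.

Lemma vline_th Y : 0 <= Y -> real_on th Y.
Proof.
  intros HY. pose proof (vline_upper Y HY) as Hu. apply Cconj_real. rewrite (vline_conj Y) at 2. rewrite th_period.
  destruct (thetas_conj (vline Y) Hu) as [_ [_ E4]].
  assert (Dth4 (- Cconj (vline Y)) = Cconj (Dth4 (vline Y))) as E.
  { apply eseries_conj; auto.
    - apply admissible_dcoef, admissible_theta, Cmod_m1.
    - intros n. unfold dcoef. rewrite Cmult_conj, Cconj_R. f_equal.
      replace (- (1))%C with (RtoC (-1)) by ring. apply theta_coef_conj. }
  unfold th, Dtb, tb. rewrite E, E4. rewrite Cdiv_conj.
  - rewrite !Cmult_conj, Cpow_conj, Cconj_R. reflexivity.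
  - apply Cpow_nz. now destruct (thetas_neq_0 _ Hu) as [_ [_ H]].
Qed.

Definition line_t (Y : R) : R := Re (t2 (vline Y)).
Definition line_G (Y : R) : R := Re (tG (vline Y)).
Definition line_E (Y : R) : R := Re (tE (vline Y)).
Definition line_h (Y : R) : R := Re (th (vline Y)).

Lemma vline_real Y : 0 <= Y -> real_on t2 Y /\ real_on tG Y /\ real_on tE Y /\ 0 < line_t Y /\ 0 < line_G Y.
Proof.
  intros HY. pose proof (vline_upper Y HY) as Hu. destruct (vline_thetas Y HY) as [a [b [c [Ea [Eb Ec]]]]].
  destruct (tabc_neq_0 _ Hu) as [Na [Nb Nc]].
  assert (a <> 0) as Na' by (intros ->; now apply Na). assert (b <> 0) as Nb' by (intros ->; now apply Nb).
  assert (c <> 0) as Nc' by (intros ->; apply Nc; rewrite Ec; ring).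
  assert (t2 (vline Y) = RtoC (4 * a ^ 2 * c ^ 2 / b ^ 4)) as Et.
  { rewrite t2_thetas, Ea, Eb, Ec by auto. rewrite RtoC_div by (now apply pow_nonzero).
    rewrite !RtoC_mult, !RtoC_pow. replace ((Ci * c) ^ 2)%C with (Ci ^ 2 * c ^ 2)%C by ring. rewrite Ci_sq.
    field. intros E. apply Nb'. now injection E. }
  assert (tG (vline Y) = RtoC (b ^ 2)) as EG by (unfold tG; now rewrite Eb, RtoC_pow).
  assert (tE (vline Y) = RtoC (a ^ 2 - c ^ 2)) as EE.
  { unfold tE. rewrite Ea, Ec, RtoC_minus, !RtoC_pow. replace ((Ci * c) ^ 2)%C with (Ci ^ 2 * c ^ 2)%C by ring. rewrite Ci_sq. ring. }
  unfold real_on, line_t, line_G. rewrite Et, EG, EE.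
  assert (0 < a ^ 2) by (now apply pow2_gt_0). assert (0 < b ^ 2) by (now apply pow2_gt_0). assert (0 < c ^ 2) by (now apply pow2_gt_0).
  change (Re (RtoC (4 * a ^ 2 * c ^ 2 / b ^ 4))) with (4 * a ^ 2 * c ^ 2 / b ^ 4).
  change (Re (RtoC (b ^ 2))) with (b ^ 2). change (Re (RtoC (a ^ 2 - c ^ 2))) with (a ^ 2 - c ^ 2).
  split; [|split; [|split; [|split]]]; auto.
  apply Rdiv_lt_0_compat; [apply Rmult_lt_0_compat; [apply Rmult_lt_0_compat|]; lra|].
  replace (b ^ 4) with (b ^ 2 * b ^ 2) by ring. now apply Rmult_lt_0_compat.
Qed.

Lemma vline_dpath Y : is_dpath vline Y Ci.
Proof.
  apply is_dpath_eps. intros eps He. exists 1. split; [lra|]. intros u _. unfold vline, rise.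
  replace (z_start + Ci * u - (z_start + Ci * Y) - (u - Y)%R * Ci)%C with (RtoC 0) by (rewrite RtoC_minus; ring).
  rewrite Cmod_0. apply Rmult_le_pos; [lra|apply Rabs_pos].
Qed.

(** Moving upwards multiplies the derivative in tau by i, and i kap = - 2 pi; so d/dY is - 2 pi
    D. *)
Lemma vline_derive f Y (r : R) : cd f (vline Y) (kap * r)%C -> is_derive (fun y => Re (f (vline y))) Y (- (2 * PI) * r).
Proof.
  intros H. pose proof (is_dpath_Re _ _ _ (cd_path _ _ _ _ _ H (vline_dpath Y))) as D.
  replace (- (2 * PI) * r) with (Re (kap * r * Ci)); auto.
  replace (kap * r * Ci)%C with (RtoC (- (2 * PI) * r)); [reflexivity|].
  rewrite RtoC_mult, RtoC_opp, RtoC_mult. unfold kap. transitivity (Ci ^ 2 * (2 * PI * r))%C; [rewrite Ci_sq; ring|ring].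
Qed.

Lemma line_t_derive Y : 0 <= Y -> is_derive line_t Y (- (2 * PI) * (line_t Y * line_E Y)).
Proof.
  intros HY. destruct (vline_real Y HY) as [Rt [RG [RE _]]]. apply vline_derive. eapply cd_eq; [apply cd_t2, vline_upper, HY|].
  rewrite Rt, RE. unfold line_t, line_E. now rewrite RtoC_mult.
Qed.

Lemma line_G_derive Y : 0 <= Y -> is_derive line_G Y (- (2 * PI) * (2 * line_h Y * line_G Y)).
Proof.
  intros HY. destruct (vline_real Y HY) as [Rt [RG [RE _]]]. pose proof (vline_th Y HY) as Rh.
  apply vline_derive. eapply cd_eq; [apply cd_tG, vline_upper, HY|].
  rewrite RG, Rh. unfold line_h, line_G. now rewrite !RtoC_mult.
Qed.

Lemma line_E_derive Y : 0 <= Y -> is_derive line_E Y (- (2 * PI) * (2 * line_h Y * line_E Y - line_t Y * line_G Y ^ 2 / 2)).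
Proof.
  intros HY. destruct (vline_real Y HY) as [Rt [RG [RE _]]]. pose proof (vline_th Y HY) as Rh.
  apply vline_derive. eapply cd_eq; [apply cd_tE, vline_upper, HY|].
  replace (2 * ta (vline Y) ^ 2 * tc (vline Y) ^ 2)%C with (2 * (ta (vline Y) ^ 2 * tc (vline Y) ^ 2))%C by ring.
  rewrite tac_sq by (now apply vline_upper).
  rewrite RG, Rh, Rt, RE. unfold line_h, line_G, line_t, line_E. rewrite RtoC_minus, RtoC_div, !RtoC_mult, RtoC_pow by lra. field.
Qed.

Lemma line_h_derive Y : 0 <= Y -> is_derive line_h Y (- (2 * PI) * (line_h Y ^ 2 + line_t Y * line_G Y ^ 2 / 16)).
Proof.
  intros HY. destruct (vline_real Y HY) as [Rt [RG [RE _]]]. pose proof (vline_th Y HY) as Rh.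
  apply vline_derive. eapply cd_eq; [apply cd_th', vline_upper, HY|].
  rewrite tac_sq by (now apply vline_upper).
  rewrite RG, Rh, Rt. unfold line_h, line_G, line_t. rewrite RtoC_plus, RtoC_div, !RtoC_mult, !RtoC_pow by lra. field.
Qed.

Lemma line_E_sq Y : 0 <= Y -> line_E Y ^ 2 = line_G Y ^ 2 * (1 - line_t Y).
Proof.
  intros HY. destruct (vline_real Y HY) as [Rt [RG [RE _]]]. pose proof (tE_sq _ (vline_upper Y HY)) as E.
  rewrite Rt, RG, RE in E. apply RtoC_inj. now rewrite RtoC_mult, RtoC_minus, !RtoC_pow.
Qed.

Lemma line_t_0 : line_t 0 = 1.
Proof. unfold line_t. now rewrite vline_0, t2_z_start. Qed.

Lemma line_E_0 : line_E 0 = 0.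
Proof. unfold line_E. now rewrite vline_0, tE_z_start. Qed.

Lemma line_E_over_G_derive Y : 0 <= Y -> is_derive (fun y => line_E y / line_G y) Y (PI * (line_t Y * line_G Y)).
Proof.
  intros HY. destruct (vline_real Y HY) as [_ [_ [_ [_ HG]]]].
  pose proof (is_derive_div _ _ _ _ _ (line_E_derive Y HY) (line_G_derive Y HY) (Rgt_not_eq _ _ HG)) as D.
  match type of D with is_derive _ _ ?l => replace (PI * (line_t Y * line_G Y)) with l; [exact D|] end. field. lra.
Qed.

(** E / G vanishes at Y = 0 and increases, its derivative being pi t G > 0; and 1 - t = (E /
    G)^2. *)
Lemma line_t_lt_1 Y : 0 < Y -> line_t Y < 1.
Proof.
  intros HY. destruct (vline_real Y) as [_ [_ [_ [Ht HG]]]]; [lra|].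
  destruct (MVT_gen (fun y => line_E y / line_G y) 0 Y (fun y => PI * (line_t y * line_G y))) as [c [Hc E]].
  - rewrite Rmin_left, Rmax_right by lra. intros x Hx. apply line_E_over_G_derive. lra.
  - rewrite Rmin_left, Rmax_right by lra. intros x Hx. apply continuity_pt_filterlim, (ex_derive_continuous (fun y => line_E y / line_G y)).
    eexists. apply line_E_over_G_derive. lra.
  - rewrite Rmin_left, Rmax_right in Hc by lra. destruct (vline_real c) as [_ [_ [_ [Hc1 Hc2]]]]; [lra|].
    rewrite line_E_0 in E. unfold Rdiv in E at 2. rewrite Rmult_0_l in E.
    pose proof PI_RGT_0. assert (0 < line_E Y / line_G Y) as Hp.
    { replace (line_E Y / line_G Y) with (PI * (line_t c * line_G c) * (Y - 0)) by lra.
      apply Rmult_lt_0_compat; [|lra]. apply Rmult_lt_0_compat; auto. now apply Rmult_lt_0_compat. }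
    assert (1 - line_t Y = (line_E Y / line_G Y) ^ 2) as E1.
    { apply (Rmult_eq_reg_l (line_G Y ^ 2)); [|apply pow_nonzero; lra]. rewrite <- line_E_sq by lra. field. lra. }
    assert (0 < (line_E Y / line_G Y) ^ 2) by (apply pow_lt; auto). lra.
Qed.

(** * The series 3F2(1/2, 1/2, 1/2; 1, 1; x) and its differential equation *)

Lemma alpha_bound k : 0 < alpha k <= 1.
Proof.
  induction k as [|k [IH1 IH2]]; [rewrite alpha_0; lra|].
  pose proof (alpha_rec k) as H. pose proof (pos_INR k) as Hk. pose proof (S_INR k) as HS.
  assert (0 < INR (S k) ^ 3) as H1 by (apply pow_lt; lra).
  assert (0 < (INR k + 1 / 2) ^ 3) as H2 by (apply pow_lt; lra).
  assert ((INR k + 1 / 2) ^ 3 <= INR (S k) ^ 3) as H3 by (apply pow_incr; lra).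
  split.
  - apply (Rmult_lt_reg_l (INR (S k) ^ 3)); auto. rewrite Rmult_0_r, H. now apply Rmult_lt_0_compat.
  - apply (Rmult_le_reg_l (INR (S k) ^ 3)); auto. rewrite H. nra.
Qed.

(** The weight k^j is the effect of j applications of the Euler operator x d/dx on the
    hypergeometric series [Fser 0]. *)
Definition acoef (j k : nat) : R := INR k ^ j * alpha k.
Definition Fser (j : nat) (x : R) : R := PSeries (acoef j) x.

Lemma acoef_step j : acoef (S j) = fun k => INR k * acoef j k.
Proof. apply functional_extensionality. intros k. unfold acoef. simpl. ring. Qed.

(** As alpha is at most 1, the coefficients grow polynomially, and at a radius r strictly between x
    and 1 the terms stay bounded. *)
Lemma CV_radius_acoef j x : 0 <= x < 1 -> Rbar_lt (Rabs x) (CV_radius (acoef j)).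
Proof.
  intros Hx. rewrite Rabs_pos_eq by lra. set (r := (1 + x) / 2).
  apply Rbar_lt_le_trans with r; [simpl; unfold r; lra|].
  assert (exists M, forall n, Rabs (acoef j n * r ^ n) <= M) as [M HM].
  { pose proof (poly_exp_summable j (- ln r)) as Hs.
    assert (0 < - ln r) as Hl by (assert (ln r < ln 1) by (apply ln_increasing; unfold r; lra); rewrite ln_1 in *; lra).
    specialize (Hs Hl). exists (Series (fun n => (INR n + 1) ^ j * exp (- (- ln r * INR n)))). intros n.
    assert (forall n, 0 <= (INR n + 1) ^ j * exp (- (- ln r * INR n))) as Hp.
    { intros m. pose proof (pos_INR m). apply Rmult_le_pos; [apply pow_le; lra|left; apply exp_pos]. }
    apply Rle_trans with ((INR n + 1) ^ j * exp (- (- ln r * INR n))).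
    - pose proof (pos_INR n). pose proof (alpha_bound n). unfold acoef.
      assert (0 <= INR n ^ j) by (now apply pow_le).
      assert (r ^ n = exp (- (- ln r * INR n))) as <-.
      { replace (- (- ln r * INR n)) with (INR n * ln r) by ring. rewrite <- Rpower_pow by (unfold r; lra). reflexivity. }
      assert (0 <= r ^ n) by (apply pow_le; unfold r; lra).
      rewrite Rabs_pos_eq by (apply Rmult_le_pos; [apply Rmult_le_pos|]; lra).
      apply Rmult_le_compat_r; auto. apply Rle_trans with (INR n ^ j * 1); [apply Rmult_le_compat_l; lra|].
      rewrite Rmult_1_r. apply pow_incr. lra.
    - apply Rle_trans with (sum_n (fun n => (INR n + 1) ^ j * exp (- (- ln r * INR n))) n); [|now apply sum_n_le_Series].
      destruct n as [|n]; [rewrite sum_O; lra|]. rewrite sum_Sn.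
      assert (0 <= sum_n (fun n => (INR n + 1) ^ j * exp (- (- ln r * INR n))) n) as Hq.
      { clear - Hp. induction n; [rewrite sum_O; auto|]. rewrite sum_Sn. now apply Rplus_le_le_0_compat. }
      match goal with |- _ <= plus ?a ?b => change (plus a b) with (a + b) end. lra. }
  apply (CV_radius_bounded (acoef j)). now exists M.
Qed.

Lemma ex_Fser j x : 0 <= x < 1 -> ex_series (fun k => acoef j k * x ^ k).
Proof.
  intros Hx. apply ex_series_Rabs, (CV_disk_inside (acoef j) x), CV_radius_acoef, Hx.
Qed.

Lemma Fser_derive j x : 0 < x < 1 -> is_derive (Fser j) x (/ x * Fser (S j) x).
Proof.
  intros Hx. replace (/ x * Fser (S j) x) with (PSeries (PS_derive (acoef j)) x).
  - apply is_derive_PSeries, CV_radius_acoef. lra.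
  - unfold Fser, PSeries. rewrite (Series_incr_1 (fun k => acoef (S j) k * x ^ k)) by (apply ex_Fser; lra).
    rewrite acoef_step. simpl INR at 1. rewrite !Rmult_0_l, Rplus_0_l, <- Series_scal_l.
    apply Series_ext. intros n. unfold PS_derive. rewrite <- tech_pow_Rmult. field. lra.
Qed.

(** The recursion of [alpha] says theta^3 F = x (theta + 1/2)^3 F for the Euler operator theta; the
    cube is expanded. *)
Lemma Fser_ode x : 0 <= x < 1 -> Fser 3 x = x * (Fser 3 x + 3 / 2 * Fser 2 x + 3 / 4 * Fser 1 x + 1 / 8 * Fser 0 x).
Proof.
  intros Hx. unfold Fser at 1, PSeries. rewrite Series_incr_1 by (now apply ex_Fser).
  unfold Fser, PSeries. rewrite <- !Series_scal_l.
  pose proof (fun j => ex_Fser j x Hx) as E.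
  assert (forall c j, ex_series (fun k => c * (acoef j k * x ^ k))) as E' by (intros; apply ex_series_scal_r, E).
  rewrite <- (Series_plus _ _ (E 3%nat) (E' (3 / 2) 2%nat)).
  rewrite <- Series_plus; [|apply (ex_series_plus _ _ (E 3%nat) (E' (3 / 2) 2%nat))|apply E'].
  rewrite <- Series_plus; [|apply (ex_series_plus _ _ (ex_series_plus _ _ (E 3%nat) (E' (3 / 2) 2%nat)) (E' (3/4) 1%nat))|apply E'].
  rewrite <- Series_scal_l.
  replace (acoef 3 0) with 0 by (unfold acoef; simpl; ring). rewrite Rmult_0_l, Rplus_0_l.
  apply Series_ext. intros n. unfold acoef. rewrite alpha_rec, <- tech_pow_Rmult. simpl pow. field.
Qed.

Lemma Fser_at_0 j : Fser j 0 = match j with O => 1 | S _ => 0 end.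
Proof.
  unfold Fser. rewrite PSeries_0. unfold acoef. rewrite alpha_0. destruct j; simpl; ring.
Qed.

Lemma Fser_lim_0 j (f : R -> R) : is_lim f p_infty 0 -> is_lim (fun y => Fser j (f y)) p_infty (Fser j 0).
Proof.
  intros H.
  apply (is_lim_comp_continuous f (Fser j) p_infty 0); auto.
  apply continuity_pt_filterlim, PSeries_continuity, CV_radius_acoef. lra.
Qed.

(* [ratio_D] and [ratio_DD] are the first two derivatives of [ratio] for the derivation D. *)
Definition ratio (Y : R) : R := Fser 0 (line_t Y) / line_G Y.
Definition ratio_D (Y : R) : R := (line_E Y * Fser 1 (line_t Y) - 2 * line_h Y * Fser 0 (line_t Y)) / line_G Y.
Definition ratio_DD (Y : R) : R :=
  (line_E Y ^ 2 * Fser 2 (line_t Y) - 2 * line_h Y * line_E Y * Fser 1 (line_t Y) + 2 * line_h Y ^ 2 * Fser 0 (line_t Y)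
   - line_t Y * line_G Y ^ 2 * (/ 2 * Fser 1 (line_t Y) + / 8 * Fser 0 (line_t Y))) / line_G Y.

Lemma Fser_lt_derive j Y : 0 < Y -> is_derive (fun y => Fser j (line_t y)) Y (- (2 * PI) * (line_E Y * Fser (S j) (line_t Y))).
Proof.
  intros HY. destruct (vline_real Y) as [_ [_ [_ [Ht _]]]]; [lra|]. pose proof (line_t_lt_1 Y HY).
  pose proof (is_derive_comp (Fser j) line_t Y _ _ (Fser_derive j (line_t Y) (conj Ht H)) (line_t_derive Y (Rlt_le _ _ HY))) as D.
  match type of D with is_derive _ _ ?l => replace (- (2 * PI) * (line_E Y * Fser (S j) (line_t Y))) with l; [exact D|] end.
  unfold scal; simpl. unfold mult; simpl. field. lra.
Qed.

Ltac derive_fields HY :=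
  match goal with |- is_derive _ ?Y _ =>
    pose proof (Fser_lt_derive 0 Y HY) as D0; pose proof (Fser_lt_derive 1 Y HY) as D1; pose proof (Fser_lt_derive 2 Y HY) as D2;
    pose proof (line_t_derive Y (Rlt_le _ _ HY)) as Dt; pose proof (line_G_derive Y (Rlt_le _ _ HY)) as DG;
    pose proof (line_E_derive Y (Rlt_le _ _ HY)) as DE; pose proof (line_h_derive Y (Rlt_le _ _ HY)) as Dh
  end.

Lemma is_derive_val (f : R -> R) (x l l' : R) : is_derive f x l -> @eq R l l' -> is_derive f x l'.
Proof. now intros H <-. Qed.

Lemma ratio_derive Y : 0 < Y -> is_derive ratio Y (- (2 * PI) * ratio_D Y).
Proof.
  intros HY. derive_fields HY. destruct (vline_real Y) as [_ [_ [_ [Ht HG]]]]; [lra|].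
  eapply is_derive_val; [apply (is_derive_div _ _ _ _ _ D0 DG); lra|]. unfold ratio_D. field. lra.
Qed.

Lemma is_derive_Rmult (f g : R -> R) x a b : is_derive f x a -> is_derive g x b -> is_derive (fun y => f y * g y) x (a * g x + f x * b).
Proof. intros. apply (is_derive_mult (K := R_AbsRing)); auto. intros; apply Rmult_comm. Qed.

Lemma is_derive_Rscal (c : R) (f : R -> R) x a : is_derive f x a -> is_derive (fun y => c * f y) x (c * a).
Proof. apply is_derive_scal. Qed.

Lemma ratio_D_derive Y : 0 < Y -> is_derive ratio_D Y (- (2 * PI) * ratio_DD Y).
Proof.
  intros HY. derive_fields HY. destruct (vline_real Y) as [_ [_ [_ [Ht HG]]]]; [lra|].
  eapply is_derive_val.
  - apply is_derive_div; [|apply DG|lra].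
    apply (is_derive_minus (V := R_NormedModule)).
    + apply is_derive_Rmult; eauto.
    + apply is_derive_Rmult; [apply is_derive_Rscal|]; eauto.
  - unfold minus, plus, opp; simpl. unfold ratio_DD. field. lra.
Qed.

(** The solutions of the third order equation are G, tau G and tau^2 G, so the quotient of any
    solution by G is a quadratic polynomial in tau and its third derivative vanishes. *)
Lemma ratio_DD_derive Y : 0 < Y -> is_derive ratio_DD Y 0.
Proof.
  intros HY. derive_fields HY. destruct (vline_real Y) as [_ [_ [_ [Ht HG]]]]; [lra|]. pose proof (line_t_lt_1 Y HY) as Ht1.
  eapply is_derive_val.
  - apply is_derive_div; [|apply DG|lra].
    apply (is_derive_minus (V := R_NormedModule)); [apply (is_derive_plus (V := R_NormedModule)); [apply (is_derive_minus (V := R_NormedModule))|]|].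
    + apply is_derive_Rmult; [apply (is_derive_pow line_E 2)|]; eauto.
    + apply is_derive_Rmult; [apply is_derive_Rmult; [apply is_derive_Rscal|]|]; eauto.
    + apply is_derive_Rmult; [apply is_derive_Rscal, (is_derive_pow line_h 2)|]; eauto.
    + apply is_derive_Rmult; [apply is_derive_Rmult; [|apply (is_derive_pow line_G 2)]; eauto|].
      apply (is_derive_plus (V := R_NormedModule)); apply is_derive_Rscal; eauto.
  - pose proof (line_E_sq Y (Rlt_le _ _ HY)) as E2. pose proof (Fser_ode (line_t Y) ltac:(lra)) as Ho.
    unfold minus, plus, opp; simpl.
    set (F0 := Fser 0 (line_t Y)) in *. set (F1 := Fser 1 (line_t Y)) in *. set (F2 := Fser 2 (line_t Y)) in *. set (F3 := Fser 3 (line_t Y)) in *.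
    revert E2 Ho HG. clearbody F0 F1 F2 F3. clear. generalize (line_t Y) (line_G Y) (line_E Y) (line_h Y). clear. intros t G E h E2 Ho HG.
    (* The differential equation multiplied by G^2, with G^2 (1 - t) replaced by E^2. *)
    assert (E ^ 2 * F3 - G ^ 2 * (t * (3 / 2 * F2 + 3 / 4 * F1 + 1 / 8 * F0)) = 0) as H1.
    { rewrite E2. transitivity (G ^ 2 * (F3 - t * (F3 + 3 / 2 * F2 + 3 / 4 * F1 + 1 / 8 * F0))); [ring|]. rewrite <- Ho. ring. }
    transitivity (- (2 * PI) * (E / G) * (E ^ 2 * F3 - G ^ 2 * (t * (3 / 2 * F2 + 3 / 4 * F1 + 1 / 8 * F0)))).
    + field. lra.
    + rewrite H1. ring.
Qed.

Lemma cusp_lim_vline f : cusp_lim f 0 -> is_lim (fun Y => Re (f (vline Y))) p_infty 0.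
Proof.
  intros H. apply is_lim_spec. intros eps. destruct (H eps (cond_pos eps)) as [Y0 [HY HB]].
  exists Y0. intros y Hy. specialize (HB (vline y)). unfold vline in *. rewrite Im_rise in HB.
  eapply Rle_lt_trans; [|apply HB; unfold z_start; simpl; lra].
  replace (Re (f (rise z_start y)) - 0) with (Re (f (rise z_start y) - 0)%C) by (destruct (f (rise z_start y)); simpl; ring).
  apply re_le_Cmod.
Qed.

Lemma cusp_lim_inv_1 f : cusp_lim f 1 -> cusp_lim (fun z => / f z)%C 1.
Proof.
  intros H eps He. destruct (H (Rmin (1 / 2) (eps / 2))) as [Y [HY HB]]; [apply Rmin_glb_lt; lra|].
  exists Y. split; auto. intros z Hz. specialize (HB z Hz). apply Rmin_Rgt_l in HB. destruct HB as [B1 B2].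
  assert (1 / 2 <= Cmod (f z)) as Hl.
  { pose proof (Cmod_triangle_rev 1 (f z)) as H1. rewrite Cmod_1, Cmod_sub_sym in H1. lra. }
  assert (f z <> 0)%C as Hn by (intros E; rewrite E, Cmod_0 in Hl; lra).
  replace (/ f z - 1)%C with ((1 - f z) * / f z)%C by (field; auto).
  rewrite Cmod_mult, Cmod_inv, Cmod_sub_sym by auto.
  assert (/ Cmod (f z) <= 2) by (rewrite <- (Rinv_inv 2); apply Rinv_le_contravar; lra).
  pose proof (Cmod_ge_0 (f z - 1)). assert (0 < / Cmod (f z)) by (apply Rinv_0_lt_compat; lra). nra.
Qed.

Lemma cusp_lim_th : cusp_lim th 0.
Proof.
  assert (cusp_lim Dth4 0) as H1.
  { apply (cusp_lim_eseries _ _ 1); [apply admissible_dcoef, admissible_theta, Cmod_m1|lra|].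
    intros [|n] Hn; [elim Hn; apply dcoef_sq_0|]. unfold sq. rewrite S_INR. pose proof (pos_INR n). nra. }
  assert (cusp_lim tb 1) as H2 by (eapply cusp_lim_eq; [apply cusp_lim_sq, cusp_lim_th4|]; ring).
  eapply cusp_lim_eq; [apply (cusp_lim_mult Dtb (fun z => / tb z)%C); [|apply cusp_lim_inv_1, H2]|].
  - apply cusp_lim_mult; [apply cusp_lim_mult; [apply cusp_lim_const|apply cusp_lim_th4]|apply H1].
  - ring.
Qed.

Lemma cusp_lim_t2 : cusp_lim t2 0.
Proof.
  assert (cusp_lim (fun z => (1 + (- (1)) * ((tE z * tE z) * (/ tG z * / tG z))))%C 0) as H.
  { eapply cusp_lim_eq; [apply cusp_lim_plus; [apply cusp_lim_const|apply cusp_lim_mult; [apply cusp_lim_const|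
      apply cusp_lim_mult; apply cusp_lim_mult; try apply cusp_lim_inv_1; try apply cusp_lim_tE; apply cusp_lim_tG]]|]. ring. }
  intros eps He. destruct (H eps He) as [Y [HY HB]]. exists Y. split; auto. intros z Hz.
  assert (upper z) as Hu by (unfold upper; lra).
  replace (t2 z) with (1 + (- (1)) * ((tE z * tE z) * (/ tG z * / tG z)))%C; auto.
  pose proof (tE_sq z Hu) as E. pose proof (tG_neq_0 z Hu).
  transitivity (1 - tE z ^ 2 / tG z ^ 2)%C; [field; auto|]. rewrite E. field. auto.
Qed.

Lemma cusp_lim_vline_1 f : cusp_lim f 1 -> is_lim (fun Y => Re (f (vline Y))) p_infty 1.
Proof.
  intros H. assert (cusp_lim (fun z => f z + - (1))%C 0) as H0.
  { eapply cusp_lim_eq; [apply cusp_lim_plus; [apply H|apply cusp_lim_const]|]. ring. }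
  apply is_lim_ext with (fun Y => Re (f (vline Y) + - (1))%C + 1).
  - intros Y. destruct (f (vline Y)); simpl. ring.
  - replace (Finite 1) with (Rbar_plus 0 1) by (simpl; f_equal; ring).
    apply is_lim_plus'; [apply (cusp_lim_vline _ H0)|apply is_lim_const].
Qed.

Lemma constant_of_limit f (l : R) : (forall Y, 0 < Y -> is_derive f Y 0) -> is_lim f p_infty l -> forall Y, 0 < Y -> f Y = l.
Proof.
  intros H Hl Y HY. assert (is_lim f p_infty (f Y)) as H1.
  { apply is_lim_ext_loc with (fun _ => f Y); [|apply is_lim_const]. exists Y. intros x Hx.
    apply (const_of_derive_0 f 0 (x + 1)); try lra. intros; apply H; lra. }
  apply is_lim_unique in Hl. apply is_lim_unique in H1. rewrite Hl in H1. now injection H1.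
Qed.

Lemma is_lim_Rmult (f g : R -> R) (a b c : R) : is_lim f p_infty a -> is_lim g p_infty b -> a * b = c ->
  is_lim (fun y => f y * g y) p_infty c.
Proof. intros Hf Hg <-. apply (is_lim_mult f g p_infty a b); auto. reflexivity. Qed.

Lemma is_lim_Rmult' (f g : R -> R) (a b : R) : is_lim f p_infty a -> is_lim g p_infty b -> is_lim (fun y => f y * g y) p_infty (a * b).
Proof. intros. now apply is_lim_Rmult with a b. Qed.

Lemma is_lim_Rplus' (f g : R -> R) (a b : R) : is_lim f p_infty a -> is_lim g p_infty b -> is_lim (fun y => f y + g y) p_infty (a + b).
Proof. intros. now apply is_lim_plus'. Qed.

Lemma is_lim_Rval (f : R -> R) (a b : R) : is_lim f p_infty a -> a = b -> is_lim f p_infty b.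
Proof. now intros H <-. Qed.

Lemma vline_limits : is_lim line_t p_infty 0 /\ is_lim line_h p_infty 0 /\ is_lim line_E p_infty 1 /\ is_lim line_G p_infty 1 /\ is_lim (fun y => / line_G y) p_infty 1.
Proof.
  assert (is_lim line_G p_infty 1) as HG by (apply cusp_lim_vline_1, cusp_lim_tG).
  split; [apply cusp_lim_vline, cusp_lim_t2|]. split; [apply cusp_lim_vline, cusp_lim_th|].
  split; [apply cusp_lim_vline_1, cusp_lim_tE|]. split; auto.
  replace (Finite 1) with (Rbar_inv 1) by (simpl; f_equal; field). apply is_lim_inv; auto. intros E. injection E. lra.
Qed.

(* [ratio], the quotient of two solutions of the same third order equation, has vanishing third
   derivative, and it tends to 1 at the cusp. *)
Lemma Fser_tG Y : 0 < Y -> Fser 0 (line_t Y) = line_G Y.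
Proof.
  intros HY. destruct vline_limits as [Lt [Lh [LE [LG LI]]]].
  pose proof (fun j => Fser_lim_0 j line_t Lt) as LF.
  pose proof (LF 0%nat) as F0. pose proof (LF 1%nat) as F1. pose proof (LF 2%nat) as F2.
  rewrite Fser_at_0 in F0, F1, F2.
  assert (forall y, 0 < y -> ratio_DD y = 0) as H2.
  { apply constant_of_limit; [apply ratio_DD_derive|]. unfold ratio_DD.
    apply is_lim_Rmult with (a := 0) (b := 1); auto; [|ring].
    apply is_lim_ext with (fun y => line_E y * line_E y * Fser 2 (line_t y) + (-2) * line_h y * line_E y * Fser 1 (line_t y) + 2 * (line_h y * line_h y) * Fser 0 (line_t y)
      + (- 1) * line_t y * (line_G y * line_G y) * (/ 2 * Fser 1 (line_t y) + / 8 * Fser 0 (line_t y))); [intros; ring|].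
    eapply is_lim_Rval; [repeat (first [apply is_lim_const | eassumption | eapply is_lim_Rplus' | eapply is_lim_Rmult'])|ring]. }
  assert (forall y, 0 < y -> ratio_D y = 0) as H1.
  { apply constant_of_limit.
    - intros y Hy. eapply is_derive_val; [now apply ratio_D_derive|]. rewrite H2 by auto. ring.
    - unfold ratio_D. apply is_lim_Rmult with (a := 0) (b := 1); auto; [|ring].
      apply is_lim_ext with (fun y => line_E y * Fser 1 (line_t y) + (-2) * line_h y * Fser 0 (line_t y)); [intros; ring|].
      eapply is_lim_Rval; [repeat (first [apply is_lim_const | eassumption | eapply is_lim_Rplus' | eapply is_lim_Rmult'])|ring]. }
  assert (ratio Y = 1) as H0.
  { apply constant_of_limit; auto.
    - intros y Hy. eapply is_derive_val; [now apply ratio_derive|]. rewrite H1 by auto. ring.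
    - unfold ratio. apply is_lim_Rmult with (a := 1) (b := 1); auto. ring. }
  destruct (vline_real Y) as [_ [_ [_ [_ HG]]]]; [lra|]. unfold ratio in H0.
  apply (Rmult_eq_reg_r (/ line_G Y)); [|apply Rinv_neq_0_compat; lra]. rewrite Rinv_r by lra. exact H0.
Qed.

(** * Summation of the moments *)

Definition apart (K : nat) (x : R) : R := sum_n (fun k => alpha k * x ^ k) K.

(** Carries inequalities known for t < 1 over to the end point t = 1 of the line, where the power
    series is on its circle of convergence. *)
Lemma le_at_0 (f g : R -> R) : continuous f 0 -> continuous g 0 -> (forall Y, 0 < Y -> f Y <= g Y) -> f 0 <= g 0.
Proof.
  intros Hf Hg H. apply Rnot_lt_le. intros Hlt. set (e := (f 0 - g 0) / 2).
  assert (0 < e) as He by (unfold e; lra).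
  destruct (proj1 (filterlim_locally f (f 0)) Hf (mkposreal e He)) as [d1 H1].
  destruct (proj1 (filterlim_locally g (g 0)) Hg (mkposreal e He)) as [d2 H2].
  set (y := Rmin d1 d2 / 2). pose proof (cond_pos d1). pose proof (cond_pos d2).
  pose proof (Rmin_l d1 d2). pose proof (Rmin_r d1 d2). assert (0 < Rmin d1 d2) by (now apply Rmin_glb_lt).
  assert (0 < y) as Hy by (unfold y; lra).
  specialize (H1 y). specialize (H2 y).
  assert (forall d : posreal, Rmin d1 d2 <= d -> ball (M := R_UniformSpace) 0 d y) as Hb.
  { intros d Hd. change (Rabs (y - 0) < d). rewrite Rminus_0_r, Rabs_pos_eq by lra. unfold y; lra. }
  specialize (H1 (Hb d1 ltac:(auto))). specialize (H2 (Hb d2 ltac:(auto))).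
  change (Rabs (f y - f 0) < e) in H1. change (Rabs (g y - g 0) < e) in H2.
  apply Rabs_lt_between in H1, H2. specialize (H y Hy). unfold e in *. lra.
Qed.

Lemma line_G_continuous : continuous line_G 0.
Proof. apply (ex_derive_continuous line_G). eexists. apply line_G_derive. lra. Qed.

Lemma apart_continuous K : continuous (fun Y => apart K (line_t Y)) 0.
Proof.
  apply (ex_derive_continuous (fun Y => apart K (line_t Y))).
  assert (ex_derive line_t 0) as Hl by (eexists; apply line_t_derive; lra).
  assert (forall k, ex_derive (fun Y => alpha k * line_t Y ^ k) 0) as Hk.
  { intros k. apply ex_derive_scal. now apply ex_derive_pow. }
  induction K as [|K IH].
  - apply (ex_derive_ext (fun Y => alpha 0 * line_t Y ^ 0)); auto. intros Y. unfold apart. now rewrite sum_O.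
  - apply (ex_derive_ext (fun Y => apart K (line_t Y) + alpha (S K) * line_t Y ^ S K)).
    + intros Y. unfold apart. now rewrite sum_Sn.
    + apply (ex_derive_plus (V := R_NormedModule) (fun Y => apart K (line_t Y))); auto.
Qed.

Lemma apart_le_line_G K Y : 0 <= Y -> apart K (line_t Y) <= line_G Y.
Proof.
  assert (forall y, 0 < y -> apart K (line_t y) <= line_G y) as H.
  { intros y Hy. rewrite <- Fser_tG by auto. destruct (vline_real y) as [_ [_ [_ [Ht _]]]]; [lra|].
    pose proof (line_t_lt_1 y Hy). unfold Fser, PSeries, apart.
    rewrite (sum_n_ext _ (fun k => acoef 0 k * line_t y ^ k)) by (intros; unfold acoef; simpl; ring).
    apply (sum_n_le_Series (fun k => acoef 0 k * line_t y ^ k)); [|apply ex_Fser; lra]. intros n. unfold acoef. simpl.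
    pose proof (alpha_bound n). rewrite Rmult_1_l. apply Rmult_le_pos; [lra|apply pow_le; lra]. }
  intros [HY| <-]; auto. apply (le_at_0 (fun Y => apart K (line_t Y)) line_G); auto using apart_continuous, line_G_continuous.
Qed.

(** The partial sums at t = 1 are bounded by the value of G at [z_start], so convergence follows
    without asymptotics of [alpha]. *)
Lemma ex_series_alpha : ex_series alpha.
Proof.
  assert (ex_finite_lim_seq (sum_n alpha)) as [l Hl].
  { apply ex_finite_lim_seq_incr with (line_G 0).
    - intros n. rewrite sum_Sn. pose proof (alpha_bound (S n)). change (sum_n alpha n <= sum_n alpha n + alpha (S n)). lra.
    - intros n. eapply Rle_trans; [|apply (apart_le_line_G n 0); lra]. rewrite line_t_0. right. apply sum_n_ext.
      intros k. rewrite pow1. symmetry. apply Rmult_1_r. }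
  exists l. exact Hl.
Qed.

Definition atail (K : nat) : R := Series (fun k => alpha (S K + k)).

(** For 0 < t < 1 the tail of the series is at most the tail of [alpha], and continuity adds t = 1:
    convergence to G is uniform on the whole line. *)
Lemma line_G_le_apart K Y : 0 <= Y -> line_G Y <= apart K (line_t Y) + atail K.
Proof.
  assert (forall y, 0 < y -> line_G y <= apart K (line_t y) + atail K) as H.
  { intros y Hy. rewrite <- Fser_tG by auto. destruct (vline_real y) as [_ [_ [_ [Ht _]]]]; [lra|].
    pose proof (line_t_lt_1 y Hy). unfold Fser, PSeries.
    rewrite (Series_ext _ (fun k => alpha k * line_t y ^ k)) by (intros; unfold acoef; simpl; ring).
    assert (ex_series (fun k => alpha k * line_t y ^ k)) as Hs.
    { apply ex_series_ext with (fun k => acoef 0 k * line_t y ^ k); [intros; unfold acoef; simpl; ring|apply ex_Fser; lra]. }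
    rewrite (Series_incr_n _ (S K)) by (auto; lia). apply Rplus_le_compat.
    - simpl pred. unfold apart. rewrite sum_n_Reals. apply Rle_refl.
    - apply Series_le; [|apply ex_series_incr_n, ex_series_alpha]. intros n. pose proof (alpha_bound (S K + n)).
      assert (0 <= line_t y ^ (S K + n) <= 1).
      { split; [apply pow_le; lra|]. rewrite <- (pow1 (S K + n)). apply pow_incr. lra. }
      split; [apply Rmult_le_pos; lra|]. rewrite <- (Rmult_1_r (alpha (S K + n))) at 2. apply Rmult_le_compat_l; lra. }
  intros [HY| <-]; auto. apply (le_at_0 line_G (fun Y => apart K (line_t Y) + atail K)); auto using line_G_continuous.
  apply (continuous_plus (fun Y => apart K (line_t Y)) (fun _ => atail K)); [apply apart_continuous|apply continuous_const].
Qed.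

Lemma atail_pos K : 0 <= atail K.
Proof. pose proof (apart_le_line_G K 0 (Rle_refl _)). pose proof (line_G_le_apart K 0 (Rle_refl _)). lra. Qed.

Lemma atail_lim eps : 0 < eps -> exists N, forall K, (N <= K)%nat -> atail K < eps.
Proof.
  intros He. assert (is_lim_seq (sum_n alpha) (Series alpha)) as H by apply Series_correct, ex_series_alpha.
  apply is_lim_seq_spec in H. destruct (H (mkposreal eps He)) as [N HN]. exists N. intros K HK. specialize (HN K HK).
  simpl in HN. unfold atail. apply Rabs_lt_between in HN.
  pose proof (Series_incr_n alpha (S K) ltac:(lia) ex_series_alpha) as E. simpl pred in E. rewrite sum_n_Reals in HN. lra.
Qed.

Definition tpart (K : nat) (z : C) : C := psum (fun k => alpha k * t2 z ^ k)%C (S K).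

Lemma tame_psum (f : nat -> C -> C) n : (forall k, tame (f k)) -> tame (fun z => psum (fun k => f k z) n).
Proof. intros H. induction n; simpl; [apply tame_const|]. now apply tame_plus. Qed.

Lemma tame_tpart K : tame (tpart K).
Proof. apply (tame_psum (fun k z => alpha k * t2 z ^ k)%C). intros k. apply tame_scal, tame_pow, tame_t2. Qed.

Lemma psum_sum_n (u : nat -> R) n : psum (fun k => RtoC (u k)) (S n) = RtoC (sum_n u n).
Proof.
  induction n as [|n IH].
  - rewrite sum_O. simpl. ring.
  - rewrite sum_Sn. change (psum (fun k => RtoC (u k)) (S (S n))) with (psum (fun k => RtoC (u k)) (S n) + RtoC (u (S n)))%C.
    rewrite IH. symmetry. apply RtoC_plus.
Qed.

Lemma tpart_vline K Y : 0 <= Y -> tpart K (vline Y) = RtoC (apart K (line_t Y)).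
Proof.
  intros HY. destruct (vline_real Y HY) as [Rt _]. unfold tpart, apart. rewrite <- psum_sum_n.
  apply psum_ext. intros k _. rewrite Rt. fold (line_t Y). now rewrite RtoC_mult, RtoC_pow.
Qed.

Lemma tpart_tG_vline K Y : 0 <= Y -> Cmod (tpart K (vline Y) - tG (vline Y)) <= atail K.
Proof.
  intros HY. destruct (vline_real Y HY) as [_ [RG _]]. rewrite tpart_vline, RG by auto. fold (line_G Y).
  rewrite <- RtoC_minus, Cmod_R. pose proof (apart_le_line_G K Y HY). pose proof (line_G_le_apart K Y HY).
  apply Rabs_le. lra.
Qed.

Lemma tpart_bound K z : Cmod (t2 z) <= 1 -> Cmod (tpart K z) <= Series alpha.
Proof.
  intros H. eapply Rle_trans; [apply psum_le with (b := alpha)|].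
  - intros k. pose proof (alpha_bound k). rewrite Cmod_mult, Cmod_pow, Cmod_R, Rabs_pos_eq by lra.
    rewrite <- (Rmult_1_r (alpha k)) at 2. apply Rmult_le_compat_l; [lra|].
    rewrite <- (pow1 k). apply pow_incr. split; auto using Cmod_ge_0.
  - apply sum_n_le_Series; [|apply ex_series_alpha]. intros n. pose proof (alpha_bound n). lra.
Qed.

(** Unlike [cusp_lim], restricted to |Re z| <= 1/2: the factors z and z^2 in [tH] and its derivative
    are unbounded in the horizontal direction. *)
Definition strip_small (f : C -> C) : Prop :=
  forall eps, 0 < eps -> exists Y, 1 / 2 <= Y /\ forall z, Y <= Im z -> Rabs (Re z) <= 1 / 2 -> Cmod (f z) < eps.

Lemma seg_rise z Y s : seg z (rise z Y) s = rise z (s * Y).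
Proof. unfold seg, rise. rewrite RtoC_mult. ring. Qed.

Lemma tpart_period K z : upper z -> tpart K (z + 1) = tpart K z.
Proof. intros Hz. apply psum_ext. intros k _. now rewrite t2_period. Qed.

(* Push the path up: vertical sides at Re = 1/2 and -1/2, on which the partial sums converge
   uniformly to [tG], joined by a horizontal side so high that [X] is negligible there. *)
Lemma moment_defect X : tame X -> strip_small X ->
  forall eps, 0 < eps -> exists N, forall K, (N <= K)%nat ->
    Cmod (Iseg (fun z => (tpart K z - tG z) * X z)%C z_start z_end) < eps.
Proof.
  intros HX Hs eps He.
  assert (0 <= Series alpha) as HA.
  { apply Rle_trans with (sum_n alpha 0).
    - rewrite sum_O. pose proof (alpha_bound 0). lra.
    - apply sum_n_le_Series; [|apply ex_series_alpha]. intros n. pose proof (alpha_bound n). lra. }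
  (* Bounds the difference of [tpart K] and [tG] on the top side, where |t| <= 1 and |G| <= 2, for
     all K at once. *)
  set (A := Series alpha + 2) in *.
  destruct (Hs (eps / (4 * A))) as [Y1 [HY1 B1]]; [apply Rdiv_lt_0_compat; unfold A; lra|].
  destruct (cusp_lim_t2 1 Rlt_0_1) as [Y2 [HY2 B2]]. destruct (cusp_lim_tG 1 Rlt_0_1) as [Y3 [HY3 B3]].
  set (Y := Rmax Y1 (Rmax Y2 Y3)). pose proof (Rmax_l Y1 (Rmax Y2 Y3)). pose proof (Rmax_r Y1 (Rmax Y2 Y3)).
  pose proof (Rmax_l Y2 Y3). pose proof (Rmax_r Y2 Y3). fold Y in H, H0.
  pose proof (rise_upper _ Y upper_z_start ltac:(lra)) as U1. pose proof (rise_upper _ Y upper_z_end ltac:(lra)) as U2.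
  destruct (tame_bounded X (Y + 1) (1 / 2) ltac:(lra) HX) as [B [HB HBX]].
  destruct (atail_lim (eps / (4 * (B * Y)))) as [N HN].
  { apply Rdiv_lt_0_compat; [lra|]. apply Rmult_lt_0_compat; [lra|]. apply Rmult_lt_0_compat; lra. }
  exists N. intros K HK. specialize (HN K HK). pose proof (atail_pos K) as Htl.
  set (f := fun z => ((tpart K z - tG z) * X z)%C).
  assert (tame f) as Hf by (apply tame_mult; [apply tame_minus; [apply tame_tpart|apply tame_tG]|auto]).
  rewrite (Iseg_arch f Y Hf) by lra.
  assert (forall z, (forall y, 0 <= y -> Cmod (tpart K (rise z y) - tG (rise z y)) <= atail K) -> Im z = 1 / 2 -> Rabs (Re z) <= 1 / 2 ->
    upper z -> Cmod (Iseg f z (rise z Y)) <= eps / 4) as Hvert.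
  { intros z Hz Hi Hr Hu. apply Rle_trans with (atail K * B * Cmod (rise z Y - z)).
    - apply Iseg_bound; auto; [apply rise_upper; auto; lra|]. intros s Hss. rewrite seg_rise. unfold f. rewrite Cmod_mult.
      assert (0 <= s * Y <= Y) as HsY by nra.
      apply Rmult_le_compat; auto using Cmod_ge_0; [apply Hz; lra|]. apply HBX. unfold box. rewrite Im_rise, Hi.
      replace (Re (rise z (s * Y))) with (Re z) by (destruct z; simpl; ring). split; [|lra]. lra.
    - replace (rise z Y - z)%C with (Ci * Y)%C by (unfold rise; ring).
      rewrite Cmod_mult, Cmod_R, Rabs_pos_eq by lra.
      replace (Cmod Ci) with 1.
      2:{ unfold Cmod, Ci; simpl. replace (0 * (0 * 1) + 1 * (1 * 1)) with 1 by ring. now rewrite sqrt_1. }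
      assert (0 < B * Y) by (apply Rmult_lt_0_compat; lra).
      apply Rle_trans with (eps / (4 * (B * Y)) * (B * Y)); [|right; field; lra].
      replace (atail K * B * (1 * Y)) with (atail K * (B * Y)) by ring. apply Rmult_le_compat_r; lra. }
  assert (Cmod (Iseg f z_start (rise z_start Y)) <= eps / 4) as V1.
  { apply Hvert; auto using upper_z_start.
    - intros y Hy. now apply tpart_tG_vline.
    - unfold z_start; simpl. rewrite Rabs_pos_eq; lra. }
  assert (Cmod (Iseg f z_end (rise z_end Y)) <= eps / 4) as V2.
  { apply Hvert; auto using upper_z_end.
    - intros y Hy. rewrite <- tpart_period, <- tG_period, <- rise_start_end by (apply rise_upper; auto using upper_z_end).
      now apply tpart_tG_vline.
    - unfold z_end; simpl. apply Rabs_le; lra. }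
  assert (Cmod (Iseg f (rise z_start Y) (rise z_end Y)) <= eps / 4) as V3.
  { replace (eps / 4) with (A * (eps / (4 * A)) * Cmod (rise z_end Y - rise z_start Y)).
    - apply Iseg_bound; auto. intros s Hss. set (z := seg _ _ s).
      assert (Im z = 1 / 2 + Y) as Hi by (unfold z, seg, rise, z_start, z_end; simpl; field).
      assert (Re z = 1 / 2 - s) as Hr by (unfold z, seg, rise, z_start, z_end; simpl; field).
      unfold f. rewrite Cmod_mult. apply Rmult_le_compat; auto using Cmod_ge_0.
      + eapply Rle_trans; [apply Cmod_triangle_minus|]. unfold A. apply Rplus_le_compat.
        * apply tpart_bound. specialize (B2 z ltac:(lra)). replace (t2 z - 0)%C with (t2 z) in B2 by ring. lra.
        * specialize (B3 z ltac:(lra)). pose proof (Cmod_triangle_rev (tG z) 1) as Ht. rewrite Cmod_1 in Ht. lra.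
      + left. apply B1; [lra|]. rewrite Hr. apply Rabs_le. lra.
    - rewrite rise_start_end. replace (rise z_end Y - (rise z_end Y + 1))%C with (- (1))%C by ring.
      rewrite Cmod_opp, Cmod_1. field. unfold A. lra. }
  eapply Rle_lt_trans; [apply Cmod_triangle_minus|].
  eapply Rle_lt_trans; [apply Rplus_le_compat_r, Cmod_triangle|]. lra.
Qed.

Lemma Iseg_tpart X K z w : tame X -> upper z -> upper w ->
  Iseg (fun x => tpart K x * X x)%C z w = psum (fun k => alpha k * Iseg (fun x => t2 x ^ k * X x)%C z w)%C (S K).
Proof.
  intros HX Hz Hw. unfold tpart. generalize (S K). intros n. induction n as [|n IH].
  - simpl. transitivity (Iseg (fun _ => RtoC 0) z w); [apply Iseg_ext; auto; intros; ring|].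
    rewrite (Iseg_primitive (fun _ => RtoC 0)); auto using tame_const; [ring|]. intros; apply cd_const.
  - assert (tame (fun x => psum (fun k => alpha k * t2 x ^ k)%C n * X x)%C) as T1.
    { apply tame_mult; auto. apply (tame_psum (fun k z => alpha k * t2 z ^ k)%C). intros k. apply tame_scal, tame_pow, tame_t2. }
    assert (tame (fun x => t2 x ^ n * X x)%C) as T2 by (apply tame_mult; auto; apply tame_pow, tame_t2).
    cbn [psum]. rewrite <- IH. rewrite <- Iseg_scal, <- Iseg_plus by auto using tame_scal.
    apply Iseg_ext; auto. intros. ring.
Qed.

(** Both hypergeometric values come from here, with X the product of [tH] and [tE] for 6F5 and X =
    [kernel_7F6] for 7F6. *)
Lemma moment_limit X : tame X -> strip_small X ->
  CL (fun K => psum (fun k => alpha k * Iseg (fun z => t2 z ^ k * X z) z_start z_end)%C (S K)) (Iseg (fun z => tG z * X z)%C z_start z_end).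
Proof.
  intros HX Hs eps He. destruct (moment_defect X HX Hs eps He) as [N HN]. exists N. intros K HK. specialize (HN K HK).
  rewrite <- Iseg_tpart by auto using upper_z_start, upper_z_end.
  rewrite <- Iseg_minus; auto using upper_z_start, upper_z_end.
  - eapply Rle_lt_trans; [|apply HN]. right. f_equal. apply Iseg_ext; auto using upper_z_start, upper_z_end. intros; ring.
  - apply tame_mult; auto using tame_tpart.
  - apply tame_mult; auto using tame_tG.
Qed.

(** * The hypergeometric values *)

Lemma strip_ext f g : (forall z, upper z -> f z = g z) -> strip_small f -> strip_small g.
Proof.
  intros H Hf eps He. destruct (Hf eps He) as [Y [HY HB]]. exists Y. split; auto. intros z Hz Hr.
  rewrite <- H by (unfold upper; lra). auto.
Qed.

Lemma strip_plus f g : strip_small f -> strip_small g -> strip_small (fun z => f z + g z)%C.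
Proof.
  intros Hf Hg eps He. destruct (Hf (eps / 2)) as [Y1 [H1 B1]]; [lra|]. destruct (Hg (eps / 2)) as [Y2 [H2 B2]]; [lra|].
  exists (Rmax Y1 Y2). pose proof (Rmax_l Y1 Y2). pose proof (Rmax_r Y1 Y2). split; [lra|]. intros z Hz Hr.
  specialize (B1 z ltac:(lra) Hr). specialize (B2 z ltac:(lra) Hr). eapply Rle_lt_trans; [apply Cmod_triangle|]. lra.
Qed.

Lemma strip_mult f g l : strip_small f -> cusp_lim g l -> strip_small (fun z => f z * g z)%C.
Proof.
  intros Hf Hg eps He. pose proof (Cmod_ge_0 l). destruct (Hf (eps / (Cmod l + 1))) as [Y1 [H1 B1]]; [apply Rdiv_lt_0_compat; lra|].
  destruct (Hg 1 Rlt_0_1) as [Y2 [H2 B2]].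
  exists (Rmax Y1 Y2). pose proof (Rmax_l Y1 Y2). pose proof (Rmax_r Y1 Y2). split; [lra|]. intros z Hz Hr.
  specialize (B1 z ltac:(lra) Hr). specialize (B2 z ltac:(lra)). pose proof (Cmod_triangle_rev (g z) l).
  rewrite Cmod_mult. apply Rle_lt_trans with (Cmod (f z) * (Cmod l + 1)); [apply Rmult_le_compat_l; [apply Cmod_ge_0|lra]|].
  apply (Rmult_lt_compat_r (Cmod l + 1)) in B1; [|lra]. unfold Rdiv in B1. rewrite Rmult_assoc, Rinv_l in B1 by lra. lra.
Qed.

(** With y = Im z, |c| = |th2|^2 is O(exp (- pi y)), and (1 + |z|)^2 <= 4 exp (2 y) in the strip; as
    pi >= 3, a factor exp (- y) is left. *)
Lemma strip_poly_tc (p : C -> C) : (forall z, Cmod (p z) <= (1 + Cmod z) ^ 2) -> strip_small (fun z => p z * tc z)%C.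
Proof.
  intros Hp eps He. destruct (eseries_decay (fun _ => RtoC 2) sq_half (1 / 4) admissible_th2) as [K [HK HB]].
  { intros n _. unfold sq_half. pose proof (pos_INR n). nra. }
  pose proof PI2_3_2 as Hpi.
  destruct (exp_decay_small 1 (4 * K ^ 2) eps) as [Y [HY HYb]]; auto; [lra|apply Rmult_le_pos; [lra|now apply pow_le]|].
  exists Y. split; auto. intros z Hz Hr. specialize (HYb (Im z) Hz). specialize (HB z ltac:(lra)). fold th2 in HB.
  rewrite Cmod_mult. unfold tc. rewrite Cmod_pow. eapply Rle_lt_trans; [|apply HYb]. set (y := Im z) in *.
  assert (1 + Cmod z <= 2 * exp y) as H1.
  { pose proof (Cmod_le_abs z) as Hc. fold y in Hc. rewrite (Rabs_pos_eq y) in Hc by lra. pose proof (exp_ineq1 y ltac:(lra)). lra. }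
  assert (Cmod (th2 z) ^ 2 <= K ^ 2 * exp (- (3 * y))) as H2.
  { apply Rle_trans with ((K * exp (- (2 * PI * (1 / 4) * y))) ^ 2); [apply pow_incr; split; auto using Cmod_ge_0|].
    replace ((K * exp (- (2 * PI * (1 / 4) * y))) ^ 2) with (K ^ 2 * (exp (- (2 * PI * (1 / 4) * y)) * exp (- (2 * PI * (1 / 4) * y)))) by ring.
    rewrite <- exp_plus. apply Rmult_le_compat_l; [now apply pow_le|]. apply exp_mono. nra. }
  apply Rle_trans with ((2 * exp y) ^ 2 * (K ^ 2 * exp (- (3 * y)))).
  - apply Rmult_le_compat; auto using Cmod_ge_0.
    + apply pow_le, Cmod_ge_0.
    + eapply Rle_trans; [apply Hp|]. apply pow_incr. pose proof (Cmod_ge_0 z). lra.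
  - replace (- (1 * y)) with (y + y + - (3 * y)) by ring. rewrite !exp_plus. right. ring.
Qed.

Lemma strip_sq_tc : strip_small (fun z => z ^ 2 * tc z)%C.
Proof.
  apply strip_poly_tc. intros z. rewrite Cmod_pow. pose proof (Cmod_ge_0 z). apply pow_incr. lra.
Qed.

Lemma strip_id_tc : strip_small (fun z => z * tc z)%C.
Proof. apply (strip_poly_tc (fun z => z)). intros z. pose proof (Cmod_ge_0 z). nra. Qed.

(** D applied to [tH]; the first summand comes from the factor tau^2, as D tau = 1 / kap. *)
Definition tDH (z : C) : C := (- (8) / kap * (z * (tc z * ta z)) - 4 * (z ^ 2 * (Dtc z * ta z + tc z * Dta z)))%C.

Lemma cd_tH_D z : upper z -> cd tH z (kap * tDH z)%C.
Proof.
  intros Hz. eapply cd_eq; [now apply cd_tH|]. unfold tDH. rewrite Dtc_eq, Dta_eq by auto. unfold tE. field. apply kap_neq_0.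
Qed.

Lemma tame_tDH : tame tDH.
Proof.
  apply tame_minus; apply tame_scal, tame_mult.
  - apply tame_id.
  - apply tame_mult; [apply tame_tc|apply tame_ta].
  - apply tame_pow, tame_id.
  - apply tame_plus; apply tame_mult; auto using tame_Dtc, tame_Dta, tame_tc, tame_ta.
Qed.

Lemma tame_HE : tame (fun z => tH z * tE z)%C.
Proof. apply tame_mult; [apply tame_tH|apply tame_tE]. Qed.

Lemma strip_HE : strip_small (fun z => tH z * tE z)%C.
Proof.
  apply strip_ext with (fun z => (z ^ 2 * tc z) * (- (4) * (ta z * tE z)))%C; [intros; unfold tH; ring|].
  eapply strip_mult; [apply strip_sq_tc|].
  apply cusp_lim_mult; [apply cusp_lim_const|apply cusp_lim_mult; [apply cusp_lim_ta|apply cusp_lim_tE]].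
Qed.

(* Integration by parts turns the factor 4k + 1 of the second series into this integrand. *)
Definition kernel_7F6 (z : C) : C := (4 * tDH z - tH z * tE z)%C.

Lemma tame_kernel_7F6 : tame kernel_7F6.
Proof. apply tame_minus; [apply tame_scal, tame_tDH|apply tame_HE]. Qed.

Lemma strip_kernel_7F6 : strip_small kernel_7F6.
Proof.
  apply strip_ext with (fun z => (z * tc z) * (- (32) / kap * ta z)
    + ((z ^ 2 * tc z) * (- (16) * (ta z * (2 * th z + / 2 * tE z))) + tH z * tE z * - (1)))%C.
  - intros z Hz. unfold kernel_7F6, tDH. rewrite Dtc_eq, Dta_eq by auto. unfold tE. field. apply kap_neq_0.
  - apply strip_plus; [|apply strip_plus].
    + eapply strip_mult; [apply strip_id_tc|]. apply cusp_lim_mult; [apply cusp_lim_const|apply cusp_lim_ta].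
    + eapply strip_mult; [apply strip_sq_tc|]. apply cusp_lim_mult; [apply cusp_lim_const|].
      apply cusp_lim_mult; [apply cusp_lim_ta|]. apply cusp_lim_plus; apply cusp_lim_mult; auto using cusp_lim_const, cusp_lim_th, cusp_lim_tE.
    + eapply strip_mult; [apply strip_HE|apply cusp_lim_const].
Qed.

Lemma t2_z_end : t2 z_end = RtoC 1.
Proof. rewrite <- t2_period by apply upper_z_end. rewrite <- z_start_end. apply t2_z_start. Qed.

(** Under the translation c changes sign, and so does the square of the end point: z_start^2 = i / 2
    and z_end^2 = - i / 2. *)
Lemma tH_ends : tH z_end = tH z_start.
Proof.
  unfold tH. rewrite z_start_end at 2 3. rewrite ta_period, tc_period by apply upper_z_end.
  assert (z_start ^ 2 = - z_end ^ 2)%C as ->.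
  { unfold z_start, z_end, Cpow, Cmult, Copp, RtoC; simpl. f_equal; field. }
  ring.
Qed.

(** Integration by parts: D (t^k H) = k t^k H E + t^k D H, and the boundary terms cancel because t =
    1 at both ends and H takes the same value there. *)
Lemma Iseg_tDH k : Iseg (fun z => t2 z ^ k * tDH z)%C z_start z_end = RtoC (INR k * alpha k).
Proof.
  pose proof upper_z_start as U1. pose proof upper_z_end as U2.
  assert (tame (fun z => t2 z ^ k * tDH z)%C) as T1 by (apply tame_mult; [apply tame_pow, tame_t2|apply tame_tDH]).
  assert (Iseg (fun z => INR k * integrand_H k z + t2 z ^ k * tDH z)%C z_start z_end = 0)%C as E.
  { rewrite (Iseg_primitive (fun z => / kap * (t2 z ^ k * tH z))%C).
    - rewrite t2_z_start, t2_z_end, tH_ends. ring.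
    - apply tame_plus; auto. apply tame_scal, tame_integrand_H.
    - auto.
    - auto.
    - intros x Hx. eapply cd_eq.
      + apply cd_scal, cd_mult; [apply cd_pow, cd_t2|apply cd_tH_D]; auto.
      + unfold integrand_H. destruct k as [|k].
        * cbn [pred]. simpl INR. change (t2 x ^ 0)%C with (RtoC 1). field. apply kap_neq_0.
        * cbn [pred]. change (t2 x ^ S k)%C with (t2 x * t2 x ^ k)%C. generalize (RtoC (INR (S k))) (t2 x ^ k)%C. intros. field. apply kap_neq_0. }
  rewrite Iseg_plus, Iseg_scal, Iseg_integrand_H in E; auto using tame_integrand_H, tame_scal.
  transitivity (INR k * RtoC (- alpha k) + Iseg (fun z => t2 z ^ k * tDH z) z_start z_end - INR k * RtoC (- alpha k))%C; [ring|].
  rewrite E, RtoC_opp, RtoC_mult. ring.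
Qed.

Lemma Iseg_kernel_7F6 k : Iseg (fun z => t2 z ^ k * kernel_7F6 z)%C z_start z_end = RtoC ((4 * INR k + 1) * alpha k).
Proof.
  pose proof upper_z_start as U1. pose proof upper_z_end as U2.
  assert (tame (fun z => t2 z ^ k * tDH z)%C) as T1 by (apply tame_mult; [apply tame_pow, tame_t2|apply tame_tDH]).
  transitivity (Iseg (fun z => 4 * (t2 z ^ k * tDH z) - integrand_H k z)%C z_start z_end).
  - apply Iseg_ext; auto. intros. unfold kernel_7F6, integrand_H. ring.
  - rewrite Iseg_minus, Iseg_scal, Iseg_integrand_H, Iseg_tDH; auto using tame_integrand_H, tame_scal.
    rewrite RtoC_opp, !RtoC_mult, RtoC_plus, RtoC_mult. ring.
Qed.

Lemma Series_CL (u : nat -> R) l : CL (fun n => psum (fun k => RtoC (u k)) (S n)) l -> RtoC (Series u) = l.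
Proof.
  intros H. apply CLim_seq_unique in H. rewrite <- H. unfold CLim_seq, Series.
  transitivity (real (Lim_seq (sum_n u)), real (Lim_seq (fun _ => 0))); [now rewrite Lim_seq_const|].
  f_equal; f_equal; apply Lim_seq_ext; intros n; now rewrite psum_sum_n.
Qed.

Lemma Series_alpha_sq : RtoC (Series (fun k => alpha k ^ 2)) = (- Iseg (fun z => tG z * (tH z * tE z)) z_start z_end)%C.
Proof.
  assert (RtoC (Series (fun k => - alpha k ^ 2)) = Iseg (fun z => tG z * (tH z * tE z))%C z_start z_end) as E.
  { apply Series_CL. eapply CL_ext; [|apply (moment_limit _ tame_HE strip_HE)]. intros n. apply psum_ext. intros k _.
    change (fun z => t2 z ^ k * (tH z * tE z))%C with (integrand_H k). rewrite Iseg_integrand_H, <- RtoC_mult. f_equal. ring. }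
  rewrite <- E. rewrite (Series_opp (fun k => alpha k ^ 2)), RtoC_opp. ring.
Qed.

Lemma Series_alpha_sq_lin : RtoC (Series (fun k => (4 * INR k + 1) * alpha k ^ 2)) = Iseg (fun z => tG z * kernel_7F6 z)%C z_start z_end.
Proof.
  apply Series_CL. eapply CL_ext; [|apply (moment_limit _ tame_kernel_7F6 strip_kernel_7F6)]. intros n. apply psum_ext. intros k _.
  rewrite Iseg_kernel_7F6, <- RtoC_mult. f_equal. ring.
Qed.

(** * Matching the coefficients of 6F5 and 7F6 *)

Lemma pochhammer_1 k : pochhammer 1 k = INR (fact k).
Proof.
  induction k as [|k IH]; [reflexivity|]. change (pochhammer 1 (S k)) with (pochhammer 1 k * (1 + INR k)).
  change (fact (S k)) with (S k * fact k)%nat. rewrite mult_INR, S_INR, IH. ring.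
Qed.

Lemma pochhammer_pos a k : 0 < a -> 0 < pochhammer a k.
Proof.
  intros Ha. induction k as [|k IH]; [simpl; lra|]. change (pochhammer a (S k)) with (pochhammer a k * (a + INR k)).
  pose proof (pos_INR k). apply Rmult_lt_0_compat; lra.
Qed.

(** The quotient of shifted factorials telescopes: (5/4)_k / (1/4)_k = (1/4 + k) / (1/4). This is
    the source of the factor 4k + 1. *)
Lemma pochhammer_shift k : pochhammer (5 / 4) k = (4 * INR k + 1) * pochhammer (1 / 4) k.
Proof.
  induction k as [|k IH]; [simpl; ring|].
  change (pochhammer (5 / 4) (S k)) with (pochhammer (5 / 4) k * (5 / 4 + INR k)).
  change (pochhammer (1 / 4) (S k)) with (pochhammer (1 / 4) k * (1 / 4 + INR k)).
  rewrite IH, S_INR. field.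
Qed.

Lemma hypergeometric_6F5 : hypergeometric [1/2; 1/2; 1/2; 1/2; 1/2; 1/2] [1; 1; 1; 1; 1] 1 = Series (fun k => alpha k ^ 2).
Proof.
  apply Series_ext. intros k. cbn [map prod_list fold_right]. rewrite pochhammer_1, pow1. unfold alpha.
  pose proof (INR_fact_neq_0 k). field. auto.
Qed.

Lemma hypergeometric_7F6 : hypergeometric [1/2; 5/4; 1/2; 1/2; 1/2; 1/2; 1/2] [1/4; 1; 1; 1; 1; 1] 1 =
  Series (fun k => (4 * INR k + 1) * alpha k ^ 2).
Proof.
  apply Series_ext. intros k. cbn [map prod_list fold_right]. rewrite pochhammer_1, pow1, pochhammer_shift. unfold alpha.
  pose proof (INR_fact_neq_0 k). pose proof (pochhammer_pos (1 / 4) k). field. split; auto. lra.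
Qed.

Lemma f_8_6_half z : upper z -> f_8_6 (z / 2) = (tc z * ta z * tb z ^ 2 / 4 * tE z)%C.
Proof.
  intros Hz. unfold f_8_6. replace (2 * (z / 2))%C with z by field. replace (8 * (z / 2))%C with (4 * z)%C by field.
  now destruct (eta_thetas z Hz) as [_ [-> _]].
Qed.

Lemma f_8_4_half z : upper z -> f_8_4 (z / 2) = (tc z * ta z * tb z ^ 2 / 4)%C.
Proof.
  intros Hz. unfold f_8_4. replace (2 * (z / 2))%C with z by field. replace (4 * (z / 2))%C with (2 * z)%C by field.
  now destruct (eta_thetas z Hz) as [-> _].
Qed.

Lemma tame_f_8_6 : tame (fun z => z ^ 2 * f_8_6 (z / 2))%C.
Proof.
  apply tame_ext with (fun z => (- / 16) * (tG z * (tH z * tE z)))%C.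
  - intros z Hz. rewrite f_8_6_half by auto. unfold tG, tH. field.
  - apply tame_scal, tame_mult; [apply tame_tG|apply tame_HE].
Qed.

Lemma Iseg_f_8_6 : (16 * Iseg (fun z => z ^ 2 * f_8_6 (z / 2)) z_start z_end = - Iseg (fun z => tG z * (tH z * tE z)) z_start z_end)%C.
Proof.
  pose proof upper_z_start as U1. pose proof upper_z_end as U2.
  rewrite (Iseg_ext _ (fun z => (- / 16) * (tG z * (tH z * tE z)))%C); auto.
  - rewrite Iseg_scal; auto; [field|]. apply tame_mult; [apply tame_tG|apply tame_HE].
  - intros z Hz. rewrite f_8_6_half by auto. unfold tG, tH. field.
Qed.

Lemma tame_f_8_4 : tame (fun z => z * f_8_4 (z / 2))%C.
Proof.
  apply tame_ext with (fun z => z * (/ 4 * (tc z * (ta z * tG z))))%C.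
  - intros z Hz. rewrite f_8_4_half by auto. unfold tG. field.
  - apply tame_mult; [apply tame_id|]. apply tame_scal, tame_mult; [apply tame_tc|apply tame_mult; [apply tame_ta|apply tame_tG]].
Qed.

Lemma tame_Dtb : tame Dtb.
Proof.
  apply tame_mult; [apply tame_scal|]; apply tame_eseries; [|apply admissible_dcoef]; apply admissible_theta, Cmod_m1.
Qed.

(** D H = (2 h + E / 2) H - (8 / kap) tau a c. Subtracting 2 D (G H), whose integral vanishes, from
    G times the kernel therefore removes all terms in tau^2. What is left is - (16 / kap) tau a c G,
    linear in tau, and - 16 / kap = 8 i / pi. *)
Lemma Iseg_f_8_4 : (32 * Ci / PI * Iseg (fun z => z * f_8_4 (z / 2)) z_start z_end = Iseg (fun z => tG z * kernel_7F6 z) z_start z_end)%C.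
Proof.
  pose proof upper_z_start as U1. pose proof upper_z_end as U2. pose proof PI_C_neq_0. pose proof Ci_neq_0.
  set (Q := fun z => (2 * tb z * Dtb z * tH z + tG z * tDH z)%C).
  assert (tame Q) as TQ.
  { apply tame_plus; apply tame_mult; auto using tame_tG, tame_tDH, tame_tH. apply tame_mult; [apply tame_scal, tame_tb|apply tame_Dtb]. }
  assert (Iseg Q z_start z_end = 0)%C as EQ.
  { rewrite (Iseg_primitive (fun z => / kap * (tG z * tH z))%C); auto.
    - rewrite tH_ends. rewrite <- (tG_period z_end), <- z_start_end. ring.
    - intros x Hx. eapply cd_eq; [apply cd_scal, cd_mult; [now apply cd_tG|now apply cd_tH_D]|].
      unfold Q. rewrite Dtb_eq by auto. unfold tG. field. apply kap_neq_0. }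
  rewrite (Iseg_ext (fun z => tG z * kernel_7F6 z)%C (fun z => 32 * Ci / PI * (z * f_8_4 (z / 2)) + 2 * Q z)%C); auto.
  - rewrite Iseg_plus, !Iseg_scal, EQ; auto using tame_scal, tame_f_8_4. ring.
  - intros z Hz. rewrite f_8_4_half by auto. unfold kernel_7F6, Q, tDH.
    rewrite Dtb_eq, Dtc_eq, Dta_eq by auto. unfold tE, tH, tG.
    transitivity (tb z ^ 2 * (tc z * ta z * z * (- (16) / kap) + (2 * 2 * th z * (- (4) * z ^ 2 * (tc z * ta z))
      + 2 * (- (8) / kap * (z * (tc z * ta z)) - 4 * (z ^ 2 * (tc z * ta z * (2 * th z + (ta z ^ 2 + tc z ^ 2) / 2)))))))%C.
    + field. apply kap_neq_0.
    + assert (- (16) / kap = 8 * Ci / PI)%C as ->; [|field; auto using kap_neq_0].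
      unfold kap. transitivity (8 * (- (1)) / (PI * Ci))%C; [field; auto|]. rewrite <- Ci_sq. field. auto.
Qed.

Lemma geodesic_contour : t2_contour geodesic (PI / 4) (3 * PI / 4).
Proof.
  split; [apply geodesic_path|]. intros s Hs. pose proof PI_RGT_0. apply geodesic_t2. lra.
Qed.

Theorem theorem6 :
  t2_contour geodesic (PI / 4) (3 * PI / 4)
  /\ (let F := hypergeometric [1/2; 1/2; 1/2; 1/2; 1/2; 1/2] [1; 1; 1; 1; 1] 1 in
      let f := fun tau : C => (tau ^ 2 * f_8_6 (tau / 2))%C in
      (forall (g : R -> C) (al be : R), t2_contour g al be ->
         RtoC F = (16 * path_integral f g al be)%C)
      /\ (forall (g : R -> C) (al be : R), path_in_H g al be z_start z_end ->
         RtoC F = (16 * path_integral f g al be)%C))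
  /\ (let F := hypergeometric [1/2; 5/4; 1/2; 1/2; 1/2; 1/2; 1/2]
                              [1/4; 1; 1; 1; 1; 1] 1 in
      let f := fun tau : C => (tau * f_8_4 (tau / 2))%C in
      (forall (g : R -> C) (al be : R), t2_contour g al be ->
         RtoC F = (32 * Ci / PI * path_integral f g al be)%C)
      /\ (forall (g : R -> C) (al be : R), path_in_H g al be z_start z_end ->
         RtoC F = (32 * Ci / PI * path_integral f g al be)%C)).
Proof.
  split; [apply geodesic_contour|].
  assert (forall g al be, path_in_H g al be z_start z_end ->
    RtoC (hypergeometric [1/2; 1/2; 1/2; 1/2; 1/2; 1/2] [1; 1; 1; 1; 1] 1)
    = (16 * path_integral (fun tau => tau ^ 2 * f_8_6 (tau / 2)) g al be)%C) as H1.
  { intros g al be Hg. rewrite hypergeometric_6F5, Series_alpha_sq, <- Iseg_f_8_6.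
    now rewrite (path_independent _ _ _ _ _ _ tame_f_8_6 Hg). }
  assert (forall g al be, path_in_H g al be z_start z_end ->
    RtoC (hypergeometric [1/2; 5/4; 1/2; 1/2; 1/2; 1/2; 1/2] [1/4; 1; 1; 1; 1; 1] 1)
    = (32 * Ci / PI * path_integral (fun tau => tau * f_8_4 (tau / 2)) g al be)%C) as H2.
  { intros g al be Hg. rewrite hypergeometric_7F6, Series_alpha_sq_lin, <- Iseg_f_8_4.
    now rewrite (path_independent _ _ _ _ _ _ tame_f_8_4 Hg). }
  cbv zeta. split; (split; [intros g al be [Hg _]|]); auto.
Qed.
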